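(* Let $\Phi\in(H^\infty+C)(\mathbb{M}_{n,n})$ with $\|H_\Phi\|\le1$, and let $r$ be the number of superoptimal singular values of $\Phi$ equal to $1$. Then for any integers $d_r,\dots,d_{n-1}$ with $0\le d_r\le d_{r+1}\le\cdots\le d_{n-1}$ there exists a unitary interpolant $U\in QC(\mathbb{M}_{n,n})$ of $\Phi$ whose nonnegative Wiener–Hopf indices are $d_r,d_{r+1},\dots,d_{n-1}$.
   Context: $H^\infty+C=\{f+g: f\in H^\infty,\ g\in C(\mathbb{T})\}$ and $QC=\{f\in H^\infty+C:\bar f\in H^\infty+C\}$; matrix versions mean all entries lie in the class. $H_\Phi f=\mathbb{P}_-\Phi f$ is the Hankel operator $H^2(\mathbb{C}^n)\to H^2_-(\mathbb{C}^n)=L^2\ominus H^2$. A unitary interpolant of $\Phi$ is a unitary-valued $U\in L^\infty(\mathbb{M}_{n,n})$ with $\Phi-U\in H^\infty(\mathbb{M}_{n,n})$. For unitary-valued $U\in QC(\mathbb{M}_{n,n})$, $T_U f=\mathbb{P}_+Uf$ is Fredholm and $U=Q_2^*\,\mathrm{diag}(z^{d_0},\dots,z^{d_{n-1}})\,Q_1$ with $Q_i,Q_i^{-1}\in H^2(\mathbb{M}_{n,n})$ and integers $d_0\le\cdots\le d_{n-1}$ uniquely determined by $U$ (the Wiener–Hopf indices). Superoptimal singular values: let $\Omega_0$ be the set of $F\in H^\infty(\mathbb{M}_{n,n})$ minimizing $t_0=\operatorname{ess\,sup}_\zeta\|\Phi(\zeta)-F(\zeta)\|$, and for $j\ge1$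 let $\Omega_j$ be the set of $F\in\Omega_{j-1}$ minimizing $t_j=\operatorname{ess\,sup}_\zeta s_j(\Phi(\zeta)-F(\zeta))$, where $s_j(A)=\inf\{\|A-R\|:\operatorname{rank}R\le j\}$; $t_0,\dots,t_{n-1}$ are the superoptimal singular values of $\Phi$. *)

(* Defs.v *)
(* R : realType, complex numbers C = R[i]
   (mathcomp-real-closed).  The unit circle T is parametrised by t in [0,1]
   via t |-> ee t = exp(2 pi i t); the (normalised) arc-length measure on T is
   Lebesgue measure on [0,1]. *)
From HB Require Import structures.
From mathcomp Require Import all_boot all_order all_algebra.
From mathcomp Require Import all_classical all_reals all_analysis.
From mathcomp.real_closed Require Import complex.
Set Implicit Arguments. Unset Strict Implicit. Unset Printing Implicit Defensive.
Import Order.TTheory GRing.Theory Num.Theory.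
Import numFieldNormedType.Exports.
Local Open Scope ring_scope.
Local Open Scope classical_set_scope.

Section Defs.
Variable R : realType.
Local Notation C := R[i].
Local Notation mu := (@lebesgue_measure R).

Definition cabs (z : C) : R := ComplexField.Normc.normc z.

Definition I01 : set R := `[0%R, 1%R].

Definition ee (t : R) : C := Complex (cos (2 * pi * t)) (sin (2 * pi * t)).

Definition cmeas (f : R -> C) : Prop :=
  measurable_fun I01 (fun t => complex.Re (f t)) /\
  measurable_fun I01 (fun t => complex.Im (f t)).

Definition cint (f : R -> C) : C :=
  Complex (Rintegral mu I01 (fun t => complex.Re (f t)))
          (Rintegral mu I01 (fun t => complex.Im (f t))).

Definition fcoef (f : R -> C) (k : int) : C :=
  cint (fun t => f t * (ee t) ^ (- k)).

Definition Linf (f : R -> C) : Prop :=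
  cmeas f /\ exists M : R, {ae mu, forall t, I01 t -> cabs (f t) <= M}.

Definition L2 (f : R -> C) : Prop :=
  cmeas f /\ mu.-integrable I01 (fun t => ((cabs (f t)) ^+ 2)%:E).

Definition Hinf (f : R -> C) : Prop :=
  Linf f /\ forall k : int, k < 0 -> fcoef f k = 0.
Definition H2 (f : R -> C) : Prop :=
  L2 f /\ forall k : int, k < 0 -> fcoef f k = 0.
Definition H2minus (f : R -> C) : Prop :=
  L2 f /\ forall k : int, 0 <= k -> fcoef f k = 0.

Definition CT (f : R -> C) : Prop :=
  exists g : R -> C,
    continuous (fun t : R => complex.Re (g t)) /\
    continuous (fun t : R => complex.Im (g t)) /\
    (forall t : R, g (t + 1) = g t) /\
    {ae mu, forall t, I01 t -> f t = g t}.

Definition HinfC (f : R -> C) : Prop :=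
  cmeas f /\
  exists h g : R -> C, Hinf h /\ CT g /\ {ae mu, forall t, I01 t -> f t = h t + g t}.

Definition QC (f : R -> C) : Prop := HinfC f /\ HinfC (fun t => conjc (f t)).

Definition mx_in (m k : nat) (P : (R -> C) -> Prop) (F : R -> 'M[C]_(m, k)) : Prop :=
  forall (i : 'I_m) (j : 'I_k), P (fun t => F t i j).

Definition adjmx (m k : nat) (A : 'M[C]_(m, k)) : 'M[C]_(k, m) := (map_mx conjc A)^T.

Definition l2norm (n : nat) (f : R -> 'cV[C]_n) : R :=
  Num.sqrt (Rintegral mu I01 (fun t => \sum_(i < n) (cabs (f t i ord0)) ^+ 2)).

(* ||H_Phi|| <= 1, where H_Phi f = P_- (Phi f) and P_- (Phi f) is the unique
   p in H^2_-(C^n) with Phi f - p in H^2(C^n) *)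
Definition hankel_norm_le1 (n : nat) (Phi : R -> 'M[C]_n) : Prop :=
  forall f p : R -> 'cV[C]_n,
    mx_in H2 f -> mx_in H2minus p -> mx_in H2 (fun t => Phi t *m f t - p t) ->
    l2norm p <= l2norm f.

Definition vnorm (n : nat) (v : 'cV[C]_n) : R :=
  Num.sqrt (\sum_(i < n) (cabs (v i ord0)) ^+ 2).
Definition opnorm (n : nat) (A : 'M[C]_n) : R :=
  inf [set M : R | 0 <= M /\ forall v : 'cV[C]_n, vnorm (A *m v) <= M * vnorm v].
Definition sval (n : nat) (j : nat) (A : 'M[C]_n) : R :=
  inf [set x : R | exists B : 'M[C]_n, (\rank B <= j)%N /\ x = opnorm (A - B)].

Definition esssupT (g : R -> R) : \bar R :=
  ereal_inf [set y : \bar R | {ae mu, forall t, I01 t -> ((g t)%:E <= y)%E}].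

Definition so_cost (n : nat) (Phi : R -> 'M[C]_n) (j : nat) (F : R -> 'M[C]_n) : \bar R :=
  esssupT (fun t => sval j (Phi t - F t)).

Definition HinfMx (n : nat) : set (R -> 'M[C]_n) := [set F | mx_in Hinf F].

Fixpoint Omega (n : nat) (Phi : R -> 'M[C]_n) (j : nat) : set (R -> 'M[C]_n) :=
  let prev := if j is j'.+1 then Omega Phi j' else @HinfMx n in
  [set F | prev F /\ so_cost Phi j F = ereal_inf (so_cost Phi j @` prev)].

Definition so_sval (n : nat) (Phi : R -> 'M[C]_n) (j : nat) : \bar R :=
  let prev := if j is j'.+1 then Omega Phi j' else @HinfMx n in
  ereal_inf (so_cost Phi j @` prev).

Definition n_sv_one (n : nat) (Phi : R -> 'M[C]_n) : nat :=
  #|[pred j : 'I_n | so_sval Phi j == 1%E]|.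

Definition unitary_interpolant (n : nat) (Phi U : R -> 'M[C]_n) : Prop :=
  mx_in Linf U /\
  {ae mu, forall t, I01 t -> adjmx (U t) *m U t = 1%:M} /\
  mx_in Hinf (fun t => Phi t - U t).

Definition WH_factorization (n : nat) (U : R -> 'M[C]_n) (d : 'I_n -> int) : Prop :=
  (forall i j : 'I_n, (i <= j)%N -> d i <= d j) /\
  exists Q1 Q2 Q1i Q2i : R -> 'M[C]_n,
    mx_in H2 Q1 /\ mx_in H2 Q2 /\ mx_in H2 Q1i /\ mx_in H2 Q2i /\
    {ae mu, forall t, I01 t ->
       [/\ Q1 t *m Q1i t = 1%:M, Q1i t *m Q1 t = 1%:M,
           Q2 t *m Q2i t = 1%:M, Q2i t *m Q2 t = 1%:M &
           U t = adjmx (Q2 t) *m diag_mx (\row_k (ee t) ^ (d k)) *m Q1 t]}.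

End Defs.

(* Main.v *)
(** A unitary interpolant of Phi is built by a Nehari-type linear fractional
    parametrization.  If the Hankel operator H of Psi has norm < 1, the equation
    (1 - H^* H) p = const and its transpose give H2 matrices p, p' and q, q' in H2minus for
    which the matrix with rows (p, conj q') and (q, conj p') is J-unitary; then
    U = (conj p' E + q) (p + conj q' E)^-1 is, for every unitary-valued E in Hinf, a unitary
    interpolant of Psi, and a Wiener-Hopf factorization of E yields one of U with the same
    indices.  Since Phi = z^-N (Psi + K) modulo Hinf with Psi small and K in Hinf, this
    reduces the problem to finding E with N prescribed Fourier coefficients subject to a
    Hankel bound.  That finite problem is solved by a Schur algorithm: either the constant
    coefficient is a strict contraction and the same parametrization lowers N, or it is
    isometric on a vector and one splits off a scalar block, which contributes one negative
    index.  When N = 0 the diagonal matrix with entries z^(dd i) is allowed.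

    The interpolant is in QC because the Hankel operators of z^M U^* tend to 0 in norm: up to
    a small error P_+ (U z^-M h) lies in the kernel of an adjoint Toeplitz operator, which
    the factorization shows to be finite-dimensional.

    Let r be the number of split blocks, and let U have indices 0 beyond r.  If Phi - F is
    contractive it agrees with U on the first r columns of Q1^-1, so the first r singular
    values are 1.  Conversely, let P be the orthogonal projection on the span of these
    columns; then |P_+ U x| >= delta |(1 - P) x|.  Factor 1 - theta (1 - P) = h^* h with h
    and h^-1 in Hinf: Phi h^-1 still has Hankel norm <= 1, hence a unitary interpolant V,
    and V h is an error function with s_r bounded by a constant < 1. *)
Require Import Defs.
From HB Require Import structures.
From mathcomp Require Import all_boot all_order all_algebra.
From mathcomp Require Import all_classical all_reals all_analysis.
From mathcomp Require Import measurable_realfun.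
From mathcomp Require Import ring lra zify.
From mathcomp Require spectral.
From mathcomp.real_closed Require Import complex.
Set Implicit Arguments. Unset Strict Implicit. Unset Printing Implicit Defensive.
Import Order.TTheory GRing.Theory Num.Theory.
Import numFieldNormedType.Exports.
Local Open Scope ring_scope.
Local Open Scope classical_set_scope.

(** * Complex modulus, almost-everywhere statements and real integrals on [0,1] *)

Section ComplexAndMeasure.
Variable R : realType.
Local Notation C := R[i].
Local Notation mu := (@lebesgue_measure R).
Local Notation Re := complex.Re.
Local Notation Im := complex.Im.

(** Most vanishing statements follow one pattern: an identity places one expression both in [H1] and
    in [H1m], hence it is 0 almost everywhere. The obstacle in the parametrization is that a
    unitary-valued E is never strictly contractive, so that (p + conj q' E)^-1 is not given by a
    Neumann series. It is obtained with r E, r < 1, and a bound of its entries that is uniform in r.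
    In general p lies only in H2, so the Wiener-Hopf factors it produces are only in H2, and
    products of several such factors could leave H2. The Schur steps avoid this: for their symbols
    z^-1 L0 both p and z q are constant, so all their factors are bounded, and H2 factors enter
    once, in the last reduction. The number r of split blocks is produced before any index is
    prescribed. The interpolant with indices 0 beyond r identifies it with the number of
    superoptimal singular values equal to 1, and the same r then serves for the given indices. *)

Lemma complex_eqP (x y : C) : Re x = Re y -> Im x = Im y -> x = y.
Proof. by case: x; case: y => a b c d /= -> ->. Qed.
Lemma cReD (x y : C) : Re (x + y) = Re x + Re y. Proof. by case: x; case: y. Qed.
Lemma cImD (x y : C) : Im (x + y) = Im x + Im y. Proof. by case: x; case: y. Qed.
Lemma cReN (x : C) : Re (- x) = - Re x. Proof. by case: x. Qed.
Lemma cImN (x : C) : Im (- x) = - Im x. Proof. by case: x. Qed.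
Lemma cReM (x y : C) : Re (x * y) = Re x * Re y - Im x * Im y.
Proof. by case: x; case: y. Qed.
Lemma cImM (x y : C) : Im (x * y) = Re x * Im y + Im x * Re y.
Proof. by case: x; case: y => a b c d /=; rewrite addrC. Qed.
Lemma cReJ (x : C) : Re (conjc x) = Re x. Proof. by case: x. Qed.
Lemma cImJ (x : C) : Im (conjc x) = - Im x. Proof. by case: x. Qed.
Lemma CrM (x y : R) : (x * y)%:C%C = x%:C%C * y%:C%C :> C.
Proof. by apply: complex_eqP; rewrite ?cReM ?cImM/= ?mulr0 ?mul0r ?subr0 ?addr0. Qed.
Lemma CrD (x y : R) : (x + y)%:C%C = x%:C%C + y%:C%C :> C.
Proof. by apply: complex_eqP; rewrite ?cReD ?cImD/= ?addr0. Qed.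
Lemma Cr_sum (I : Type) (r : seq I) (P : pred I) (F : I -> R) :
  (\sum_(i <- r | P i) F i)%:C%C = \sum_(i <- r | P i) (F i)%:C%C :> C.
Proof. by apply: big_morph => //; exact: CrD. Qed.
Lemma cJD (x y : C) : conjc (x + y) = conjc x + conjc y. Proof. exact: rmorphD. Qed.
Lemma cJM (x y : C) : conjc (x * y) = conjc x * conjc y. Proof. exact: rmorphM. Qed.
Lemma cJN (x : C) : conjc (- x) = - conjc x. Proof. exact: rmorphN. Qed.
Lemma cJ_sum (I : Type) (r : seq I) (P : pred I) (F : I -> C) :
  conjc (\sum_(i <- r | P i) F i) = \sum_(i <- r | P i) conjc (F i).
Proof. by apply: big_morph => //; [exact: cJD|exact: conjc0]. Qed.
Lemma cabsE (z : C) : cabs z = Num.sqrt (Re z ^+ 2 + Im z ^+ 2).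
Proof. by case: z. Qed.
Lemma cabs_ge0 (z : C) : 0 <= cabs z. Proof. by rewrite cabsE sqrtr_ge0. Qed.
Lemma cabs_sq (z : C) : cabs z ^+ 2 = Re z ^+ 2 + Im z ^+ 2.
Proof. by rewrite cabsE sqr_sqrtr// addr_ge0// sqr_ge0. Qed.
Lemma cabs0 : cabs (0 : C) = 0. Proof. exact: ComplexField.Normc.normc0. Qed.
Lemma cabs1 : cabs (1 : C) = 1. Proof. exact: ComplexField.Normc.normc1. Qed.
Lemma cabs_eq0 (z : C) : cabs z = 0 -> z = 0.
Proof. exact: ComplexField.Normc.eq0_normc. Qed.
Lemma cabsM (x y : C) : cabs (x * y) = cabs x * cabs y.
Proof. exact: ComplexField.Normc.normcM. Qed.
Lemma cabsD (x y : C) : cabs (x + y) <= cabs x + cabs y.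
Proof. exact: le_normcD. Qed.
Lemma cabsN (x : C) : cabs (- x) = cabs x.
Proof. by rewrite !cabsE cReN cImN !sqrrN. Qed.
Lemma cabsJ (x : C) : cabs (conjc x) = cabs x.
Proof. by rewrite !cabsE cReJ cImJ !sqrrN. Qed.
Lemma cabs_Cr (x : R) : cabs x%:C%C = `|x|.
Proof. by rewrite cabsE /= expr0n /= addr0 sqrtr_sqr. Qed.
Lemma cabs_sum (I : Type) (r : seq I) (P : pred I) (F : I -> C) :
  cabs (\sum_(i <- r | P i) F i) <= \sum_(i <- r | P i) cabs (F i).
Proof.
elim/big_ind2: _ => [|x x' y y' h h'|//]; first by rewrite cabs0.
by rewrite (le_trans (cabsD _ _))// lerD.
Qed.
Lemma cabsX (x : C) n : cabs (x ^+ n) = cabs x ^+ n.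
Proof. by elim: n => [|n IH]; rewrite ?expr0 ?cabs1// !exprS cabsM IH. Qed.
Lemma Re_le_cabs (z : C) : `|Re z| <= cabs z.
Proof. by rewrite cabsE -sqrtr_sqr ler_wsqrtr// lerDl sqr_ge0. Qed.
Lemma Im_le_cabs (z : C) : `|Im z| <= cabs z.
Proof. by rewrite cabsE -sqrtr_sqr ler_wsqrtr// lerDr sqr_ge0. Qed.
Lemma cabs_le_ReIm (z : C) : cabs z <= `|Re z| + `|Im z|.
Proof.
rewrite -[leRHS]ger0_norm ?addr_ge0// -sqrtr_sqr cabsE ler_wsqrtr//.
rewrite sqrrD !real_normK ?num_real//.
by rewrite addrAC lerDl mulrn_wge0// mulr_ge0.
Qed.
Lemma mulcJ (z : C) : z * conjc z = (cabs z ^+ 2)%:C%C.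
Proof.
rewrite cabs_sq; apply: complex_eqP; rewrite ?cReM ?cImM cReJ cImJ /=; ring.
Qed.
Lemma cabs_diff (x y : C) : `|cabs x - cabs y| <= cabs (x - y).
Proof.
have h1 : cabs x <= cabs (x - y) + cabs y by rewrite -[in leLHS](subrK y x) cabsD.
have h2 : cabs y <= cabs (x - y) + cabs x.
  by rewrite -[in leLHS](subrK x y) -(cabsN (x - y)) opprB cabsD.
by rewrite ler_norml; apply/andP; split; lra.
Qed.

Definition aeI (P : R -> Prop) : Prop := {ae mu, forall t, I01 t -> P t}.

Lemma aeI_W (P : R -> Prop) : (forall t, I01 t -> P t) -> aeI P.
Proof. by move=> h; apply: aeW => t; exact: h. Qed.
Lemma aeI_filter : Filter (almost_everywhere mu).
Proof. exact: ae_filter_ringOfSetsType. Qed.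
Lemma aeI_S (P Q : R -> Prop) : (forall t, I01 t -> P t -> Q t) -> aeI P -> aeI Q.
Proof.
by move=> h; apply: (@filterS _ _ aeI_filter) => t Pt It; apply: h => //; exact: Pt.
Qed.
Lemma aeI_S2 (P Q S : R -> Prop) : (forall t, I01 t -> P t -> Q t -> S t) ->
  aeI P -> aeI Q -> aeI S.
Proof.
by move=> h; apply: (@filterS2 _ _ aeI_filter) => t Pt Qt It; apply: h; auto.
Qed.
Lemma aeI_S3 (P Q S U : R -> Prop) :
  (forall t, I01 t -> P t -> Q t -> S t -> U t) ->
  aeI P -> aeI Q -> aeI S -> aeI U.
Proof.
by move=> h; apply: (@filterS3 _ _ aeI_filter) => t Pt Qt St It; apply: h; auto.
Qed.
Lemma aeI_and (P Q : R -> Prop) : aeI P -> aeI Q -> aeI (fun t => P t /\ Q t).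
Proof. by apply: aeI_S2. Qed.
Lemma aeI_foralln (P : nat -> R -> Prop) :
  (forall n, aeI (P n)) -> aeI (fun t => forall n, P n t).
Proof.
by move=> h; have := ae_foralln h; apply: (@filterS _ _ aeI_filter) => t H It n; exact: H.
Qed.
(** A finite index type is embedded in the naturals by [enum_rank], so that the countable
    intersection applies. *)
Lemma aeI_forall (I : finType) (P : I -> R -> Prop) :
  (forall i, aeI (P i)) -> aeI (fun t => forall i, P i t).
Proof.
move=> h.
have h' n : aeI (fun t => forall i, n = enum_rank i :> nat -> P i t).
  case: (pselect (exists i : I, n = enum_rank i :> nat)) => [[i0 e0]|ne].
    apply: aeI_S (h i0) => t _ H i e; suff -> : i = i0 by [].
    by apply: enum_rank_inj; apply: val_inj; rewrite /= -e -e0.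
  by apply: aeI_W => t _ i e; case: ne; exists i.
by apply: aeI_S (aeI_foralln h') => t _ H i; apply: (H (enum_rank i) i).
Qed.

Lemma mI01 : measurable (@I01 R). Proof. exact: measurable_itv. Qed.
Lemma mI01' : @measurable _ (measurableTypeR R) (@I01 R).
Proof. exact: measurable_itv. Qed.
Lemma muI01 : mu (@I01 R) = 1%E.
Proof. by rewrite /I01 lebesgue_measure_itv/= lte_fin ltr01 sube0. Qed.
Lemma aeI_False : aeI (fun _ => False) -> False.
Proof.
move=> h.
have : mu.-negligible (@I01 R).
  by apply: negligibleS h => t It /= /(_ It).
move=> hn; have : mu (@I01 R) = 0%E.
  by apply: measure_negligible => //; exact: measurable_itv.
by rewrite muI01 => /eqP; rewrite onee_eq0.
Qed.
Lemma aeI_ex (P : R -> Prop) : aeI P -> exists2 t, I01 t & P t.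
Proof.
move=> h; apply: contrapT => nx; apply: aeI_False.
by apply: aeI_S h => t It Pt; apply: nx; exists t.
Qed.

Definition RI (f : R -> R) := mu.-integrable (@I01 R) (EFin \o f).
Definition rint (f : R -> R) : R := Rintegral mu (@I01 R) f.
Definition rmeas (f : R -> R) := measurable_fun (@I01 R) f.

Lemma RI_meas f : RI f -> rmeas f.
Proof. by move/measurable_int/measurable_EFinP. Qed.
Lemma RI_le (f g : R -> R) : rmeas f -> aeI (fun t => `|f t| <= g t) -> RI g -> RI f.
Proof.
move=> mf fg /integrableP[mg ig]; apply/integrableP; split; first exact/measurable_EFinP.
apply: le_lt_trans ig; apply: ae_ge0_le_integral => //.
- exact: mI01.
- by apply: measurableT_comp => //; exact/measurable_EFinP.
- exact: measurableT_comp.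
- apply: (@filterS _ _ aeI_filter) fg => t H It; rewrite /= lee_fin (le_trans (H It))// ler_norm//.
Qed.
Lemma RI_cst (c : R) : RI (cst c).
Proof.
apply: measurable_bounded_integrable => //; first exact: mI01.
- by have := ltry (1 : R); rewrite -muI01.
- by exists `|c|; split => // M hM t _ /=; exact: ltW.
Qed.

Lemma RI_D f g : RI f -> RI g -> RI (fun t => f t + g t).
Proof. by move=> hf hg; have := integrableD mI01' hf hg. Qed.
Lemma RI_Z c f : RI f -> RI (fun t => c * f t).
Proof. by move=> hf; have := integrableZl mI01' c hf. Qed.
Lemma RI_N f : RI f -> RI (fun t => - f t).
Proof. by move=> hf; have := integrableN hf. Qed.
Lemma RI_B f g : RI f -> RI g -> RI (fun t => f t - g t).
Proof. by move=> hf hg; apply: RI_D => //; exact: RI_N. Qed.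
Lemma RI_sum (I : Type) (r : seq I) (P : pred I) (F : I -> R -> R) :
  (forall i, P i -> RI (F i)) -> RI (fun t => \sum_(i <- r | P i) F i t).
Proof.
move=> h; elim: r => [|i r IH].
  by under eq_fun do rewrite big_nil; exact: RI_cst.
under eq_fun do rewrite big_cons.
by case: (boolP (P i)) => Pi //; apply: RI_D => //; exact: h.
Qed.
Lemma RI_norm f : RI f -> RI (fun t => `|f t|).
Proof.
by move=> hf; have := integrable_norm hf.
Qed.
Lemma rintD f g : RI f -> RI g -> rint (fun t => f t + g t) = rint f + rint g.
Proof. by move=> hf hg; rewrite /rint RintegralD//; exact: mI01. Qed.
Lemma rintB f g : RI f -> RI g -> rint (fun t => f t - g t) = rint f - rint g.
Proof. by move=> hf hg; rewrite /rint RintegralB//; exact: mI01. Qed.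
Lemma rintZ c f : RI f -> rint (fun t => c * f t) = c * rint f.
Proof. by move=> hf; rewrite /rint RintegralZl//; exact: mI01. Qed.
Lemma rint_sum (I : Type) (r : seq I) (P : pred I) (F : I -> R -> R) :
  (forall i, P i -> RI (F i)) ->
  rint (fun t => \sum_(i <- r | P i) F i t) = \sum_(i <- r | P i) rint (F i).
Proof.
move=> h; elim: r => [|i r IH].
  rewrite big_nil; under eq_fun do rewrite big_nil.
  by rewrite /rint Rintegral_cst ?mul0r//; exact: mI01.
rewrite big_cons; under eq_fun do rewrite big_cons.
by case: (boolP (P i)) => Pi //; rewrite rintD ?IH//; [exact: h | exact: RI_sum].
Qed.
Lemma rint_ae f g : rmeas f -> rmeas g -> aeI (fun t => f t = g t) -> rint f = rint g.
Proof.
move=> mf mg h; rewrite /rint /Rintegral; congr fine; apply: ae_eq_integral.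
- exact: mI01.
- exact/measurable_EFinP.
- exact/measurable_EFinP.
- by apply: (@filterS _ _ aeI_filter) h => t H It; rewrite H.
Qed.
Lemma RI_ae f g : rmeas g -> aeI (fun t => f t = g t) -> RI f -> RI g.
Proof.
move=> mg h hf; apply: (@RI_le g (fun t => `|f t|)) => //; last exact: RI_norm.
by apply: aeI_S h => t _ ->.
Qed.
Lemma rint_le f g : RI f -> RI g -> aeI (fun t => f t <= g t) -> rint f <= rint g.
Proof.
move=> hf hg h.
have mm : rmeas (fun t => Num.min (f t) (g t)).
  by apply: measurable_minr; exact: RI_meas.
have e : aeI (fun t => f t = Num.min (f t) (g t)).
  by apply: aeI_S h => t _ le; rewrite minEle le.
rewrite (rint_ae _ _ e)//; last exact: RI_meas.
apply: le_Rintegral => //; first exact: mI01.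
  exact: RI_ae e hf.
by move=> t _; rewrite ge_min lexx orbT.
Qed.
Lemma rint_ge0 f : aeI (fun t => 0 <= f t) -> RI f -> 0 <= rint f.
Proof.
move=> h hf; have <- : rint (cst 0) = 0.
  by rewrite /rint Rintegral_cst ?mul0r//; exact: mI01.
by apply: rint_le => //; exact: RI_cst.
Qed.
Lemma rint_cst c : rint (cst c) = c.
Proof. rewrite /rint Rintegral_cst; last exact: mI01.
by have := muI01; rewrite /= => ->; rewrite mulr1. Qed.
Lemma rint_eq0 f : RI f -> (forall t, 0 <= f t) -> rint f = 0 -> aeI (fun t => f t = 0).
Proof.
move=> hf f0 h0.
have h : (\int[mu]_(x in @I01 R) `|(f x)%:E| = 0)%E.
  under eq_integral do rewrite gee0_abs ?lee_fin//.
  have <- : (rint f)%:E = 0%E by rewrite h0.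
  rewrite /rint /Rintegral fineK//.
  by apply: (integrable_fin_num mI01' hf).
have := (ae_eq_integral_abs mu mI01' (measurable_int mu hf)).1 h.
by apply: (@filterS _ _ aeI_filter) => t H It; have := H It; case.
Qed.

Definition L1 (f : R -> C) : Prop := cmeas f /\ RI (fun t => cabs (f t)).
Lemma cmeasD (f g : R -> C) : cmeas f -> cmeas g -> cmeas (fun t => f t + g t).
Proof.
move=> [f1 f2] [g1 g2]; split.
- by under eq_fun do rewrite cReD; exact: measurable_funD.
- by under eq_fun do rewrite cImD; exact: measurable_funD.
Qed.
Lemma cmeasN (f : R -> C) : cmeas f -> cmeas (fun t => - f t).
Proof.
move=> [f1 f2]; split.
- by under eq_fun do rewrite cReN; exact: measurable_funN.
- by under eq_fun do rewrite cImN; exact: measurable_funN.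
Qed.
Lemma cmeasB (f g : R -> C) : cmeas f -> cmeas g -> cmeas (fun t => f t - g t).
Proof. by move=> hf hg; apply: cmeasD => //; exact: cmeasN. Qed.
Lemma cmeasM (f g : R -> C) : cmeas f -> cmeas g -> cmeas (fun t => f t * g t).
Proof.
move=> [f1 f2] [g1 g2]; split.
- under eq_fun do rewrite cReM; apply: measurable_funB; exact: measurable_funM.
- under eq_fun do rewrite cImM; apply: measurable_funD; exact: measurable_funM.
Qed.
Lemma cmeasJ (f : R -> C) : cmeas f -> cmeas (fun t => conjc (f t)).
Proof.
move=> [f1 f2]; split.
- by under eq_fun do rewrite cReJ.
- by under eq_fun do rewrite cImJ; exact: measurable_funN.
Qed.
Lemma cmeas_cst (c : C) : cmeas (fun=> c). Proof. by split; exact: measurable_cst. Qed.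
Lemma cmeas_sum (I : Type) (r : seq I) (P : pred I) (F : I -> R -> C) :
  (forall i, P i -> cmeas (F i)) -> cmeas (fun t => \sum_(i <- r | P i) F i t).
Proof.
move=> h; elim: r => [|i r IH].
  by under eq_fun do rewrite big_nil; exact: cmeas_cst.
under eq_fun do rewrite big_cons.
by case: (boolP (P i)) => Pi //; apply: cmeasD => //; exact: h.
Qed.
Lemma cmeas_prod (I : Type) (r : seq I) (P : pred I) (F : I -> R -> C) :
  (forall i, P i -> cmeas (F i)) -> cmeas (fun t => \prod_(i <- r | P i) F i t).
Proof.
move=> h; elim: r => [|i r IH].
  by under eq_fun do rewrite big_nil; exact: cmeas_cst.
under eq_fun do rewrite big_cons.
by case: (boolP (P i)) => Pi //; apply: cmeasM => //; exact: h.
Qed.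
Lemma rmeas_cabs2 (f : R -> C) : cmeas f -> rmeas (fun t => cabs (f t) ^+ 2).
Proof.
move=> [f1 f2]; rewrite /rmeas; under eq_fun do rewrite cabs_sq.
by apply: measurable_funD; exact: measurable_funX.
Qed.
Lemma rmeas_cabs (f : R -> C) : cmeas f -> rmeas (fun t => cabs (f t)).
Proof.
move=> hf; rewrite /rmeas.
have -> : (fun t => cabs (f t)) = Num.sqrt \o (fun t => cabs (f t) ^+ 2).
  by apply/funext => t /=; rewrite sqrtr_sqr ger0_norm// cabs_ge0.
apply: measurableT_comp; last exact: rmeas_cabs2.
by apply: continuous_measurable_fun; exact: sqrt_continuous.
Qed.
(** The inverse is the pointwise limit of f / (f^2 + 1/(n+1)), which has no singularity and is 0
    where f vanishes, in agreement with 0^-1 = 0. *)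
Lemma rmeas_inv (f : R -> R) : rmeas f -> rmeas (fun t => (f t)^-1).
Proof.
move=> mf; apply: (@measurable_fun_cvg _ _ _ _
  (fun (n : nat) t => f t / (f t ^+ 2 + n.+1%:R^-1))) => [n|t It].
  apply: measurable_funM => //.
  have -> : (fun x => (f x ^+ 2 + n.+1%:R^-1)^-1) =
     (fun y : R => (`|y| + n.+1%:R^-1)^-1) \o (fun t => f t ^+ 2).
    by apply/funext => t /=; rewrite ger0_norm ?sqr_ge0.
  apply: measurableT_comp; last exact: measurable_funX.
  apply: continuous_measurable_fun => x; apply: cvgV.
    by rewrite gt_eqF// ltr_wpDl// invr_gt0.
  by apply: cvgD; [apply: norm_continuous|exact: cvg_cst].
have [->|f0] := eqVneq (f t) 0.
  by under eq_fun do rewrite mul0r; rewrite invr0; exact: cvg_cst.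
have -> : (f t)^-1 = f t / (f t ^+ 2 + 0) by field.
apply: cvgM; first exact: cvg_cst.
apply: cvgV; first by rewrite addr0 expf_neq0.
by apply: cvgD; [exact: cvg_cst|exact: cvg_harmonic].
Qed.
Lemma cmeasV (f : R -> C) : cmeas f -> cmeas (fun t => (f t)^-1).
Proof.
move=> hf.
have e t : (f t)^-1 = conjc (f t) * ((cabs (f t) ^+ 2)^-1)%:C%C.
  have [->|f0] := eqVneq (f t) 0; first by rewrite invr0 conjc0 mul0r.
  have e1 := mulcJ (f t); have c0 : (cabs (f t) ^+ 2) != 0.
    by rewrite expf_neq0//; apply: contra_neq f0; exact: cabs_eq0.
  apply: (mulfI f0); rewrite divff// mulrA e1 -rmorphM/= mulfV//.
under eq_fun do rewrite e; apply: cmeasM; first exact: cmeasJ.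
split => /=; last exact: measurable_cst.
by apply: rmeas_inv; exact: rmeas_cabs2.
Qed.

End ComplexAndMeasure.

(** * The classes L1, L2, Linf and the complex integral *)

Section LebesgueClasses.
Variable R : realType.
Local Notation C := R[i].
Local Notation mu := (@lebesgue_measure R).
Local Notation Re := complex.Re.
Local Notation Im := complex.Im.
Implicit Types (f g h : R -> C).

Lemma L1_ReIm f : L1 f <-> [/\ cmeas f, RI (fun t => Re (f t)) & RI (fun t => Im (f t))].
Proof.
split=> [[mf hf]|[mf h1 h2]].
  split=> //; [apply: RI_le mf.1 _ hf|apply: RI_le mf.2 _ hf]; apply: aeI_W => t _.
    exact: Re_le_cabs.
  exact: Im_le_cabs.
split=> //; apply: RI_le (RI_D (RI_norm h1) (RI_norm h2)); first exact: rmeas_cabs.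
by apply: aeI_W => t _; rewrite ger0_norm ?cabs_ge0// cabs_le_ReIm.
Qed.
Lemma L1_meas f : L1 f -> cmeas f. Proof. by case. Qed.
Lemma L1_le f (g : R -> R) : cmeas f -> aeI (fun t => cabs (f t) <= g t) -> RI g -> L1 f.
Proof.
move=> mf h hg; split=> //; apply: RI_le hg; first exact: rmeas_cabs.
by apply: aeI_S h => t _ H; rewrite ger0_norm ?cabs_ge0.
Qed.
Lemma L1D f g : L1 f -> L1 g -> L1 (fun t => f t + g t).
Proof.
move=> [mf hf] [mg hg]; apply: (L1_le (g := fun t => cabs (f t) + cabs (g t))).
- exact: cmeasD.
- by apply: aeI_W => t _; exact: cabsD.
- exact: RI_D.
Qed.
Lemma L1N f : L1 f -> L1 (fun t => - f t).
Proof. by move=> [mf hf]; split; [exact: cmeasN|under eq_fun do rewrite cabsN]. Qed.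
Lemma L1B f g : L1 f -> L1 g -> L1 (fun t => f t - g t).
Proof. by move=> hf hg; apply: L1D => //; exact: L1N. Qed.
Lemma L1J f : L1 f -> L1 (fun t => conjc (f t)).
Proof. by move=> [mf hf]; split; [exact: cmeasJ|under eq_fun do rewrite cabsJ]. Qed.
Lemma L1_cst (c : C) : L1 (fun _ : R => c).
Proof. by split; [exact: cmeas_cst|exact: RI_cst]. Qed.
Lemma L1_sum (I : Type) (r : seq I) (P : pred I) (F : I -> R -> C) :
  (forall i, P i -> L1 (F i)) -> L1 (fun t => \sum_(i <- r | P i) F i t).
Proof.
move=> h; elim: r => [|i r IH].
  by under eq_fun do rewrite big_nil; exact: L1_cst.
under eq_fun do rewrite big_cons.
by case: (boolP (P i)) => Pi //; apply: L1D => //; exact: h.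
Qed.
Lemma L1_ae f g : cmeas g -> aeI (fun t => f t = g t) -> L1 f -> L1 g.
Proof.
move=> mg h [mf hf]; split=> //; apply: RI_ae hf; first exact: rmeas_cabs.
by apply: aeI_S h => t _ ->.
Qed.

Lemma Linf_bound f : Linf f -> exists2 M, 0 <= M & aeI (fun t => cabs (f t) <= M).
Proof.
move=> [_ [M h]]; exists `|M| => //; apply: aeI_S h => t _ H.
exact: le_trans (ler_norm _).
Qed.
Lemma Linf_meas f : Linf f -> cmeas f. Proof. by case. Qed.
Lemma LinfD f g : Linf f -> Linf g -> Linf (fun t => f t + g t).
Proof.
move=> [mf [M hM]] [mg [N hN]]; split; first exact: cmeasD.
exists (M + N); apply: aeI_S2 hM hN => t _ h1 h2.
by rewrite (le_trans (cabsD _ _))// lerD.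
Qed.
Lemma LinfN f : Linf f -> Linf (fun t => - f t).
Proof.
move=> [mf [M h]]; split; first exact: cmeasN.
by exists M; apply: aeI_S h => t _ H; rewrite cabsN.
Qed.
Lemma LinfB f g : Linf f -> Linf g -> Linf (fun t => f t - g t).
Proof. by move=> hf hg; apply: LinfD => //; exact: LinfN. Qed.
Lemma LinfJ f : Linf f -> Linf (fun t => conjc (f t)).
Proof.
move=> [mf [M h]]; split; first exact: cmeasJ.
by exists M; apply: aeI_S h => t _ H; rewrite cabsJ.
Qed.
Lemma LinfM f g : Linf f -> Linf g -> Linf (fun t => f t * g t).
Proof.
move=> hf hg; have [M M0 hM] := Linf_bound hf; have [N N0 hN] := Linf_bound hg.
split; first by apply: cmeasM; exact: Linf_meas.
exists (M * N); apply: aeI_S2 hM hN => t _ h1 h2.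
by rewrite cabsM ler_pM// cabs_ge0.
Qed.
Lemma Linf_cst (c : C) : Linf (fun _ : R => c).
Proof. by split; [exact: cmeas_cst|exists (cabs c); exact: aeI_W]. Qed.
Lemma Linf_sum (I : Type) (r : seq I) (P : pred I) (F : I -> R -> C) :
  (forall i, P i -> Linf (F i)) -> Linf (fun t => \sum_(i <- r | P i) F i t).
Proof.
move=> h; elim: r => [|i r IH].
  by under eq_fun do rewrite big_nil; exact: Linf_cst.
under eq_fun do rewrite big_cons.
by case: (boolP (P i)) => Pi //; apply: LinfD => //; exact: h.
Qed.
Lemma Linf_ae f g : cmeas g -> aeI (fun t => f t = g t) -> Linf f -> Linf g.
Proof.
by move=> mg h [mf [M hM]]; split=> //; exists M; apply: aeI_S2 h hM => t _ ->.
Qed.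

Lemma L2_meas f : L2 f -> cmeas f. Proof. by case. Qed.
Lemma L2E f : L2 f <-> cmeas f /\ RI (fun t => cabs (f t) ^+ 2). Proof. by []. Qed.
Lemma L2_L1M f g : L2 f -> L2 g -> L1 (fun t => f t * g t).
Proof.
move=> [mf hf] [mg hg].
apply: (L1_le (g := fun t => cabs (f t) ^+ 2 + cabs (g t) ^+ 2)).
- exact: cmeasM.
- apply: aeI_W => t _; rewrite cabsM; have := cabs_ge0 (f t); have := cabs_ge0 (g t).
  by nra.
- exact: RI_D.
Qed.
Lemma L2D f g : L2 f -> L2 g -> L2 (fun t => f t + g t).
Proof.
move=> [mf hf] [mg hg]; apply/L2E; split; first exact: cmeasD.
apply: RI_le (RI_D (RI_Z 2 hf) (RI_Z 2 hg)).
  by apply: rmeas_cabs2; exact: cmeasD.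
apply: aeI_W => t _; rewrite ger0_norm ?exprn_ge0 ?cabs_ge0//.
have h : cabs (f t + g t) ^+ 2 <= (cabs (f t) + cabs (g t)) ^+ 2.
  by rewrite lerXn2r ?nnegrE ?addr_ge0 ?cabs_ge0 ?cabsD.
by have := sqr_ge0 (cabs (f t) - cabs (g t)); move: h; rewrite sqrrB sqrrD; lra.
Qed.
Lemma L2N f : L2 f -> L2 (fun t => - f t).
Proof. by move=> [mf hf]; split; [exact: cmeasN|under eq_fun do rewrite cabsN]. Qed.
Lemma L2B f g : L2 f -> L2 g -> L2 (fun t => f t - g t).
Proof. by move=> hf hg; apply: L2D => //; exact: L2N. Qed.
Lemma L2J f : L2 f -> L2 (fun t => conjc (f t)).
Proof. by move=> [mf hf]; split; [exact: cmeasJ|under eq_fun do rewrite cabsJ]. Qed.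
Lemma Linf_L2M f g : Linf f -> L2 g -> L2 (fun t => f t * g t).
Proof.
move=> hf [mg hg]; have [M M0 hM] := Linf_bound hf.
have mf := Linf_meas hf.
apply/L2E; split; first exact: cmeasM.
apply: RI_le (RI_Z (M ^+ 2) hg); first by apply: rmeas_cabs2; exact: cmeasM.
apply: aeI_S hM => t _ H; rewrite ger0_norm ?exprn_ge0 ?cabs_ge0//.
rewrite cabsM exprMn ler_wpM2r ?exprn_ge0 ?cabs_ge0//.
by rewrite lerXn2r// nnegrE cabs_ge0.
Qed.
Lemma Linf_L1M f g : Linf f -> L1 g -> L1 (fun t => f t * g t).
Proof.
move=> hf [mg hg]; have [M M0 hM] := Linf_bound hf.
have mf := Linf_meas hf.
apply: (L1_le (g := fun t => M * cabs (g t))); first exact: cmeasM.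
  by apply: aeI_S hM => t _ H; rewrite cabsM ler_wpM2r ?cabs_ge0.
exact: RI_Z.
Qed.
Lemma L2_cst (c : C) : L2 (fun _ : R => c).
Proof. by apply/L2E; split; [exact: cmeas_cst|exact: RI_cst]. Qed.
Lemma L2_L1 f : L2 f -> L1 f.
Proof.
move=> hf; have := L2_L1M hf (L2_cst 1); by under eq_fun do rewrite mulr1.
Qed.
Lemma Linf_L2 f : Linf f -> L2 f.
Proof.
move=> hf; have := Linf_L2M hf (L2_cst 1); by under eq_fun do rewrite mulr1.
Qed.
Lemma Linf_L1 f : Linf f -> L1 f. Proof. by move/Linf_L2/L2_L1. Qed.
Lemma L2Z c f : L2 f -> L2 (fun t => c * f t).
Proof. by move=> hf; apply: Linf_L2M => //; exact: Linf_cst. Qed.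
Lemma L1Z c f : L1 f -> L1 (fun t => c * f t).
Proof. by move=> hf; apply: Linf_L1M => //; exact: Linf_cst. Qed.
Lemma L2_sum (I : Type) (r : seq I) (P : pred I) (F : I -> R -> C) :
  (forall i, P i -> L2 (F i)) -> L2 (fun t => \sum_(i <- r | P i) F i t).
Proof.
move=> h; elim: r => [|i r IH].
  by under eq_fun do rewrite big_nil; exact: L2_cst.
under eq_fun do rewrite big_cons.
by case: (boolP (P i)) => Pi //; apply: L2D => //; exact: h.
Qed.
Lemma L2_le f (g : R -> R) : cmeas f -> aeI (fun t => cabs (f t) ^+ 2 <= g t) -> RI g -> L2 f.
Proof.
move=> mf h hg; apply/L2E; split=> //; apply: RI_le hg; first exact: rmeas_cabs2.
by apply: aeI_S h => t _ H; rewrite ger0_norm ?exprn_ge0 ?cabs_ge0.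
Qed.
Lemma L2_ae f g : cmeas g -> aeI (fun t => f t = g t) -> L2 f -> L2 g.
Proof.
move=> mg h [mf hf]; apply: (L2_le (g := fun t => cabs (f t) ^+ 2)) => //.
by apply: aeI_S h => t _ ->.
Qed.

Lemma cintD f g : L1 f -> L1 g -> cint (fun t => f t + g t) = cint f + cint g.
Proof.
move=> /L1_ReIm[_ f1 f2] /L1_ReIm[_ g1 g2]; apply: complex_eqP; rewrite ?cReD ?cImD /=.
  by under eq_Rintegral do rewrite cReD; exact: rintD.
by under eq_Rintegral do rewrite cImD; exact: rintD.
Qed.
Lemma cintZ c f : L1 f -> cint (fun t => c * f t) = c * cint f.
Proof.
move=> /L1_ReIm[_ f1 f2]; apply: complex_eqP; rewrite ?cReM ?cImM /=.
  under eq_Rintegral do rewrite cReM.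
  rewrite -[LHS]/(rint _) rintB; [|exact: RI_Z|exact: RI_Z].
  by rewrite !rintZ.
under eq_Rintegral do rewrite cImM.
rewrite -[LHS]/(rint _) rintD; [|exact: RI_Z|exact: RI_Z].
by rewrite !rintZ.
Qed.
Lemma cintN f : L1 f -> cint (fun t => - f t) = - cint f.
Proof. by move=> hf; rewrite -mulN1r -cintZ//; under [in RHS]eq_fun do rewrite mulN1r. Qed.
Lemma cintB f g : L1 f -> L1 g -> cint (fun t => f t - g t) = cint f - cint g.
Proof. by move=> hf hg; rewrite cintD ?cintN//; exact: L1N. Qed.
Lemma cint_cst (c : C) : cint (fun _ : R => c) = c.
Proof. by apply: complex_eqP; exact: rint_cst. Qed.
Lemma cint_sum (I : Type) (r : seq I) (P : pred I) (F : I -> R -> C) :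
  (forall i, P i -> L1 (F i)) ->
  cint (fun t => \sum_(i <- r | P i) F i t) = \sum_(i <- r | P i) cint (F i).
Proof.
move=> h; elim: r => [|i r IH].
  by rewrite big_nil; under eq_fun do rewrite big_nil; rewrite cint_cst.
rewrite big_cons; under eq_fun do rewrite big_cons.
by case: (boolP (P i)) => Pi //; rewrite cintD ?IH//; [exact: h | exact: L1_sum].
Qed.
Lemma cintJ f : L1 f -> cint (fun t => conjc (f t)) = conjc (cint f).
Proof.
move=> /L1_ReIm[_ f1 f2]; apply: complex_eqP; rewrite ?cReJ ?cImJ /=.
  by under eq_Rintegral do rewrite cReJ.
under eq_Rintegral do rewrite cImJ -mulN1r.
by rewrite -[LHS]/(rint _) rintZ// mulN1r.
Qed.
Lemma cint_ae f g : cmeas f -> cmeas g -> aeI (fun t => f t = g t) -> cint f = cint g.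
Proof.
move=> mf mg h; apply: complex_eqP; apply: rint_ae.
- exact: mf.1.
- exact: mg.1.
- by apply: aeI_S h => t _ ->.
- exact: mf.2.
- exact: mg.2.
- by apply: aeI_S h => t _ ->.
Qed.
Lemma cabs_cint f : L1 f -> cabs (cint f) <= rint (fun t => cabs (f t)).
Proof.
move=> hf; have [e|n0] := eqVneq (cint f) 0.
  rewrite e cabs0; apply: rint_ge0; last exact: hf.2.
  by apply: aeI_W => t _; exact: cabs_ge0.
have c0 : cabs (cint f) != 0 by apply: contra_neq n0; exact: cabs_eq0.
(* Unimodular constant rotating the integral onto the positive axis, so that its modulus is a real
   part, which can be estimated inside the integral. *)
pose u := conjc (cint f) * ((cabs (cint f))^-1)%:C%C.
have cu : cabs u = 1.
  by rewrite cabsM cabsJ cabs_Cr normfV ger0_norm ?cabs_ge0// divff.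
have e : (cabs (cint f))%:C%C = cint (fun t => u * f t).
  rewrite cintZ// /u mulrAC [_ * cint f]mulrC mulcJ -rmorphM/= expr2.
  by rewrite mulfK.
have -> : cabs (cint f) = Re (cint (fun t => u * f t)) by rewrite -e.
have /L1_ReIm[_ h1 _] := L1Z u hf.
apply: rint_le => //; first exact: hf.2.
apply: aeI_W => t _; rewrite (le_trans (ler_norm _))// (le_trans (Re_le_cabs _))//.
by rewrite cabsM cu mul1r.
Qed.

Lemma ee0 : ee (0 : R) = 1.
Proof. by rewrite /ee mulr0 cos0 sin0. Qed.
Lemma ee1 : ee (1 : R) = 1.
Proof. by rewrite /ee mulr1 mulr_natl cos2pi sin2pi. Qed.
Lemma eeD (s t : R) : ee (s + t) = ee s * ee t.
Proof.
by rewrite /ee mulrDr cosD sinD; apply: complex_eqP; rewrite ?cReM ?cImM/= // addrC.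
Qed.
Lemma cabs_ee (t : R) : cabs (ee t) = 1.
Proof. by rewrite cabsE /= cos2Dsin2 sqrtr1. Qed.
Lemma ee_neq0 (t : R) : ee t != 0.
Proof. by apply/eqP => e; have := cabs_ee t; rewrite e cabs0 => /eqP; rewrite eq_sym oner_eq0. Qed.
Lemma eeN (t : R) : ee (- t) = (ee t)^-1.
Proof. by apply: (mulfI (ee_neq0 t)); rewrite -eeD subrr ee0 divff// ee_neq0. Qed.
Lemma eeJ (t : R) : conjc (ee t) = (ee t)^-1.
Proof.
by rewrite -eeN /ee mulrN cosN sinN.
Qed.
Lemma ee_natM n (t : R) : ee (n%:R * t) = ee t ^+ n.
Proof.
elim: n => [|n IH]; first by rewrite mul0r ee0.
by rewrite -natr1 mulrDl mul1r eeD IH exprSr.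
Qed.
Lemma ee_intM (k : int) (t : R) : ee (k%:~R * t) = ee t ^ k.
Proof.
case: k => n; first exact: ee_natM.
by rewrite NegzE mulrNz mulNr eeN ee_natM exprnN.
Qed.
Lemma cabs_eez (k : int) (t : R) : cabs (ee t ^ k) = 1.
Proof. by rewrite -ee_intM cabs_ee. Qed.
Lemma eezJ (k : int) (t : R) : conjc (ee t ^ k) = ee t ^ (- k).
Proof. by rewrite -!ee_intM eeJ -eeN mulrNz mulNr. Qed.
Lemma eezD (k l : int) (t : R) : ee t ^ (k + l) = ee t ^ k * ee t ^ l.
Proof. by rewrite expfzDr// ee_neq0. Qed.
Lemma eezK (k : int) (t : R) : ee t ^ k * ee t ^ (- k) = 1.
Proof. by rewrite -eezD subrr expr0z. Qed.

Lemma cmeas_eez (k : int) : cmeas (fun t : R => ee t ^ k).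
Proof.
under eq_fun do rewrite -ee_intM.
have c : continuous (fun t : R => 2 * pi * (k%:~R * t)).
  by move=> t; apply: cvgM; [exact: cvg_cst|apply: cvgM; [exact: cvg_cst|exact: cvg_id]].
have m (F : R -> R) : continuous F -> measurable_fun (@I01 R) F.
  by move=> cF; apply: (@measurable_funS _ _ _ _ setT) => //; exact: continuous_measurable_fun.
split; apply: m => t.
  by apply: (@continuous_comp _ _ _ _ (@cos R) t (c t)); exact: continuous_cos.
by apply: (@continuous_comp _ _ _ _ (@sin R) t (c t)); exact: continuous_sin.
Qed.
Lemma Linf_eez (k : int) : Linf (fun t : R => ee t ^ k).
Proof. by split; [exact: cmeas_eez|exists 1; apply: aeI_W => t _; rewrite cabs_eez]. Qed.

(** For k <> 0 the fundamental theorem of calculus is applied with the antiderivatives sin (a t) / a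
    and - cos (a t) / a, where a = 2 pi k; each takes equal values at 0 and 1. *)
Lemma cint_eez (k : int) : cint (fun t : R => ee t ^ k) = (k == 0)%:R.
Proof.
have [->|k0] := eqVneq k 0; first by under eq_fun do rewrite expr0z; rewrite cint_cst.
under eq_fun do rewrite -ee_intM.
pose a : R := 2 * pi * k%:~R.
have a0 : a != 0.
  by rewrite /a mulf_neq0 ?intr_eq0// mulf_neq0 ?pnatr_eq0// gt_eqF ?pi_gt0.
have e1 : ee k%:~R = 1 :> C by rewrite -[k%:~R]mulr1 ee_intM ee1 exp1rz.
have cca : cos a = 1 by case: e1.
have ssa : sin a = 0 by case: e1.
have ca : continuous (fun t : R => a * t).
  by move=> t; apply: cvgM; [exact: cvg_cst|exact: cvg_id].
have cc : continuous (fun t : R => cos (a * t)).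
  by move=> t; apply: continuous_comp; [exact: ca|exact: continuous_cos].
have cs : continuous (fun t : R => sin (a * t)).
  by move=> t; apply: continuous_comp; [exact: ca|exact: continuous_sin].
have ea t : 2 * pi * (k%:~R * t) = a * t by rewrite mulrA.
have da (x : R) : is_derive x (1 : R) (fun t : R => a * t) a.
  by have := is_deriveZ a (is_derive_id x (1 : R)); rewrite /GRing.scale/= mulr1.
have dS (x : R) : is_derive x (1 : R) (fun t : R => a^-1 * sin (a * t)) (cos (a * x)).
  have h : is_derive x (1 : R) (fun t => sin (a * t)) (cos (a * x) * a) by exact: is_derive1_comp.
  by have := is_deriveZ a^-1 h; rewrite /GRing.scale/= (_ : a^-1 * (cos (a * x) * a) = cos (a * x)); last by field.
have dC (x : R) : is_derive x (1 : R) (fun t : R => - a^-1 * cos (a * t)) (sin (a * x)).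
  have h : is_derive x (1 : R) (fun t => cos (a * t)) (- sin (a * x) * a) by exact: is_derive1_comp.
  by have := is_deriveZ (- a^-1) h; rewrite /GRing.scale/= (_ : - a^-1 * (- sin (a * x) * a) = sin (a * x)); last by field.
apply: complex_eqP; rewrite /cint /= /Rintegral.
- under eq_integral do rewrite ea.
  rewrite (@continuous_FTC2 _ _ (fun t => a^-1 * sin (a * t))) ?ltr01//.
  + by rewrite mulr1 mulr0 ssa sin0 mulr0 subee.
  + exact: continuous_subspaceT.
  + split.
    * by move=> x _; apply: ex_derive.
    * by apply: cvgM; [exact: cvg_cst|apply: cvg_at_right_filter; exact: cs].
    * by apply: cvgM; [exact: cvg_cst|apply: cvg_at_left_filter; exact: cs].
  + by move=> x _; rewrite derive1E derive_val.
- under eq_integral do rewrite ea.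
  rewrite (@continuous_FTC2 _ _ (fun t => - a^-1 * cos (a * t))) ?ltr01//.
  + by rewrite mulr1 mulr0 cca cos0 subee.
  + exact: continuous_subspaceT.
  + split.
    * by move=> x _; apply: ex_derive.
    * by apply: cvgM; [exact: cvg_cst|apply: cvg_at_right_filter; exact: cc].
    * by apply: cvgM; [exact: cvg_cst|apply: cvg_at_left_filter; exact: cc].
  + by move=> x _; rewrite derive1E derive_val.
Qed.

End LebesgueClasses.

(** * Fourier coefficients, trigonometric polynomials and uniform approximation *)

Section FourierUniqueness.
Variable R : realType.
Local Notation C := R[i].
Local Notation mu := (@lebesgue_measure R).
Local Notation Re := complex.Re.
Local Notation Im := complex.Im.
Implicit Types (f g h : R -> C).

Lemma L1_eez f (k : int) : L1 f -> L1 (fun t => f t * ee t ^ k).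
Proof.
move=> hf; under eq_fun do rewrite mulrC.
by apply: Linf_L1M => //; exact: Linf_eez.
Qed.
Lemma L2_eez f (k : int) : L2 f -> L2 (fun t => f t * ee t ^ k).
Proof.
move=> hf; under eq_fun do rewrite mulrC.
by apply: Linf_L2M => //; exact: Linf_eez.
Qed.
Lemma fcoefD f g k : L1 f -> L1 g -> fcoef (fun t => f t + g t) k = fcoef f k + fcoef g k.
Proof.
move=> hf hg; rewrite /fcoef; under eq_fun do rewrite mulrDl.
by rewrite cintD//; exact: L1_eez.
Qed.
Lemma fcoefZ c f k : L1 f -> fcoef (fun t => c * f t) k = c * fcoef f k.
Proof.
move=> hf; rewrite /fcoef; under eq_fun do rewrite -mulrA.
by rewrite cintZ//; exact: L1_eez.
Qed.
Lemma fcoefN f k : L1 f -> fcoef (fun t => - f t) k = - fcoef f k.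
Proof. by move=> hf; rewrite -mulN1r -fcoefZ//; under [in RHS]eq_fun do rewrite mulN1r. Qed.
Lemma fcoefB f g k : L1 f -> L1 g -> fcoef (fun t => f t - g t) k = fcoef f k - fcoef g k.
Proof. by move=> hf hg; rewrite fcoefD ?fcoefN//; exact: L1N. Qed.
Lemma fcoef_sum (I : Type) (r : seq I) (P : pred I) (F : I -> R -> C) k :
  (forall i, P i -> L1 (F i)) ->
  fcoef (fun t => \sum_(i <- r | P i) F i t) k = \sum_(i <- r | P i) fcoef (F i) k.
Proof.
move=> h; rewrite /fcoef; under eq_fun do rewrite mulr_suml.
by rewrite cint_sum// => i Pi; apply: L1_eez; exact: h.
Qed.
Lemma fcoef_ae f g k : cmeas f -> cmeas g -> aeI (fun t => f t = g t) -> fcoef f k = fcoef g k.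
Proof.
move=> mf mg h; apply: cint_ae; try (apply: cmeasM => //; exact: cmeas_eez).
by apply: aeI_S h => t _ ->.
Qed.
Lemma fcoef_shift f (m k : int) : fcoef (fun t => f t * ee t ^ m) k = fcoef f (k - m).
Proof. by rewrite /fcoef; under eq_fun do rewrite -mulrA -eezD; rewrite opprB. Qed.
Lemma fcoefJ f k : L1 f -> fcoef (fun t => conjc (f t)) k = conjc (fcoef f (- k)).
Proof.
move=> hf; rewrite /fcoef -cintJ; last exact: L1_eez.
by congr cint; apply/funext => t; rewrite rmorphM/= eezJ !opprK.
Qed.
Lemma fcoef_eez (m k : int) : fcoef (fun t : R => ee t ^ m) k = (k == m)%:R.
Proof. by rewrite /fcoef; under eq_fun do rewrite -eezD; rewrite cint_eez subr_eq0 eq_sym. Qed.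
Lemma fcoef_cst (c : C) k : fcoef (fun=> c : C) k = c * (k == 0)%:R.
Proof.
rewrite -(fcoef_eez 0 k) -fcoefZ; last exact: Linf_L1 (@Linf_eez R _).
by under [in RHS]eq_fun do rewrite expr0z mulr1.
Qed.

(** Trigonometric polynomials. The inductive form turns closure properties and the bound on the
    degree into inductions on the construction. *)
Inductive trig : (R -> C) -> Prop :=
  | trig_mono c (k : int) : trig (fun t => c * ee t ^ k)
  | trig_add f g : trig f -> trig g -> trig (fun t => f t + g t).

Lemma trig_Linf f : trig f -> Linf f.
Proof.
elim=> [c k|{}f g _ hf _ hg]; last exact: LinfD.
by apply: LinfM; [exact: Linf_cst|exact: Linf_eez].
Qed.
Lemma trig_sum (I : Type) (r : seq I) (F : I -> R -> C) :
  (forall i, trig (F i)) -> trig (fun t => \sum_(i <- r) F i t).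
Proof.
move=> h; elim: r => [|i r IH].
  under eq_fun do rewrite big_nil.
  by have := trig_mono 0 0; under eq_fun do rewrite mul0r.
by under eq_fun do rewrite big_cons; exact: trig_add.
Qed.
Lemma trigZ c f : trig f -> trig (fun t => c * f t).
Proof.
elim=> [d k|{}f g _ hf _ hg].
  by under eq_fun do rewrite mulrA; exact: trig_mono.
by under eq_fun do rewrite mulrDr; exact: trig_add.
Qed.
Lemma trig_bound f : trig f -> exists N : nat, forall k : int, (N < absz k)%N -> fcoef f k = 0.
Proof.
elim=> [c k|{}f g tf [N hN] tg [M hM]].
  exists (absz k) => l hl; rewrite fcoefZ; last exact: Linf_L1 (@Linf_eez R _).
  by rewrite fcoef_eez; case: eqP => [e|_]; rewrite ?mulr0//; move: hl; rewrite e ltnn.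
exists (maxn N M) => k; rewrite gtn_max => /andP[h1 h2].
by rewrite fcoefD ?hN ?hM ?addr0//; apply: Linf_L1; exact: trig_Linf.
Qed.
Lemma trig_orth f g : L1 f -> (forall k, fcoef f k = 0) -> trig g -> cint (fun t => f t * g t) = 0.
Proof.
move=> hf h; elim=> [c k|{}g g' tg hg tg' hg'].
  under eq_fun do rewrite mulrCA; rewrite cintZ; last exact: L1_eez.
  by have := h (- k); rewrite /fcoef opprK => ->; rewrite mulr0.
under eq_fun do rewrite mulrDr; rewrite cintD ?hg ?hg' ?addr0//.
  by under eq_fun do rewrite mulrC; apply: Linf_L1M => //; exact: trig_Linf.
by under eq_fun do rewrite mulrC; apply: Linf_L1M => //; exact: trig_Linf.
Qed.

Lemma cabs_1ee (u : R) : cabs (ee u - 1) ^+ 2 = 2 - 2 * cos (2 * pi * u).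
Proof.
by rewrite cabs_sq cReD cImD cReN cImN /= subr0 sin2cos2; ring.
Qed.
Lemma cos_far (e u : R) : 0 < e -> e <= 1 / 2 -> e <= u <= 1 - e ->
  cos (2 * pi * u) <= cos (2 * pi * e).
Proof.
move=> e0 e2 /andP[h1 h2]; have p0 := pi_gt0 R.
have aux (x y : R) : 0 <= x -> x <= y -> y <= 1 / 2 -> cos (2 * pi * y) <= cos (2 * pi * x).
  move=> x0 xy y2; have [->//|ne] := eqVneq x y.
  have {ne xy}xy : x < y by rewrite lt_neqAle ne.
  have pp : 0 < 2 * pi :> R by rewrite mulr_gt0.
  have hI (w : R) : 0 <= w -> w <= 1 / 2 -> 2 * pi * w \in `[0, pi]%R.
    move=> w0 w2; rewrite in_itv/= mulr_ge0 ?(ltW pp)//=.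
    have hw : 2 * pi * w <= 2 * pi * (1 / 2) by rewrite ler_pM2l.
    by move: hw; lra.
  apply: ltW; rewrite ltr_cos ?ltr_pM2l ?hI//; lra.
have [u2|u2] := leP u (1 / 2); first by apply: aux => //; exact: ltW.
have -> : cos (2 * pi * u) = cos (2 * pi * (1 - u)).
  rewrite mulrBr mulr1 cosB.
  by rewrite mulr_natl cos2pi sin2pi mul1r mul0r addr0.
by apply: aux; [exact: ltW|lra|lra].
Qed.
Lemma cos_lt1 (e : R) : 0 < e -> e <= 1 / 2 -> cos (2 * pi * e) < 1.
Proof.
move=> e0 e2; have p0 := pi_gt0 R.
have pp : 0 < 2 * pi :> R by rewrite mulr_gt0.
have h0 : 0 < 2 * pi * e by rewrite mulr_gt0.
have h1 : 2 * pi * e <= 2 * pi * (1 / 2) by rewrite ler_pM2l.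
have i0 : (0 : R) \in `[0, pi]%R by rewrite in_itv/= lexx pi_ge0.
have i1 : 2 * pi * e \in `[0, pi]%R by rewrite in_itv/= (ltW h0)/=; lra.
by rewrite -[ltRHS](@cos0 R) ltr_cos.
Qed.
Lemma ee_far (e u : R) : 0 < e -> e <= 1 / 2 -> e <= `|u| <= 1 - e ->
  2 - 2 * cos (2 * pi * e) <= cabs (ee u - 1) ^+ 2.
Proof.
move=> e0 e2 h; rewrite cabs_1ee.
have -> : cos (2 * pi * u) = cos (2 * pi * `|u|).
  by case: (ltrP u 0) => u0; [rewrite ltr0_norm// mulrN cosN|rewrite ger0_norm].
by have := cos_far e0 e2 h; lra.
Qed.
Lemma ee_neq1 (u : R) : 0 < `|u| < 1 -> ee u != 1.
Proof.
move=> /andP[u0 u1]; apply/eqP => e.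
pose d := Num.min (`|u|) (1 - `|u|).
have d0 : 0 < d by rewrite lt_min u0 subr_gt0.
have d2 : d <= 1 / 2.
  by rewrite /d; case: (ltrP `|u| (1 - `|u|)) => h; lra.
have := @ee_far d u d0 d2; rewrite e subrr cabs0 expr0n/=.
have := cos_lt1 d0 d2 => h1 h2.
have : 2 - 2 * cos (2 * pi * d) <= 0.
  apply: h2; rewrite ge_min lexx /=; have : d <= 1 - `|u| by rewrite ge_min lexx orbT.
  by lra.
by lra.
Qed.

(** One-sided Dirichlet kernel; its squared modulus divided by M is the Fejer kernel. *)
Definition Dker (M : nat) (t : R) : C := \sum_(l < M) ee t ^+ l.

(** The geometric sum gives (z - 1) D_M = z^M - 1, of modulus at most 2. *)
Lemma Dker_far M (t : R) : cabs (Dker M t) ^+ 2 * cabs (ee t - 1) ^+ 2 <= 4.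
Proof.
rewrite -exprMn -cabsM mulrC -subrX1.
have -> : 4 = 2 ^+ 2 :> R by ring.
rewrite lerXn2r ?nnegrE ?cabs_ge0//.
apply: le_trans (cabsD _ _) _; rewrite cabsN cabs1 cabsX cabs_ee expr1n; lra.
Qed.

(** Orthogonality of the M-th roots of unity: w = exp(2 pi i k / M) satisfies w^M = 1, and w <> 1
    because 0 < |k| < M. *)
Lemma root_sum (M : nat) (k : int) : (absz k < M)%N ->
  \sum_(j < M) ee (j%:R / M%:R : R) ^ k = (k == 0)%:R * M%:R.
Proof.
move=> kM; have [->|k0] := eqVneq k 0.
  under eq_bigr do rewrite expr0z; rewrite sumr_const card_ord mul1r//.
have M0 : (M%:R : R) != 0 by rewrite pnatr_eq0 -lt0n; case: (M) kM.
have Mp : (0 : R) < M%:R by rewrite ltr0n; case: (M) kM.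
pose w : C := ee (k%:~R / M%:R).
have ew (j : 'I_M) : ee (j%:R / M%:R : R) ^ k = w ^+ j.
  by rewrite -ee_intM /w -ee_natM; congr ee; field.
under eq_bigr do rewrite ew; rewrite mul0r.
have w1 : w != 1.
  apply: ee_neq1; rewrite normrM normfV normr_nat -intr_norm -natr_absz.
  apply/andP; split; last by rewrite ltr_pdivrMr// mul1r ltr_nat.
  by apply: divr_gt0 => //; rewrite ltr0n absz_gt0.
have : w ^+ M - 1 = 0.
  apply/eqP; rewrite subr_eq0; apply/eqP; rewrite /w -ee_natM.
  have -> : M%:R * (k%:~R / M%:R) = k%:~R * 1 :> R by field.
  by rewrite ee_intM ee1 exp1rz.
rewrite subrX1 => /eqP; rewrite mulf_eq0 subr_eq0 (negbTE w1)/= => /eqP //.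
Qed.

Lemma Dker_sqE M (t s : R) : (cabs (Dker M (t - s)) ^+ 2)%:C%C =
  \sum_(l < M) \sum_(l' < M) ee t ^ (l%:Z - l'%:Z) * ee s ^ (l'%:Z - l%:Z).
Proof.
rewrite -mulcJ /Dker rmorph_sum/= mulr_suml; apply: eq_bigr => l _.
rewrite mulr_sumr; apply: eq_bigr => l' _.
rewrite -[_ ^+ l]/(_ ^ l%:Z) -[_ ^+ l']/(_ ^ l'%:Z) eezJ -eezD.
by rewrite -!ee_intM mulrBr eeD -[(l'%:Z - l%:Z)]opprB mulrNz mulNr.
Qed.
(** Discrete form of the normalization of the Fejer kernel: the exponents l - l' have modulus less
    than M, so summation over the M nodes keeps only l = l'. *)
Lemma Dker_sum M (t : R) : \sum_(j < M) cabs (Dker M (t - j%:R / M%:R)) ^+ 2 = M%:R ^+ 2.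
Proof.
apply: (@complexI R); rewrite rmorph_sum/=.
under eq_bigr do rewrite Dker_sqE.
rewrite exchange_big/=.
rewrite rmorphXn/= rmorph_nat expr2.
transitivity (\sum_(l < M) (M%:R : C)); last by rewrite sumr_const card_ord mulr_natr.
apply: eq_bigr => l _; rewrite exchange_big/=.
rewrite (eq_bigr (fun l' : 'I_M => ee t ^ (l%:Z - l'%:Z) *
  ((l'%:Z - l%:Z == 0)%:R * M%:R))); last first.
  move=> l' _; rewrite -mulr_sumr root_sum//.
  by have := ltn_ord l; have := ltn_ord l'; lia.
rewrite (bigD1 l)//= subrr eqxx expr0z !mul1r big1 ?addr0// => i il.
by rewrite subr_eq0 eqz_nat (negbTE (_ : (i : nat) != l)) ?mul0r ?mulr0.
Qed.

Lemma unif_cont01 (g : R -> R) : continuous g -> forall e : R, 0 < e ->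
  exists2 d : R, 0 < d & forall s y : R, I01 s -> `|s - y| < d -> `|g s - g y| < e.
Proof.
move=> cg e e0.
have /compact_near_coveringP := @segment_compact R 0 1.
move=> /(_ R (0^'+) (fun d s => forall y, `|s - y| < d -> `|g s - g y| < e) _).
have h (x : R) : `[0, 1]%classic x -> \forall x' \near x & i \near 0^'+,
    (fun d s => forall y, `|s - y| < d -> `|g s - g y| < e) i x'.
  move=> _; have e2 : 0 < e / 2 by rewrite divr_gt0.
  have /cvgrPdist_lt /(_ _ e2) /nbhs_ballP[r /= r0 hr] := cg x.
  have r2 : 0 < r / 2 by rewrite divr_gt0.
  exists (ball x (r / 2), [set d | d < r / 2]); first split => /=.
  - exact: nbhsx_ballx.
  - exact: nbhs_right_lt.
  - move=> [x' d]/= [hx' hd] y hy.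
    have h1 : `|g x - g x'| < e / 2.
      by apply: hr; rewrite /ball/= (lt_trans hx')// ltr_pdivrMr// ltr_pMr// ltr1n.
    have h2 : `|g x - g y| < e / 2.
      apply: hr; rewrite /ball/= -[x](subrK x') -addrA (le_lt_trans (ler_normD _ _))//.
      by move: hx'; rewrite /ball/= => hx'; rewrite [r]splitr ltrD// (lt_trans hy).
    rewrite -[g x'](subrK (g x)) -addrA (le_lt_trans (ler_normD _ _))//.
    by rewrite [e]splitr ltrD// distrC.
move=> /(_ h) [d /= d0 hd].
exists (d / 2); first by rewrite divr_gt0.
move=> s y Is; apply: (hd (d / 2)) => //=; last by rewrite divr_gt0.
by rewrite sub0r normrN gtr0_norm ?divr_gt0// ltr_pdivrMr// ltr_pMr// ltr1n.
Qed.

Lemma bounded01 (g : R -> R) : continuous g -> exists2 B, 0 < B & forall t, I01 t -> `|g t| <= B.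
Proof.
move=> cg; have [|c _ hc] := @EVT_max R (fun t => `|g t|) 0 1 ler01.
  by apply: continuous_subspaceT => t; apply: continuous_comp; [exact: cg|exact: norm_continuous].
exists (`|g c| + 1); first by rewrite ltr_wpDl.
by move=> t It; rewrite (le_trans (hc t It))// lerDl.
Qed.

(** Fejer means with the integral replaced by an average over the nodes j / M. The approximant is a
    finite sum, hence a trigonometric polynomial by construction, and its weights still add up to
    1. *)
Lemma fejer_real (g : R -> R) : continuous g -> g 0 = g 1 -> forall e : R, 0 < e ->
  exists2 p, trig p & forall t, I01 t -> cabs (p t - (g t)%:C%C) <= e.
Proof.
move=> cg g01 e e0; have [B B0 hB] := bounded01 cg.
have e4 : 0 < e / 4 by rewrite divr_gt0.
have [d' d'0 hd'] := unif_cont01 cg e4.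
pose d := Num.min (1/2) (d' / 2).
have d0 : 0 < d by rewrite lt_min !divr_gt0.
have d2 : d <= 1 / 2 by rewrite ge_min lexx.
have dd' : d < d'.
  apply: (@le_lt_trans _ _ (d' / 2)); first by rewrite ge_min lexx orbT.
  by rewrite ltr_pdivrMr// ltr_pMr// ltr1n.
pose c := 2 - 2 * cos (2 * pi * d).
have c0 : 0 < c by rewrite /c; have := cos_lt1 d0 d2; lra.
(* Far nodes contribute at most 8 B / c each to the unnormalized sum; this size of M makes their
   total at most M^2 e / 2. *)
have [m hm] : exists m : nat, 16 * B / (c * e) < m.+1%:R.
  exists (Num.bound (16 * B / (c * e))); apply: (lt_le_trans (archi_boundP _)).
    by rewrite divr_ge0 ?mulr_ge0 ?ltW.
  by rewrite ler_nat.
pose M := m.+1; have M0 : (0 : R) < M%:R by rewrite ltr0n.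
pose K (t s : R) : R := cabs (Dker M (t - s)) ^+ 2.
have K0 t s : 0 <= K t s by rewrite exprn_ge0// cabs_ge0.
pose x (j : 'I_M) : R := j%:R / M%:R.
have Ix j : I01 (x j).
  rewrite /I01/= in_itv/=; apply/andP; split; first by rewrite divr_ge0 ?ler0n.
  by rewrite ler_pdivrMr// mul1r ler_nat ltnW.
pose p (t : R) : C := (M%:R ^- 2)%:C%C * \sum_(j < M) (g (x j))%:C%C * (K t (x j))%:C%C.
exists p.
  rewrite /p; apply: trigZ; apply: trig_sum => j; apply: trigZ.
  under eq_fun do rewrite /K Dker_sqE.
  apply: trig_sum => l; apply: trig_sum => l'.
  by under eq_fun do rewrite mulrC; exact: trig_mono.
move=> t It.
have -> : p t - (g t)%:C%C = ((M%:R ^- 2) * \sum_(j < M) (g (x j) - g t) * K t (x j))%:C%C.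
  have ep : p t = (M%:R ^- 2 * \sum_(j < M) g (x j) * K t (x j))%:C%C.
    rewrite /p CrM Cr_sum; congr (_ * _).
    by apply: eq_bigr => j _; rewrite CrM.
  have eg : g t = M%:R ^- 2 * \sum_(j < M) g t * K t (x j).
    have M2 : (M%:R ^+ 2 : R) != 0 by apply: expf_neq0; rewrite gt_eqF.
    by rewrite -mulr_sumr /K Dker_sum mulrCA mulVf// mulr1.
  rewrite ep {1}eg -rmorphB/= -mulrBr -sumrB.
  rewrite (eq_bigr (fun j => (g (x j) - g t) * K t (x j)))// => j _.
  by rewrite mulrBl.
rewrite cabs_Cr normrM ger0_norm ?invr_ge0 ?exprn_ge0//.
rewrite mulrC ler_pdivrMr ?exprn_gt0//.
apply: (le_trans (ler_norm_sum _ _ _)).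
have key (j : 'I_M) : `|(g (x j) - g t) * K t (x j)| <= e / 2 * K t (x j) + 8 * B / c.
  rewrite normrM [`|K _ _|]ger0_norm//.
  have [near|far] := boolP ((d <= `|t - x j| <= 1 - d)); last first.
    have : `|g (x j) - g t| <= e / 2.
      move: far; rewrite negb_and -!ltNge => /orP[far|far].
        have e24 : e / 4 <= e / 2 by lra.
        apply: le_trans e24; apply: ltW; apply: hd' => //.
        by rewrite distrC (lt_trans far).
      (* Here t and the node are near opposite ends of [0,1], hence near on the circle; [g 0 = g 1]
         links the two ends. *)
      have It' := It; move: It' (Ix j); rewrite /I01/= !in_itv/= => /andP[t0 t1] /andP[x0 x1].
      have [xt|tx] := lerP (x j) t.
        move: far; rewrite ger0_norm ?subr_ge0// => far.
        have h1 : `|g (x j) - g 0| < e / 4.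
          by apply: hd' => //; rewrite subr0 ger0_norm//; lra.
        have h2 : `|g t - g 1| < e / 4.
          by apply: hd' => //; rewrite distrC ger0_norm ?subr_ge0//; lra.
        move: h1 h2; rewrite g01 !ltr_norml => /andP[? ?] /andP[? ?].
        by rewrite ler_norml; apply/andP; split; lra.
      move: far; rewrite ltr0_norm ?subr_lt0// => far.
      have h1 : `|g (x j) - g 1| < e / 4.
        by apply: hd' => //; rewrite distrC ger0_norm ?subr_ge0//; lra.
      have h2 : `|g t - g 0| < e / 4.
        by apply: hd' => //; rewrite subr0 ger0_norm//; lra.
      move: h1 h2; rewrite g01 !ltr_norml => /andP[? ?] /andP[? ?].
      by rewrite ler_norml; apply/andP; split; lra.
    move=> h; rewrite -[leLHS]addr0 lerD ?ler_wpM2r//.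
    by rewrite divr_ge0 ?mulr_ge0 ?ltW.
  have h1 : `|g (x j) - g t| <= 2 * B.
    apply: le_trans (ler_normB _ _) _; have := hB _ (Ix j); have := hB _ It; lra.
  have h2 : K t (x j) <= 4 / c.
    rewrite ler_pdivlMr//; apply: le_trans (Dker_far M (t - x j)).
    by rewrite /K ler_wpM2l ?exprn_ge0 ?cabs_ge0//; exact: ee_far.
  apply: (@le_trans _ _ (2 * B * (4 / c))); first by rewrite ler_pM.
  have -> : 2 * B * (4 / c) = 8 * B / c by field; rewrite gt_eqF.
  by rewrite lerDr mulr_ge0// divr_ge0// ltW.
apply: (le_trans (ler_sum _ (fun j _ => key j))).
rewrite big_split/= -mulr_sumr /K Dker_sum sumr_const card_ord -mulr_natl -/M.
have : 16 * B / (c * e) <= M%:R by exact: ltW.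
rewrite ler_pdivrMr ?mulr_gt0// => h.
have h8 : 8 * B / c <= M%:R * (e / 2).
  by rewrite ler_pdivrMr//; lra.
have : M%:R * (8 * B / c) <= M%:R * (M%:R * (e / 2)) by rewrite ler_wpM2l// ltW.
by rewrite expr2; lra.
Qed.

Lemma fejer (g : R -> C) : continuous (fun t => Re (g t)) -> continuous (fun t => Im (g t)) ->
  g 0 = g 1 -> forall e : R, 0 < e ->
  exists2 p, trig p & forall t, I01 t -> cabs (p t - g t) <= e.
Proof.
move=> c1 c2 g01 e e0; have e2 : 0 < e / 2 by rewrite divr_gt0.
have [p tp hp] := @fejer_real _ c1 (congr1 (@complex.Re R) g01) _ e2.
have [q tq hq] := @fejer_real _ c2 (congr1 (@complex.Im R) g01) _ e2.
exists (fun t => p t + 'i%C * q t); first by apply: trig_add => //; exact: trigZ.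
move=> t It.
have -> : p t + 'i%C * q t - g t = (p t - (Re (g t))%:C%C) + 'i%C * (q t - (Im (g t))%:C%C).
  by rewrite {1}(complexE (g t)); ring.
apply: le_trans (cabsD _ _) _; rewrite [e]splitr lerD ?hp// cabsM.
have -> : cabs ('i%C : C) = 1 by rewrite cabsE/= expr0n/= add0r expr1n sqrtr1.
by rewrite mul1r hq.
Qed.

End FourierUniqueness.

(** * Uniqueness of Fourier coefficients *)

Section Uniqueness.
Variable R : realType.
Local Notation C := R[i].
Local Notation mu := (@lebesgue_measure R).
Local Notation Re := complex.Re.
Local Notation Im := complex.Im.
Implicit Types (f g h : R -> C).

Lemma rint_dct (u : nat -> R -> R) (v w : R -> R) :
  (forall n, rmeas (u n)) -> rmeas v ->
  aeI (fun t => (u n t @[n --> \oo] --> v t)%R) -> RI w ->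
  (forall n, aeI (fun t => `|u n t| <= w t)) ->
  RI v /\ rint (u n) @[n --> \oo] --> rint v.
Proof.
move=> mu' mv h hw hb.
have [] := @dominated_convergence _ _ _ mu (@I01 R) (@mI01' R) (fun n t => (u n t)%:E) (EFin \o v) (EFin \o w).
- by move=> n; apply/measurable_EFinP; exact: mu'.
- exact/measurable_EFinP.
- apply: (@filterS _ _ (aeI_filter R)) h => t H It.
  by apply: cvg_EFin; [exact: nearW|apply: H].
- by [].
- apply: (@filterS _ _ (aeI_filter R)) (aeI_foralln hb) => t H n It.
  by rewrite lee_fin; apply: H.
move=> iv _ hc; split=> //.
have e : (\int[mu]_(x in @I01 R) (EFin \o v) x)%E = (rint v)%:E.
  by rewrite /rint /Rintegral fineK//; apply: (integrable_fin_num (@mI01' R) iv).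
rewrite e in hc.
exact: fine_cvg hc.
Qed.

(** Trapezoids tending to the indicator of ]0, b[ show that the primitive of phi starting at 0
    vanishes on [0,1]; Lebesgue differentiation then gives phi = 0. The trapezoids vanish at 0 and
    at 1, so they are admissible test functions. *)
Lemma RI_zero_test (phi : R -> R) : RI phi ->
  (forall g : R -> R, continuous g -> g 0 = g 1 -> rint (fun t => phi t * g t) = 0) ->
  aeI (fun t => phi t = 0).
Proof.
move=> hphi H.
have key (b : R) : 0 <= b <= 1 -> \int[mu]_(t in `[0, b]) (phi t) = 0.
  move=> /andP[b0 b1].
  pose g (n : nat) (t : R) := Num.max 0 (Num.min 1 (Num.min (n%:R * t) (n%:R * (b - t)))).
  have cg n : continuous (g n).
    have c1 : continuous (fun t : R => n%:R * t).
      by move=> t; apply: cvgM; [exact: cvg_cst|exact: cvg_id].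
    have c2 : continuous (fun t : R => n%:R * (b - t)).
      by move=> t; apply: cvgM; [exact: cvg_cst|apply: cvgB; [exact: cvg_cst|exact: cvg_id]].
    have cc (z : R) : continuous (fun _ : R => z) by move=> t; exact: cvg_cst.
    move=> t; have h1 := continuous_min (c1 t) (c2 t).
    exact: (continuous_max (cc 0 t) (continuous_min (cc 1 t) h1)).
  have g0 n : g n 0 = 0.
    by rewrite /g mulr0; apply/eqP; rewrite eq_le le_max lexx /= andbT ge_max lexx/= !ge_min lexx orbT.
  have g1 n : g n 1 = 0.
    rewrite /g; apply/eqP; rewrite eq_le le_max lexx /= andbT ge_max lexx/= !ge_min.
    by rewrite (_ : n%:R * (b - 1) <= 0) ?orbT// mulr_ge0_le0 ?subr_le0.
  have gb n t : `|g n t| <= 1.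
    rewrite /g ger0_norm; last by rewrite le_max lexx.
    by rewrite ge_max ler01/= ge_min lexx.
  have lim0 : aeI (fun t => (phi t * g n t @[n --> \oo] --> (phi \_ `]0, b[%classic) t)%R).
    apply: aeI_W => t _; rewrite patchE; case: ifPn => [|/negP].
      rewrite inE/= in_itv/= => /andP[t0 tb].
      rewrite -[X in _ --> X]mulr1; apply: cvgM; first exact: cvg_cst.
      pose d := Num.min t (b - t); have d0 : 0 < d by rewrite lt_min t0 subr_gt0.
      apply: cvg_near_cst; near=> n.
      have nd : 1 <= n%:R * d.
        rewrite -ler_pdivrMr// mul1r; near: n; exact: nbhs_infty_ger.
      have h1 : 1 <= n%:R * t by apply: le_trans nd _; rewrite ler_wpM2l// ge_min lexx.
      have h2 : 1 <= n%:R * (b - t).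
        by apply: le_trans nd _; rewrite ler_wpM2l// ge_min lexx orbT.
      rewrite /g; rewrite (min_idPl _); last by rewrite le_min h1.
      by apply/max_idPr.
    rewrite inE/= in_itv/= => /negP; rewrite negb_and -!leNgt => tt.
    have -> : (fun n => phi t * g n t) = (fun=> 0).
      apply/funext => n; rewrite /g (max_idPl _) ?mulr0// !ge_min.
      case/orP: tt => tt; first by rewrite (mulr_ge0_le0 (ler0n _ n) tt) orbT.
      by rewrite (_ : n%:R * (b - t) <= 0) ?orbT// mulr_ge0_le0 ?subr_le0.
    exact: cvg_cst.
  have hm : rmeas (phi \_ `]0, b[%classic).
    apply/measurable_restrict => //; first exact: mI01.
    apply: measurable_funS (RI_meas hphi); first exact: mI01.
    by move=> x [].
  have [_ hl] : RI (phi \_ `]0, b[%classic) /\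
      rint (fun t => phi t * g n t) @[n --> \oo] --> rint (phi \_ `]0, b[%classic).
    apply: (@rint_dct _ _ (fun t => `|phi t|)) => //.
    - move=> n; apply: measurable_funM; first exact: RI_meas.
      by apply: (@measurable_funS _ _ _ _ setT) => //; exact: continuous_measurable_fun.
    - exact: RI_norm.
    - by move=> n; apply: aeI_W => t _; rewrite normrM ler_piMr.
  have z : rint (phi \_ `]0, b[%classic) = 0.
    apply: (cvg_unique _ hl) => //.
    have -> : (fun n => rint (fun t => phi t * g n t)) = (fun=> 0).
      by apply/funext => n; apply: (H (g n)); rewrite ?g0 ?g1.
    exact: cvg_cst.
  have sub : (`]0, b[%classic : set R) `<=` @I01 R.
    move=> x; rewrite /I01/= !in_itv/= => /andP[x0 xb]; rewrite ltW//=.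
    by rewrite ltW// (lt_le_trans xb).
  have i1 : mu.-integrable `]0, b[%classic (EFin \o phi).
    by apply: integrableS hphi => //; exact: mI01'.
  have i2 : mu.-integrable `[0, b[%classic (EFin \o phi).
    apply: integrableS hphi => //; first exact: mI01'.
    move=> x; rewrite /I01/= !in_itv/= => /andP[-> xb]/=.
    by rewrite ltW// (lt_le_trans xb).
  rewrite -[RHS]z /rint -Rintegral_mkcondr.
  have -> : @I01 R `&` `]0, b[%classic = `]0, b[%classic by apply/seteqP; split=> [x []|x h] //; split=> //; exact: sub.
  by rewrite (Rintegral_itv_obnd_cbnd i1) (Rintegral_itv_bndo_bndc i2).
(* Extension by 0, so that the differentiation theorem applies on the whole line. *)
pose psi := phi \_ (@I01 R).
have ipsi : mu.-integrable setT (EFin \o psi).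
  have : mu.-integrable setT ((EFin \o phi) \_ (@I01 R)).
    by have [h _] := @integrable_mkcond _ _ _ mu (@I01 R) (EFin \o phi) (@mI01' R); exact: h.
  by rewrite restrict_EFin.
have := @FTC1 R psi (BLeft 0) _ (integrable_locally (@mI01' R) hphi).
have hy (y : R) : mu.-integrable [set` Interval (BLeft 0) (BRight y)] (EFin \o psi).
  by apply: integrableS ipsi.
move=> /(_ hy).
have hF (x : R) : 0 <= x <= 1 -> \int[mu]_(t in [set` Interval (BLeft 0) (BRight x)]) psi t = 0.
  move=> hx; rewrite -[RHS](key x hx); apply: eq_Rintegral => t; rewrite inE/= in_itv/= => /andP[t0 tx].
  rewrite /psi patchE mem_set// /I01/= in_itv/= t0/=.
  by case/andP: hx => _; exact: le_trans.
have ne (a : R) : aeI (fun t : R => t != a).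
  exists ([set a] : set R); split.
  - exact: measurable_set1.
  - exact: lebesgue_measure_set1.
  - by move=> t /= ht; apply: contrapT => hn; apply: ht => It; apply/eqP.
have n0 : aeI (fun t : R => t != 0 /\ t != 1) by apply: aeI_and; exact: ne.
move=> hftc; apply: (@filterS2 _ _ (aeI_filter R)) hftc n0 => t /= h1 h2 It.
have [t0 t1] := h2 It.
have It' := It; move: It'; rewrite /I01/= in_itv/= => /andP[t00 t11].
have tt : 0 < t < 1 by rewrite !lt_neqAle eq_sym t0 t00 t1 t11.
have [|_] := h1; first by rewrite /= lte_fin; case/andP: tt.
have -> : psi t = phi t by rewrite /psi patchE mem_set.
move=> <-; rewrite derive1E.
rewrite (@near_eq_derive _ _ _ _ (cst 0)) ?derive_cst//.
near=> y; apply: hF; near: y; case/andP: tt => a b.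
have : \forall y \near t, y \in `]0, 1[%R by apply: near_in_itvoo; rewrite in_itv/= a b.
by apply: filterS => y; rewrite in_itv/= => /andP[/ltW-> /ltW->].
Unshelve. all: by end_near. Qed.

(** Orthogonality to trigonometric polynomials extends to continuous periodic functions by uniform
    approximation, at the cost of the uniform error times the L1 norm of f. *)
Lemma L1_unique f : L1 f -> (forall k, fcoef f k = 0) -> aeI (fun t => f t = 0).
Proof.
move=> hf h.
have H (g : R -> R) : continuous g -> g 0 = g 1 -> cint (fun t => f t * (g t)%:C%C) = 0.
  move=> cg g01; apply: cabs_eq0; apply/eqP; rewrite eq_le cabs_ge0 andbT.
  apply/ler_addgt0Pl => e e0; rewrite addr0.
  pose N := rint (fun t => cabs (f t)).
  have N0 : 0 <= N by apply: rint_ge0 hf.2; apply: aeI_W => t _; exact: cabs_ge0.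
  have e1 : 0 < e / (N + 1) by rewrite divr_gt0// ltr_wpDl.
  have [p tp hp] := fejer_real cg g01 e1.
  have mg : Linf (fun t => (g t)%:C%C : C).
    have [B _ hB] := bounded01 cg; split; last first.
      by exists B; apply: aeI_W => t It; rewrite cabs_Cr; exact: hB.
    split=> /=; last exact: measurable_cst.
    by apply: (@measurable_funS _ _ _ _ setT) => //; exact: continuous_measurable_fun.
  have fg : L1 (fun t => f t * (g t)%:C%C) by under eq_fun do rewrite mulrC; exact: Linf_L1M.
  have fp : L1 (fun t => f t * p t).
    by under eq_fun do rewrite mulrC; apply: Linf_L1M => //; exact: trig_Linf.
  have -> : cint (fun t => f t * (g t)%:C%C) = cint (fun t => f t * (g t)%:C%C - f t * p t).
    by rewrite cintB// (trig_orth hf h tp) subr0.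
  apply: (le_trans (cabs_cint (L1B fg fp))).
  apply: (@le_trans _ _ (rint (fun t => e / (N + 1) * cabs (f t)))).
    apply: rint_le; [exact: (L1B fg fp).2|apply: RI_Z; exact: hf.2|].
    apply: aeI_W => t It; rewrite -mulrBr cabsM mulrC ler_wpM2r ?cabs_ge0//.
    by rewrite -cabsN opprB hp.
  rewrite rintZ; last exact: hf.2.
  rewrite -/N mulrAC ler_pdivrMr ?ltr_wpDl//.
  by rewrite ler_pM2l// lerDl.
have /L1_ReIm[_ h1 h2] := hf.
have z1 : aeI (fun t => Re (f t) = 0).
  apply: RI_zero_test => // g cg g01; have := congr1 (@complex.Re R) (H g cg g01).
  rewrite /cint/=; under eq_Rintegral do rewrite cReM/= mulr0 subr0; by [].
have z2 : aeI (fun t => Im (f t) = 0).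
  apply: RI_zero_test => // g cg g01; have := congr1 (@complex.Im R) (H g cg g01).
  rewrite /cint/=; under eq_Rintegral do rewrite cImM/= mulr0 add0r; by [].
by apply: aeI_S2 z1 z2 => t _ e1 e2; exact: complex_eqP.
Qed.

Lemma L1_unique2 f g : L1 f -> L1 g -> (forall k, fcoef f k = fcoef g k) -> aeI (fun t => f t = g t).
Proof.
move=> hf hg h; have := @L1_unique _ (L1B hf hg).
have h0 k : fcoef (fun t => f t - g t) k = 0 by rewrite fcoefB// h subrr.
by move=> /(_ h0); apply: aeI_S => t _ /eqP; rewrite subr_eq0 => /eqP.
Qed.
End Uniqueness.

(** * The Hilbert spaces L2 of scalar and of vector functions *)

Section HilbertSpace.
Variable R : realType.
Local Notation C := R[i].
Local Notation mu := (@lebesgue_measure R).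
Local Notation Re := complex.Re.
Local Notation Im := complex.Im.

Definition ipc (f g : R -> C) : C := cint (fun t => f t * conjc (g t)).
Definition n2 (f : R -> C) : R := rint (fun t => cabs (f t) ^+ 2).

Section Vec.
Variable n : nat.
Implicit Types (f g h : R -> 'cV[C]_n).

Definition V2 f := mx_in (@L2 R) f.
Definition nn f : R := rint (fun t => \sum_(i < n) cabs (f t i ord0) ^+ 2).
Definition vip f g : C := \sum_(i < n) ipc (fun t => f t i ord0) (fun t => g t i ord0).

Lemma l2normE f : l2norm f = Num.sqrt (nn f). Proof. by []. Qed.
Lemma l2norm_ge0 f : 0 <= l2norm f. Proof. exact: sqrtr_ge0. Qed.
Lemma V2D f g : V2 f -> V2 g -> V2 (fun t => f t + g t).
Proof. by move=> hf hg i j; under eq_fun do rewrite mxE; apply: L2D; [exact: hf|exact: hg]. Qed.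
Lemma V2N f : V2 f -> V2 (fun t => - f t).
Proof. by move=> hf i j; under eq_fun do rewrite mxE; apply: L2N; exact: hf. Qed.
Lemma V2B f g : V2 f -> V2 g -> V2 (fun t => f t - g t).
Proof. by move=> hf hg; apply: V2D => //; exact: V2N. Qed.
Lemma V2Z c f : V2 f -> V2 (fun t => c *: f t).
Proof. by move=> hf i j; under eq_fun do rewrite mxE; apply: L2Z; exact: hf. Qed.
Lemma V2_cst (c : 'cV[C]_n) : V2 (fun=> c).
Proof. by move=> i j; exact: L2_cst. Qed.

Lemma V2_ip f g i : V2 f -> V2 g -> L1 (fun t => f t i ord0 * conjc (g t i ord0)).
Proof. by move=> hf hg; apply: L2_L1M; [exact: hf|apply: L2J; exact: hg]. Qed.
Lemma RI_nn f : V2 f -> RI (fun t => \sum_(i < n) cabs (f t i ord0) ^+ 2).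
Proof. by move=> hf; apply: RI_sum => i _; exact: (hf i ord0).2. Qed.
Lemma nn_ge0 f : V2 f -> 0 <= nn f.
Proof.
move=> hf; apply: rint_ge0; last exact: RI_nn.
by apply: aeI_W => t _; apply: sumr_ge0 => i _; rewrite exprn_ge0// cabs_ge0.
Qed.
Lemma nn_sum f : V2 f -> nn f = \sum_(i < n) n2 (fun t => f t i ord0).
Proof. by move=> hf; rewrite /nn rint_sum// => i _; exact: (hf i ord0).2. Qed.
Lemma l2norm_sq f : V2 f -> l2norm f ^+ 2 = nn f.
Proof. by move=> hf; rewrite sqr_sqrtr//; exact: nn_ge0. Qed.
Lemma vipDl f g h : V2 f -> V2 g -> V2 h -> vip (fun t => f t + g t) h = vip f h + vip g h.
Proof.
move=> hf hg hh; rewrite /vip -big_split/=; apply: eq_bigr => i _; rewrite /ipc.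
by under eq_fun do rewrite mxE mulrDl; rewrite cintD//; exact: V2_ip.
Qed.
Lemma vipZl c f h : V2 f -> V2 h -> vip (fun t => c *: f t) h = c * vip f h.
Proof.
move=> hf hh; rewrite /vip mulr_sumr; apply: eq_bigr => i _; rewrite /ipc.
by under eq_fun do rewrite mxE -mulrA; rewrite cintZ//; exact: V2_ip.
Qed.
Lemma vipNl f h : V2 f -> V2 h -> vip (fun t => - f t) h = - vip f h.
Proof.
move=> hf hh; rewrite -mulN1r -vipZl//; congr vip; apply/funext => t.
by rewrite scaleN1r.
Qed.
Lemma vipBl f g h : V2 f -> V2 g -> V2 h -> vip (fun t => f t - g t) h = vip f h - vip g h.
Proof. by move=> hf hg hh; rewrite vipDl ?vipNl//; exact: V2N. Qed.
Lemma vipC f g : V2 f -> V2 g -> vip g f = conjc (vip f g).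
Proof.
move=> hf hg; rewrite /vip cJ_sum; apply: eq_bigr => i _; rewrite /ipc -cintJ; last exact: V2_ip.
by congr cint; apply/funext => t; rewrite cJM conjcK mulrC.
Qed.
Lemma vipDr f g h : V2 f -> V2 g -> V2 h -> vip h (fun t => f t + g t) = vip h f + vip h g.
Proof.
move=> hf hg hh; rewrite (vipC (V2D hf hg) hh) vipDl// cJD.
by rewrite -!vipC.
Qed.
Lemma vipBr f g h : V2 f -> V2 g -> V2 h -> vip h (fun t => f t - g t) = vip h f - vip h g.
Proof.
move=> hf hg hh; rewrite (vipC (V2B hf hg) hh) vipBl// cJD cJN.
by rewrite -!vipC.
Qed.
Lemma vipZr c f h : V2 f -> V2 h -> vip h (fun t => c *: f t) = conjc c * vip h f.
Proof.
by move=> hf hh; rewrite (vipC (V2Z c hf) hh) vipZl// cJM -vipC.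
Qed.
Lemma vip_nn f : V2 f -> vip f f = (nn f)%:C%C.
Proof.
move=> hf; rewrite nn_sum// Cr_sum; apply: eq_bigr => i _; rewrite /ipc.
under eq_fun do rewrite mulcJ.
apply: complex_eqP => /=; first by [].
by rewrite -[LHS]/(rint (cst 0)) rint_cst.
Qed.
Lemma nnD f g : V2 f -> V2 g -> nn (fun t => f t + g t) = nn f + nn g + 2 * Re (vip f g).
Proof.
move=> hf hg; have hfg := V2D hf hg; apply: (@complexI R); rewrite -vip_nn//.
rewrite vipDl// !vipDr// (vipC hf hg) !vip_nn//.
by apply: complex_eqP; rewrite ?cReD ?cImD ?cReJ ?cImJ /=; ring.
Qed.
Lemma nnZ c f : V2 f -> nn (fun t => c *: f t) = cabs c ^+ 2 * nn f.
Proof.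
move=> hf; have hz := V2Z c hf; apply: (@complexI R); rewrite -vip_nn//.
rewrite vipZl// vipZr// mulrA mulcJ vip_nn//.
by rewrite -CrM.
Qed.
Lemma nnN f : V2 f -> nn (fun t => - f t) = nn f.
Proof. by move=> hf; rewrite /nn; under eq_fun do under eq_bigr do rewrite mxE cabsN. Qed.
Lemma nnB f g : V2 f -> V2 g -> nn (fun t => f t - g t) = nn f + nn g - 2 * Re (vip f g).
Proof.
move=> hf hg; rewrite nnD ?nnN//; last exact: V2N.
have -> : vip f (fun t => - g t) = - vip f g.
  rewrite (vipC (V2N hg) hf) vipNl// cJN -vipC//.
by rewrite cReN mulrN.
Qed.
Lemma nn_eq0 f : V2 f -> nn f = 0 -> aeI (fun t => f t = 0).
Proof.
move=> hf h.
have := rint_eq0 (RI_nn hf) _ h.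
have p t : 0 <= \sum_(i < n) cabs (f t i ord0) ^+ 2.
  by apply: sumr_ge0 => i _; rewrite exprn_ge0// cabs_ge0.
move=> /(_ p); apply: aeI_S => t _ /eqP; rewrite psumr_eq0; last first.
  by move=> i _; rewrite exprn_ge0// cabs_ge0.
move=> /allP H; apply/matrixP => i j; rewrite ord1 mxE; apply: cabs_eq0.
by have /(_ (mem_index_enum i)) := H i; rewrite sqrf_eq0 => /eqP.
Qed.
Lemma nn_ae f g : V2 f -> V2 g -> aeI (fun t => f t = g t) -> nn f = nn g.
Proof.
move=> hf hg h; apply: rint_ae.
- exact: RI_meas (RI_nn hf).
- exact: RI_meas (RI_nn hg).
- by apply: aeI_S h => t _ ->.
Qed.
Lemma vip_ae f g h : V2 f -> V2 g -> V2 h -> aeI (fun t => f t = g t) -> vip f h = vip g h.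
Proof.
move=> hf hg hh e; apply: eq_bigr => i _; apply: cint_ae.
- exact: L1_meas (V2_ip i hf hh).
- exact: L1_meas (V2_ip i hg hh).
- by apply: aeI_S e => t _ ->.
Qed.
Lemma CS_sq f g : V2 f -> V2 g -> cabs (vip f g) ^+ 2 <= nn f * nn g.
Proof.
move=> hf hg; have [g0|g0] := eqVneq (nn g) 0.
  have gz := nn_eq0 hg g0.
  have -> : vip f g = 0.
    rewrite (vipC hg hf) (vip_ae hg (V2_cst 0) hf gz).
    rewrite /vip big1 ?conjc0// => i _; rewrite /ipc.
    by under eq_fun do rewrite mxE mul0r; rewrite cint_cst.
  by rewrite cabs0 expr0n/= g0 mulr0.
have gp : 0 < nn g by rewrite lt_neqAle eq_sym g0 nn_ge0.
(* f - c g is the component of f orthogonal to g; the inequality is the positivity of its squared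
   norm. *)
pose c := vip f g * ((nn g)^-1)%:C%C.
have := nn_ge0 (V2B hf (V2Z c hg)).
rewrite nnB//; last exact: V2Z.
rewrite nnZ// vipZr//.
have -> : conjc c * vip f g = (cabs (vip f g) ^+ 2 / nn g)%:C%C.
  rewrite /c cJM conjc_real mulrAC [_ * vip f g]mulrC mulcJ -CrM//.
rewrite cabsM cabs_Cr exprMn /=.
have gi : 0 <= (nn g)^-1 by rewrite invr_ge0 ltW.
rewrite (ger0_norm gi).
set x := cabs (vip f g) ^+ 2; have -> : x * (nn g)^-1 ^+ 2 * nn g = x / nn g by field.
move=> h; rewrite -ler_pdivrMr//; lra.
Qed.
Lemma CS f g : V2 f -> V2 g -> cabs (vip f g) <= l2norm f * l2norm g.
Proof.
move=> hf hg; rewrite -(@ler_pXn2r _ 2)// ?nnegrE ?cabs_ge0 ?mulr_ge0 ?l2norm_ge0//.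
by rewrite exprMn !l2norm_sq// CS_sq.
Qed.
Lemma l2normD f g : V2 f -> V2 g -> l2norm (fun t => f t + g t) <= l2norm f + l2norm g.
Proof.
move=> hf hg; have hfg := V2D hf hg.
rewrite -(@ler_pXn2r _ 2)// ?nnegrE ?addr_ge0 ?l2norm_ge0//.
rewrite sqrrD !l2norm_sq// nnD//.
have h1 := CS hf hg; have h2 := le_trans (ler_norm _) (Re_le_cabs (vip f g)).
by rewrite mulr2n; lra.
Qed.
Lemma l2normN f : V2 f -> l2norm (fun t => - f t) = l2norm f.
Proof. by move=> hf; rewrite !l2normE nnN. Qed.
Lemma l2normB f g : V2 f -> V2 g -> l2norm (fun t => f t - g t) <= l2norm f + l2norm g.
Proof. by move=> hf hg; rewrite -(l2normN hg); apply: l2normD => //; exact: V2N. Qed.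
Lemma l2normZ c f : V2 f -> l2norm (fun t => c *: f t) = cabs c * l2norm f.
Proof.
by move=> hf; rewrite !l2normE nnZ// sqrtrM ?exprn_ge0 ?cabs_ge0// sqrtr_sqr ger0_norm// cabs_ge0.
Qed.
Lemma l2norm_ae f g : V2 f -> V2 g -> aeI (fun t => f t = g t) -> l2norm f = l2norm g.
Proof. by move=> hf hg h; rewrite !l2normE (nn_ae hf hg). Qed.
Lemma l2norm_eq0 f : V2 f -> l2norm f = 0 -> aeI (fun t => f t = 0).
Proof. by move=> hf h; apply: nn_eq0 => //; rewrite -l2norm_sq// h expr0n. Qed.
Lemma nn_le (a : R) f g : 0 <= a -> V2 f -> V2 g ->
  aeI (fun t => \sum_(i < n) cabs (f t i ord0) ^+ 2 <= a ^+ 2 * \sum_(i < n) cabs (g t i ord0) ^+ 2) ->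
  l2norm f <= a * l2norm g.
Proof.
move=> a0 hf hg h; rewrite -(@ler_pXn2r _ 2)// ?nnegrE ?mulr_ge0 ?l2norm_ge0//.
rewrite exprMn !l2norm_sq// /nn -rintZ; last exact: RI_nn.
by apply: rint_le => //; [exact: RI_nn|apply: RI_Z; exact: RI_nn].
Qed.
End Vec.

(** Scalar functions as vectors of length one, so that the identities proved for vectors carry over
    to [ipc] and [n2]. *)
Definition sc (f : R -> C) : R -> 'cV[C]_1 := fun t => const_mx (f t).
Lemma V2_sc f : L2 f -> V2 (sc f).
Proof. by move=> hf i j; under eq_fun do rewrite mxE. Qed.
Lemma nn_sc f : nn (sc f) = n2 f.
Proof. by rewrite /nn /n2; under eq_fun do rewrite big_ord1 mxE. Qed.
Lemma vip_sc f g : vip (sc f) (sc g) = ipc f g.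
Proof. by rewrite /vip big_ord1 /ipc; under eq_fun do rewrite !mxE. Qed.
Lemma n2_ge0 f : L2 f -> 0 <= n2 f.
Proof. by move=> hf; rewrite -nn_sc; apply: nn_ge0; exact: V2_sc. Qed.
Lemma ipc_CS f g : L2 f -> L2 g -> cabs (ipc f g) ^+ 2 <= n2 f * n2 g.
Proof. by move=> hf hg; rewrite -vip_sc -!nn_sc; apply: CS_sq; exact: V2_sc. Qed.
Lemma n2_eez k : n2 (fun t => ee t ^ k) = 1.
Proof. by rewrite /n2; under eq_fun do rewrite cabs_eez expr1n; exact: rint_cst. Qed.
Lemma fcoef_ipc f k : fcoef f k = ipc f (fun t => ee t ^ k).
Proof. by rewrite /fcoef /ipc; under [in RHS]eq_fun do rewrite eezJ. Qed.
Lemma fcoef_n2 f k : L2 f -> cabs (fcoef f k) ^+ 2 <= n2 f.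
Proof.
move=> hf; rewrite fcoef_ipc -[leRHS]mulr1 -(n2_eez k); apply: ipc_CS => //.
exact: Linf_L2 (@Linf_eez R k).
Qed.
Lemma cabs_cint_n2 f : L2 f -> cabs (cint f) ^+ 2 <= n2 f.
Proof.
by move=> hf; have := fcoef_n2 0 hf; rewrite /fcoef; under eq_fun do rewrite oppr0 expr0z mulr1.
Qed.
Lemma n2_ae f g : L2 f -> L2 g -> aeI (fun t => f t = g t) -> n2 f = n2 g.
Proof.
by move=> hf hg h; rewrite -!nn_sc; apply: nn_ae; [exact: V2_sc|exact: V2_sc|apply: aeI_S h => t _ e; rewrite /sc e].
Qed.
End HilbertSpace.

(** * Completeness of L2 *)

Section Completeness.
Variable R : realType.
Local Notation C := R[i].
Local Notation mu := (@lebesgue_measure R).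
Local Notation Re := complex.Re.
Local Notation Im := complex.Im.

Lemma rintE (f : R -> R) : RI f -> (rint f)%:E = (\int[mu]_(x in @I01 R) (f x)%:E)%E.
Proof. by move=> hf; rewrite /rint /Rintegral fineK//; exact: (integrable_fin_num (@mI01' R) hf). Qed.

(** The sum of the series has integral at most B, so it is finite almost everywhere and bounds all
    partial sums. *)
Lemma beppo_levi (w : nat -> R -> R) B : (forall k, RI (w k)) -> (forall k t, 0 <= w k t) ->
  (forall n, \sum_(k < n) rint (w k) <= B) ->
  aeI (fun t => exists M, forall n, \sum_(k < n) w k t <= M).
Proof.
move=> iw w0 hB.
pose S (t : R) : \bar R := (\sum_(k <oo) (w k t)%:E)%E.
have mw k : measurable_fun (@I01 R) (fun t => (w k t)%:E).
  by apply/measurable_EFinP; exact: RI_meas.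
have mS : measurable_fun (@I01 R) S.
  by apply: ge0_emeasurable_sum => // *; rewrite lee_fin.
have iS : (\int[mu]_(t in @I01 R) S t <= B%:E)%E.
  have w0' n x : @I01 R x -> (0 <= (w n x)%:E)%E by rewrite lee_fin.
  rewrite (integral_nneseries mu (@mI01' R) mw w0').
  apply: lime_le.
    by apply: is_cvg_nneseries => k _ _; apply: integral_ge0 => *; rewrite lee_fin.
  near=> n; rewrite big_mkord.
  under eq_bigr do rewrite -rintE//.
  by rewrite sumEFin lee_fin.
have S0 t : (0 <= S t)%E by apply: nneseries_ge0 => k _ _; rewrite lee_fin.
have : mu.-integrable (@I01 R) S.
  apply/integrableP; split=> //.
  under eq_integral do rewrite gee0_abs//.
  by apply: le_lt_trans iS _; exact: ltry.
move/integrable_ae => /(_ (@mI01' R)); apply: (@filterS _ _ (aeI_filter R)) => t h It.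
exists (fine (S t)) => n; rewrite -lee_fin fineK; last exact: h.
rewrite -sumEFin -(big_mkord xpredT (fun k => (w k t)%:E)).
by apply: nneseries_lim_ge => k _ _; rewrite lee_fin.
Unshelve. all: by end_near. Qed.

Lemma rint_fatou (g : nat -> R -> R) (h : R -> R) e :
  (forall k, RI (g k)) -> (forall k t, 0 <= g k t) -> rmeas h -> (forall t, 0 <= h t) ->
  aeI (fun t => (g k t @[k --> \oo] --> h t)%R) -> (forall k, rint (g k) <= e) ->
  RI h /\ rint h <= e.
Proof.
move=> ig g0 mh h0 hc he.
have key : (\int[mu]_(t in @I01 R) (h t)%:E <= e%:E)%E.
  have -> : (\int[mu]_(t in @I01 R) (h t)%:E = \int[mu]_(t in @I01 R) limn_einf (fun k => (g k t)%:E))%E.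
    apply: ae_eq_integral => //.
    - exact: mI01'.
    - exact/measurable_EFinP.
    - have -> : (fun t => limn_einf (fun k => (g k t)%:E)) =
         (fun t => - limn_esup (fun k => (- g k t)%:E))%E.
        by apply/funext => t; rewrite /limn_einf; congr (- limn_esup _)%E; apply/funext => k /=.
      apply: measurableT_comp => //; apply: measurable_fun_limn_esup => k.
      by apply/measurable_EFinP; apply: measurable_funN; exact: RI_meas.
    - apply: (@filterS _ _ (aeI_filter R)) hc => t H It.
      have cE : ((g k t)%:E @[k --> \oo] --> (h t)%:E)%E.
        by apply: cvg_EFin; [exact: nearW|exact: H].
      by have [-> _] := cvg_limn_einf_sup cE.
  have mg k : measurable_fun (@I01 R) (fun t => (g k t)%:E).
    by apply/measurable_EFinP; exact: RI_meas.
  have g0' k x : @I01 R x -> (0 <= (g k x)%:E)%E by rewrite lee_fin.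
  apply: le_trans (fatou mu (@mI01' R) mg g0') _.
  apply: le_trans (limn_einf_sup _) _; rewrite limn_esup_lim.
  apply: lime_le; first exact: is_cvg_esups.
  apply: nearW => n; apply: ge_ereal_sup => _ [k _ <-].
  by rewrite -rintE// lee_fin.
have ih : RI h.
  apply/integrableP; split; first exact/measurable_EFinP.
  under eq_integral do rewrite gee0_abs ?lee_fin//.
  by apply: le_lt_trans key _; exact: ltry.
by split=> //; rewrite -lee_fin rintE.
Qed.

(** Cauchy-Schwarz against the constant 1, applied to |f|. *)
Lemma n2_L1 (f : R -> C) : L2 f -> rint (fun t => cabs (f t)) <= Num.sqrt (n2 f).
Proof.
move=> hf; pose g t : C := (cabs (f t))%:C%C.
have hg : L2 g.
  apply/L2E; split; first by split; [exact: rmeas_cabs (L2_meas hf)|exact: measurable_cst].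
  by under eq_fun do rewrite /g cabs_Cr ger0_norm ?cabs_ge0//; exact: hf.2.
have e1 : n2 g = n2 f.
  by rewrite /n2; under eq_fun do rewrite /g cabs_Cr ger0_norm ?cabs_ge0//.
have e2 : cint g = (rint (fun t => cabs (f t)))%:C%C.
  by apply: complex_eqP => //=; exact: rint_cst.
have r0 : 0 <= rint (fun t => cabs (f t)).
  by apply: rint_ge0 (L2_L1 hf).2; apply: aeI_W => t _; exact: cabs_ge0.
have := cabs_cint_n2 hg; rewrite e1 e2 cabs_Cr (ger0_norm r0) => h.
by rewrite -(ger0_norm r0) -sqrtr_sqr ler_wsqrtr.
Qed.

Lemma cvg_series_bounded (a w : nat -> R) M : (forall k, `|a k.+1 - a k| <= w k) ->
  (forall n, \sum_(k < n) w k <= M) -> cvgn a.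
Proof.
move=> ha hw.
have w0 k : 0 <= w k by apply: le_trans (ha k).
have cw : cvgn (series w).
  apply: nondecreasing_is_cvgn.
    by apply/nondecreasing_seqP => n; rewrite !seriesEnat/= big_nat_recr//= lerDl.
  by exists M => _ [n _ <-]; rewrite seriesEnat/= big_mkord.
have ca : cvgn (series (telescope a)).
  apply: normed_cvg; apply: (series_le_cvg _ _ _ cw) => k //=.
  by rewrite /telescope/=; exact: ha.
have -> : a = (fun n => series (telescope a) n + a 0%N).
  by apply/funext => n; rewrite telescopeK/= subrK.
by apply: is_cvgD => //; exact: is_cvg_cst.
Qed.

(** Along a subsequence with squared increments at most 4^-k the L1 norms of the increments are at
    most 2^-k, hence summable, and the subsequence converges almost everywhere. Fatou's lemma
    carries the Cauchy estimate to the limit. *)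
Lemma L2_complete (u : nat -> R -> C) : (forall k, L2 (u k)) ->
  (forall e : R, 0 < e -> exists N, forall m k, (N <= m)%N -> (N <= k)%N ->
     n2 (fun t => u m t - u k t) <= e) ->
  exists2 f, L2 f & forall e : R, 0 < e -> exists N, forall m, (N <= m)%N ->
     n2 (fun t => u m t - f t) <= e.
Proof.
move=> hu hc.
have hc4 (k : nat) : exists N, forall m l, (N <= m)%N -> (N <= l)%N ->
    n2 (fun t => u m t - u l t) <= (4 ^- k : R) by apply: hc; rewrite invr_gt0 exprn_gt0.
have [phi0 hphi0] := choice hc4.
(* The partial sums make both [phi k] and [phi k.+1] at least [phi0 k], and the summand k sends the
   indices to infinity. *)
pose phi k := (\sum_(i < k.+1) phi0 i + k)%N.
have phi_ge k : (phi0 k <= phi k)%N.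
  by rewrite /phi big_ord_recr/= addnAC; apply: leq_trans (leq_addl _ _).
have phi_geS k : (phi0 k <= phi k.+1)%N.
  rewrite /phi big_ord_recr/= big_ord_recr/=; lia.
have phi_id k : (k <= phi k)%N by rewrite /phi leq_addl.
pose v k := u (phi k).
have dv k : n2 (fun t => v k.+1 t - v k t) <= 4 ^- k by apply: hphi0.
have ldv k : L2 (fun t => v k.+1 t - v k t) by apply: L2B; exact: hu.
pose w k t := cabs (v k.+1 t - v k t).
have iw k : RI (w k) := (L2_L1 (ldv k)).2.
have w0 k t : 0 <= w k t by exact: cabs_ge0.
have rw k : rint (w k) <= 2 ^- k.
  apply: le_trans (n2_L1 (ldv k)) _.
  have -> : 2 ^- k = Num.sqrt (4 ^- k) :> R.
    rewrite -exprVn -[in RHS]exprVn.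
    have -> : 4^-1 = (2^-1) ^+ 2 :> R by field.
    by rewrite -exprM mulnC exprM sqrtr_sqr ger0_norm// exprn_ge0// invr_ge0.
  by rewrite ler_wsqrtr.
have sw n : \sum_(k < n) rint (w k) <= 2.
  have : \sum_(k < n) rint (w k) <= 2 - 2 * 2 ^- n.
    elim: n => [|n IH]; first by rewrite big_ord0 expr0 invr1; lra.
    rewrite big_ord_recr/=; have := rw n; rewrite exprS invfM.
    move: IH; lra.
  move/le_trans; apply; rewrite lerBlDr lerDl mulr_ge0// invr_ge0 exprn_ge0//.
have good := beppo_levi iw w0 sw.
(* The upper limit is measurable on all of [0,1] and equals the limit wherever that exists. *)
pose fr t := fine (limn_esup (fun k => (Re (v k t))%:E)).
pose fi t := fine (limn_esup (fun k => (Im (v k t))%:E)).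
pose f t : C := Complex (fr t) (fi t).
have mf : cmeas f.
  have aux (a : nat -> R -> R) : (forall k, rmeas (a k)) ->
      rmeas (fun t => fine (limn_esup (fun k => (a k t)%:E))).
    move=> ma; have h : measurable_fun (@I01 R) (fun t => limn_esup (fun k => (a k t)%:E)).
      by apply: measurable_fun_limn_esup => k; apply/measurable_EFinP; exact: ma.
    by apply: (measurableT_comp _ h).
  split; apply: aux => k.
    exact: (L2_meas (hu _)).1.
  exact: (L2_meas (hu _)).2.
have cr : aeI (fun t => (Re (v k t) @[k --> \oo] --> fr t)%R /\ (Im (v k t) @[k --> \oo] --> fi t)%R).
  apply: aeI_S good => t _ [M hM].
  have aux (a : nat -> R) : (forall k, `|a k.+1 - a k| <= w k t) ->
      a k @[k --> \oo] --> fine (limn_esup (fun k => (a k)%:E)).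
    move=> ha; have ca := cvg_series_bounded ha hM.
    have /cvg_ex[l hl] := ca.
    have cE : ((a k)%:E @[k --> \oo] --> l%:E)%E by apply: cvg_EFin; [exact: nearW|exact: hl].
    by have [_ ->] := cvg_limn_einf_sup cE.
  split; apply: aux => k; apply: le_trans (_ : _ <= cabs (v k.+1 t - v k t)) _ => //.
    by rewrite -cReN -cReD; exact: Re_le_cabs.
  by rewrite -cImN -cImD; exact: Im_le_cabs.
have key (e : R) N : (forall m k, (N <= m)%N -> (N <= k)%N -> n2 (fun t => u m t - u k t) <= e) ->
  forall m, (N <= m)%N -> RI (fun t => cabs (u m t - f t) ^+ 2) /\ n2 (fun t => u m t - f t) <= e.
  move=> hN m Nm.
  apply: (@rint_fatou (fun k t => cabs (u m t - v (k + N)%N t) ^+ 2)).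
  - by move=> k; apply: (L2B (hu m) (hu _)).2.
  - by move=> k t; rewrite exprn_ge0// cabs_ge0.
  - by apply: rmeas_cabs2; apply: cmeasB => //; exact: L2_meas.
  - by move=> t; rewrite exprn_ge0// cabs_ge0.
  - apply: aeI_S cr => t _ [c1 c2].
    rewrite cabs_sq; under eq_fun do rewrite cabs_sq !cReD !cImD !cReN !cImN.
    rewrite cReD cImD cReN cImN.
    have s1 : Re (v (k + N)%N t) @[k --> \oo] --> fr t by rewrite (cvg_shiftn N (fun k => Re (v k t))).
    have s2 : Im (v (k + N)%N t) @[k --> \oo] --> fi t by rewrite (cvg_shiftn N (fun k => Im (v k t))).
    apply: cvgD.
      have h1 : Re (u m t) - Re (v (k + N)%N t) @[k --> \oo] --> Re (u m t) - fr t.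
        by apply: cvgB => //; exact: cvg_cst.
      exact: (cvgM h1 h1).
    have h2 : Im (u m t) - Im (v (k + N)%N t) @[k --> \oo] --> Im (u m t) - fi t.
      by apply: cvgB => //; exact: cvg_cst.
    exact: (cvgM h2 h2).
  - move=> k; apply: hN => //.
    by apply: leq_trans (phi_id _); exact: leq_addl.
have hf : L2 f.
  have [N hN] := hc 1 ltr01.
  have [h1 _] := key _ _ hN N (leqnn _).
  have : L2 (fun t => u N t - f t) by apply/L2E; split=> //; apply: cmeasB => //; exact: L2_meas.
  move=> h2; have := L2B (hu N) h2.
  by under eq_fun do rewrite subKr.
exists f => // e e0; have [N hN] := hc e e0; exists N => m Nm.
by have [] := key _ _ hN m Nm.
Qed.
End Completeness.

(** * Riesz projection and the scalar Hardy classes *)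

Section RieszProjection.
Variable R : realType.
Local Notation C := R[i].
Local Notation Re := complex.Re.
Local Notation Im := complex.Im.
Implicit Types (f g h : R -> C).

Lemma sc_D f g : sc (fun t => f t + g t) = (fun t => sc f t + sc g t).
Proof. by apply/funext => t; apply/matrixP => i j; rewrite !mxE. Qed.
Lemma sc_N f : sc (fun t => - f t) = (fun t => - sc f t).
Proof. by apply/funext => t; apply/matrixP => i j; rewrite !mxE. Qed.
Lemma sc_Z c f : sc (fun t => c * f t) = (fun t => c *: sc f t).
Proof. by apply/funext => t; apply/matrixP => i j; rewrite !mxE. Qed.
Lemma n2D f g : L2 f -> L2 g -> n2 (fun t => f t + g t) = n2 f + n2 g + 2 * Re (ipc f g).
Proof.
by move=> hf hg; rewrite -!nn_sc -vip_sc sc_D nnD//; exact: V2_sc.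
Qed.
Lemma n2N f : n2 (fun t => - f t) = n2 f.
Proof. by rewrite /n2; under eq_fun do rewrite cabsN. Qed.
Lemma n2B f g : L2 f -> L2 g -> n2 (fun t => f t - g t) = n2 f + n2 g - 2 * Re (ipc f g).
Proof.
move=> hf hg; rewrite -!nn_sc -vip_sc sc_D sc_N nnB//; exact: V2_sc.
Qed.
Lemma n2Z c f : L2 f -> n2 (fun t => c * f t) = cabs c ^+ 2 * n2 f.
Proof. by move=> hf; rewrite -!nn_sc sc_Z nnZ//; exact: V2_sc. Qed.
Lemma ipcBl f g h : L2 f -> L2 g -> L2 h -> ipc (fun t => f t - g t) h = ipc f h - ipc g h.
Proof. by move=> hf hg hh; rewrite -!vip_sc sc_D sc_N vipBl//; exact: V2_sc. Qed.
Lemma ipcC f g : L2 f -> L2 g -> ipc g f = conjc (ipc f g).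
Proof. by move=> hf hg; rewrite -!vip_sc -vipC//; exact: V2_sc. Qed.
Lemma ipcBr f g h : L2 f -> L2 g -> L2 h -> ipc h (fun t => f t - g t) = ipc h f - ipc h g.
Proof. by move=> hf hg hh; rewrite -!vip_sc sc_D sc_N vipBr//; exact: V2_sc. Qed.
Lemma ipc_ae f g h : L2 f -> L2 g -> L2 h -> aeI (fun t => f t = g t) -> ipc f h = ipc g h.
Proof.
move=> hf hg hh e; rewrite -!vip_sc; apply: vip_ae; try exact: V2_sc.
by apply: aeI_S e => t _ e; rewrite /sc e.
Qed.
Lemma L2_eezZ (c : C) (k : int) : L2 (fun t => c * ee t ^ k).
Proof. by apply: L2Z; exact: Linf_L2 (@Linf_eez R k). Qed.
Lemma ipc_eez (c : C) (k : int) f : L2 f -> ipc f (fun t => c * ee t ^ k) = conjc c * fcoef f k.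
Proof.
move=> hf; rewrite /ipc /fcoef -cintZ; last by apply: L1_eez; exact: L2_L1.
by congr cint; apply/funext => t; rewrite cJM eezJ mulrCA.
Qed.

Section Series.
Variables (kap : nat -> int) (f : R -> C).
Hypotheses (kinj : injective kap) (hf : L2 f).

(** The injection [kap] enumerates a set of frequencies: [Posz] gives the analytic part of f, [Negz]
    the antianalytic part. *)
Definition psum m n (t : R) : C := \sum_(m <= k < n) fcoef f (kap k) * ee t ^ kap k.

Lemma L2_psum m n : L2 (psum m n).
Proof. by apply: L2_sum => k _; exact: L2_eezZ. Qed.
Lemma fcoef_psum m n j : fcoef (psum m n) j = \sum_(m <= k < n) fcoef f (kap k) * (j == kap k)%:R.
Proof.
rewrite /psum fcoef_sum; last by move=> k _; apply: L2_L1; exact: L2_eezZ.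
apply: eq_bigr => k _; rewrite fcoefZ ?fcoef_eez//.
exact: Linf_L1 (@Linf_eez R _).
Qed.
Lemma n2_psum m n : n2 (psum m n) = \sum_(m <= k < n) cabs (fcoef f (kap k)) ^+ 2.
Proof.
have [nm|mn] := leqP n m.
  rewrite /psum big_geq//; under eq_fun do rewrite big_geq//.
  by rewrite /n2; under eq_fun do rewrite cabs0 expr0n/=; exact: rint_cst.
elim: n mn => // n IH; rewrite ltnS leq_eqVlt => /orP[/eqP<-|mn].
  rewrite /psum big_nat1; under eq_fun do rewrite big_nat1.
  by rewrite n2Z ?n2_eez ?mulr1//; exact: Linf_L2 (@Linf_eez R _).
rewrite big_nat_recr 1?ltnW//= -IH//.
have -> : psum m n.+1 = (fun t => psum m n t + fcoef f (kap n) * ee t ^ kap n).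
  by apply/funext => t; rewrite /psum big_nat_recr 1?ltnW.
rewrite n2D; [|exact: L2_psum|exact: L2_eezZ].
rewrite ipc_eez; last exact: L2_psum.
rewrite fcoef_psum big_nat big1 => [|k /andP[mk kn]].
  rewrite mulr0 mulr0 addr0 n2Z ?n2_eez ?mulr1//.
  exact: Linf_L2 (@Linf_eez R _).
case: eqP => [/kinj e|_]; last by rewrite mulr0.
by move: kn; rewrite e ltnn.
Qed.
Lemma bessel n : \sum_(0 <= k < n) cabs (fcoef f (kap k)) ^+ 2 <= n2 f.
Proof.
have := n2_ge0 (L2B hf (L2_psum 0 n)).
rewrite n2B//; last exact: L2_psum.
have -> : ipc f (psum 0 n) = (\sum_(0 <= k < n) cabs (fcoef f (kap k)) ^+ 2)%:C%C.
  rewrite (ipcC (L2_psum 0 n) hf) /ipc.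
  under eq_fun do rewrite /psum mulr_suml.
  rewrite cint_sum; last by move=> k _; apply: L2_L1M; [exact: L2_eezZ|exact: L2J].
  rewrite cJ_sum Cr_sum; apply: eq_bigr => k _.
  rewrite -[cint _]/(ipc (fun t => fcoef f (kap k) * ee t ^ kap k) f).
  rewrite -(ipcC (L2_eezZ _ _) hf) ipc_eez//.
  by rewrite mulrC mulcJ.
by rewrite n2_psum/=; lra.
Qed.

(** Bessel's inequality makes the partial sums a Cauchy sequence; a single coefficient is continuous
    in L2, which identifies the coefficients of the limit. *)
Lemma riesz_fischer : exists2 g, L2 g &
  [/\ forall j, fcoef g (kap j) = fcoef f (kap j),
      forall j, (forall k, kap k <> j) -> fcoef g j = 0 &
      forall e : R, 0 < e -> exists N, forall m, (N <= m)%N -> n2 (fun t => psum 0 m t - g t) <= e].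
Proof.
have [g hg hc] : exists2 g, L2 g &
   forall e : R, 0 < e -> exists N, forall m, (N <= m)%N -> n2 (fun t => psum 0 m t - g t) <= e.
  apply: L2_complete => [k|e e0]; first exact: L2_psum.
  pose a n := \sum_(0 <= k < n) cabs (fcoef f (kap k)) ^+ 2.
  have ca : cvgn a.
    apply: nondecreasing_is_cvgn.
      apply/nondecreasing_seqP => n; rewrite /a big_nat_recr//= lerDl.
      by rewrite exprn_ge0// cabs_ge0.
    by exists (n2 f) => _ [n _ <-]; exact: bessel.
  have /cauchy_cvgP/cauchyP := ca.
  have e2 : 0 < e / 2 by rewrite divr_gt0.
  move=> /(_ _ e2)[l [N _ hN]].
  have aux m k : (N <= m)%N -> (m <= k)%N -> n2 (fun t => psum 0 k t - psum 0 m t) <= e.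
    move=> Nm mk.
    have -> : (fun t => psum 0 k t - psum 0 m t) = psum m k.
      by apply/funext => t; rewrite /psum (big_cat_nat _ mk)//= addrAC subrr add0r.
    rewrite n2_psum.
    have -> : \sum_(m <= i < k) cabs (fcoef f (kap i)) ^+ 2 = a k - a m.
      by rewrite /a [in RHS](big_cat_nat _ mk)//= addrAC subrr add0r.
    have h1 : ball l (e / 2) (a m) by apply: hN.
    have h2 : ball l (e / 2) (a k) by apply: hN; exact: leq_trans mk.
    move: h1 h2; rewrite /ball/= !ltr_norml => /andP[? ?] /andP[? ?]; lra.
  exists N => m k Nm Nk; have [mk|/ltnW km] := leqP m k; last exact: aux.
  rewrite -n2N; under eq_fun do rewrite opprB; exact: aux.
exists g => //.
have lim j (c : C) N0 : (forall m, (N0 <= m)%N -> fcoef (psum 0 m) j = c) -> fcoef g j = c.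
  move=> hN0; apply/eqP; rewrite -subr_eq0; apply/eqP; apply: cabs_eq0; apply/eqP.
  rewrite -sqrf_eq0 eq_le exprn_ge0 ?cabs_ge0// andbT; apply/ler_addgt0Pl => e e0; rewrite addr0.
  have [N hN] := hc e e0; pose m := maxn N0 N.
  have := hN m (leq_maxr _ _); apply: le_trans.
  rewrite -(hN0 m (leq_maxl _ _)) -cabsN opprB -fcoefB.
  - by apply: fcoef_n2; apply: L2B => //; exact: L2_psum.
  - by apply: L2_L1; exact: L2_psum.
  - exact: L2_L1.
split=> // j.
  apply: (lim _ _ j.+1) => m jm; rewrite fcoef_psum big_mkord.
  rewrite (bigD1 (Ordinal jm))//= eqxx mulr1 big1 ?addr0// => i /eqP ij.
  case: eqP => [/kinj e|]; last by rewrite mulr0.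
  by case: ij; apply: val_inj.
move=> hj; apply: (lim _ _ 0%N) => m _; rewrite fcoef_psum big1// => i _.
by case: eqP => [e|]; rewrite ?mulr0//; case: (hj i).
Qed.
End Series.

Lemma trig_psum kap f m n : trig (psum kap f m n).
Proof. by apply: trig_sum => k; exact: trig_mono. Qed.

Lemma H2_L2 f : H2 f -> L2 f. Proof. by case. Qed.
Lemma H2m_L2 f : H2minus f -> L2 f. Proof. by case. Qed.

Lemma riesz_proj f : L2 f -> exists2 g, H2 g & H2minus (fun t => f t - g t).
Proof.
move=> hf; have inj : injective Posz by move=> a b [].
have [g hg [h1 h2 _]] := riesz_fischer inj hf.
exists g; split=> //; first by move=> k k0; apply: h2 => j e; move: k0; rewrite -e.
  exact: L2B.
move=> [k|//] _; rewrite fcoefB ?h1 ?subrr//; exact: L2_L1.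
Qed.

Lemma trig_dense f (e : R) : L2 f -> 0 < e -> exists2 p, trig p & n2 (fun t => f t - p t) <= e.
Proof.
move=> hf e0; have inj : injective Posz by move=> a b [].
have inj' : injective Negz by move=> a b [].
have [g hg [g1 g2 g3]] := riesz_fischer inj hf.
have [h hh [h1 h2 h3]] := riesz_fischer inj' hf.
have gh : aeI (fun t => g t + h t = f t).
  apply: L1_unique2; [by apply: L2_L1; exact: L2D|exact: L2_L1|move=> k].
  rewrite fcoefD; [|exact: L2_L1|exact: L2_L1].
  by case: k => k; rewrite ?g1 ?h1 ?h2 ?g2 ?addr0 ?add0r.
(* By the parallelogram law n2 (a + b) <= 2 n2 a + 2 n2 b, so two errors of e / 4 give at most e. *)
have e4 : 0 < e / 4 by rewrite divr_gt0.
have [N1 /(_ _ (leqnn _)) k1] := g3 _ e4; have [N2 /(_ _ (leqnn _)) k2] := h3 _ e4.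
set p := psum _ _ _ _ in k1; set q := psum _ _ _ _ in k2.
have Lp : L2 p := L2_psum _ _ _ _; have Lq : L2 q := L2_psum _ _ _ _.
exists (fun t => p t + q t); first by apply: trig_add; exact: trig_psum.
have La := L2B hg Lp; have Lb := L2B hh Lq.
have -> : n2 (fun t => f t - (p t + q t)) = n2 (fun t => (g t - p t) + (h t - q t)).
  apply: n2_ae; [by apply: L2B => //; exact: L2D|exact: L2D|].
  by apply: aeI_S gh => t _ <-; ring.
move: k1 k2; rewrite -n2N -[X in _ -> X <= _ -> _]n2N.
under eq_fun do rewrite opprB; under [X in _ -> n2 X <= _ -> _]eq_fun do rewrite opprB.
move=> k1 k2.
have := n2_ge0 (L2B La Lb); rewrite (n2B La Lb) (n2D La Lb); lra.
Qed.

Lemma H2_orth f g : H2 f -> H2minus g -> ipc f g = 0.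
Proof.
move=> [hf f0] [hg g0]; have inj : injective Posz by move=> a b [].
have [g' hg' [h1 h2 h3]] := riesz_fischer inj hf.
have ff : aeI (fun t => f t = g' t).
  apply: L1_unique2; [exact: L2_L1|exact: L2_L1|].
  by move=> [k|k]; rewrite ?h1// f0// h2.
rewrite (ipc_ae hf hg' hg ff).
apply: cabs_eq0; apply/eqP; rewrite -sqrf_eq0 eq_le exprn_ge0 ?cabs_ge0// andbT.
apply/ler_addgt0Pl => e e0; rewrite addr0.
have e1 : 0 < e / (n2 g + 1) by rewrite divr_gt0// ltr_wpDl// n2_ge0.
have [N /(_ _ (leqnn _)) hN] := h3 _ e1.
set p := psum _ _ _ _ in hN; have Lp : L2 p := L2_psum _ _ _ _.
have -> : ipc g' g = - ipc (fun t => p t - g' t) g.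
  rewrite ipcBl// opprB; suff -> : ipc p g = 0 by rewrite subr0.
  rewrite /ipc; under eq_fun do rewrite /p /psum mulr_suml.
  rewrite cint_sum; last by move=> k _; apply: L2_L1M; [exact: L2_eezZ|exact: L2J].
  rewrite big1// => k _.
  rewrite -[cint _]/(ipc (fun t => fcoef f (Posz k) * ee t ^ Posz k) g).
  by rewrite (ipcC hg (L2_eezZ _ _)) ipc_eez// g0// mulr0 conjc0.
rewrite cabsN; apply: le_trans (ipc_CS _ hg) _; first exact: L2B.
apply: le_trans (ler_wpM2r (n2_ge0 hg) hN) _.
have d0 : 0 < n2 g + 1 by rewrite ltr_wpDl// n2_ge0.
by rewrite mulrAC ler_pdivrMr// ler_pM2l// lerDl.
Qed.

(** Products of functions of H2 are only integrable, so analytic and antianalytic classes are needed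
    inside L1; a function in both vanishes. *)
Definition H1 f := L1 f /\ forall k : int, k < 0 -> fcoef f k = 0.
Definition H1m f := L1 f /\ forall k : int, 0 <= k -> fcoef f k = 0.

Lemma H1_H1m f : H1 f -> H1m f -> aeI (fun t => f t = 0).
Proof.
move=> [hf h1] [_ h2]; apply: L1_unique => // k.
by case: (ltP k 0); [exact: h1|exact: h2].
Qed.
Lemma H2_eez f (m : int) : 0 <= m -> H2 f -> H2 (fun t => f t * ee t ^ m).
Proof.
move=> m0 [hf h]; split; first exact: L2_eez.
by move=> k k0; rewrite fcoef_shift h//; lia.
Qed.
Lemma H2m_eez f (m : int) : m <= 0 -> H2minus f -> H2minus (fun t => f t * ee t ^ m).
Proof.
move=> m0 [hf h]; split; first exact: L2_eez.
by move=> k k0; rewrite fcoef_shift h//; lia.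
Qed.
Lemma H2J_m f (m : int) : m < 0 -> H2 f -> H2minus (fun t => conjc (f t) * ee t ^ m).
Proof.
move=> m0 [hf h]; split; first by apply: L2_eez; exact: L2J.
by move=> k k0; rewrite fcoef_shift fcoefJ ?h ?conjc0//; [lia|exact: L2_L1].
Qed.
(** The k-th coefficient of f g is the inner product of f with conj g z^k, which lies in H2minus for
    k < 0. *)
Lemma H2_H1M f g : H2 f -> H2 g -> H1 (fun t => f t * g t).
Proof.
move=> hf hg; split; first by apply: L2_L1M; exact: H2_L2.
move=> k k0; rewrite /fcoef -(H2_orth hf (H2J_m k0 hg)) /ipc.
by congr cint; apply/funext => t; rewrite cJM conjcK eezJ mulrA.
Qed.
Lemma H2J_H1m f g : H2 f -> H2minus g -> H1m (fun t => conjc (f t) * g t).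
Proof.
move=> hf hg; have Lf := H2_L2 hf; have Lg := H2m_L2 hg.
split; first by apply: L2_L1M => //; exact: L2J.
move=> k k0; rewrite -[RHS]conjc0 -(H2_orth (H2_eez k0 hf) hg) /ipc -cintJ.
  rewrite /fcoef; congr cint; apply/funext => t.
  by rewrite !cJM conjcK eezJ mulrAC.
by apply: L2_L1M; [exact: L2_eez|exact: L2J].
Qed.
Lemma H1D f g : H1 f -> H1 g -> H1 (fun t => f t + g t).
Proof.
move=> [hf h1] [hg h2]; split; first exact: L1D.
by move=> k k0; rewrite fcoefD// h1// h2// addr0.
Qed.
Lemma H1N f : H1 f -> H1 (fun t => - f t).
Proof.
by move=> [hf h1]; split; [exact: L1N|move=> k k0; rewrite fcoefN// h1// oppr0].
Qed.
Lemma H1mD f g : H1m f -> H1m g -> H1m (fun t => f t + g t).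
Proof.
move=> [hf h1] [hg h2]; split; first exact: L1D.
by move=> k k0; rewrite fcoefD// h1// h2// addr0.
Qed.
Lemma H1mN f : H1m f -> H1m (fun t => - f t).
Proof.
by move=> [hf h1]; split; [exact: L1N|move=> k k0; rewrite fcoefN// h1// oppr0].
Qed.
Lemma H1_cst (c : C) : H1 (fun=> c).
Proof.
split; first exact: L1_cst.
by move=> k k0; rewrite fcoef_cst (_ : k == 0 = false) ?mulr0//; lia.
Qed.
Lemma H1m_0 : H1m (fun=> 0).
Proof. by split; [exact: L1_cst|move=> k _; rewrite fcoef_cst mul0r]. Qed.
Lemma H1_ae f g : cmeas g -> aeI (fun t => f t = g t) -> H1 f -> H1 g.
Proof.
move=> mg h [hf h1]; split; first exact: L1_ae h hf.
by move=> k k0; rewrite -(fcoef_ae k (L1_meas hf) mg h) h1.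
Qed.
Lemma H1m_ae f g : cmeas g -> aeI (fun t => f t = g t) -> H1m f -> H1m g.
Proof.
move=> mg h [hf h1]; split; first exact: L1_ae h hf.
by move=> k k0; rewrite -(fcoef_ae k (L1_meas hf) mg h) h1.
Qed.
Lemma H1_sum (I : Type) (r : seq I) (P : pred I) (F : I -> R -> C) :
  (forall i, P i -> H1 (F i)) -> H1 (fun t => \sum_(i <- r | P i) F i t).
Proof.
move=> h; elim: r => [|i r IH].
  by under eq_fun do rewrite big_nil; exact: H1_cst.
under eq_fun do rewrite big_cons.
by case: (boolP (P i)) => Pi //; apply: H1D => //; exact: h.
Qed.
Lemma H1m_sum (I : Type) (r : seq I) (P : pred I) (F : I -> R -> C) :
  (forall i, P i -> H1m (F i)) -> H1m (fun t => \sum_(i <- r | P i) F i t).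
Proof.
move=> h; elim: r => [|i r IH].
  by under eq_fun do rewrite big_nil; exact: H1m_0.
under eq_fun do rewrite big_cons.
by case: (boolP (P i)) => Pi //; apply: H1mD => //; exact: h.
Qed.
Lemma H2E f : H2 f <-> L2 f /\ H1 f.
Proof. by split=> [[hf h]|[hf [_ h]]]; [split=> //; split=> //; exact: L2_L1|split]. Qed.
Lemma HinfE f : Hinf f <-> Linf f /\ H1 f.
Proof. by split=> [[hf h]|[hf [_ h]]]; [split=> //; split=> //; exact: Linf_L1|split]. Qed.
Lemma H2mE f : H2minus f <-> L2 f /\ H1m f.
Proof. by split=> [[hf h]|[hf [_ h]]]; [split=> //; split=> //; exact: L2_L1|split]. Qed.
Lemma Hinf_H2 f : Hinf f -> H2 f.
Proof. by move=> [hf h]; split=> //; exact: Linf_L2. Qed.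
Lemma Hinf_eez (m : int) : 0 <= m -> Hinf (fun t : R => ee t ^ m).
Proof.
move=> m0; split; first exact: Linf_eez.
by move=> k k0; rewrite fcoef_eez (_ : k == m = false)//; lia.
Qed.

(** When g is approximated by a trigonometric polynomial p, the shift p z^M is analytic for large M
    and drops out; the bound depends on h only through its norm. This uniformity turns a
    finite-dimensional kernel into a norm estimate when the interpolant is shown to be in QC. *)
Lemma shift_orth g (e : R) : L2 g -> 0 < e -> exists M0 : nat, forall M, (M0 <= M)%N ->
  forall h, H2minus h -> cabs (ipc h (fun t => g t * ee t ^ M%:Z)) <= e * Num.sqrt (n2 h).
Proof.
move=> hg e0; have e2 : 0 < e ^+ 2 by rewrite exprn_gt0.
have [p tp hp] := trig_dense hg e2; have [N hN] := trig_bound tp.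
exists N => M NM h hh; have Lh := H2m_L2 hh; have Lp := Linf_L2 (trig_Linf tp).
have hpM : H2 (fun t => p t * ee t ^ M%:Z).
  split; first exact: L2_eez.
  by move=> k k0; rewrite fcoef_shift hN//; lia.
have -> : ipc h (fun t => g t * ee t ^ M%:Z) = ipc h (fun t => (g t - p t) * ee t ^ M%:Z).
  under [in RHS]eq_fun do rewrite mulrBl.
  rewrite ipcBr//; [|exact: L2_eez|exact: L2_eez].
  by rewrite (ipcC (H2_L2 hpM) Lh) (H2_orth hpM hh) conjc0 subr0.
have Lgp := L2B hg Lp.
have := ipc_CS Lh (L2_eez M%:Z Lgp).
have -> : n2 (fun t => (g t - p t) * ee t ^ M%:Z) = n2 (fun t => g t - p t).
  by rewrite /n2; under eq_fun do rewrite cabsM cabs_eez mulr1.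
move=> h1; have p1 : 0 <= e * Num.sqrt (n2 h) by rewrite mulr_ge0 ?sqrtr_ge0 ?(ltW e0).
rewrite -(@ler_pXn2r _ 2)// ?nnegrE ?cabs_ge0//.
rewrite exprMn (sqr_sqrtr (n2_ge0 Lh)).
apply: (le_trans h1).
by rewrite mulrC ler_wpM2r// n2_ge0.
Qed.

End RieszProjection.

(** * Matrix-valued functions and their classes *)

Section MatrixFunctions.
Variable R : realType.
Local Notation C := R[i].
Local Notation Re := complex.Re.
Local Notation Im := complex.Im.
Local Notation "A ^a" := (adjmx A) (at level 8, format "A ^a").

Lemma adjmxE m n (A : 'M[C]_(m, n)) i j : A^a i j = conjc (A j i).
Proof. by rewrite !mxE. Qed.
Lemma adjmxM m n p (A : 'M[C]_(m, n)) (B : 'M[C]_(n, p)) : (A *m B)^a = B^a *m A^a.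
Proof. by rewrite /adjmx map_mxM trmx_mul. Qed.
Lemma adjmxD m n (A B : 'M[C]_(m, n)) : (A + B)^a = A^a + B^a.
Proof. by rewrite /adjmx map_mxD linearD. Qed.
Lemma adjmxN m n (A : 'M[C]_(m, n)) : (- A)^a = - A^a.
Proof. by rewrite /adjmx map_mxN linearN. Qed.
Lemma adjmxB m n (A B : 'M[C]_(m, n)) : (A - B)^a = A^a - B^a.
Proof. by rewrite adjmxD adjmxN. Qed.
Lemma adjmxK m n (A : 'M[C]_(m, n)) : A^a^a = A.
Proof. by apply/matrixP => i j; rewrite !adjmxE conjcK. Qed.
Lemma adjmx1 n : (1%:M : 'M[C]_n)^a = 1%:M.
Proof. by rewrite /adjmx map_mx1 trmx1. Qed.
Lemma adjmx0 m n : (0 : 'M[C]_(m, n))^a = 0.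
Proof. by rewrite /adjmx map_mx0 trmx0. Qed.
Lemma adjmxZ m n (c : C) (A : 'M[C]_(m, n)) : (c *: A)^a = conjc c *: A^a.
Proof. by apply/matrixP => i j; rewrite !mxE cJM. Qed.

Definition cjmx m n (A : 'M[C]_(m, n)) : 'M[C]_(m, n) := map_mx conjc A.
Lemma cjmxE m n (A : 'M[C]_(m, n)) i j : cjmx A i j = conjc (A i j).
Proof. by rewrite mxE. Qed.
Lemma cjmxM m n p (A : 'M[C]_(m, n)) (B : 'M[C]_(n, p)) : cjmx (A *m B) = cjmx A *m cjmx B.
Proof. exact: map_mxM. Qed.
Lemma cjmxD m n (A B : 'M[C]_(m, n)) : cjmx (A + B) = cjmx A + cjmx B.
Proof. exact: map_mxD. Qed.
Lemma cjmxB m n (A B : 'M[C]_(m, n)) : cjmx (A - B) = cjmx A - cjmx B.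
Proof. exact: map_mxB. Qed.
Lemma cjmx1 n : cjmx (1%:M : 'M[C]_n) = 1%:M. Proof. exact: map_mx1. Qed.
Lemma cjmxK m n (A : 'M[C]_(m, n)) : cjmx (cjmx A) = A.
Proof. by apply/matrixP => i j; rewrite !mxE conjcK. Qed.
Lemma cjmx_tr m n (A : 'M[C]_(m, n)) : cjmx A^T = A^a.
Proof. by apply/matrixP => i j; rewrite !mxE. Qed.
Lemma adj_cjmx m n (A : 'M[C]_(m, n)) : (cjmx A)^a = A^T.
Proof. by apply/matrixP => i j; rewrite !mxE conjcK. Qed.
Lemma tr_cjmx m n (A : 'M[C]_(m, n)) : (cjmx A)^T = A^a.
Proof. by apply/matrixP => i j; rewrite !mxE. Qed.
Lemma cj_adjmx m n (A : 'M[C]_(m, n)) : cjmx A^a = A^T.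
Proof. by apply/matrixP => i j; rewrite !mxE conjcK. Qed.
Lemma adj_tr m n (A : 'M[C]_(m, n)) : (A^T)^a = cjmx A.
Proof. by apply/matrixP => i j; rewrite !mxE. Qed.

Definition vsq n (v : 'cV[C]_n) : R := \sum_(i < n) cabs (v i ord0) ^+ 2.
Definition vdot n (u v : 'cV[C]_n) : C := (v^a *m u) ord0 ord0.

Lemma vdotE n (u v : 'cV[C]_n) : vdot u v = \sum_(i < n) u i ord0 * conjc (v i ord0).
Proof. by rewrite /vdot mxE; apply: eq_bigr => i _; rewrite adjmxE mulrC. Qed.
Lemma vsq_ge0 n (v : 'cV[C]_n) : 0 <= vsq v.
Proof. by apply: sumr_ge0 => i _; rewrite exprn_ge0// cabs_ge0. Qed.
Lemma vdot_vsq n (v : 'cV[C]_n) : vdot v v = (vsq v)%:C%C.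
Proof. by rewrite vdotE Cr_sum; apply: eq_bigr => i _; rewrite mulcJ. Qed.
Lemma vsq_eq0 n (v : 'cV[C]_n) : vsq v = 0 -> v = 0.
Proof.
move/eqP; rewrite psumr_eq0; last by move=> i _; rewrite exprn_ge0// cabs_ge0.
move=> /allP H; apply/matrixP => i j; rewrite ord1 mxE; apply: cabs_eq0.
by have /(_ (mem_index_enum i)) := H i; rewrite sqrf_eq0 => /eqP.
Qed.
Lemma vsq0 n : vsq (0 : 'cV[C]_n) = 0.
Proof. by rewrite /vsq big1// => i _; rewrite mxE cabs0 expr0n. Qed.
Lemma vdotC n (u v : 'cV[C]_n) : vdot v u = conjc (vdot u v).
Proof. by rewrite !vdotE cJ_sum; apply: eq_bigr => i _; rewrite cJM conjcK mulrC. Qed.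
Lemma vdot_adj m n (A : 'M[C]_(m, n)) u v : vdot (A *m u) v = vdot u (A^a *m v).
Proof. by rewrite /vdot adjmxM adjmxK mulmxA. Qed.
Lemma vdotDl n (u v w : 'cV[C]_n) : vdot (u + v) w = vdot u w + vdot v w.
Proof. by rewrite /vdot mulmxDr mxE. Qed.
Lemma vdotDr n (u v w : 'cV[C]_n) : vdot w (u + v) = vdot w u + vdot w v.
Proof. by rewrite /vdot adjmxD mulmxDl mxE. Qed.
Lemma vdotZl n c (u w : 'cV[C]_n) : vdot (c *: u) w = c * vdot u w.
Proof. by rewrite /vdot -scalemxAr mxE. Qed.
Lemma vdotZr n c (u w : 'cV[C]_n) : vdot u (c *: w) = conjc c * vdot u w.
Proof. by rewrite /vdot adjmxZ -scalemxAl mxE. Qed.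
Lemma vsqD n (u v : 'cV[C]_n) : vsq (u + v) = vsq u + vsq v + 2 * Re (vdot u v).
Proof.
apply: (@complexI R); rewrite -vdot_vsq vdotDl !vdotDr !vdot_vsq (vdotC u v).
by apply: complex_eqP; rewrite ?cReD ?cImD ?cReJ ?cImJ /=; ring.
Qed.
Lemma vsqZ n c (u : 'cV[C]_n) : vsq (c *: u) = cabs c ^+ 2 * vsq u.
Proof. by rewrite /vsq mulr_sumr; apply: eq_bigr => i _; rewrite mxE cabsM exprMn. Qed.
Lemma vsqN n (u : 'cV[C]_n) : vsq (- u) = vsq u.
Proof. by rewrite -scaleN1r vsqZ cabsN cabs1 expr1n mul1r. Qed.
Lemma vsq_unitary n (U : 'M[C]_n) v : U^a *m U = 1%:M -> vsq (U *m v) = vsq v.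
Proof. by move=> h; apply: (@complexI R); rewrite -!vdot_vsq vdot_adj mulmxA h mul1mx. Qed.
(** Constant functions reduce it to the inequality for integrals. *)
Lemma vdot_CS n (u v : 'cV[C]_n) : cabs (vdot u v) ^+ 2 <= vsq u * vsq v.
Proof.
have := CS_sq (@V2_cst R n u) (@V2_cst R n v).
rewrite /nn !rint_cst -/(vsq u) -/(vsq v); congr (_ <= _); congr (cabs _ ^+ 2).
by rewrite vdotE; apply: eq_bigr => i _; rewrite /ipc cint_cst.
Qed.
Lemma nnE n (f : R -> 'cV[C]_n) : nn f = rint (fun t => vsq (f t)). Proof. by []. Qed.

(** Square of the Frobenius norm: it bounds the square of the operator norm and is visibly
    integrable for entries in L2. *)
Definition frob m n (A : 'M[C]_(m, n)) : R := \sum_i \sum_j cabs (A i j) ^+ 2.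
Lemma frob_ge0 m n (A : 'M[C]_(m, n)) : 0 <= frob A.
Proof. by apply: sumr_ge0 => i _; apply: sumr_ge0 => j _; rewrite exprn_ge0// cabs_ge0. Qed.
Lemma vsq_frob m n (A : 'M[C]_(m, n)) v : vsq (A *m v) <= frob A * vsq v.
Proof.
rewrite /vsq /frob mulr_suml; apply: ler_sum => i _.
have -> : (A *m v) i ord0 = vdot v ((row i A)^a).
  by rewrite /vdot adjmxK -row_mul [RHS]mxE.
apply: le_trans (vdot_CS _ _) _; rewrite mulrC /vsq; apply: ler_wpM2r; first exact: vsq_ge0.
by apply: ler_sum => j _; rewrite adjmxE mxE cabsJ.
Qed.
Lemma col_vsq m n (A : 'M[C]_(m, n)) i j : cabs (A i j) ^+ 2 <= vsq (col j A).
Proof.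
rewrite /vsq (bigD1 i)//= mxE lerDl; apply: sumr_ge0 => k _; rewrite exprn_ge0// cabs_ge0//.
Qed.

Lemma mx_in_mul m n p (P Q S : (R -> C) -> Prop) (A : R -> 'M[C]_(m, n)) (B : R -> 'M[C]_(n, p)) :
  (forall f g, P f -> Q g -> S (fun t => f t * g t)) ->
  (forall (F : 'I_n -> R -> C), (forall i, S (F i)) -> S (fun t => \sum_i F i t)) ->
  mx_in P A -> mx_in Q B -> mx_in S (fun t => A t *m B t).
Proof.
move=> h1 h2 hA hB i j; under eq_fun do rewrite mxE.
by apply: h2 => k; apply: h1; [exact: hA|exact: hB].
Qed.
Lemma mx_inS m n (P Q : (R -> C) -> Prop) (A : R -> 'M[C]_(m, n)) :
  (forall f, P f -> Q f) -> mx_in P A -> mx_in Q A.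
Proof. by move=> h hA i j; apply: h; exact: hA. Qed.
Lemma mx_in_add m n (P : (R -> C) -> Prop) (A B : R -> 'M[C]_(m, n)) :
  (forall f g, P f -> P g -> P (fun t => f t + g t)) ->
  mx_in P A -> mx_in P B -> mx_in P (fun t => A t + B t).
Proof. by move=> h hA hB i j; under eq_fun do rewrite mxE; apply: h; [exact: hA|exact: hB]. Qed.
Lemma mx_in_opp m n (P : (R -> C) -> Prop) (A : R -> 'M[C]_(m, n)) :
  (forall f, P f -> P (fun t => - f t)) -> mx_in P A -> mx_in P (fun t => - A t).
Proof. by move=> h hA i j; under eq_fun do rewrite mxE; apply: h; exact: hA. Qed.

Lemma H2D f g : @H2 R f -> H2 g -> H2 (fun t => f t + g t).
Proof. by move=> /H2E[h1 h2] /H2E[h3 h4]; apply/H2E; split; [exact: L2D|exact: H1D]. Qed.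
Lemma H2N f : @H2 R f -> H2 (fun t => - f t).
Proof. by move=> /H2E[h1 h2]; apply/H2E; split; [exact: L2N|exact: H1N]. Qed.
Lemma H2mD f g : @H2minus R f -> H2minus g -> H2minus (fun t => f t + g t).
Proof. by move=> /H2mE[h1 h2] /H2mE[h3 h4]; apply/H2mE; split; [exact: L2D|exact: H1mD]. Qed.
Lemma H2mN f : @H2minus R f -> H2minus (fun t => - f t).
Proof. by move=> /H2mE[h1 h2]; apply/H2mE; split; [exact: L2N|exact: H1mN]. Qed.
Lemma HinfD f g : @Hinf R f -> Hinf g -> Hinf (fun t => f t + g t).
Proof. by move=> /HinfE[h1 h2] /HinfE[h3 h4]; apply/HinfE; split; [exact: LinfD|exact: H1D]. Qed.
Lemma HinfN f : @Hinf R f -> Hinf (fun t => - f t).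
Proof. by move=> /HinfE[h1 h2]; apply/HinfE; split; [exact: LinfN|exact: H1N]. Qed.
Lemma HinfM f g : @Hinf R f -> Hinf g -> Hinf (fun t => f t * g t).
Proof.
move=> hf hg; apply/HinfE; split; first by apply: LinfM; [exact: hf.1|exact: hg.1].
by apply: H2_H1M; exact: Hinf_H2.
Qed.
Lemma Hinf_H2M f g : @Hinf R f -> H2 g -> H2 (fun t => f t * g t).
Proof.
move=> hf hg; apply/H2E; split; first by apply: Linf_L2M; [exact: hf.1|exact: hg.1].
by apply: H2_H1M => //; exact: Hinf_H2.
Qed.
Lemma Hinf_cst (c : C) : Hinf (fun=> c).
Proof. by apply/HinfE; split; [exact: Linf_cst|exact: H1_cst]. Qed.
Lemma H2_sum (I : Type) (r : seq I) (P : pred I) (F : I -> R -> C) :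
  (forall i, P i -> H2 (F i)) -> H2 (fun t => \sum_(i <- r | P i) F i t).
Proof.
move=> h; apply/H2E; split; first by apply: L2_sum => i Pi; exact: H2_L2 (h i Pi).
by apply: H1_sum => i Pi; have /H2E[] := h i Pi.
Qed.
Lemma H2m_sum (I : Type) (r : seq I) (P : pred I) (F : I -> R -> C) :
  (forall i, P i -> H2minus (F i)) -> H2minus (fun t => \sum_(i <- r | P i) F i t).
Proof.
move=> h; apply/H2mE; split; first by apply: L2_sum => i Pi; exact: H2m_L2 (h i Pi).
by apply: H1m_sum => i Pi; have /H2mE[] := h i Pi.
Qed.
Lemma Hinf_sum (I : Type) (r : seq I) (P : pred I) (F : I -> R -> C) :
  (forall i, P i -> Hinf (F i)) -> Hinf (fun t => \sum_(i <- r | P i) F i t).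
Proof.
move=> h; apply/HinfE; split; first by apply: Linf_sum => i Pi; have [] := h i Pi.
by apply: H1_sum => i Pi; have /HinfE[] := h i Pi.
Qed.
Lemma H2m_ae f g : @cmeas R g -> aeI (fun t => f t = g t) -> H2minus f -> H2minus g.
Proof. by move=> mg h /H2mE[h1 h2]; apply/H2mE; split; [exact: L2_ae h h1|exact: H1m_ae h h2]. Qed.
Lemma Hinf_ae f g : @cmeas R g -> aeI (fun t => f t = g t) -> Hinf f -> Hinf g.
Proof. by move=> mg h /HinfE[h1 h2]; apply/HinfE; split; [exact: Linf_ae h h1|exact: H1_ae h h2]. Qed.
Lemma H2m_cstM (c : C) f : H2minus f -> H2minus (fun t => c * f t).
Proof.
move=> [hf h]; split; first exact: L2Z.
by move=> k k0; rewrite fcoefZ ?h ?mulr0//; exact: L2_L1.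
Qed.

Section MulClosure.
Variables (m n p : nat) (A : R -> 'M[C]_(m, n)) (B : R -> 'M[C]_(n, p)).
Lemma mx_cmeasM : mx_in (@cmeas R) A -> mx_in (@cmeas R) B -> mx_in (@cmeas R) (fun t => A t *m B t).
Proof. by apply: mx_in_mul => [f g|F h]; [exact: cmeasM|exact: cmeas_sum]. Qed.
Lemma mx_LinfM : mx_in (@Linf R) A -> mx_in (@Linf R) B -> mx_in (@Linf R) (fun t => A t *m B t).
Proof. by apply: mx_in_mul => [f g|F h]; [exact: LinfM|exact: Linf_sum]. Qed.
Lemma mx_Linf_L2M : mx_in (@Linf R) A -> mx_in (@L2 R) B -> mx_in (@L2 R) (fun t => A t *m B t).
Proof. by apply: mx_in_mul => [f g|F h]; [exact: Linf_L2M|exact: L2_sum]. Qed.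
Lemma mx_L2_LinfM : mx_in (@L2 R) A -> mx_in (@Linf R) B -> mx_in (@L2 R) (fun t => A t *m B t).
Proof.
apply: mx_in_mul => [f g hf hg|F h]; last exact: L2_sum.
by under eq_fun do rewrite mulrC; exact: Linf_L2M.
Qed.
Lemma mx_L2_L1M : mx_in (@L2 R) A -> mx_in (@L2 R) B -> mx_in (@L1 R) (fun t => A t *m B t).
Proof. by apply: mx_in_mul => [f g|F h]; [exact: L2_L1M|exact: L1_sum]. Qed.
Lemma mx_H2_H1M : mx_in (@H2 R) A -> mx_in (@H2 R) B -> mx_in (@H1 R) (fun t => A t *m B t).
Proof. by apply: mx_in_mul => [f g|F h]; [exact: H2_H1M|exact: H1_sum]. Qed.
Lemma mx_Hinf_H2M : mx_in (@Hinf R) A -> mx_in (@H2 R) B -> mx_in (@H2 R) (fun t => A t *m B t).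
Proof. by apply: mx_in_mul => [f g|F h]; [exact: Hinf_H2M|exact: H2_sum]. Qed.
Lemma mx_H2_HinfM : mx_in (@H2 R) A -> mx_in (@Hinf R) B -> mx_in (@H2 R) (fun t => A t *m B t).
Proof.
apply: mx_in_mul => [f g hf hg|F h]; last exact: H2_sum.
by under eq_fun do rewrite mulrC; exact: Hinf_H2M.
Qed.
Lemma mx_HinfM : mx_in (@Hinf R) A -> mx_in (@Hinf R) B -> mx_in (@Hinf R) (fun t => A t *m B t).
Proof. by apply: mx_in_mul => [f g|F h]; [exact: HinfM|exact: Hinf_sum]. Qed.
Lemma mx_H2a_H2m (D : R -> 'M[C]_(n, m)) : mx_in (@H2 R) D -> mx_in (@H2minus R) B ->
  mx_in (@H1m R) (fun t => (D t)^a *m B t).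
Proof.
move=> hD hB i j; under eq_fun do rewrite mxE.
by apply: H1m_sum => k _; under eq_fun do rewrite adjmxE; apply: H2J_H1m; [exact: hD|exact: hB].
Qed.
End MulClosure.

Section AddClosure.
Variables (m n : nat).
Implicit Types A B : R -> 'M[C]_(m, n).
Lemma mx_cmeasD A B : mx_in (@cmeas R) A -> mx_in (@cmeas R) B -> mx_in (@cmeas R) (fun t => A t + B t).
Proof. by apply: mx_in_add; exact: cmeasD. Qed.
Lemma mx_L2D A B : mx_in (@L2 R) A -> mx_in (@L2 R) B -> mx_in (@L2 R) (fun t => A t + B t).
Proof. by apply: mx_in_add; exact: L2D. Qed.
Lemma mx_LinfD A B : mx_in (@Linf R) A -> mx_in (@Linf R) B -> mx_in (@Linf R) (fun t => A t + B t).
Proof. by apply: mx_in_add; exact: LinfD. Qed.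
Lemma mx_H2D A B : mx_in (@H2 R) A -> mx_in (@H2 R) B -> mx_in (@H2 R) (fun t => A t + B t).
Proof. by apply: mx_in_add; exact: H2D. Qed.
Lemma mx_H2mD A B : mx_in (@H2minus R) A -> mx_in (@H2minus R) B -> mx_in (@H2minus R) (fun t => A t + B t).
Proof. by apply: mx_in_add; exact: H2mD. Qed.
Lemma mx_H1D A B : mx_in (@H1 R) A -> mx_in (@H1 R) B -> mx_in (@H1 R) (fun t => A t + B t).
Proof. by apply: mx_in_add; exact: H1D. Qed.
Lemma mx_H1mD A B : mx_in (@H1m R) A -> mx_in (@H1m R) B -> mx_in (@H1m R) (fun t => A t + B t).
Proof. by apply: mx_in_add; exact: H1mD. Qed.
Lemma mx_HinfD A B : mx_in (@Hinf R) A -> mx_in (@Hinf R) B -> mx_in (@Hinf R) (fun t => A t + B t).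
Proof. by apply: mx_in_add; exact: HinfD. Qed.
Lemma mx_cmeasN A : mx_in (@cmeas R) A -> mx_in (@cmeas R) (fun t => - A t).
Proof. by apply: mx_in_opp; exact: cmeasN. Qed.
Lemma mx_L2N A : mx_in (@L2 R) A -> mx_in (@L2 R) (fun t => - A t).
Proof. by apply: mx_in_opp; exact: L2N. Qed.
Lemma mx_LinfN A : mx_in (@Linf R) A -> mx_in (@Linf R) (fun t => - A t).
Proof. by apply: mx_in_opp; exact: LinfN. Qed.
Lemma mx_H2N A : mx_in (@H2 R) A -> mx_in (@H2 R) (fun t => - A t).
Proof. by apply: mx_in_opp; exact: H2N. Qed.
Lemma mx_H2mN A : mx_in (@H2minus R) A -> mx_in (@H2minus R) (fun t => - A t).
Proof. by apply: mx_in_opp; exact: H2mN. Qed.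
Lemma mx_H1N A : mx_in (@H1 R) A -> mx_in (@H1 R) (fun t => - A t).
Proof. by apply: mx_in_opp; exact: H1N. Qed.
Lemma mx_H1mN A : mx_in (@H1m R) A -> mx_in (@H1m R) (fun t => - A t).
Proof. by apply: mx_in_opp; exact: H1mN. Qed.
Lemma mx_HinfN A : mx_in (@Hinf R) A -> mx_in (@Hinf R) (fun t => - A t).
Proof. by apply: mx_in_opp; exact: HinfN. Qed.
Lemma mx_H2B A B : mx_in (@H2 R) A -> mx_in (@H2 R) B -> mx_in (@H2 R) (fun t => A t - B t).
Proof. by move=> hA hB; apply: mx_H2D => //; exact: mx_H2N. Qed.
Lemma mx_H2mB A B : mx_in (@H2minus R) A -> mx_in (@H2minus R) B -> mx_in (@H2minus R) (fun t => A t - B t).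
Proof. by move=> hA hB; apply: mx_H2mD => //; exact: mx_H2mN. Qed.
Lemma mx_H1B A B : mx_in (@H1 R) A -> mx_in (@H1 R) B -> mx_in (@H1 R) (fun t => A t - B t).
Proof. by move=> hA hB; apply: mx_H1D => //; exact: mx_H1N. Qed.
Lemma mx_H1mB A B : mx_in (@H1m R) A -> mx_in (@H1m R) B -> mx_in (@H1m R) (fun t => A t - B t).
Proof. by move=> hA hB; apply: mx_H1mD => //; exact: mx_H1mN. Qed.
Lemma mx_HinfB A B : mx_in (@Hinf R) A -> mx_in (@Hinf R) B -> mx_in (@Hinf R) (fun t => A t - B t).
Proof. by move=> hA hB; apply: mx_HinfD => //; exact: mx_HinfN. Qed.
Lemma mx_L2B A B : mx_in (@L2 R) A -> mx_in (@L2 R) B -> mx_in (@L2 R) (fun t => A t - B t).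
Proof. by move=> hA hB; apply: mx_L2D => //; exact: mx_L2N. Qed.
Lemma mx_LinfB A B : mx_in (@Linf R) A -> mx_in (@Linf R) B -> mx_in (@Linf R) (fun t => A t - B t).
Proof. by move=> hA hB; apply: mx_LinfD => //; exact: mx_LinfN. Qed.
Lemma mx_cmeasB A B : mx_in (@cmeas R) A -> mx_in (@cmeas R) B -> mx_in (@cmeas R) (fun t => A t - B t).
Proof. by move=> hA hB; apply: mx_cmeasD => //; exact: mx_cmeasN. Qed.
Lemma mx_H2_L2 A : mx_in (@H2 R) A -> mx_in (@L2 R) A.
Proof. by apply: mx_inS => f; exact: H2_L2. Qed.
Lemma mx_H2m_L2 A : mx_in (@H2minus R) A -> mx_in (@L2 R) A.
Proof. by apply: mx_inS => f; exact: H2m_L2. Qed.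
Lemma mx_Hinf_H2 A : mx_in (@Hinf R) A -> mx_in (@H2 R) A.
Proof. by apply: mx_inS => f; exact: Hinf_H2. Qed.
Lemma mx_Hinf_Linf A : mx_in (@Hinf R) A -> mx_in (@Linf R) A.
Proof. by apply: mx_inS => f []. Qed.
Lemma mx_Linf_L2 A : mx_in (@Linf R) A -> mx_in (@L2 R) A.
Proof. by apply: mx_inS => f; exact: Linf_L2. Qed.
Lemma mx_L2_meas A : mx_in (@L2 R) A -> mx_in (@cmeas R) A.
Proof. by apply: mx_inS => f; exact: L2_meas. Qed.
Lemma mx_Linf_meas A : mx_in (@Linf R) A -> mx_in (@cmeas R) A.
Proof. by apply: mx_inS => f; exact: Linf_meas. Qed.
Lemma mx_Hinf_cst (c : 'M[C]_(m, n)) : mx_in (@Hinf R) (fun=> c).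
Proof. by move=> i j; exact: Hinf_cst. Qed.
Lemma mx_L2_adj A : mx_in (@L2 R) A -> mx_in (@L2 R) (fun t => (A t)^a).
Proof. by move=> h i j; under eq_fun do rewrite adjmxE; apply: L2J; exact: h. Qed.
Lemma mx_Linf_adj A : mx_in (@Linf R) A -> mx_in (@Linf R) (fun t => (A t)^a).
Proof. by move=> h i j; under eq_fun do rewrite adjmxE; apply: LinfJ; exact: h. Qed.
Lemma mx_L2_cj A : mx_in (@L2 R) A -> mx_in (@L2 R) (fun t => cjmx (A t)).
Proof. by move=> h i j; under eq_fun do rewrite cjmxE; apply: L2J; exact: h. Qed.
Lemma mx_Linf_cj A : mx_in (@Linf R) A -> mx_in (@Linf R) (fun t => cjmx (A t)).
Proof. by move=> h i j; under eq_fun do rewrite cjmxE; apply: LinfJ; exact: h. Qed.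
Lemma mx_cmeas_adj A : mx_in (@cmeas R) A -> mx_in (@cmeas R) (fun t => (A t)^a).
Proof. by move=> h i j; under eq_fun do rewrite adjmxE; apply: cmeasJ; exact: h. Qed.
Lemma mx_in_tr (P : (R -> C) -> Prop) A : mx_in P A -> mx_in P (fun t => (A t)^T).
Proof. by move=> h i j; under eq_fun do rewrite mxE; exact: h. Qed.
Lemma mx_in_ae (P : (R -> C) -> Prop) A B :
  (forall f g, @cmeas R g -> aeI (fun t => f t = g t) -> P f -> P g) ->
  mx_in (@cmeas R) B -> aeI (fun t => A t = B t) -> mx_in P A -> mx_in P B.
Proof.
move=> h mB e hA i j; apply: (h (fun t => A t i j)); [exact: mB| |exact: hA].
by apply: aeI_S e => t _ ->.
Qed.
Lemma mx_H1_H1m A : mx_in (@H1 R) A -> mx_in (@H1m R) A -> aeI (fun t => A t = 0).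
Proof.
move=> h1 h2; have : aeI (fun t => forall i j, A t i j = 0).
  by apply: aeI_forall => i; apply: aeI_forall => j; exact: H1_H1m (h1 i j) (h2 i j).
by apply: aeI_S => t _ H; apply/matrixP => i j; rewrite H mxE.
Qed.
End AddClosure.

Lemma mx_cstM_H2m m n p (c : 'M[C]_(m, n)) (B : R -> 'M[C]_(n, p)) :
  mx_in (@H2minus R) B -> mx_in (@H2minus R) (fun t => c *m B t).
Proof.
move=> hB i j; under eq_fun do rewrite mxE.
by apply: H2m_sum => k _; apply: H2m_cstM; exact: hB.
Qed.
Lemma mx_H2m_cst m n p (B : R -> 'M[C]_(m, n)) (c : 'M[C]_(n, p)) :
  mx_in (@H2minus R) B -> mx_in (@H2minus R) (fun t => B t *m c).
Proof.
move=> hB i j; under eq_fun do rewrite mxE.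
by apply: H2m_sum => k _; under eq_fun do rewrite mulrC; apply: H2m_cstM; exact: hB.
Qed.
Lemma mx_cmeas_inv n (A : R -> 'M[C]_n) : mx_in (@cmeas R) A ->
  mx_in (@cmeas R) (fun t => (\det (A t))^-1 *: \adj (A t)).
Proof.
have hdet k (B : R -> 'M[C]_k) : mx_in (@cmeas R) B -> cmeas (fun t => \det (B t)).
  move=> hB; rewrite /determinant; apply: cmeas_sum => s _.
  apply: cmeasM; first exact: cmeas_cst.
  by apply: cmeas_prod => i _; exact: hB.
move=> hA i j; under eq_fun do rewrite mxE; apply: cmeasM; first by apply: cmeasV; exact: hdet.
under eq_fun do rewrite mxE /cofactor; apply: cmeasM; first exact: cmeas_cst.
by apply: hdet => k l; under eq_fun do rewrite !mxE; exact: hA.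
Qed.
(* [invmx A = A] when [A] is singular, so the everywhere-measurable inverse is built from the adjugate *)
Definition iv n (A : 'M[C]_n) : 'M[C]_n := (\det A)^-1 *: \adj A.
Lemma iv_mulVmx n (A : 'M[C]_n) : A \in unitmx -> iv A *m A = 1%:M.
Proof.
by move=> uA; rewrite /iv -scalemxAl mul_adj_mx scale_scalar_mx mulVf// -unitfE -unitmxE.
Qed.
Lemma iv_mulmxV n (A : 'M[C]_n) : A \in unitmx -> A *m iv A = 1%:M.
Proof. by move=> uA; apply: mulmx1C; exact: iv_mulVmx. Qed.
Lemma mx_meas_iv n (A : R -> 'M[C]_n) : mx_in (@cmeas R) A -> mx_in (@cmeas R) (fun t => iv (A t)).
Proof. exact: mx_cmeas_inv. Qed.
Lemma unit_inj n (A : 'M[C]_n) : (forall v : 'cV[C]_n, A *m v = 0 -> v = 0) -> A \in unitmx.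
Proof.
move=> h; rewrite -unitmx_tr -row_free_unit -kermx_eq0; apply/rowV0P => v /sub_kermxP hv.
apply: trmx_inj; rewrite trmx0; apply: h; apply: trmx_inj.
by rewrite trmx_mul trmxK hv trmx0.
Qed.
End MatrixFunctions.

(** * Vector Hardy spaces and Hankel operators *)

Section Hardy.
Variables (R : realType) (n : nat).
Local Notation C := R[i].
Local Notation Re := complex.Re.
Local Notation Im := complex.Im.
Local Notation "A ^a" := (adjmx A) (at level 8, format "A ^a").
Local Notation VH := (mx_in (@H2 R)).
Local Notation VHm := (mx_in (@H2minus R)).
Implicit Types (f g h p q : R -> 'cV[C]_n).

Lemma vip_orth f g : VH f -> VHm g -> vip f g = 0.
Proof. by move=> hf hg; rewrite /vip big1// => i _; exact: H2_orth (hf i ord0) (hg i ord0). Qed.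
Lemma vip_orth' f g : VH f -> VHm g -> vip g f = 0.
Proof. by move=> hf hg; rewrite (vipC (mx_H2_L2 hf) (mx_H2m_L2 hg)) vip_orth// conjc0. Qed.
Lemma vproj f : V2 f -> exists2 g : R -> 'cV[C]_n, VH g & VHm (fun t => f t - g t).
Proof.
move=> hf.
have hex (i : 'I_n) : exists g : R -> C, H2 g /\ H2minus (fun t => f t i ord0 - g t).
  by have [g h1 h2] := riesz_proj (hf i ord0); exists g.
have [G hG] := choice hex.
exists (fun t => \col_i G i t) => i j.
  by under eq_fun do rewrite mxE; exact: (hG i).1.
by rewrite (ord1 j); under eq_fun do rewrite !mxE; exact: (hG i).2.
Qed.
Lemma vip_cint f g : V2 f -> V2 g -> vip f g = cint (fun t => vdot (f t) (g t)).
Proof.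
move=> hf hg; rewrite /vip -cint_sum; last by move=> i _; exact: V2_ip.
by congr cint; apply/funext => t; rewrite vdotE.
Qed.
Lemma vip_adj (A : R -> 'M[C]_n) f g : mx_in (@Linf R) A -> V2 f -> V2 g ->
  vip (fun t => A t *m f t) g = vip f (fun t => (A t)^a *m g t).
Proof.
move=> hA hf hg; rewrite !vip_cint//.
- by congr cint; apply/funext => t; exact: vdot_adj.
- by apply: mx_Linf_L2M => //; exact: mx_Linf_adj.
- exact: mx_Linf_L2M.
Qed.
Lemma nn_pyth f g : VH f -> VHm g -> nn (fun t => f t + g t) = nn f + nn g.
Proof.
by move=> hf hg; rewrite nnD ?vip_orth ?mulr0 ?addr0//; [exact: mx_H2_L2|exact: mx_H2m_L2].
Qed.
Lemma l2norm_le f g : V2 f -> V2 g -> nn f <= nn g -> l2norm f <= l2norm g.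
Proof. by move=> hf hg h; rewrite !l2normE ler_wsqrtr. Qed.
Lemma nn_proj f g : V2 f -> VH g -> VHm (fun t => f t - g t) ->
  nn f = nn g + nn (fun t => f t - g t).
Proof. by move=> hf hg hh; rewrite -nn_pyth//; congr nn; apply/funext => t; rewrite subrKC. Qed.
Lemma l2norm_proj f g : V2 f -> VH g -> VHm (fun t => f t - g t) -> l2norm g <= l2norm f.
Proof.
move=> hf hg hh; apply: l2norm_le => //; first exact: mx_H2_L2.
by rewrite (nn_proj hf hg hh) lerDl; apply: nn_ge0; exact: mx_H2m_L2.
Qed.
Lemma l2norm_projm f p : V2 f -> VHm p -> VH (fun t => f t - p t) -> l2norm p <= l2norm f.
Proof.
move=> hf hp hh; apply: l2norm_le => //; first exact: mx_H2m_L2.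
have -> : f = (fun t => (f t - p t) + p t) by apply/funext => t; rewrite subrK.
by rewrite nn_pyth// lerDr; apply: nn_ge0; exact: mx_H2_L2.
Qed.
Lemma VH_VHm0 f : VH f -> VHm f -> aeI (fun t => f t = 0).
Proof.
move=> h1 h2; apply: nn_eq0; first exact: mx_H2_L2.
by apply: (@complexI R); rewrite -vip_nn ?vip_orth//; exact: mx_H2_L2.
Qed.
Lemma nn_unitary (U : R -> 'M[C]_n) f : aeI (fun t => (U t)^a *m U t = 1%:M) ->
  mx_in (@Linf R) U -> V2 f -> nn (fun t => U t *m f t) = nn f.
Proof.
move=> hU lU hf; rewrite !nnE; apply: rint_ae.
- by apply: RI_meas; apply: RI_nn; exact: mx_Linf_L2M.
- by apply: RI_meas; apply: RI_nn.
- by apply: aeI_S hU => t _ h; rewrite vsq_unitary.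
Qed.
Lemma H2_complete (u : nat -> R -> 'cV[C]_n) (c d : R) : 0 <= c -> c < 1 -> 0 <= d ->
  (forall k, VH (u k)) -> (forall k, l2norm (fun t => u k.+1 t - u k t) <= d * c ^+ k) ->
  exists2 p : R -> 'cV[C]_n, VH p & forall e : R, 0 < e -> exists N, forall m, (N <= m)%N ->
    l2norm (fun t => u m t - p t) <= e.
Proof.
move=> c0 c1 d0 hu hd; have c1' : 0 < 1 - c by rewrite subr_gt0.
have Lu k := mx_H2_L2 (hu k).
have step k j : l2norm (fun t => u (k + j)%N t - u k t) <= d * c ^+ k / (1 - c) * (1 - c ^+ j).
  elim: j => [|j IH].
    rewrite addn0 expr0 subrr mulr0 l2normE (_ : nn _ = 0) ?sqrtr0//.
    rewrite nnE -[RHS](@rint_cst R 0); congr rint; apply/funext => t.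
    by rewrite subrr vsq0.
  have -> : (fun t => u (k + j.+1)%N t - u k t) =
     (fun t => (u (k + j).+1 t - u (k + j)%N t) + (u (k + j)%N t - u k t)).
    by apply/funext => t; rewrite addnS addrA subrK.
  apply: (le_trans (l2normD (V2B (Lu _) (Lu _)) (V2B (Lu _) (Lu _)))).
  apply: le_trans (lerD (hd _) IH) _; rewrite exprD exprS.
  rewrite le_eqVlt; apply/orP; left; apply/eqP; field.
  by rewrite gt_eqF.
have stepb k j : l2norm (fun t => u (k + j)%N t - u k t) <= d * c ^+ k / (1 - c).
  apply: le_trans (step k j) _; apply: ler_piMr.
    by rewrite divr_ge0 ?(ltW c1')// mulr_ge0// exprn_ge0.
  by rewrite lerBlDr lerDl exprn_ge0.
have small (e : R) : 0 < e -> exists N, forall k, (N <= k)%N -> d * c ^+ k / (1 - c) <= e.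
  move=> e0.
  have cl : (fun k : nat => d * c ^+ k / (1 - c)) @ \oo --> (0 : R).
    rewrite -[X in _ --> X](mul0r (1 - c)^-1); apply: cvgM; last exact: cvg_cst.
    rewrite -[X in _ --> X](mulr0 d); apply: cvgM; first exact: cvg_cst.
    by apply: cvg_expr; rewrite ger0_norm.
  have /cvgrPdist_le /(_ _ e0)[N _ hN] := cl; exists N => k Nk.
  have := hN k Nk; rewrite /= sub0r normrN; exact: le_trans (ler_norm _).
have n2_nn f i : V2 f -> n2 (fun t => f t i ord0) <= nn f.
  move=> hf; rewrite nn_sum// (bigD1 i)//= lerDl; apply: sumr_ge0 => j _.
  by apply: n2_ge0; exact: hf.
have comp (i : 'I_n) : exists2 g : R -> C, L2 g & forall e : R, 0 < e -> exists N, forall m, (N <= m)%N ->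
     n2 (fun t => u m t i ord0 - g t) <= e.
  apply: L2_complete => [k|e e0]; first exact: Lu.
  have se : 0 < Num.sqrt e by rewrite sqrtr_gt0.
  have [N hN] := small _ se; exists N.
  have aux m k : (N <= m)%N -> (m <= k)%N -> n2 (fun t => u k t i ord0 - u m t i ord0) <= e.
    move=> Nm mk; have := n2_nn _ i (V2B (Lu k) (Lu m)).
    under [X in n2 X <= _ -> _]eq_fun do rewrite !mxE; move/le_trans; apply.
    rewrite -(l2norm_sq (V2B (Lu k) (Lu m))).
    rewrite -[leRHS](sqr_sqrtr (ltW e0)) lerXn2r ?nnegrE ?l2norm_ge0 ?sqrtr_ge0//.
    by have := stepb m (k - m)%N; rewrite subnKC// => hs; exact: le_trans hs (hN _ Nm).
  move=> m k Nm Nk; have [mk|/ltnW km] := leqP m k; last exact: aux.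
  by rewrite -n2N; under eq_fun do rewrite opprB; exact: aux.
have comp' (i : 'I_n) : exists g : R -> C, L2 g /\ forall e : R, 0 < e -> exists N, forall m, (N <= m)%N ->
     n2 (fun t => u m t i ord0 - g t) <= e.
  by have [g h1 h2] := comp i; exists g.
have [G hG] := choice comp'.
pose p t : 'cV[C]_n := \col_i G i t.
have hp : VH p.
  move=> i j; rewrite /p; under eq_fun do rewrite mxE; have [LG hGi] := hG i.
  split=> // k k0; apply: cabs_eq0; apply/eqP; rewrite -sqrf_eq0 eq_le exprn_ge0 ?cabs_ge0// andbT.
  apply/ler_addgt0Pl => e e0; rewrite addr0.
  have [N /(_ _ (leqnn _)) hN] := hGi e e0.
  have Lui : L2 (fun t => u N t i ord0) by exact: Lu.
  have -> : fcoef (G i) k = - fcoef (fun t => u N t i ord0 - G i t) k.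
    by rewrite fcoefB ?(hu N i ord0).2 ?sub0r ?opprK//; exact: L2_L1.
  by rewrite cabsN; apply: le_trans hN; apply: fcoef_n2; exact: L2B.
exists p => // e e0.
(* The n components share the error e^2; [n.+1] keeps the quotient meaningful for n = 0. *)
have e1 : 0 < e ^+ 2 / n.+1%:R by rewrite divr_gt0 ?exprn_gt0.
have hex i : exists N, forall m, (N <= m)%N -> n2 (fun t => u m t i ord0 - G i t) <= e ^+ 2 / n.+1%:R.
  exact: (hG i).2.
have [N hN] := choice hex.
exists (\max_i N i) => m hm.
have Lup : V2 (fun t => u m t - p t) by apply: V2B => //; exact: mx_H2_L2.
rewrite -(@ler_pXn2r _ 2)// ?nnegrE ?l2norm_ge0 ?(ltW e0)// l2norm_sq// nn_sum//.
apply: (@le_trans _ _ (\sum_(i < n) e ^+ 2 / n.+1%:R)).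
  apply: ler_sum => i _; under eq_fun do rewrite !mxE; apply: hN.
  by apply: leq_trans hm; exact: leq_bigmax.
rewrite sumr_const card_ord -[leLHS]mulr_natr mulrAC ler_pdivrMr// ler_wpM2l ?ler_nat//.
by rewrite exprn_ge0// ltW.
Qed.

(** Banach's fixed point theorem by iteration from 0. Elements are functions and not classes, so the
    fixed point equation holds almost everywhere. *)
Lemma fix_H2 (T : (R -> 'cV[C]_n) -> R -> 'cV[C]_n) (c : R) : 0 <= c -> c < 1 ->
  (forall p, VH p -> VH (T p)) ->
  (forall p q, VH p -> VH q -> l2norm (fun t => T p t - T q t) <= c * l2norm (fun t => p t - q t)) ->
  exists2 p, VH p & aeI (fun t => p t = T p t).
Proof.
move=> c0 c1 hT hc.
pose u k := iter k T (fun=> 0).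
have hu k : VH (u k).
  elim: k => [|k IH]; last exact: hT.
  by apply: mx_Hinf_H2; exact: mx_Hinf_cst.
pose d := l2norm (fun t => u 1%N t - u 0%N t).
have hd k : l2norm (fun t => u k.+1 t - u k t) <= d * c ^+ k.
  elim: k => [|k IH]; first by rewrite expr0 mulr1.
  apply: le_trans (hc _ _ (hu k.+1) (hu k)) _.
  by rewrite exprS mulrCA ler_wpM2l.
have [p hp lim] := H2_complete c0 c1 (l2norm_ge0 _) hu hd.
exists p => //.
have Lp := mx_H2_L2 hp; have LT := mx_H2_L2 (hT _ hp).
have : l2norm (fun t => p t - T p t) = 0.
  apply/eqP; rewrite eq_le l2norm_ge0 andbT; apply/ler_addgt0Pl => e e0; rewrite addr0.
  have e2 : 0 < e / 2 by rewrite divr_gt0.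
  have [N hN] := lim _ e2.
  have Lk k : V2 (u k) := mx_H2_L2 (hu k).
  have -> : (fun t => p t - T p t) = (fun t => - (u N.+1 t - p t) + (u N.+1 t - T p t)).
    by apply/funext => t; rewrite opprB addrA subrK.
  apply: (le_trans (l2normD (V2N (V2B (Lk _) Lp)) (V2B (Lk _) LT))).
  rewrite l2normN; last exact: V2B.
  rewrite [leRHS]splitr; apply: lerD; first exact: (hN N.+1 (leqnSn N)).
  apply: le_trans (hc _ _ (hu N) hp) _.
  apply: le_trans (hN _ (leqnn _)); apply: ler_piMl; [exact: l2norm_ge0|exact: ltW].
move=> /(l2norm_eq0 (V2B Lp LT)); apply: aeI_S => t _ /eqP.
by rewrite subr_eq0 => /eqP.
Qed.

(** As in [hankel_norm_le1], the projection is relational: p ranges over all representatives of P_-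
    (Psi f). *)
Definition hankel_le (k : R) (Psi : R -> 'M[C]_n) : Prop :=
  forall f p, VH f -> VHm p -> VH (fun t => Psi t *m f t - p t) -> l2norm p <= k * l2norm f.

(** For f = P_+ (Psi^* q) one has |f|^2 = <q, H f>, where H f = P_- (Psi f) has norm at most k
    |f|. *)
Lemma hankel_dual k Psi : 0 <= k -> mx_in (@Linf R) Psi -> hankel_le k Psi ->
  forall f q, VH f -> VHm q -> VHm (fun t => (Psi t)^a *m q t - f t) -> l2norm f <= k * l2norm q.
Proof.
move=> k0 lP hk f q hf hq hd; have Lf := mx_H2_L2 hf; have Lq := mx_H2m_L2 hq.
have LPf : V2 (fun t => Psi t *m f t) by exact: mx_Linf_L2M.
have LPq : V2 (fun t => (Psi t)^a *m q t) by apply: mx_Linf_L2M => //; exact: mx_Linf_adj.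
have [g hg hgm] := vproj LPf.
have hp := mx_H2_L2 hg.
have h1 : l2norm (fun t => Psi t *m f t - g t) <= k * l2norm f.
  apply: hk => //; rewrite (_ : (fun t => _) = g)//.
  by apply/funext => t; rewrite opprB addrC subrK.
have e : (nn f)%:C%C = vip q (fun t => Psi t *m f t - g t).
  rewrite vipBr// (vip_orth' hg hq) subr0.
  rewrite (vipC LPf Lq) vip_adj// -(vip_nn Lf).
  have -> : (fun t => (Psi t)^a *m q t) = (fun t => ((Psi t)^a *m q t - f t) + f t).
    by apply/funext => t; rewrite subrK.
  rewrite vipDr// ?(vip_orth hf hd) ?add0r; last exact: mx_H2m_L2.
  by rewrite vip_nn// conjc_real.
have h2 : l2norm f ^+ 2 <= l2norm q * (k * l2norm f).
  rewrite l2norm_sq//; have -> : nn f = cabs (nn f)%:C%C by rewrite cabs_Cr ger0_norm// nn_ge0.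
  rewrite e; apply: le_trans (CS Lq (mx_H2m_L2 hgm)) _.
  by apply: ler_wpM2l => //; exact: l2norm_ge0.
have [f0|f0] := eqVneq (l2norm f) 0; first by rewrite f0 mulr_ge0// l2norm_ge0.
have fp : 0 < l2norm f by rewrite lt_neqAle eq_sym f0 l2norm_ge0.
by move: h2; rewrite expr2 mulrA ler_pM2r// mulrC.
Qed.

(** The unknowns satisfy q = H p and p = g + H^* q. The map p -> g + H^* H p contracts by k^2, which
    gives the solution and its estimate. *)
Lemma hankel_fix k Psi g : 0 <= k -> k < 1 -> mx_in (@Linf R) Psi -> hankel_le k Psi -> VH g ->
  exists p q, [/\ VH p, VHm q, VH (fun t => Psi t *m p t - q t),
    VHm (fun t => (Psi t)^a *m q t - (p t - g t)) & (1 - k ^+ 2) * l2norm p <= l2norm g].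
Proof.
move=> k0 k1 lP hk hg.
have lPa := mx_Linf_adj lP.
have hex1 (p : R -> 'cV[C]_n) : exists q : R -> 'cV[C]_n, VH p -> VHm q /\ VH (fun t => Psi t *m p t - q t).
  case: (pselect (VH p)) => hp; last by exists (fun=> 0).
  have [r h1 h2] := vproj (mx_Linf_L2M lP (mx_H2_L2 hp)).
  exists (fun t => Psi t *m p t - r t) => _; split=> //.
  by rewrite (_ : (fun t => _) = r)//; apply/funext => t; rewrite opprB addrC subrK.
have [Q hQ] := choice hex1.
have hex2 (q : R -> 'cV[C]_n) : exists p : R -> 'cV[C]_n, VHm q -> VH p /\ VHm (fun t => (Psi t)^a *m q t - p t).
  case: (pselect (VHm q)) => hq; last by exists (fun=> 0).
  by have [r h1 h2] := vproj (mx_Linf_L2M lPa (mx_H2m_L2 hq)); exists r.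
have [P hP] := choice hex2.
pose T p t := g t + P (Q p) t.
have k2 : k ^+ 2 < 1 by rewrite expr_lt1.
have hT p : VH p -> VH (T p).
  by move=> hp; apply: mx_H2D => //; exact: (hP _ (hQ _ hp).1).1.
have estQ p1 p2 : VH p1 -> VH p2 -> l2norm (fun t => Q p1 t - Q p2 t) <= k * l2norm (fun t => p1 t - p2 t).
  move=> h1 h2; have [a1 b1] := hQ _ h1; have [a2 b2] := hQ _ h2.
  apply: hk; [exact: mx_H2B|exact: mx_H2mB|].
  rewrite (_ : (fun t => _) = (fun t => (Psi t *m p1 t - Q p1 t) - (Psi t *m p2 t - Q p2 t))).
    exact: mx_H2B.
  by apply/funext => t; rewrite mulmxBr !opprB addrACA [in RHS]addrACA [- _ + _]addrC.
have estP q1 q2 : VHm q1 -> VHm q2 -> l2norm (fun t => P q1 t - P q2 t) <= k * l2norm (fun t => q1 t - q2 t).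
  move=> h1 h2; have [a1 b1] := hP _ h1; have [a2 b2] := hP _ h2.
  apply: (hankel_dual k0 lP hk); [exact: mx_H2B|exact: mx_H2mB|].
  rewrite (_ : (fun t => _) = (fun t => ((Psi t)^a *m q1 t - P q1 t) - ((Psi t)^a *m q2 t - P q2 t))).
    exact: mx_H2mB.
  by apply/funext => t; rewrite mulmxBr !opprB addrACA [in RHS]addrACA [- _ + _]addrC.
have est p1 p2 : VH p1 -> VH p2 -> l2norm (fun t => T p1 t - T p2 t) <= k ^+ 2 * l2norm (fun t => p1 t - p2 t).
  move=> h1 h2; rewrite (_ : (fun t => _) = (fun t => P (Q p1) t - P (Q p2) t)); last first.
    by apply/funext => t; rewrite /T opprD addrACA subrr add0r.
  apply: le_trans (estP _ _ (hQ _ h1).1 (hQ _ h2).1) _.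
  by rewrite expr2 -mulrA ler_wpM2l// estQ.
have [p hp ep] := fix_H2 (exprn_ge0 2 k0) k2 hT est.
have [hq hpq] := hQ _ hp; have [hPq hPm] := hP _ hq.
exists p, (Q p); split=> //.
  apply: (mx_in_ae (@H2m_ae R)) hPm.
    apply: mx_cmeasB; first by apply: mx_cmeasM; [exact: mx_Linf_meas|exact: mx_L2_meas (mx_H2m_L2 hq)].
    by apply: mx_L2_meas; apply: mx_L2B; exact: mx_H2_L2.
  by apply: aeI_S ep => t _ e; rewrite e /T [g t + _]addrC addrK.
have b1 : l2norm p <= l2norm g + l2norm (P (Q p)).
  rewrite (l2norm_ae (mx_H2_L2 hp) (mx_H2_L2 (hT _ hp)) ep).
  by apply: l2normD; exact: mx_H2_L2.
have b2 : l2norm (P (Q p)) <= k * l2norm (Q p) by apply: (hankel_dual k0 lP hk).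
have b3 : l2norm (Q p) <= k * l2norm p by apply: hk.
have b4 : k * l2norm (Q p) <= k * (k * l2norm p) by rewrite ler_wpM2l.
by rewrite mulrBl mul1r expr2 -mulrA; lra.
Qed.

End Hardy.

(** The norm-preserving map J g = z^-1 conj g exchanges H2 and H2minus and turns the Hankel operator
    of Psi^T into the adjoint of that of Psi. *)
Lemma hankel_tr (R : realType) n (k : R) (Psi : R -> 'M[R[i]]_n) : 0 <= k -> mx_in (@Linf R) Psi ->
  hankel_le k Psi -> hankel_le k (fun t => (Psi t)^T).
Proof.
move=> k0 lP hk f p hf hp hd.
pose J (g : R -> 'cV[R[i]]_n) : R -> 'cV[R[i]]_n := fun t => ee t ^ (-1) *: cjmx (g t).
have nJ g : l2norm (J g) = l2norm g.
  rewrite !l2normE !nnE; congr Num.sqrt; congr rint; apply/funext => t.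
  rewrite vsqZ cabs_eez expr1n mul1r /vsq; apply: eq_bigr => i _.
  by rewrite cjmxE cabsJ.
have JH g : mx_in (@H2 R) g -> mx_in (@H2minus R) (J g).
  move=> hg i j; rewrite /J; under eq_fun do rewrite mxE cjmxE mulrC.
  exact: H2J_m.
have JHm g : mx_in (@H2minus R) g -> mx_in (@H2 R) (J g).
  move=> hg i j; rewrite /J; under eq_fun do rewrite mxE cjmxE mulrC.
  have [L h] := hg i j; split; first by apply: L2_eez; exact: L2J.
  by move=> l l0; rewrite fcoef_shift fcoefJ ?h ?conjc0//; [lia|exact: L2_L1].
rewrite -(nJ f) -(nJ p).
apply: (hankel_dual k0 lP hk); [exact: JHm|exact: JH|].
rewrite (_ : (fun t => _) = J (fun t => (Psi t)^T *m f t - p t)); first exact: JH.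
apply/funext => t; rewrite /J cjmxB cjmxM cjmx_tr scalerBr -scalemxAr//.
Qed.

(** Matrix products are abstracted first, so that the entrywise [ring] sees only an additive
    identity. *)
Ltac mxabel := do ?[move: (_ *m _) => ?]; apply/matrixP => ? ?; rewrite !mxE; ring.

(** * Half of a Nehari parametrization *)

Section Theta.
Variable (R : realType).
Local Notation C := R[i].
Local Notation Re := complex.Re.
Local Notation Im := complex.Im.
Local Notation "A ^a" := (adjmx A) (at level 8, format "A ^a").

Lemma mxD_E m n (A B : 'M[C]_(m, n)) i j : (A + B) i j = A i j + B i j.
Proof. by rewrite mxE. Qed.
Lemma mxN_E m n (A : 'M[C]_(m, n)) i j : (- A) i j = - A i j.
Proof. by rewrite mxE. Qed.
Lemma col_mulmx m n p (A : 'M[C]_(m, n)) (B : 'M[C]_(n, p)) j : col j (A *m B) = A *m col j B.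
Proof. by rewrite !colE mulmxA. Qed.
Lemma vdot_herm_real n (b : 'M[C]_n) v : b^a = b -> Im (vdot (b *m v) v) = 0.
Proof.
move=> hb; have := vdotC (b *m v) v; rewrite vdot_adj hb => e.
have := congr1 (@complex.Im R) e; rewrite cImJ vdotC cImJ; lra.
Qed.

(** The spectral decomposition b = P^* S^2 P gives be = P^* S^-1 and ga = S P. Consequently b = ga^*
    ga, which is how a positive form is later inverted with an explicit bound. *)
Lemma posdef_factor n (b : 'M[C]_n) : b^a = b ->
  (forall v : 'cV[C]_n, v != 0 -> 0 < Re (vdot (b *m v) v)) ->
  exists be ga : 'M[C]_n, [/\ be^a *m b *m be = 1%:M, be *m ga = 1%:M & ga *m be = 1%:M].
Proof.
move=> hb pos.
have eC (A : 'M[C]_n) : map_mx Num.conj A^T = A^a by apply/matrixP => i j; rewrite !mxE.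
have nb : b \is spectral.normalmx by apply/spectral.normalmxP; rewrite eC hb.
have := spectral.orthomx_spectralP nb.
have := spectral.spectral_unitarymx b.
set P := spectral.spectralmx b; set sp := spectral.spectral_diag b => uP.
rewrite (spectral.invmx_unitary uP) eC => eb.
have PP : P *m P^a = 1%:M by have /spectral.unitarymxP := uP; rewrite eC.
have PP' : P^a *m P = 1%:M by exact: mulmx1C.
have spP i : Im (sp ord0 i) = 0 /\ 0 < Re (sp ord0 i).
  pose v := P^a *m delta_mx i (ord0 : 'I_1).
  have vv : vsq v = 1.
    apply: (@complexI R); rewrite -vdot_vsq /v vdot_adj adjmxK mulmxA PP mul1mx.
    rewrite vdotE (bigD1 i)//= !mxE eqxx big1 ?addr0 ?mul1r ?conjc1// => k ki.
    by rewrite mxE (negbTE ki) mul0r.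
  have v0 : v != 0.
    by apply/eqP => e; move: vv; rewrite e vsq0 => /eqP; rewrite eq_sym oner_eq0.
  have bv : b *m v = sp ord0 i *: v.
    rewrite eb /v -!mulmxA (mulmxA P) PP mul1mx scalemxAr; congr (_ *m _).
    apply/matrixP => k l; rewrite mul_diag_mx !mxE; case: (k =P i) => [->//|_].
    by rewrite !mulr0.
  have h1 := vdot_herm_real v hb; have h2 := pos v v0.
  by move: h1 h2; rewrite bv vdotZl vdot_vsq vv mulr1.
pose s i : R := Num.sqrt (Re (sp ord0 i)).
have s0 i : s i != 0 by rewrite gt_eqF// sqrtr_gt0; case: (spP i).
have ss i : (s i)%:C%C * (s i)%:C%C = sp ord0 i.
  rewrite -CrM -expr2 sqr_sqrtr; last by case: (spP i) => _ /ltW.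
  by apply: complex_eqP => //=; case: (spP i).
pose S : 'M[C]_n := diag_mx (\row_i (s i)%:C%C).
pose Si : 'M[C]_n := diag_mx (\row_i ((s i)^-1)%:C%C).
have SSi : S *m Si = 1%:M.
  rewrite mulmx_diag -diag_const_mx; congr diag_mx; apply/matrixP => k l.
  by rewrite !mxE -CrM divff.
have aSi : Si^a = Si.
  apply/matrixP => k l; rewrite adjmxE !mxE.
  by case: (k =P l) => [->|h]; rewrite ?eqxx ?mulr1n ?conjc_real// eq_sym; case: eqP => [/esym//|_]; rewrite mulr0n conjc0.
have dsp : diag_mx sp = S *m S.
  by rewrite mulmx_diag; congr diag_mx; apply/matrixP => k l; rewrite ord1 !mxE ss.
have SiS : Si *m S = 1%:M by exact: mulmx1C.
exists (P^a *m Si), (S *m P); split.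
- rewrite adjmxM adjmxK aSi eb dsp !mulmxA -(mulmxA Si) PP mulmx1.
  by rewrite SiS mul1mx -(mulmxA S) PP mulmx1 SSi.
- by rewrite mulmxA -(mulmxA _ Si) SiS mulmx1 PP'.
- by rewrite mulmxA -(mulmxA S) PP mulmx1 SSi.
Qed.

Lemma vsq_herm n (p q : 'M[C]_n) (b : 'M[C]_n) v : p^a *m p - q^a *m q = b ->
  vdot (b *m v) v = (vsq (p *m v) - vsq (q *m v))%:C%C.
Proof.
move=> <-; rewrite mulmxBl -[- _]scaleN1r vdotDl vdotZl -!mulmxA.
rewrite -[p^a]adjmxK -[q^a]adjmxK !adjmxK.
have e (A : 'M[C]_n) : vdot (A^a *m (A *m v)) v = (vsq (A *m v))%:C%C.
  by rewrite vdot_adj adjmxK vdot_vsq.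
by rewrite !e; apply: complex_eqP; rewrite ?cReD ?cImD ?cReM ?cImM /=; ring.
Qed.

Variable n : nat.

(** When p and Psi p - q are in H2, and q and Psi^* q - (p - 1) in H2minus, no term on the right has
    a Fourier coefficient of positive index. The left side is Hermitian, so it is then constant. *)
Lemma theta_id (Ps p q : 'M[C]_n) : p^a *m p - q^a *m q =
  p^a - p^a *m (Ps^a *m q - (p - 1%:M)) + (Ps *m p - q)^a *m q.
Proof.
rewrite adjmxB adjmxM mulmxBl !mulmxBr mulmx1 !mulmxA opprB addrA.
by congr (_ - _); rewrite -addrA subrK addrC subrK.
Qed.

(* With H the Hankel operator of Psi, the columns of p and q satisfy q = H p and
   (1 - H^* H) p = be; the last clause normalises them. *)
Definition half_theta (Psi p q : R -> 'M[C]_n) (be : 'M[C]_n) : Prop :=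
  [/\ mx_in (@H2 R) p, mx_in (@H2minus R) q, mx_in (@H2 R) (fun t => Psi t *m p t - q t),
      mx_in (@H2minus R) (fun t => (Psi t)^a *m q t - (p t - be)) &
      aeI (fun t => (p t)^a *m p t - (q t)^a *m q t = 1%:M)].

(** The columns of p solve (1 - H^* H) p = e_j. Then p^* p - q^* q is a constant Hermitian matrix b,
    positive because q v has norm at most k times that of p v. Right multiplication by a matrix [be]
    with be^* b be = 1 normalizes it. *)
Lemma half_thetaP k (Psi : R -> 'M[C]_n) : 0 <= k -> k < 1 -> mx_in (@Linf R) Psi ->
  hankel_le k Psi ->
  exists p q be ga, half_theta Psi p q be /\ (be *m ga = 1%:M /\ ga *m be = 1%:M).
Proof.
move=> k0 k1 lP hk.
have hex (j : 'I_n) : exists pq : (R -> 'cV[C]_n) * (R -> 'cV[C]_n),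
   [/\ mx_in (@H2 R) pq.1, mx_in (@H2minus R) pq.2,
     mx_in (@H2 R) (fun t => Psi t *m pq.1 t - pq.2 t) &
     mx_in (@H2minus R) (fun t => (Psi t)^a *m pq.2 t - (pq.1 t - delta_mx j ord0))].
  have hg : mx_in (@H2 R) (fun=> (delta_mx j ord0 : 'cV[C]_n)).
    by apply: mx_Hinf_H2; exact: mx_Hinf_cst.
  by have [p [q [h1 h2 h3 h4 _]]] := hankel_fix k0 k1 lP hk hg; exists (p, q).
have [F hF] := choice hex.
pose p t : 'M[C]_n := \matrix_(i, j) (F j).1 t i ord0.
pose q t : 'M[C]_n := \matrix_(i, j) (F j).2 t i ord0.
have colp t j : col j (p t) = (F j).1 t by apply/matrixP => i l; rewrite !mxE (ord1 l).
have colq t j : col j (q t) = (F j).2 t by apply/matrixP => i l; rewrite !mxE (ord1 l).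
have entry (A : R -> 'M[C]_n) P : (forall j, mx_in P (fun t => col j (A t))) -> mx_in P A.
  by move=> h i j; have := h j i ord0; under eq_fun do rewrite mxE.
have col1 j : col j (1%:M : 'M[C]_n) = delta_mx j ord0.
  by apply/matrixP => i l; rewrite !mxE ord1 eqxx andbT.
have hp : mx_in (@H2 R) p.
  by apply: entry => j; under eq_fun do rewrite colp; case: (hF j).
have hq : mx_in (@H2minus R) q.
  by apply: entry => j; under eq_fun do rewrite colq; case: (hF j).
have hB : mx_in (@H2 R) (fun t => Psi t *m p t - q t).
  apply: entry => j; under eq_fun do rewrite linearB/= col_mulmx colp colq.
  by case: (hF j).
have hs : mx_in (@H2minus R) (fun t => (Psi t)^a *m q t - (p t - 1%:M)).
  apply: entry => j; under eq_fun do rewrite [col _ _]linearB/= [col _ (_ - 1%:M)]linearB/= col1 colp col_mulmx colq.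
  by case: (hF j).
clearbody p q.
pose X t := (p t)^a *m p t - (q t)^a *m q t.
have Lp := mx_H2_L2 hp; have Lq := mx_H2m_L2 hq.
have eX t : X t = (p t)^a - (p t)^a *m ((Psi t)^a *m q t - (p t - 1%:M))
    + (Psi t *m p t - q t)^a *m q t.
  exact: theta_id.
have LX : mx_in (@L1 R) X.
  move=> i j; rewrite /X; under eq_fun do rewrite mxD_E mxN_E; apply: L1B.
    exact: (mx_L2_L1M (mx_L2_adj Lp) Lp).
  exact: (mx_L2_L1M (mx_L2_adj Lq) Lq).
have aX t i j : X t i j = conjc (X t j i).
  by rewrite -adjmxE /X adjmxB !adjmxM !adjmxK.
have hk1 i j l : 0 < l -> fcoef (fun t => X t i j) l = 0.
  move=> l0; under eq_fun do rewrite eX !mxD_E mxN_E adjmxE.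
  have [L1b hb] := mx_H2a_H2m hp hs i j; have [L1c hc] := mx_H2a_H2m hB hq i j.
  have L1p : L1 (fun t => conjc (p t j i)) by apply: L1J; apply: L2_L1; exact: Lp.
  rewrite fcoefD ?fcoefB ?hb ?hc ?subr0 ?addr0 ?(ltW l0)//; last exact: L1B.
  by rewrite fcoefJ ?(hp j i).2 ?conjc0//; [rewrite oppr_lt0|apply: L2_L1; exact: Lp].
have hk2 i j l : l < 0 -> fcoef (fun t => X t i j) l = 0.
  move=> l0; under eq_fun do rewrite aX; rewrite fcoefJ; last exact: LX.
  by rewrite hk1 ?conjc0// oppr_gt0.
pose b : 'M[C]_n := \matrix_(i, j) fcoef (fun t => X t i j) 0.
have Xb : aeI (fun t => X t = b).
  have : aeI (fun t => forall i j, X t i j = b i j).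
    apply: aeI_forall => i; apply: aeI_forall => j.
    apply: L1_unique2; [exact: LX|exact: L1_cst|move=> l].
    rewrite fcoef_cst mxE; case: (ltrgtP l 0) => l0 /=.
    - by rewrite hk2// ?mulr0.
    - by rewrite hk1// ?mulr0.
    - by rewrite l0 ?mulr1.
  by apply: aeI_S => t _ h; apply/matrixP => i j.
have ba : b^a = b.
  have [t _ <-] := aeI_ex Xb; apply/matrixP => i j; by rewrite adjmxE -aX.
have pos (v : 'cV[C]_n) : v != 0 -> 0 < Re (vdot (b *m v) v).
  move=> v0; have hpv : mx_in (@H2 R) (fun t => p t *m v) by apply: mx_H2_HinfM => //; exact: mx_Hinf_cst.
  have hqv : mx_in (@H2minus R) (fun t => q t *m v) by exact: mx_H2m_cst.
  have Lpv := mx_H2_L2 hpv; have Lqv := mx_H2m_L2 hqv.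
  have e : Re (vdot (b *m v) v) = nn (fun t => p t *m v) - nn (fun t => q t *m v).
    rewrite !nnE -rintB; [|exact: RI_nn|exact: RI_nn].
    rewrite -[LHS](@rint_cst R); apply: rint_ae.
    - exact: measurable_cst.
    - by apply: RI_meas; apply: RI_B; exact: RI_nn.
    - by apply: aeI_S Xb => t _ h; rewrite /cst (vsq_herm v h).
  have b1 : l2norm (fun t => q t *m v) <= k * l2norm (fun t => p t *m v).
    apply: hk => //; rewrite (_ : (fun t => _) = (fun t => (Psi t *m p t - q t) *m v)).
      by apply: mx_H2_HinfM => //; exact: mx_Hinf_cst.
    by apply/funext => t; rewrite mulmxBl mulmxA.
  have b2 : nn (fun t => q t *m v) <= k ^+ 2 * nn (fun t => p t *m v).
    rewrite -!l2norm_sq// -exprMn lerXn2r// nnegrE ?mulr_ge0 ?l2norm_ge0//.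
  have k2 : k ^+ 2 < 1 by rewrite expr_lt1.
  have [z|nz] := eqVneq (nn (fun t => p t *m v)) 0; last first.
    have p0 : 0 < nn (fun t => p t *m v) by rewrite lt_neqAle eq_sym nz nn_ge0.
    by rewrite e subr_gt0 (le_lt_trans b2)// -[ltRHS]mul1r ltr_pM2r.
  have qz : nn (fun t => q t *m v) = 0.
    by apply/eqP; rewrite eq_le nn_ge0// andbT (le_trans b2)// z mulr0.
  have pz' := nn_eq0 Lpv z; have qz' := nn_eq0 Lqv qz.
  (* Where p v = 0 and q v = 0, the column equation puts the constant v into H2minus, whose
     functions have no coefficient of index 0. *)
  have hv : mx_in (@H2minus R) (fun _ : R => v).
    apply: (mx_in_ae (@H2m_ae R)) (mx_H2m_cst v hs); first by apply: mx_L2_meas; exact: V2_cst.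
    apply: aeI_S2 pz' qz' => t _ h1 h2.
    by rewrite mulmxBl mulmxBl -mulmxA h1 h2 mulmx0 mul1mx !sub0r opprK.
  case/eqP: v0; apply/matrixP => i j; have [_ /(_ 0 (lexx _))] := hv i j.
  by rewrite fcoef_cst eqxx mulr1 mxE.
have [be [ga [h1 h2 h3]]] := posdef_factor ba pos.
exists (fun t => p t *m be), (fun t => q t *m be), be, ga; split; last by split.
split.
- by apply: mx_H2_HinfM => //; exact: mx_Hinf_cst.
- exact: mx_H2m_cst.
- under eq_fun do rewrite mulmxA -mulmxBl.
  by apply: mx_H2_HinfM => //; exact: mx_Hinf_cst.
- rewrite (_ : (fun t => _) = (fun t => ((Psi t)^a *m q t - (p t - 1%:M)) *m be)).
    exact: mx_H2m_cst.
  by apply/funext => t; rewrite !mulmxBl mul1mx mulmxA.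
- apply: aeI_S Xb => t _ e; rewrite !adjmxM -!mulmxA -mulmxBr !mulmxA -mulmxBl.
  by rewrite -/(X t) e mulmxA.
Qed.
End Theta.

(** * J-unitary matrices, limits in H1 and outer functions *)

Section Outer.
Variable (R : realType).
Local Notation C := R[i].
Local Notation Re := complex.Re.
Local Notation Im := complex.Im.
Local Notation "A ^a" := (adjmx A) (at level 8, format "A ^a").

Lemma contr_adj n (A : 'M[C]_n) : (forall v, vsq (A *m v) <= vsq v) ->
  forall v, vsq (A^a *m v) <= vsq v.
Proof.
move=> h v; set w := A^a *m v.
have e : vdot (A *m w) v = (vsq w)%:C%C by rewrite vdot_adj -/w vdot_vsq.
have := vdot_CS (A *m w) v; rewrite e cabs_Cr ger0_norm ?vsq_ge0// => h1.
have h2 := h w; have w0 := vsq_ge0 w; have v0 := vsq_ge0 v.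
have [z|nz] := eqVneq (vsq w) 0; first by rewrite z.
have p0 : 0 < vsq w by rewrite lt_neqAle eq_sym nz.
rewrite -(ler_pM2l p0) -expr2 (le_trans h1)// ler_wpM2r//.
Qed.

Lemma vsq_entry m n (A : 'M[C]_(m, n)) (M : R) i j :
  (forall v, vsq (A *m v) <= M * vsq v) -> cabs (A i j) ^+ 2 <= M.
Proof.
move=> h; apply: le_trans (col_vsq A i j) _; rewrite colE.
have e : vsq (delta_mx j ord0 : 'cV[C]_n) = 1.
  rewrite /vsq (bigD1 j)//= mxE !eqxx cabs1 expr1n big1 ?addr0// => l lj.
  by rewrite mxE (negbTE lj) cabs0 expr0n.
by have := h (delta_mx j ord0); rewrite e mulr1.
Qed.

Lemma vsqJ_pt n (p q : 'M[C]_n) v : p^a *m p - q^a *m q = 1%:M ->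
  vsq (p *m v) = vsq v + vsq (q *m v).
Proof.
move=> h; have := vsq_herm v h; rewrite mul1mx vdot_vsq => /(congr1 (@complex.Re R)) /= ->; ring.
Qed.

Lemma Jp_unit n (p q : 'M[C]_n) : p^a *m p - q^a *m q = 1%:M -> p \in unitmx.
Proof.
move=> h; apply: unit_inj => v e; apply: vsq_eq0; have := vsqJ_pt v h.
by rewrite e vsq0 => h1; have := vsq_ge0 v; have := vsq_ge0 (q *m v); lra.
Qed.

Lemma Jp_contr n (p q : 'M[C]_n) v : p^a *m p - q^a *m q = 1%:M ->
  vsq (iv p *m v) <= vsq v.
Proof.
move=> h; have := vsqJ_pt (iv p *m v) h; rewrite mulmxA iv_mulmxV ?(Jp_unit h)// mul1mx => ->.
by rewrite lerDl vsq_ge0.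
Qed.

(** The block matrix with rows (P, Qp) and (Q, Pm) is J-unitary, so J times its adjoint times J is a
    left inverse. Being square it is also a right inverse, and a corner of that product is the
    claim. *)
Lemma J_inv n (P Q Pm Qp : 'M[C]_n) : P^a *m P - Q^a *m Q = 1%:M ->
  Pm^a *m Pm - Qp^a *m Qp = 1%:M -> Pm^a *m Q = Qp^a *m P ->
  P *m P^a - Qp *m Qp^a = 1%:M.
Proof.
move=> h1 h2 h3.
have h4 : P^a *m Qp = Q^a *m Pm by rewrite -[LHS]adjmxK adjmxM adjmxK -h3 adjmxM adjmxK.
have : block_mx P^a (- Q^a) (- Qp^a) Pm^a *m block_mx P Qp Q Pm = 1%:M.
  by rewrite mulmx_block !mulNmx h1 h4 h3 subrr addNr [- _ + _]addrC h2 -scalar_mx_block.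
move/mulmx1C; rewrite mulmx_block !mulmxN (scalar_mx_block n n) => /eq_block_mx[->//].
Qed.

(* |D^* v| >= |P^* v| - |Qp^* v| = |v|^2 / (|P^* v| + |Qp^* v|), uniformly in r. *)
Lemma Dlow n (P Qp E : 'M[C]_n) (r : R) v : 0 <= r -> r <= 1 ->
  P *m P^a - Qp *m Qp^a = 1%:M -> E^a *m E = 1%:M ->
  vsq v <= 4 * frob P^a * vsq ((P + r%:C%C *: (Qp *m E))^a *m v).
Proof.
move=> r0 r1 hP hE.
have hE' : (E^a)^a *m E^a = 1%:M by rewrite adjmxK; exact: mulmx1C.
have hP' : (P^a)^a *m P^a - (Qp^a)^a *m Qp^a = 1%:M by rewrite !adjmxK.
have := vsqJ_pt v hP'; rewrite -[vsq (Qp^a *m v)](vsq_unitary _ hE') mulmxA -adjmxM.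
rewrite adjmxD adjmxZ mulmxDl -scalemxAl.
set x := P^a *m v; set w := _ *m v => e.
rewrite conjc_real vsqD vsqZ cabs_Cr ger0_norm// vdotZr conjc_real cReM /= mul0r subr0.
have cs := vdot_CS x w.
have fr : vsq x <= frob P^a * vsq v by exact: vsq_frob.
move: e cs fr; rewrite -/x.
have x0 := vsq_ge0 x; have w0 := vsq_ge0 w; have v0 := vsq_ge0 v.
have := Re_le_cabs (vdot x w); rewrite ler_norml => /andP[c1 _].
have c0 := cabs_ge0 (vdot x w).
move: c1 c0 (frob_ge0 P^a); move: (cabs _) (Re _) (frob _) => c d f c1 c0 f0 e cs fr.
have [a [a0 ea]] : exists a, 0 <= a /\ a ^+ 2 = vsq x.
  by exists (Num.sqrt (vsq x)); rewrite sqrtr_ge0 sqr_sqrtr.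
have [b [b0 eb]] : exists b, 0 <= b /\ b ^+ 2 = vsq w.
  by exists (Num.sqrt (vsq w)); rewrite sqrtr_ge0 sqr_sqrtr.
move: x0 w0 v0 e cs fr; rewrite -ea -eb; move: (vsq v) => V _ _ V0 e cs fr.
have cab : c <= a * b.
  by rewrite -(@ler_pXn2r _ 2)// ?nnegrE ?mulr_ge0// exprMn.
have ba : b <= a by rewrite -(@ler_pXn2r _ 2)// ?nnegrE//; lra.
have rb : r * b <= b by rewrite ler_piMl.
have h1 : (a - b) ^+ 2 <= a ^+ 2 + r ^+ 2 * b ^+ 2 + 2 * (r * d).
  have h2 : (a - b) ^+ 2 <= (a - r * b) ^+ 2.
    have ab : 0 <= a - b by lra.
    by rewrite lerXn2r ?nnegrE//; lra.
  apply: le_trans h2 _; have : - (r * (a * b)) <= r * d by rewrite -mulrN ler_wpM2l//; lra.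
  have -> : (a - r * b) ^+ 2 = a ^+ 2 + r ^+ 2 * b ^+ 2 - 2 * (r * (a * b)) by ring.
  lra.
have [-> |Vn] := eqVneq V 0.
  by rewrite !mulr_ge0//; apply: le_trans h1; exact: sqr_ge0.
have Vp : 0 < V by rewrite lt_neqAle eq_sym Vn.
apply: le_trans (_ : 4 * f * (a - b) ^+ 2 <= _); last by rewrite ler_wpM2l// mulr_ge0.
rewrite -(ler_pM2l Vp); have -> : V = (a - b) * (a + b) by rewrite -subr_sqr e; ring.
have -> : (a - b) * (a + b) * (4 * f * (a - b) ^+ 2) = (a - b) ^+ 2 * (4 * (f * ((a - b) * (a + b)))) by ring.
have -> : (a - b) * (a + b) * ((a - b) * (a + b)) = (a - b) ^+ 2 * (a + b) ^+ 2 by ring.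
rewrite ler_wpM2l ?sqr_ge0//.
have -> : (a - b) * (a + b) = V by rewrite -subr_sqr e; ring.
apply: le_trans (_ : 4 * a ^+ 2 <= _); last by rewrite ler_wpM2l.
have -> : 4 * a ^+ 2 = (2 * a) ^+ 2 by ring.
rewrite lerXn2r// ?nnegrE; lra.
Qed.

(** [Dlow] makes the adjoint of D injective, which suffices for a square matrix. *)
Lemma D_unit n (P Qp E : 'M[C]_n) (r : R) : 0 <= r -> r <= 1 ->
  P *m P^a - Qp *m Qp^a = 1%:M -> E^a *m E = 1%:M ->
  P + r%:C%C *: (Qp *m E) \in unitmx.
Proof.
move=> r0 r1 hP hE; set D := _ + _.
have : D^a \in unitmx.
  apply: unit_inj => v e; apply: vsq_eq0; apply/eqP; rewrite eq_le vsq_ge0 andbT.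
  by have := Dlow v r0 r1 hP hE; rewrite -/D e vsq0 mulr0.
move=> h; apply: unit_inj => v e.
have : v^a *m (D^a *m iv D^a) = 0 by rewrite mulmxA -adjmxM e adjmx0 mul0mx.
by rewrite iv_mulmxV// mulmx1 => /(congr1 (@adjmx R _ _)); rewrite adjmxK adjmx0.
Qed.

Lemma D_entry n (P Qp E : 'M[C]_n) (r : R) i j : 0 <= r -> r <= 1 ->
  P *m P^a - Qp *m Qp^a = 1%:M -> E^a *m E = 1%:M ->
  cabs (iv (P + r%:C%C *: (Qp *m E)) i j) ^+ 2 <= 4 * frob P^a.
Proof.
move=> r0 r1 hP hE; have uD := D_unit r0 r1 hP hE.
have low := fun v => Dlow v r0 r1 hP hE; move: low uD.
set D := _ + _ => low uD.
rewrite -cabsJ -adjmxE; apply: vsq_entry => v.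
apply: le_trans (low _) _.
by rewrite mulmxA -adjmxM iv_mulVmx// adjmx1 mul1mx.
Qed.

(** Dominated convergence for each Fourier coefficient. The constant K may depend on t, since the
    rate only serves pointwise convergence. *)
Lemma H1_lim (u : nat -> R -> C) (v : R -> C) (w : R -> R) :
  (forall m, H1 (u m)) -> cmeas v -> 
  aeI (fun t => exists K : R, forall m, cabs (u m t - v t) <= K / m.+1%:R) ->
  RI w -> aeI (fun t => forall m, cabs (u m t) <= w t) -> H1 v.
Proof.
move=> hu mv hc iw hw.
have cvR (a : nat -> R) (b K : R) : (forall m, `|a m - b| <= K / m.+1%:R) -> (a n @[n --> \oo] --> b)%R.
  move=> h; apply/cvgrPdist_le => e e0.
  have K0 : 0 <= K by have := h 0%N; rewrite divr1; apply: le_trans.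
  have [N hN] : exists N : nat, K / e <= N%:R.
    exists (Num.bound (K / e)); apply/ltW/archi_boundP; rewrite divr_ge0// ltW//.
  exists N => // m /= Nm; rewrite distrC (le_trans (h m))// ler_pdivrMr// -ler_pdivrMl//.
  by rewrite mulrC (le_trans hN)// ler_nat (leq_trans Nm).
have vw : aeI (fun t => cabs (v t) <= w t).
  apply: aeI_S2 hc hw => t _ [K hK] hm.
  have h1 : (cabs (u m t) @[m --> \oo] --> cabs (v t))%R.
    by apply: cvR => m; exact: le_trans (cabs_diff _ _) (hK m).
  by apply: (@cvgr_to_le _ _ _ _ _ _ _ h1); exact: nearW.
have Lv : L1 v by exact: L1_le vw iw.
split=> // k k0.
have part (F : C -> R) : (forall z, `|F z| <= cabs z) -> (forall x y, F (x - y) = F x - F y) ->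
   (forall f, cmeas f -> rmeas (fun t => F (f t))) ->
   (forall m, rint (fun t => F (u m t * ee t ^ (- k))) = 0) -> rint (fun t => F (v t * ee t ^ (- k))) = 0.
  move=> hF FB Fm h0.
  have mz (f : R -> C) : cmeas f -> cmeas (fun t => f t * ee t ^ (- k)).
    by move=> mf; apply: cmeasM => //; exact: cmeas_eez.
  have : (rint (fun t => F (u m t * ee t ^ (- k))) @[m --> \oo] --> rint (fun t => F (v t * ee t ^ (- k))))%R.
    apply: (proj2 (rint_dct (w := w) _ _ _ _ _)) => //.
    - by move=> m; apply: Fm; apply: mz; case: (hu m) => [[]].
    - by apply: Fm; apply: mz.
    - apply: aeI_S hc => t _ [K hK]; apply: cvR => m; rewrite -FB -mulrBl.
      by apply: le_trans (hF _) _; rewrite cabsM cabs_eez mulr1; exact: hK.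
    - move=> m; apply: aeI_S hw => t _ h.
      by apply: le_trans (hF _) _; rewrite cabsM cabs_eez mulr1; exact: h.
  under eq_fun do rewrite h0; move=> /cvg_lim <- //; exact: lim_cst.
have hz m := (hu m).2 k k0.
apply: complex_eqP => /=; apply: part => //.
- exact: Re_le_cabs.
- by move=> x y; rewrite cReD cReN.
- by move=> f [].
- by move=> m; have /(congr1 (@complex.Re R)) := hz m.
- exact: Im_le_cabs.
- by move=> x y; rewrite cImD cImN.
- by move=> f [].
- by move=> m; have /(congr1 (@complex.Im R)) := hz m.
Qed.

(* For k < 0 the H2-projection g of Gi^* z^k e_i satisfies G^* g in H1m, hence g = 0,
   and this says that the k-th coefficients of row i of Gi vanish. *)
Lemma outer_inv n (G Gi : R -> 'M[C]_n) : mx_in (@H2 R) G -> mx_in (@L2 R) Gi ->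
  aeI (fun t => Gi t *m G t = 1%:M) ->
  (forall g : R -> 'cV[C]_n, mx_in (@H2 R) g -> mx_in (@H1m R) (fun t => (G t)^a *m g t) ->
     aeI (fun t => g t = 0)) ->
  mx_in (@H2 R) Gi.
Proof.
move=> hG hGi e hout i j; split; first exact: hGi.
move=> k k0.
pose h t : 'cV[C]_n := ee t ^ k *: delta_mx i ord0.
have hh : mx_in (@H2minus R) h.
  move=> a b; under eq_fun do rewrite /h mxE mulrC.
  have -> : (fun t : R => (delta_mx i ord0 : 'cV[C]_n) a b * ee t ^ k) = (fun t => conjc (conjc ((delta_mx i ord0 : 'cV[C]_n) a b)) * ee t ^ k).
    by apply/funext => t; rewrite conjcK.
  by apply: H2J_m => //; apply: Hinf_H2; exact: Hinf_cst.
have LGh : mx_in (@L2 R) (fun t => (Gi t)^a *m h t).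
  apply: mx_L2_LinfM; first exact: mx_L2_adj.
  by move=> a b; under eq_fun do rewrite /h mxE mulrC; apply: LinfM; [exact: Linf_cst|exact: Linf_eez].
have [g hg hgm] := vproj LGh.
have g0 : aeI (fun t => g t = 0).
  apply: hout => //.
  apply: (mx_in_ae (A := fun t => h t - (G t)^a *m ((Gi t)^a *m h t - g t)) (@H1m_ae R)).
  - apply: mx_cmeasM; first by apply: mx_cmeas_adj; apply: mx_L2_meas; exact: mx_H2_L2.
    by apply: mx_L2_meas; exact: mx_H2_L2.
  - apply: aeI_S e => t _ e; rewrite mulmxBr mulmxA -adjmxM e adjmx1 mul1mx.
    by rewrite opprB addrC subrK.
  - apply: mx_H1mB; first by move=> a b; have /H2mE[] := hh a b.
    exact: mx_H2a_H2m.
have hz : mx_in (@H2minus R) (fun t => (Gi t)^a *m h t).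
  apply: (mx_in_ae (@H2m_ae R)) hgm; first exact: mx_L2_meas.
  by apply: aeI_S g0 => t _ ->; rewrite subr0.
have [_ /(_ 0 (lexx _))] := hz j ord0.
under eq_fun do rewrite /h -scalemxAr mxE -colE mxE adjmxE mulrC.
rewrite fcoef_shift fcoefJ ?sub0r ?opprK; last by apply: L2_L1; exact: hGi.
by move/(congr1 (@conjc R)); rewrite conjcK conjc0.
Qed.
End Outer.

(** * The denominator p + conj q' E and its inverse *)

Section ThetaU.
Variable (R : realType).
Local Notation C := R[i].
Local Notation Re := complex.Re.
Local Notation Im := complex.Im.
Local Notation "A ^a" := (adjmx A) (at level 8, format "A ^a").

Lemma mxZ_E m n (c : C) (A : 'M[C]_(m, n)) i j : (c *: A) i j = c * A i j.
Proof. by rewrite mxE. Qed.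
Lemma le_sq1 (x : R) : x <= 1 + x ^+ 2.
Proof. have := sqr_ge0 (x - 1 / 2); lra. Qed.

Lemma H2m_cj f : @H2minus R f -> H2 (fun t => conjc (f t)).
Proof.
move=> [hf h]; split; first exact: L2J.
by move=> k k0; rewrite fcoefJ ?h ?conjc0 ?oppr_ge0 ?ltW//; exact: L2_L1.
Qed.
Lemma mx_H2m_cj m n (A : R -> 'M[C]_(m, n)) : mx_in (@H2minus R) A -> mx_in (@H2 R) (fun t => cjmx (A t)).
Proof. by move=> h i j; under eq_fun do rewrite cjmxE; exact: H2m_cj. Qed.
Lemma mx_H2m_adj m n (A : R -> 'M[C]_(m, n)) : mx_in (@H2minus R) A -> mx_in (@H2 R) (fun t => (A t)^a).
Proof. by move=> h i j; under eq_fun do rewrite adjmxE; exact: H2m_cj. Qed.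
Lemma mx_H2m_H1mM m n p (A : R -> 'M[C]_(n, m)) (B : R -> 'M[C]_(n, p)) :
  mx_in (@H2minus R) A -> mx_in (@H2minus R) B -> mx_in (@H1m R) (fun t => (A t)^T *m B t).
Proof.
move=> hA hB; have := mx_H2a_H2m (mx_H2m_cj hA) hB.
by under eq_fun do rewrite adj_cjmx.
Qed.
Lemma mx_H2m_H1m m n (A : R -> 'M[C]_(m, n)) : mx_in (@H2minus R) A -> mx_in (@H1m R) A.
Proof. by move=> h i j; have /H2mE[] := h i j. Qed.
Lemma mx_H2_H1 m n (A : R -> 'M[C]_(m, n)) : mx_in (@H2 R) A -> mx_in (@H1 R) A.
Proof. by move=> h i j; have /H2E[] := h i j. Qed.
Lemma mx_H2_meas m n (A : R -> 'M[C]_(m, n)) : mx_in (@H2 R) A -> mx_in (@cmeas R) A.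
Proof. by move=> h; apply: mx_L2_meas; exact: mx_H2_L2. Qed.
Lemma mx_H2m_meas m n (A : R -> 'M[C]_(m, n)) : mx_in (@H2minus R) A -> mx_in (@cmeas R) A.
Proof. by move=> h; apply: mx_L2_meas; exact: mx_H2m_L2. Qed.
Lemma mx_cmeas_cj m n (A : R -> 'M[C]_(m, n)) : mx_in (@cmeas R) A -> mx_in (@cmeas R) (fun t => cjmx (A t)).
Proof. by move=> h i j; under eq_fun do rewrite cjmxE; apply: cmeasJ. Qed.
Lemma mx_HinfE m n (A : R -> 'M[C]_(m, n)) : mx_in (@Linf R) A -> mx_in (@H1 R) A -> mx_in (@Hinf R) A.
Proof. by move=> h1 h2 i j; apply/HinfE; split. Qed.
Lemma mx_H2I m n (A : R -> 'M[C]_(m, n)) : mx_in (@L2 R) A -> mx_in (@H1 R) A -> mx_in (@H2 R) A.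
Proof. by move=> h1 h2 i j; apply/H2E; split. Qed.

Lemma RI_frob m n (A : R -> 'M[C]_(m, n)) : mx_in (@L2 R) A -> RI (fun t => frob (A t)).
Proof.
move=> h; apply: RI_sum => i _; apply: RI_sum => j _.
by have /L2E[] := h i j.
Qed.
Lemma Linf_sq_le (f : R -> C) (M : R) : cmeas f -> aeI (fun t => cabs (f t) ^+ 2 <= M) -> Linf f.
Proof.
move=> mf h; split=> //; exists (1 + M); apply: aeI_S h => t _ h.
by apply: le_trans (le_sq1 _) _; rewrite lerD2l.
Qed.
Lemma mx_Linf_frob m n (A : R -> 'M[C]_(m, n)) : mx_in (@Linf R) A ->
  exists M : R, aeI (fun t => frob (A t) <= M).
Proof.
move=> h.
have hex (ij : 'I_m * 'I_n) : exists M : R, 0 <= M /\ aeI (fun t => cabs (A t ij.1 ij.2) <= M).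
  by have [M M0 hM] := Linf_bound (h ij.1 ij.2); exists M.
have [F hF] := choice hex.
exists (\sum_i \sum_j F (i, j) ^+ 2).
have := aeI_forall (fun ij => (hF ij).2); apply: aeI_S => t _ H.
apply: ler_sum => i _; apply: ler_sum => j _.
by rewrite lerXn2r ?nnegrE ?cabs_ge0 ?(hF (i, j)).1//; exact: (H (i, j)).
Qed.
Lemma mx_Linf_unitary n (U : R -> 'M[C]_n) : mx_in (@cmeas R) U ->
  aeI (fun t => (U t)^a *m U t = 1%:M) -> mx_in (@Linf R) U.
Proof.
move=> mU hU i j; apply: (@Linf_sq_le _ 1); first exact: mU.
by apply: aeI_S hU => t _ h; apply: vsq_entry => v; rewrite mul1r vsq_unitary.
Qed.

Section Data.
Variables (n : nat) (k : R) (Psi p q p' q' : R -> 'M[C]_n) (be be' : 'M[C]_n).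
Hypotheses (k0 : 0 <= k) (k1 : k < 1) (lP : mx_in (@Linf R) Psi) (hk : hankel_le k Psi).
Hypotheses (h : half_theta Psi p q be) (h' : half_theta (fun t => (Psi t)^T) p' q' be').

(** The difference of the two sides is expressed through Psi p - q and Psi^T p' - q', which puts it
    in [H1], and through the two adjoint equations, which puts it in [H1m]. *)
Lemma theta_cross : aeI (fun t => (p' t)^T *m q t = (q' t)^T *m p t).
Proof.
case: h => hp hq hB hs _; case: h' => hp' hq' hB' hs' _.
pose X t := (p' t)^T *m q t - (q' t)^T *m p t.
have : aeI (fun t => X t = 0).
  apply: mx_H1_H1m.
    rewrite (_ : X = fun t => ((Psi t)^T *m p' t - q' t)^T *m p t - (p' t)^T *m (Psi t *m p t - q t)).
      apply: mx_H1B; apply: mx_H2_H1M => //; exact: mx_in_tr.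
    apply/funext => t; rewrite /X linearB/= trmx_mul trmxK mulmxBl mulmxBr mulmxA.
    by rewrite opprB [RHS]addrC addrA subrK.
  rewrite (_ : X = fun t => ((q' t)^T *m ((Psi t)^a *m q t - (p t - be))
    - (((Psi t)^T)^a *m q' t - (p' t - be'))^T *m q t) + (be'^T *m q t - (be^T *m q' t)^T)).
    apply: mx_H1mD; apply: mx_H1mB; try exact: mx_H2m_H1mM.
      by apply: mx_H2m_H1m; exact: mx_cstM_H2m.
    by apply: mx_H2m_H1m; apply: mx_in_tr; exact: mx_cstM_H2m.
  apply/funext => t; rewrite /X.
  move: (Psi t) (p t) (q t) (p' t) (q' t) => Ps a b a' b'.
  have -> : ((Ps^T)^a *m b' - (a' - be'))^T = b'^T *m Ps^a - (a'^T - be'^T).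
    by rewrite [LHS]linearB/= [(a' - be')^T]linearB/= trmx_mul adj_tr tr_cjmx.
  rewrite trmx_mul trmxK !mulmxBl !mulmxBr !mulmxA.
  by mxabel.
by apply: aeI_S => t _ /eqP; rewrite subr_eq0 => /eqP.
Qed.

(** The cross identity and the two normalizations make the matrix with rows (p, conj q') and (q,
    conj p') J-unitary; this is its first row relation. *)
Lemma theta_J : aeI (fun t => p t *m (p t)^a - cjmx (q' t) *m (cjmx (q' t))^a = 1%:M).
Proof.
have [_ _ _ _ j1] := h; have [_ _ _ _ j2] := h'.
apply: aeI_S3 theta_cross j1 j2 => t _ c e1 e2.
apply: (@J_inv _ _ (p t) (q t) (cjmx (p' t))) => //; last by rewrite !adj_cjmx.
have := congr1 (@cjmx R _ _) e2; rewrite cjmxB !cjmxM !cj_adjmx !adj_cjmx => ->.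
by apply/matrixP => i j; rewrite !mxE; case: eqP; rewrite ?mulr1n ?mulr0n ?conjc1 ?conjc0.
Qed.

(** p^-1 is contractive since p^* p >= 1; for analyticity p has to be outer. If p^* g is in [H1m],
    solve (1 - H^* H) P = g and put Q = H P. Then p^* P = q^* Q, so |P| <= |Q| pointwise because q
    p^-1 is contractive, while the norm of Q is at most k times that of P. Hence P, Q and g
    vanish. *)
Lemma theta_p_inv : mx_in (@Hinf R) (fun t => iv (p t)).
Proof.
have [hp hq hB hs j1] := h.
have Lip : mx_in (@Linf R) (fun t => iv (p t)).
  move=> i j; apply: (@Linf_sq_le _ 1).
    by apply: mx_meas_iv; exact: mx_H2_meas.
  by apply: aeI_S j1 => t _ e; apply: vsq_entry => v; rewrite mul1r; exact: Jp_contr e.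
suff: mx_in (@H2 R) (fun t => iv (p t)) by move=> H; apply: mx_HinfE => //; exact: mx_H2_H1.
apply: (outer_inv hp); first exact: mx_Linf_L2.
  by apply: aeI_S j1 => t _ e; rewrite iv_mulVmx// (Jp_unit e).
move=> g hg hpg; have [P [Q [hP hQ hBv hsv _]]] := hankel_fix k0 k1 lP hk hg.
have rel : aeI (fun t => (p t)^a *m P t - (q t)^a *m Q t = 0).
  apply: mx_H1_H1m.
    rewrite (_ : (fun t => _) = fun t => ((q t)^a *m (Psi t *m P t - Q t) - ((Psi t)^a *m q t - (p t - be))^a *m P t) + be^a *m P t).
      apply: mx_H1D; last first.
        by apply: mx_H2_H1; apply: mx_Hinf_H2M => //; exact: mx_Hinf_cst.
      by apply: mx_H1B; apply: mx_H2_H1M => //; exact: mx_H2m_adj.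
    apply/funext => t; move: (Psi t) (p t) (q t) (P t) (Q t) => Ps a b c d.
    rewrite !adjmxB adjmxM adjmxK !mulmxBl !mulmxBr !mulmxA; by mxabel.
  rewrite (_ : (fun t => _) = fun t => ((Psi t *m p t - q t)^a *m Q t - (p t)^a *m ((Psi t)^a *m Q t - (P t - g t))) + (p t)^a *m g t).
    by apply: mx_H1mD; [apply: mx_H1mB; exact: mx_H2a_H2m|exact: hpg].
  apply/funext => t; move: (Psi t) (p t) (q t) (P t) (Q t) (g t) => Ps a b c d e.
  rewrite !adjmxB adjmxM !mulmxBl !mulmxBr !mulmxA; by mxabel.
have PQ : aeI (fun t => vsq (P t) <= 1 ^+ 2 * vsq (Q t)).
  apply: aeI_S2 rel j1 => t _ /eqP; rewrite subr_eq0 => /eqP e jj; rewrite expr1n mul1r.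
  have up := Jp_unit jj.
  have -> : P t = (q t *m iv (p t))^a *m Q t.
    by rewrite adjmxM -mulmxA -e mulmxA -adjmxM iv_mulmxV// adjmx1 mul1mx.
  apply: contr_adj => v; have := vsqJ_pt (iv (p t) *m v) jj.
  rewrite !mulmxA iv_mulmxV// mul1mx => ->; rewrite lerDr; exact: vsq_ge0.
have LP := mx_H2_L2 hP; have LQ := mx_H2m_L2 hQ.
have n1 : l2norm P <= 1 * l2norm Q by apply: nn_le.
have n2' := hk hP hQ hBv.
have P0 : l2norm P = 0.
  by have := l2norm_ge0 P; have := l2norm_ge0 Q; move: n1 n2' k0 k1; rewrite mul1r; nra.
have Q0 : l2norm Q = 0.
  by apply/eqP; rewrite eq_le l2norm_ge0 andbT; move: n2'; rewrite P0 mulr0.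
have zP := l2norm_eq0 LP P0; have zQ := l2norm_eq0 LQ Q0.
apply: VH_VHm0 => //; apply: (mx_in_ae (@H2m_ae R)) hsv; first exact: mx_H2_meas.
by apply: aeI_S2 zP zQ => t _ -> ->; rewrite mulmx0 !sub0r opprK.
Qed.

Local Notation Qp := (fun t => cjmx (q' t)).

Lemma theta_Qp : mx_in (@H2 R) Qp.
Proof. by have [_ hq _ _ _] := h'; exact: mx_H2m_cj. Qed.

Lemma theta_s_contr : aeI (fun t => forall v, vsq (iv (p t) *m Qp t *m v) <= vsq v).
Proof.
have [_ _ _ _ j1] := h.
apply: aeI_S2 theta_J j1 => t _ e jj v.
rewrite -[iv _ *m _]adjmxK; apply: contr_adj => {}v.
have e' : ((p t)^a)^a *m (p t)^a - ((Qp t)^a)^a *m (Qp t)^a = 1%:M by rewrite !adjmxK.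
have := vsqJ_pt ((iv (p t))^a *m v) e'.
rewrite !mulmxA -!adjmxM iv_mulVmx ?(Jp_unit jj)// adjmx1 mul1mx => ->.
by rewrite lerDr vsq_ge0.
Qed.

Lemma theta_s : mx_in (@Hinf R) (fun t => iv (p t) *m Qp t).
Proof.
have hH2 : mx_in (@H2 R) (fun t => iv (p t) *m Qp t).
  by apply: mx_Hinf_H2M; [exact: theta_p_inv|exact: theta_Qp].
apply: mx_HinfE; last exact: mx_H2_H1.
move=> i j; apply: (@Linf_sq_le _ 1); first exact: (mx_H2_meas hH2).
by apply: aeI_S theta_s_contr => t _ H; apply: vsq_entry => v; rewrite mul1r.
Qed.

Lemma vsq_pert m (v w : 'cV[C]_m) (r : R) : 0 <= r -> r <= 1 -> vsq w <= vsq v ->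
  (1 - r) ^+ 2 * vsq v <= vsq (v + r%:C%C *: w).
Proof.
move=> r0 r1 hw; rewrite vsqD vsqZ cabs_Cr ger0_norm// vdotZr conjc_real cReM /= mul0r subr0.
have cs := vdot_CS v w; have v0 := vsq_ge0 v; have w0 := vsq_ge0 w.
have := Re_le_cabs (vdot v w); rewrite ler_norml => /andP[c1 _].
have c0 := cabs_ge0 (vdot v w).
move: cs c1 c0; move: (cabs _) (Re _) => c d cs c1 c0.
have [a [a0 ea]] : exists a, 0 <= a /\ a ^+ 2 = vsq v.
  by exists (Num.sqrt (vsq v)); rewrite sqrtr_ge0 sqr_sqrtr.
have [b [b0 eb]] : exists b, 0 <= b /\ b ^+ 2 = vsq w.
  by exists (Num.sqrt (vsq w)); rewrite sqrtr_ge0 sqr_sqrtr.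
move: hw cs; rewrite -ea -eb => hw cs {v0 w0 ea eb}.
have cab : c <= a * b.
  by rewrite -(@ler_pXn2r _ 2)// ?nnegrE ?mulr_ge0// exprMn.
have ba : b <= a by rewrite -(@ler_pXn2r _ 2)// ?nnegrE.
have rb : r * b <= r * a by rewrite ler_wpM2l.
have ra : r * a <= a by rewrite ler_piMl.
apply: le_trans (_ : (a - r * b) ^+ 2 <= _).
  have -> : (1 - r) ^+ 2 * a ^+ 2 = (a - r * a) ^+ 2 by ring.
  by rewrite lerXn2r ?nnegrE//; lra.
have : - (r * (a * b)) <= r * d by rewrite -mulrN ler_wpM2l//; lra.
have -> : (a - r * b) ^+ 2 = a ^+ 2 + r ^+ 2 * b ^+ 2 - 2 * (r * (a * b)) by ring.
lra.
Qed.

Variable E : R -> 'M[C]_n.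
Hypotheses (hE : mx_in (@Hinf R) E) (uE : aeI (fun t => (E t)^a *m E t = 1%:M)).

(** Denominator of the parametrization with r E in place of E; the values r < 1 serve to reach r = 1
    in the limit. *)
Definition thD (r : R) (t : R) : 'M[C]_n := p t + r%:C%C *: (Qp t *m E t).

Lemma thD_H2 r : mx_in (@H2 R) (thD r).
Proof.
have [hp _ _ _ _] := h; apply: mx_H2D => // i j; under eq_fun do rewrite mxE.
have : mx_in (@H2 R) (fun t => Qp t *m E t) by apply: mx_H2_HinfM => //; exact: theta_Qp.
move=> H; apply: (@Hinf_H2M _ (fun=> r%:C%C)); [exact: Hinf_cst|exact: H].
Qed.

(** D = p (1 + r S) with S = p^-1 conj q' E contractive and in Hinf. The factor 1 + r S is bounded
    below by 1 - r, and it is outer: if (1 + r S)^* g is antianalytic, then <(1 + r S) g, g> = 0, so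
    |g|^2 <= r |g|^2. *)
Lemma thD_inv_r (r : R) : 0 <= r -> r < 1 -> mx_in (@H1 R) (fun t => iv (thD r t)).
Proof.
move=> r0 r1; have r1' := ltW r1; have [hp _ _ _ j1] := h.
pose S t := iv (p t) *m Qp t *m E t.
pose G t : 'M[C]_n := 1%:M + r%:C%C *: S t.
have hS : mx_in (@Hinf R) S by apply: mx_HinfM => //; exact: theta_s.
have hG : mx_in (@Hinf R) G.
  apply: mx_HinfD; first exact: mx_Hinf_cst.
  by move=> i j; under eq_fun do rewrite mxE; apply: HinfM; [exact: Hinf_cst|exact: hS].
have cS : aeI (fun t => forall v, vsq (S t *m v) <= vsq v).
  apply: aeI_S2 theta_s_contr uE => t _ H u v; rewrite /S -mulmxA.
  by apply: le_trans (H _) _; rewrite vsq_unitary.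
have GD : aeI (fun t => p t *m G t = thD r t).
  apply: aeI_S j1 => t _ e; rewrite /G mulmxDr mulmx1 -scalemxAr /S !mulmxA.
  by rewrite iv_mulmxV; [rewrite mul1mx|exact: Jp_unit e].
have mDi : mx_in (@cmeas R) (fun t => iv (thD r t)) by apply: mx_meas_iv; exact: (mx_H2_meas (thD_H2 r)).
have lowG : aeI (fun t => forall v, (1 - r) ^+ 2 * vsq v <= vsq (G t *m v)).
  by apply: aeI_S cS => t _ H v; rewrite /G mulmxDl mul1mx -scalemxAl; exact: vsq_pert.
pose Gi t := iv (thD r t) *m p t.
have uD : aeI (fun t => thD r t \in unitmx).
  by apply: aeI_S2 theta_J uE => t _ e u; exact: D_unit.
have GiG : aeI (fun t => Gi t *m G t = 1%:M).
  by apply: aeI_S2 uD GD => t _ u e; rewrite /Gi -mulmxA e iv_mulVmx.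
have r1p : 0 < (1 - r) ^+ 2 by rewrite exprn_gt0// subr_gt0.
have LGi : mx_in (@Linf R) Gi.
  move=> i j; apply: (@Linf_sq_le _ ((1 - r) ^- 2)).
    by apply: mx_cmeasM => //; exact: mx_H2_meas.
  apply: aeI_S2 lowG GiG => t _ low e; apply: vsq_entry => v.
  by rewrite ler_pdivlMl// (le_trans (low _))// mulmxA (mulmx1C e) mul1mx.
have hGi : mx_in (@H2 R) Gi.
  apply: (outer_inv (mx_Hinf_H2 hG)) => //; first exact: mx_Linf_L2.
  move=> g hg hGg; have Lg := mx_H2_L2 hg.
  have hm : mx_in (@H2minus R) (fun t => (G t)^a *m g t).
    move=> i j; apply/H2mE; split; last exact: hGg.
    by apply: mx_Linf_L2M => //; apply: mx_Linf_adj; exact: mx_Hinf_Linf.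
  have LSg : mx_in (@L2 R) (fun t => S t *m g t) by apply: mx_Linf_L2M => //; exact: mx_Hinf_Linf.
  have : vip (fun t => G t *m g t) g = 0.
    by rewrite vip_adj ?vip_orth//; exact: mx_Hinf_Linf.
  have -> : (fun t => G t *m g t) = (fun t => g t + r%:C%C *: (S t *m g t)).
    by apply/funext => t; rewrite /G mulmxDl mul1mx -scalemxAl.
  rewrite vipDl ?vipZl//; last exact: V2Z.
  rewrite vip_nn// => /eqP; rewrite addr_eq0 => /eqP e0.
  have nS : l2norm (fun t => S t *m g t) <= 1 * l2norm g.
    by apply: nn_le => //; apply: aeI_S cS => t _ H; rewrite expr1n mul1r; exact: H.
  have cs := CS LSg Lg.
  have : l2norm g ^+ 2 <= r * l2norm g ^+ 2.
    rewrite l2norm_sq// -[leLHS]ger0_norm ?nn_ge0// -cabs_Cr e0 cabsN cabsM cabs_Cr ger0_norm//.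
    rewrite ler_wpM2l// (le_trans cs)// -l2norm_sq// expr2 ler_wpM2r ?l2norm_ge0//.
    by rewrite (le_trans nS)// mul1r.
  move=> le; apply: l2norm_eq0 => //; apply/eqP.
  have : l2norm g ^+ 2 <= 0 by have := sqr_ge0 (l2norm g); nra.
  by rewrite le_eqVlt ltNge sqr_ge0 orbF expf_eq0.
have hGi' : mx_in (@Hinf R) Gi by apply: mx_HinfE => //; exact: mx_H2_H1.
have hfin := mx_HinfM hGi' theta_p_inv.
apply: (mx_in_ae (@H1_ae R) mDi) (mx_H2_H1 (mx_Hinf_H2 hfin)).
by apply: aeI_S j1 => t _ e; rewrite /Gi -mulmxA iv_mulmxV ?mulmx1// (Jp_unit e).
Qed.

(** Passage to r = 1. The bound [D_entry] is uniform in r and integrable, and D_r^-1 - D_1^-1 = (1 -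
    r) D_r^-1 conj q' E D_1^-1 gives pointwise convergence. *)
Lemma thD_inv_H1 : mx_in (@H1 R) (fun t => iv (thD 1 t)).
Proof.
have [hp _ _ _ j1] := h.
pose r (m : nat) : R := 1 - m.+1%:R^-1.
have r0 m : 0 <= r m by rewrite subr_ge0 invf_le1// ler1n.
have r1 m : r m < 1 by rewrite gtrBl invr_gt0.
have i1 m : (m.+1%:R : R)^-1 = 1 - r m by rewrite /r opprB addrC subrK.
have mD s : mx_in (@cmeas R) (fun t => iv (thD s t)) by apply: mx_meas_iv; exact: (mx_H2_meas (thD_H2 s)).
have Je := aeI_and theta_J uE.
move=> i j; apply: (H1_lim (u := fun m t => iv (thD (r m) t) i j) (w := fun t => 1 + 4 * frob (p t)^a)).
- by move=> m; apply: thD_inv_r.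
- exact: mD.
- apply: aeI_S Je => t _ [J u]; pose X := (Qp t *m E t) *m iv (thD 1 t).
  exists (\sum_l (1 + 4 * frob (p t)^a) * cabs (X l j)) => m.
  have uD := D_unit (r0 m) (ltW (r1 m)) J u; have uD1 := D_unit ler01 (lexx _) J u.
  have -> : iv (thD (r m) t) i j - iv (thD 1 t) i j = (1 - r m)%:C%C * (iv (thD (r m) t) *m X) i j.
    rewrite -mxZ_E -mxN_E -mxD_E scalemxAr.
    have -> : (1 - r m)%:C%C *: X = (thD 1 t - thD (r m) t) *m iv (thD 1 t).
      rewrite /thD [in RHS]opprD addrACA subrr add0r -scaleNr -scalerDl -scalemxAl /X; congr (_ *: _).
      by apply: complex_eqP => /=; rewrite ?oppr0 ?addr0.
    by rewrite mulmxBl mulmxBr (iv_mulmxV uD1) mulmx1 mulmxA (iv_mulVmx uD) mul1mx.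
  rewrite cabsM cabs_Cr ger0_norm; last by rewrite subr_ge0 ltW ?r1.
  rewrite -i1 [leLHS]mulrC ler_wpM2r ?invr_ge0//.
  rewrite mxE; apply: le_trans (cabs_sum _ _ _) _; apply: ler_sum => l _.
  rewrite cabsM ler_wpM2r ?cabs_ge0//; apply: le_trans (le_sq1 _) _; rewrite lerD2l.
  exact: D_entry (r0 m) (ltW (r1 m)) J u.
- apply: RI_D; first exact: RI_cst.
  by apply: RI_Z; apply: RI_frob; apply: mx_L2_adj; exact: mx_H2_L2.
- apply: aeI_S Je => t _ [J u] m; apply: le_trans (le_sq1 _) _; rewrite lerD2l.
  exact: D_entry (r0 m) (ltW (r1 m)) J u.
Qed.

Lemma thD_inv_H2 : mx_in (@H2 R) (fun t => iv (thD 1 t)).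
Proof.
have [hp _ _ _ _] := h.
apply: mx_H2I; last exact: thD_inv_H1.
move=> i j; apply: (L2_le (g := fun t => 4 * frob (p t)^a)).
- by apply: mx_meas_iv; exact: (mx_H2_meas (thD_H2 1)).
- by apply: aeI_S2 theta_J uE => t _ J u; exact: D_entry ler01 (lexx _) J u.
- by apply: RI_Z; apply: RI_frob; apply: mx_L2_adj; exact: mx_H2_L2.
Qed.

Lemma thD_inv_Hinf : mx_in (@Linf R) p -> mx_in (@Hinf R) (fun t => iv (thD 1 t)).
Proof.
move=> Lp; apply: mx_HinfE; last exact: thD_inv_H1.
have [M hM] := mx_Linf_frob (mx_Linf_adj Lp).
move=> i j; apply: (@Linf_sq_le _ (4 * M)).
  by apply: mx_meas_iv; exact: (mx_H2_meas (thD_H2 1)).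
apply: aeI_S3 theta_J uE hM => t _ J u le.
by apply: le_trans (D_entry _ _ ler01 (lexx _) J u) _; rewrite ler_wpM2l.
Qed.
End Data.
End ThetaU.

(** * Shifts by powers of z *)

Section Step.
Variable (R : realType).
Local Notation C := R[i].
Local Notation Re := complex.Re.
Local Notation Im := complex.Im.
Local Notation "A ^a" := (adjmx A) (at level 8, format "A ^a").

Definition zs m n (k : int) (F : R -> 'M[C]_(m, n)) (t : R) : 'M[C]_(m, n) := ee t ^ k *: F t.

Lemma zsE m n k (F : R -> 'M[C]_(m, n)) t i j : zs k F t i j = F t i j * ee t ^ k.
Proof. by rewrite mxE mulrC. Qed.
Lemma zs_zs m n k l (F : R -> 'M[C]_(m, n)) : zs k (zs l F) = zs (k + l) F.
Proof. by apply/funext => t; rewrite /zs scalerA eezD. Qed.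
Lemma zs0 m n (F : R -> 'M[C]_(m, n)) : zs 0 F = F.
Proof. by apply/funext => t; rewrite /zs expr0z scale1r. Qed.
Lemma zsD m n k (F G : R -> 'M[C]_(m, n)) t : zs k (fun t => F t + G t) t = zs k F t + zs k G t.
Proof. by rewrite /zs scalerDr. Qed.
Lemma zsB m n k (F G : R -> 'M[C]_(m, n)) t : zs k (fun t => F t - G t) t = zs k F t - zs k G t.
Proof. by rewrite /zs scalerBr. Qed.
Lemma zs_in m n k (P Q : (R -> C) -> Prop) (F : R -> 'M[C]_(m, n)) :
  (forall f, P f -> Q (fun t => f t * ee t ^ k)) -> mx_in P F -> mx_in Q (zs k F).
Proof. by move=> h hF i j; under eq_fun do rewrite zsE; exact/h/hF. Qed.
Lemma zs_cmeas m n k (F : R -> 'M[C]_(m, n)) : mx_in (@cmeas R) F -> mx_in (@cmeas R) (zs k F).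
Proof. by apply: zs_in => f hf; apply: cmeasM => //; exact: cmeas_eez. Qed.
Lemma zs_L2 m n k (F : R -> 'M[C]_(m, n)) : mx_in (@L2 R) F -> mx_in (@L2 R) (zs k F).
Proof. by apply: zs_in => f hf; exact: L2_eez. Qed.
Lemma zs_Linf m n k (F : R -> 'M[C]_(m, n)) : mx_in (@Linf R) F -> mx_in (@Linf R) (zs k F).
Proof. by apply: zs_in => f hf; apply: LinfM => //; exact: Linf_eez. Qed.
Lemma zs_H2 m n k (F : R -> 'M[C]_(m, n)) : 0 <= k -> mx_in (@H2 R) F -> mx_in (@H2 R) (zs k F).
Proof. by move=> k0; apply: zs_in => f hf; exact: H2_eez. Qed.
Lemma zs_H2m m n k (F : R -> 'M[C]_(m, n)) : k <= 0 -> mx_in (@H2minus R) F -> mx_in (@H2minus R) (zs k F).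
Proof. by move=> k0; apply: zs_in => f hf; exact: H2m_eez. Qed.
Lemma zs_Hinf m n k (F : R -> 'M[C]_(m, n)) : 0 <= k -> mx_in (@Hinf R) F -> mx_in (@Hinf R) (zs k F).
Proof. by move=> k0; apply: zs_in => f hf; apply: HinfM => //; exact: Hinf_eez. Qed.
Lemma zs_nn n k (f : R -> 'cV[C]_n) : nn (zs k f) = nn f.
Proof.
rewrite !nnE; congr rint; apply/funext => t.
by rewrite /zs vsqZ cabs_eez expr1n mul1r.
Qed.
Lemma zs_l2norm n k (f : R -> 'cV[C]_n) : l2norm (zs k f) = l2norm f.
Proof. by rewrite !l2normE zs_nn. Qed.

Definition cf m n (F : R -> 'M[C]_(m, n)) (k : int) : 'M[C]_(m, n) := \matrix_(i, j) fcoef (fun t => F t i j) k.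

Lemma zs_H2_down m n (F : R -> 'M[C]_(m, n)) : mx_in (@H2 R) F -> cf F 0 = 0 -> mx_in (@H2 R) (zs (-1) F).
Proof.
move=> hF h0 i j; split; first exact: (zs_L2 (-1) (mx_H2_L2 hF)).
move=> k k0; under eq_fun do rewrite zsE; rewrite fcoef_shift opprK.
have [->|kn] := eqVneq k (-1); last by rewrite (hF i j).2//; lia.
by have := congr1 (fun M => fun_of_matrix M i j) h0; rewrite !mxE addNr.
Qed.

Lemma cf_mul_cst m n p (F : R -> 'M[C]_(m, n)) (c : 'M[C]_(n, p)) k : mx_in (@L1 R) F ->
  cf (fun t => F t *m c) k = cf F k *m c.
Proof.
move=> hF; apply/matrixP => i j; rewrite !mxE.
under eq_fun do rewrite mxE; rewrite fcoef_sum; last first.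
  by move=> l _; under eq_fun do rewrite mulrC; apply: L1Z; exact: hF.
by apply: eq_bigr => l _; under eq_fun do rewrite mulrC; rewrite fcoefZ ?mxE 1?mulrC//; exact: hF.
Qed.
Lemma cfB m n (F G : R -> 'M[C]_(m, n)) k : mx_in (@L1 R) F -> mx_in (@L1 R) G ->
  cf (fun t => F t - G t) k = cf F k - cf G k.
Proof.
move=> hF hG; apply/matrixP => i j; rewrite !mxE; under eq_fun do rewrite mxD_E mxN_E.
by rewrite fcoefB.
Qed.
Lemma cfD m n (F G : R -> 'M[C]_(m, n)) k : mx_in (@L1 R) F -> mx_in (@L1 R) G ->
  cf (fun t => F t + G t) k = cf F k + cf G k.
Proof.
move=> hF hG; apply/matrixP => i j; rewrite !mxE; under eq_fun do rewrite mxD_E.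
by rewrite fcoefD.
Qed.
Lemma mx_H2_L1 m n (A : R -> 'M[C]_(m, n)) : mx_in (@H2 R) A -> mx_in (@L1 R) A.
Proof. by move=> h i j; apply: L2_L1; have [] := h i j. Qed.

Lemma H2_poly f N : @H2 R f -> H2minus (fun t => f t * ee t ^ (- N%:Z)) ->
  aeI (fun t => f t = \sum_(k < N) fcoef f k%:Z * ee t ^ k%:Z).
Proof.
move=> [Lf h1] [_ h2]; apply: L1_unique2; first exact: L2_L1.
  by apply: L1_sum => k _; apply: L2_L1; exact: L2_eezZ.
move=> j; rewrite fcoef_sum; last by move=> k _; apply: L2_L1; exact: L2_eezZ.
under eq_bigr do rewrite (fcoefZ _ _ (Linf_L1 (@Linf_eez R _))) fcoef_eez.
have [j0|j0] := ltP j 0.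
  rewrite h1// big1// => i _; case: eqP => [e|]; last by rewrite mulr0.
  by move: j0; rewrite e ltNge.
case: j j0 => // j _; have [jN|Nj] := ltnP j N.
  rewrite (bigD1 (Ordinal jN))//= eqxx mulr1 big1 ?addr0// => i ne.
  by case: eqP => [[e]|]; [case/eqP: ne; apply/val_inj|rewrite mulr0].
have := h2 (j%:Z - N%:Z); rewrite fcoef_shift opprK subrK subr_ge0 lez_nat => /(_ Nj) ->.
rewrite big1// => i _; case: eqP => [[e]|]; last by rewrite mulr0.
by have := ltn_ord i; rewrite -e ltnNge Nj.
Qed.

Lemma H2_poly_Hinf m n (F : R -> 'M[C]_(m, n)) N : mx_in (@H2 R) F -> mx_in (@H2minus R) (zs (- N%:Z) F) ->
  mx_in (@Hinf R) F.
Proof.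
move=> hF hm i j; have := hm i j; under eq_fun do rewrite zsE; move=> h.
have e := H2_poly (hF i j) h; apply/HinfE; split; last by have /H2E[] := hF i j.
have mf : cmeas (fun t => F t i j) by apply: mx_H2_meas.
apply: (Linf_ae (f := fun t => \sum_(k < N) fcoef (fun t => F t i j) k%:Z * ee t ^ k%:Z)) => //.
  by apply: aeI_S e => t _ ->.
by apply: Linf_sum => k _; apply: LinfM; [exact: Linf_cst|exact: Linf_eez].
Qed.

(** Division of power series: A L = B modulo z^N is solved one coefficient at a time, using the
    right inverse of the constant coefficient of A. L is a polynomial, hence bounded. *)
Lemma solve_mod n (A B : R -> 'M[C]_n) (Ai : 'M[C]_n) N : mx_in (@H2 R) A -> mx_in (@H2 R) B ->
  cf A 0 *m Ai = 1%:M ->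
  exists2 L, mx_in (@Hinf R) L & mx_in (@H2 R) (zs (- N%:Z) (fun t => A t *m L t - B t)).
Proof.
move=> hA hB hi; elim: N => [|N [L hL hF]].
  exists (fun=> 0); first exact: mx_Hinf_cst.
  rewrite oppr0 zs0; apply: mx_H2B => //; apply: mx_H2_HinfM => //; exact: mx_Hinf_cst.
pose F := zs (- N%:Z) (fun t => A t *m L t - B t).
pose c := Ai *m cf F 0.
exists (fun t => L t - zs N%:Z (fun=> c) t).
  by apply: mx_HinfB; [exact: hL|apply: (@zs_Hinf _ _ N%:Z); [by []|exact: mx_Hinf_cst]].
have hAc : mx_in (@H2 R) (fun t => A t *m c) by apply: mx_H2_HinfM => //; exact: mx_Hinf_cst.
rewrite (_ : zs _ _ = zs (-1) (fun t => F t - A t *m c)); last first.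
  have -> : (- N.+1%:Z)%R = -1 + - N%:Z by lia.
  rewrite -zs_zs; congr (zs _ _); apply/funext => t; rewrite /F /zs mulmxBr -scalemxAr.
  by rewrite addrAC scalerBr scalerA -eezD addNr expr0z scale1r.
apply: zs_H2_down; first exact: mx_H2B.
rewrite cfB ?cf_mul_cst; [|exact: mx_H2_L1..].
by rewrite /c mulmxA hi mul1mx subrr.
Qed.

(** * The unitary function conj D' E D^-1 *)

Section Data.
Variables (n : nat) (k : R) (Psi p q p' q' : R -> 'M[C]_n) (be be' : 'M[C]_n).
Hypotheses (k0 : 0 <= k) (k1 : k < 1) (lP : mx_in (@Linf R) Psi) (hk : hankel_le k Psi).
Hypotheses (h : half_theta Psi p q be) (h' : half_theta (fun t => (Psi t)^T) p' q' be').
Local Notation Qp := (fun t => cjmx (q' t)).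

Lemma half_trr : half_theta (fun t => ((Psi t)^T)^T) p q be.
Proof. by under eq_fun do rewrite trmxK. Qed.

(** The normalization p^* p - q^* q = 1 gives |q v| <= |p v| pointwise. *)
Lemma half_Linf (Ps a b : R -> 'M[C]_n) be0 : half_theta Ps a b be0 -> mx_in (@Linf R) a -> mx_in (@Linf R) b.
Proof.
move=> [ha hb _ _ j1] La i j; have [M hM] := mx_Linf_frob La.
apply: (@Linf_sq_le _ _ M); first exact: mx_H2m_meas.
apply: aeI_S2 j1 hM => t _ jj le; apply: vsq_entry => v.
have : vsq (b t *m v) <= vsq (a t *m v) by rewrite (vsqJ_pt v jj) lerDr vsq_ge0.
move/le_trans; apply; apply: le_trans (vsq_frob _ _) _.
by rewrite ler_wpM2r// vsq_ge0.
Qed.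

Section E.
Variable E : R -> 'M[C]_n.
Hypotheses (hE : mx_in (@Hinf R) E) (uE : aeI (fun t => (E t)^a *m E t = 1%:M)).
Let D := thD p q' E 1.
Let D' := thD p' q (fun t => (E t)^T) 1.
Let U t := cjmx (D' t) *m E t *m iv (D t).

Lemma uET : aeI (fun t => ((E t)^T)^a *m (E t)^T = 1%:M).
Proof.
by apply: aeI_S uE => t _ e; rewrite adj_tr -cj_adjmx -cjmxM (mulmx1C e) cjmx1.
Qed.

Lemma thU_D : aeI (fun t => D t \in unitmx /\ D' t \in unitmx).
Proof.
apply: aeI_and.
  by apply: aeI_S2 (theta_J h h') uE => t _ J u; exact: D_unit.
by apply: aeI_S2 (theta_J h' half_trr) uET => t _ J u; exact: D_unit.
Qed.

(** D' is the denominator of the transposed problem with parameter E^T. Since E^* E = 1, conj D' E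
    is exactly the numerator conj p' E + q. Thus the linear fractional image of E is E with the
    adjoint of an analytic factor on its left and an analytic factor on its right, which is why the
    Wiener-Hopf indices are those of E. *)
Lemma thU_UD : aeI (fun t => U t *m D t = cjmx (p' t) *m E t + q t).
Proof.
apply: aeI_S2 uE thU_D => t _ u [uD _].
rewrite /U -mulmxA iv_mulVmx// mulmx1 /D' /thD scale1r cjmxD cjmxM cjmxK cjmx_tr mulmxDl -mulmxA u.
by rewrite mulmx1.
Qed.

(** For unitary E, J-unitarity gives numerator and denominator the same modulus: (U D)^* (U D) = D^*
    D. *)
Lemma thU_unitary : aeI (fun t => (U t)^a *m U t = 1%:M).
Proof.
have [_ _ _ _ j1] := h; have [_ _ _ _ j2] := h'.
apply: aeI_S3 thU_D (aeI_and thU_UD uE) (aeI_and (theta_cross h h') (aeI_and j1 j2)).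
move=> t _ [uD _] [eU u] [cr [e1 e2]].
have e2' : (cjmx (p' t))^a *m cjmx (p' t) - (Qp t)^a *m Qp t = 1%:M.
  by have := congr1 (@cjmx R _ _) e2; rewrite cjmxB !cjmxM !cj_adjmx !adj_cjmx cjmx1.
have cr' : (cjmx (p' t))^a *m q t = (Qp t)^a *m p t by rewrite !adj_cjmx.
have cr2 : (q t)^a *m cjmx (p' t) = (p t)^a *m Qp t.
  by rewrite -[LHS]adjmxK adjmxM adjmxK cr' adjmxM adjmxK.
have eD : (U t *m D t)^a *m (U t *m D t) = (D t)^a *m D t.
  rewrite eU /D /thD scale1r !adjmxD !mulmxDl !mulmxDr !adjmxM !mulmxA.
  move/eqP: e1; rewrite subr_eq => /eqP e1; move/eqP: e2'; rewrite subr_eq => /eqP e2'.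
  rewrite -(mulmxA (E t)^a) e2' -(mulmxA (E t)^a _ (q t)) cr' mulmxA cr2 e1.
  rewrite mulmxDr mulmx1 mulmxDl u mulmxA; by mxabel.
have -> : U t = U t *m D t *m iv (D t) by rewrite -mulmxA iv_mulmxV// mulmx1.
rewrite adjmxM mulmxA -(mulmxA (iv _)^a) eD mulmxA -adjmxM iv_mulmxV// adjmx1 mul1mx.
exact: iv_mulmxV.
Qed.

Lemma thU_H2 : [/\ mx_in (@H2 R) D, mx_in (@H2 R) D', mx_in (@H2 R) (fun t => iv (D t)) &
   mx_in (@H2 R) (fun t => iv (D' t))].
Proof.
have hET := mx_in_tr hE; have uE' := uET.
have lPT := mx_in_tr lP; have hkT := hankel_tr k0 lP hk.
split; [exact: thD_H2 h h' _ hE _|exact: thD_H2 h' half_trr _ hET _| |].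
  exact: thD_inv_H2 k0 k1 lP hk h h' _ hE uE.
exact: thD_inv_H2 k0 k1 lPT hkT h' half_trr _ hET uE'.
Qed.

Lemma thU_Hinf : mx_in (@Linf R) p -> mx_in (@Linf R) p' ->
  [/\ mx_in (@Hinf R) D, mx_in (@Hinf R) D', mx_in (@Hinf R) (fun t => iv (D t)) &
   mx_in (@Hinf R) (fun t => iv (D' t))].
Proof.
move=> Lp Lp'; have [h1 h2 h3 h4] := thU_H2.
have hET := mx_in_tr hE; have uE' := uET.
have lPT := mx_in_tr lP; have hkT := hankel_tr k0 lP hk.
have Lq := half_Linf h Lp; have Lq' := half_Linf h' Lp'.
split.
- apply: mx_HinfE; last exact: mx_H2_H1.
  rewrite /D /thD; under eq_fun do rewrite scale1r.
  by apply: mx_LinfD => //; apply: mx_LinfM; [exact: mx_Linf_cj|exact: mx_Hinf_Linf].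
- apply: mx_HinfE; last exact: mx_H2_H1.
  rewrite /D' /thD; under eq_fun do rewrite scale1r.
  by apply: mx_LinfD => //; apply: mx_LinfM; [exact: mx_Linf_cj|exact: mx_Hinf_Linf].
- exact: thD_inv_Hinf k0 k1 lP hk h h' _ hE uE Lp.
exact: thD_inv_Hinf k0 k1 lPT hkT h' half_trr _ hET uE' Lp'.
Qed.

Lemma thU_meas : mx_in (@cmeas R) U.
Proof.
have [h1 h2 h3 h4] := thU_H2.
apply: mx_cmeasM; last exact: mx_H2_meas.
apply: mx_cmeasM; first by apply: mx_cmeas_cj; exact: mx_H2_meas.
by apply: mx_Linf_meas; exact: mx_Hinf_Linf.
Qed.

Lemma thU_Linf : mx_in (@Linf R) U.
Proof. by apply: mx_Linf_unitary; [exact: thU_meas|exact: thU_unitary]. Qed.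
End E.
End Data.
End Step.

(** * One reduction: from Psi + K modulo z^N to the data L *)

Section Step2.
Variable (R : realType).
Local Notation C := R[i].
Local Notation Re := complex.Re.
Local Notation Im := complex.Im.
Local Notation "A ^a" := (adjmx A) (at level 8, format "A ^a").

Lemma cf_zs m n k l (F : R -> 'M[C]_(m, n)) : cf (zs k F) l = cf F (l - k).
Proof. by apply/matrixP => i j; rewrite !mxE; under eq_fun do rewrite zsE; rewrite fcoef_shift. Qed.
Lemma cf_H2 m n k (F : R -> 'M[C]_(m, n)) : mx_in (@H2 R) F -> k < 0 -> cf F k = 0.
Proof. by move=> h k0; apply/matrixP => i j; rewrite !mxE (h i j).2. Qed.
Lemma cf_cj_H2m m n (F : R -> 'M[C]_(m, n)) : mx_in (@H2minus R) F -> cf (fun t => cjmx (F t)) 0 = 0.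
Proof.
move=> h; apply/matrixP => i j; rewrite !mxE; under eq_fun do rewrite cjmxE.
rewrite fcoefJ ?oppr0 ?(h i j).2 ?conjc0//; apply: L2_L1; exact: (mx_H2m_L2 h).
Qed.
Lemma cf_cst m n (c : 'M[C]_(m, n)) : cf (fun=> c) 0 = c.
Proof. by apply/matrixP => i j; rewrite mxE fcoef_cst eqxx mulr1. Qed.
Lemma mx_L2_L1 m n (A : R -> 'M[C]_(m, n)) : mx_in (@L2 R) A -> mx_in (@L1 R) A.
Proof. by move=> h i j; apply: L2_L1; exact: h. Qed.

Lemma mx_H2mE m n (A : R -> 'M[C]_(m, n)) : mx_in (@L2 R) A -> mx_in (@H1m R) A -> mx_in (@H2minus R) A.
Proof. by move=> h1 h2 i j; apply/H2mE; split. Qed.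

(** The J-unitary map (x, y) -> (P x + Qp y, Q x + Pm y) preserves the difference of the squared
    lengths. *)
Lemma J_identity n (P Q Pm Qp : 'M[C]_n) x y : P^a *m P - Q^a *m Q = 1%:M ->
  Pm^a *m Pm - Qp^a *m Qp = 1%:M -> Pm^a *m Q = Qp^a *m P ->
  vsq (Qp *m y + P *m x) + vsq y = vsq (Pm *m y + Q *m x) + vsq x.
Proof.
move=> h1 h2 h3; rewrite !vsqD (vsqJ_pt x h1) (vsqJ_pt y h2).
have -> : vdot (Qp *m y) (P *m x) = vdot (Pm *m y) (Q *m x).
  by rewrite !vdot_adj !mulmxA -h3.
ring.
Qed.

Section Data.
Variables (n : nat) (k : R) (Psi p q p' q' : R -> 'M[C]_n) (be be' ga' : 'M[C]_n).
Hypotheses (k0 : 0 <= k) (k1 : k < 1) (lP : mx_in (@Linf R) Psi) (hk : hankel_le k Psi).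
Hypotheses (h : half_theta Psi p q be) (h' : half_theta (fun t => (Psi t)^T) p' q' be').
Hypothesis (hga : be' *m ga' = 1%:M).
Variables (N : nat) (K : R -> 'M[C]_n).
Hypothesis hK : mx_in (@Hinf R) K.
Local Notation Qp := (fun t => cjmx (q' t)).
(** For the function U attached to E one has (U - (Psi + K)) D = A E - B, with A and B analytic.
    Hence U agrees with Psi + K modulo z^N as soon as A E = B modulo z^N, and the data for E are L =
    A^-1 B modulo z^N. *)
Let A t := cjmx (p' t) - (Psi t + K t) *m Qp t.
Let B t := (Psi t + K t) *m p t - q t.

Lemma step_Qp : mx_in (@H2 R) (zs (-1) Qp).
Proof.
have [_ hq' _ _ _] := h'.
by apply: zs_H2_down; [exact: theta_Qp h'|exact: cf_cj_H2m].
Qed.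

(** A = conj be' - conj S - K conj q' with S and q' in H2minus. The functions conj S and conj q'
    have no constant coefficient, which leaves the invertible [cjmx be']. *)
Lemma step_A : mx_in (@H2 R) A /\ cf A 0 = cjmx be'.
Proof.
have [_ hq' _ hs' _] := h'.
pose S t := ((Psi t)^T)^a *m q' t - (p' t - be').
have hS : mx_in (@H2minus R) S by exact: hs'.
have eA : A = fun t => cjmx be' - cjmx (S t) - zs 1 (fun t => K t *m zs (-1) Qp t) t.
  apply/funext => t; rewrite /A /S adj_tr !cjmxB cjmxM cjmxK /zs -scalemxAr scalerA -eezD subrr expr0z scale1r.
  rewrite mulmxDl; by mxabel.
have hKQ : mx_in (@H2 R) (fun t => K t *m zs (-1) Qp t) by apply: mx_Hinf_H2M => //; exact: step_Qp.
have h1 : mx_in (@H2 R) (fun t => cjmx be' - cjmx (S t)).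
  by apply: mx_H2B; [apply: mx_Hinf_H2; exact: mx_Hinf_cst|exact: mx_H2m_cj].
have h2 : mx_in (@H2 R) (zs 1 (fun t => K t *m zs (-1) Qp t)) by apply: zs_H2.
have h3 : mx_in (@H2 R) (fun t => cjmx (S t)) by exact: mx_H2m_cj.
split; first by rewrite eA; apply: mx_H2B.
rewrite eA cfB; [|exact: mx_H2_L1 h1|exact: mx_H2_L1 h2].
rewrite cfB; [|by apply: mx_H2_L1; apply: mx_Hinf_H2; exact: mx_Hinf_cst|exact: mx_H2_L1 h3].
by rewrite cf_cst cf_cj_H2m// cf_zs cf_H2// !subr0.
Qed.

Lemma step_B : mx_in (@H2 R) B.
Proof.
have [hp hq hB hs _] := h.
rewrite (_ : B = fun t => (Psi t *m p t - q t) + K t *m p t); last first.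
  by apply/funext => t; rewrite /B mulmxDl addrAC.
by apply: mx_H2D => //; exact: mx_Hinf_H2M.
Qed.

Lemma step_L : exists2 L, mx_in (@Hinf R) L & mx_in (@H2 R) (zs (- N%:Z) (fun t => A t *m L t - B t)).
Proof.
have [hA eA] := step_A; apply: (solve_mod (Ai := cjmx ga')) => //; first exact: step_B.
by rewrite eA -cjmxM hga cjmx1.
Qed.

(** Only the truncation x of f modulo z^N matters, and y = z^N g is the truncation of L x. Put F = p
    x + conj q' y, which is in H2, and G = q x + conj p' y, for which z^-N G is in H2minus. Since
    (Psi + K) F - G = B x - A y is divisible by z^N, z^-N G is the Hankel image of F under z^-N (Psi
    + K), so |G| <= |F|. J-unitarity gives |F|^2 + |y|^2 = |G|^2 + |x|^2, hence |y| <= |x|. *)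
Lemma step_hankel L : mx_in (@Hinf R) L -> mx_in (@H2 R) (zs (- N%:Z) (fun t => A t *m L t - B t)) ->
  hankel_le 1 (zs (- N%:Z) (fun t => Psi t + K t)) -> hankel_le 1 (zs (- N%:Z) L).
Proof.
move=> hL hF hh f g hf hg hfg.
have [hp hq _ _ j1] := h; have [hp' hq' _ _ j2] := h'.
have [hA _] := step_A; have hB := step_B; have hQp := theta_Qp h'.
(* truncation: only the first N Fourier coefficients of f matter *)
have [x' hx' hxm] := vproj (zs_L2 (- N%:Z) (mx_H2_L2 hf)).
pose x t := f t - zs N%:Z x' t.
have hx : mx_in (@H2 R) x by apply: mx_H2B => //; exact: zs_H2.
have exm : zs (- N%:Z) x = fun t => zs (- N%:Z) f t - x' t.
  apply/funext => t; rewrite /x zsB; congr (_ - _).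
  by have := congr1 (fun F => F t) (zs_zs (- N%:Z) N%:Z x'); rewrite addNr zs0.
have hxm' : mx_in (@H2minus R) (zs (- N%:Z) x) by rewrite exm.
(* x is a polynomial of degree less than N, hence bounded; its products with the possibly unbounded
   p and q stay in L2. *)
have bx : mx_in (@Hinf R) x by exact: H2_poly_Hinf hx hxm'.
have nx : l2norm x <= l2norm f.
  rewrite -(zs_l2norm (- N%:Z) x) -(zs_l2norm (- N%:Z) f); apply: l2norm_projm => //.
    by apply: zs_L2; exact: mx_H2_L2.
  by rewrite exm; under eq_fun do rewrite opprB addrC subrK.
suff : l2norm g <= l2norm x by move=> H; rewrite mul1r (le_trans H).
pose w t := zs (- N%:Z) L t *m x t - g t.
have hw : mx_in (@H2 R) w.
  rewrite (_ : w = fun t => (zs (- N%:Z) L t *m f t - g t) - L t *m x' t).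
    by apply: mx_H2B => //; exact: mx_Hinf_H2M.
  apply/funext => t; rewrite /w /x mulmxBr addrAC; congr (_ - _).
  by rewrite /zs -scalemxAl -scalemxAr scalerA -eezD addNr expr0z scale1r.
pose y := zs N%:Z g.
have ymg : zs (- N%:Z) y = g by rewrite /y zs_zs addNr zs0.
have ey t : y t = L t *m x t - zs N%:Z w t.
  rewrite /y /w /zs scalerBr -scalemxAl scalerA -eezD subrr expr0z scale1r.
  by rewrite opprB addrC subrK.
have hy : mx_in (@H2 R) y.
  rewrite (_ : y = fun t => L t *m x t - zs N%:Z w t); last by apply/funext.
  by apply: mx_H2B; [exact: mx_Hinf_H2M|exact: zs_H2].
have byy : mx_in (@Hinf R) y by apply: (H2_poly_Hinf (N := N) hy); rewrite ymg; exact: hg.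
have bw : mx_in (@Hinf R) w.
  apply: mx_HinfE; last exact: mx_H2_H1.
  rewrite (_ : w = zs (- N%:Z) (fun t => L t *m x t - y t)).
    by apply: zs_Linf; apply: mx_LinfB; [apply: mx_LinfM|]; exact: mx_Hinf_Linf.
  apply/funext => t; rewrite zsB -[zs _ y t]/((zs (- N%:Z) y) t) ymg /w; congr (_ - _).
  by rewrite /zs -scalemxAl.
clearbody y w x.
pose F t := Qp t *m y t + p t *m x t.
pose G t := cjmx (p' t) *m y t + q t *m x t.
have hFF : mx_in (@H2 R) F by apply: mx_H2D; exact: mx_H2_HinfM.
have LG : mx_in (@L2 R) G.
  apply: mx_L2D; apply: mx_L2_LinfM; try exact: mx_Hinf_Linf.
    by apply: mx_L2_cj; exact: mx_H2_L2.
  exact: mx_H2m_L2.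
have hG : mx_in (@H2minus R) (zs (- N%:Z) G).
  apply: mx_H2mE; first exact: zs_L2.
  rewrite (_ : zs _ _ = fun t => ((p' t)^T)^a *m g t + (((q t)^T)^T) *m zs (- N%:Z) x t); last first.
    apply/funext => t; rewrite zsD trmxK adj_tr; congr (_ + _); last by rewrite /zs -scalemxAr.
    have -> : g t = zs (- N%:Z) y t by rewrite ymg.
    by rewrite /zs -scalemxAr.
  apply: mx_H1mD; first by apply: mx_H2a_H2m => //; exact: mx_in_tr.
  by apply: mx_H2m_H1mM => //; exact: mx_in_tr.
have hD : mx_in (@H2 R) (fun t => zs (- N%:Z) (fun t => Psi t + K t) t *m F t - zs (- N%:Z) G t).
  rewrite (_ : (fun t => _) = fun t => A t *m w t - zs (- N%:Z) (fun t => A t *m L t - B t) t *m x t).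
    by apply: mx_H2B; exact: mx_H2_HinfM.
  apply/funext => t.
  have e1 : zs (- N%:Z) (fun t => A t *m L t - B t) t *m x t =
    ee t ^ (- N%:Z) *: ((A t *m L t - B t) *m x t) by rewrite /zs scalemxAl.
  have e2 : w t = ee t ^ (- N%:Z) *: (L t *m x t - y t).
    by rewrite ey opprB addrC subrK /zs scalerA -eezD addNr expr0z scale1r.
  rewrite e1 e2 -scalemxAr -scalerBr /zs -scalemxAl -scalerBr; congr (_ *: _).
  rewrite /F /G /A /B; move: (Psi t + K t) (p t) (q t) (p' t) (q' t) (x t) (y t) (L t) => P a b a' b' xx yy l.
  rewrite ?(mulNmx, mulmxN, mulmxBl, mulmxBr, mulmxDl, mulmxDr) ?mulmxA; by mxabel.
have le := hh _ _ hFF hG hD; rewrite mul1r zs_l2norm in le.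
have Lx := mx_H2_L2 hx; have Ly := mx_H2_L2 hy; have LF := mx_H2_L2 hFF.
have Jid : nn F + nn y = nn G + nn x.
  apply: (etrans (esym (rintD (RI_nn LF) (RI_nn Ly)))).
  apply: (etrans _ (rintD (RI_nn LG) (RI_nn Lx))).
  apply: rint_ae; [exact: RI_meas (RI_D (RI_nn LF) (RI_nn Ly))|exact: RI_meas (RI_D (RI_nn LG) (RI_nn Lx))|].
  apply: aeI_S3 (theta_cross h h') j1 j2 => t _ cr e1 e2; apply: J_identity => //; last by rewrite !adj_cjmx.
  by have := congr1 (@cjmx R _ _) e2; rewrite cjmxB !cjmxM !cj_adjmx !adj_cjmx cjmx1.
have -> : l2norm g = l2norm y by rewrite -ymg zs_l2norm.
have nFG : nn G <= nn F by rewrite -(l2norm_sq LG) -(l2norm_sq LF) lerXn2r ?nnegrE ?l2norm_ge0.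
by apply: l2norm_le; [exact: Ly|exact: Lx|rewrite -(lerD2l (nn F)) Jid lerD2r].
Qed.

(** U - (Psi + K) = (A (E - L) + (A L - B)) D^-1, and both terms in the bracket are divisible by
    z^N. The factors relating U to E are D^-1 and D'^T; they are in H2, and bounded if p and p'
    are. *)
Lemma step_U L E : mx_in (@Hinf R) L -> mx_in (@H2 R) (zs (- N%:Z) (fun t => A t *m L t - B t)) ->
  mx_in (@Hinf R) E -> aeI (fun t => (E t)^a *m E t = 1%:M) ->
  mx_in (@Hinf R) (zs (- N%:Z) (fun t => E t - L t)) ->
  exists U D1 D2 D1i D2i,
   [/\ mx_in (@Linf R) U, aeI (fun t => (U t)^a *m U t = 1%:M),
      mx_in (@Hinf R) (zs (- N%:Z) (fun t => U t - (Psi t + K t))) &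
      aeI (fun t => [/\ U t = (D2 t)^a *m E t *m D1 t, D1 t *m D1i t = 1%:M & D2 t *m D2i t = 1%:M])] /\
      ([/\ mx_in (@H2 R) D1, mx_in (@H2 R) D2, mx_in (@H2 R) D1i & mx_in (@H2 R) D2i] /\
      (mx_in (@Linf R) p -> mx_in (@Linf R) p' ->
      [/\ mx_in (@Hinf R) D1, mx_in (@Hinf R) D2, mx_in (@Hinf R) D1i & mx_in (@Hinf R) D2i])).
Proof.
move=> hL hF hE uE hEL.
pose D := thD p q' E 1; pose D' := thD p' q (fun t => (E t)^T) 1.
pose U t := cjmx (D' t) *m E t *m iv (D t).
have [hD hD' hDi hD'i] := thU_H2 k0 k1 lP hk h h' hE uE.
have uD := thU_D h h' uE.
have LU : mx_in (@Linf R) U := thU_Linf k0 k1 lP hk h h' hE uE.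
exists U, (fun t => iv (D t)), (fun t => (D' t)^T), D, (fun t => (iv (D' t))^T); split; [split|split].
- exact: LU.
- exact: (thU_unitary h h' uE).
- have [hA _] := step_A; have hB := step_B.
  have LUP := mx_LinfB LU (mx_LinfD lP (mx_Hinf_Linf hK)).
  apply: mx_HinfE.
    exact: zs_Linf LUP.
  apply: (mx_in_ae (A := fun t => (A t *m zs (- N%:Z) (fun t => E t - L t) t + zs (- N%:Z) (fun t => A t *m L t - B t) t) *m iv (D t)) (@H1_ae R)).
  + exact: zs_cmeas (mx_Linf_meas LUP).
  + apply: aeI_S2 (thU_UD h h' uE) uD => t _ eU [uDt _].
    have eUP : U t - (Psi t + K t) = (cjmx (p' t) *m E t + q t - (Psi t + K t) *m D t) *m iv (D t).
      by rewrite -eU -mulmxBl -[RHS]mulmxA (iv_mulmxV uDt) mulmx1.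
    rewrite /zs eUP; move: (iv (D t)) => Di; rewrite -scalemxAr -scalerDr -scalemxAl; congr (_ *: (_ *m _)).
    rewrite /A /B /D /thD scale1r; move: (Psi t + K t) (p t) (q t) (p' t) (q' t) (E t) (L t) => P a b a' b' e l.
    rewrite ?(mulNmx, mulmxN, mulmxBl, mulmxBr, mulmxDl, mulmxDr) ?mulmxA; by mxabel.
  + exact: mx_H2_H1M (mx_H2D (mx_H2_HinfM hA hEL) hF) hDi.
- apply: aeI_S uD => t _ [u1 u2]; split; [by rewrite adj_tr|exact: iv_mulVmx|].
  by rewrite -trmx_mul iv_mulVmx// trmx1.
- by split; [exact: hDi|exact: mx_in_tr hD'|exact: hD|exact: mx_in_tr hD'i].
- move=> Lp Lp'; have [H1 H2 H3 H4] := thU_Hinf k0 k1 lP hk h h' hE uE Lp Lp'.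
  by split; [exact: H3|exact: mx_in_tr H2|exact: H1|exact: mx_in_tr H4].
Qed.
End Data.
End Step2.

(** * Finite Schur problem *)

Section Schur.
Variable (R : realType).
Local Notation C := R[i].
Local Notation Re := complex.Re.
Local Notation Im := complex.Im.
Local Notation "A ^a" := (adjmx A) (at level 8, format "A ^a").

(** Gram-Schmidt applied to a matrix with first row u returns a unitary matrix whose first row is
    proportional to u; the factor is unimodular and is scaled away. *)
Lemma unitary_first_col n (u : 'cV[C]_n.+1) : vsq u = 1 ->
  exists2 W : 'M[C]_n.+1, W^a *m W = 1%:M & W *m delta_mx ord0 ord0 = u.
Proof.
move=> hu.
have eC (A : 'M[C]_n.+1) : map_mx Num.conj A^T = A^a by apply/matrixP => i j; rewrite !mxE.
pose A : 'M[C]_n.+1 := \matrix_(i, j) (if i == ord0 then u j ord0 else 0).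
have uB : spectral.schmidt A \is spectral.unitarymx by exact: spectral.schmidt_unitarymx.
have := spectral.row_schmidt_sub A ord0; set B := spectral.schmidt A in uB *.
rewrite (big_pred1 ord0); last by move=> i; rewrite /= leqn0.
rewrite genmxE => /sub_rVP[c ec].
have BB : B *m B^a = 1%:M by have /spectral.unitarymxP := uB; rewrite eC.
have eu j : u j ord0 = c * B ord0 j.
  by have := congr1 (fun M => fun_of_matrix M ord0 j) ec; rewrite !mxE eqxx.
have c1 : cabs c ^+ 2 = 1.
  have := congr1 (fun M => fun_of_matrix M ord0 ord0) BB; rewrite !mxE eqxx => hB.
  apply: (@complexI R); rewrite -mulcJ.
  have -> : (1%:C)%C = (vsq u)%:C%C :> C by rewrite hu.
  rewrite -vdot_vsq vdotE; under eq_bigr do rewrite eu cJM mulrACA.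
  rewrite -mulr_sumr -[X in X = _]mulr1; congr (_ * _); rewrite -[LHS]hB; apply: eq_bigr => j _.
  by rewrite adjmxE.
exists ((c *: B)^T).
  rewrite adj_tr; have -> : cjmx (c *: B) = conjc c *: cjmx B.
    by apply/matrixP => i j; rewrite !mxE cJM.
  rewrite linearZ/= -scalemxAl -scalemxAr scalerA [conjc c * c]mulrC mulcJ c1 scale1r.
  by rewrite -cj_adjmx -cjmxM BB cjmx1.
by apply/matrixP => i j; rewrite (ord1 j) -colE !mxE eu.
Qed.

(** The Hankel bound is tested on the constant v: the first N coefficients of M v are those of P_-
    (z^-N M v), and Bessel's inequality applies. *)
Lemma hankel_coefs n N (M : R -> 'M[C]_n) v : mx_in (@Hinf R) M -> hankel_le 1 (zs (- N%:Z) M) ->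
  \sum_(k < N) vsq (cf M k%:Z *m v) <= vsq v.
Proof.
move=> hM hh.
have LM := mx_Hinf_Linf hM.
have hv : mx_in (@H2 R) (fun=> v) by apply: mx_Hinf_H2; exact: mx_Hinf_cst.
pose f t := zs (- N%:Z) M t *m v.
have Lf : mx_in (@L2 R) f by apply: mx_Linf_L2M; [exact: zs_Linf|exact: mx_H2_L2].
have [h hh2 hhm] := vproj Lf.
pose g t := f t - h t.
have gh : mx_in (@H2 R) (fun t => f t - g t).
  by rewrite /g; under eq_fun do rewrite opprB addrC subrK.
have le := hh _ g hv hhm gh.
have Lg := mx_H2m_L2 hhm.
have le2 : nn g <= vsq v.
  have -> : vsq v = nn (fun=> v) by rewrite nnE rint_cst.
  rewrite -(l2norm_sq Lg) -(l2norm_sq (mx_H2_L2 hv)) lerXn2r ?nnegrE ?l2norm_ge0//.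
  by rewrite mul1r in le.
apply: le_trans le2; rewrite (nn_sum Lg) exchange_big/=; apply: ler_sum => i _.
have inj : injective (fun k : nat => k%:Z - N%:Z) by move=> a b /addIr [].
have := bessel inj (Lg i ord0) N; rewrite big_mkord; apply: le_trans.
rewrite le_eqVlt; apply/orP; left; apply/eqP; apply: eq_bigr => k _; congr (cabs _ ^+ 2).
have Lh := mx_H2_L1 hh2.
rewrite -[RHS](_ : cf g (k%:Z - N%:Z) i ord0 = _); last by rewrite mxE.
rewrite cfB; [|exact: mx_L2_L1|exact: Lh].
rewrite [cf h _](cf_H2 hh2) ?subr0; last by have := ltn_ord k; lia.
rewrite /f cf_mul_cst; last by apply: mx_L2_L1; apply: mx_Linf_L2; exact: zs_Linf.
by rewrite cf_zs opprK subrK.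
Qed.

Lemma zs_Hinf_down m n N (F : R -> 'M[C]_(m, n)) : mx_in (@Hinf R) F ->
  (forall k : nat, (k < N)%N -> cf F k%:Z = 0) -> mx_in (@Hinf R) (zs (- N%:Z) F).
Proof.
move=> hF h0 i j; split; first exact: (zs_Linf (- N%:Z) (mx_Hinf_Linf hF)).
move=> k k0; under eq_fun do rewrite zsE; rewrite fcoef_shift opprK.
have [kn|kp] := ltP (k + N%:Z) 0; first by rewrite (hF i j).2.
have [l el] : exists l : nat, k + N%:Z = l%:Z by exists (absz (k + N%:Z)); lia.
rewrite el; have := h0 l; have -> : (l < N)%N by lia.
by move=> /(_ isT) /(congr1 (fun M => fun_of_matrix M i j)); rewrite !mxE.
Qed.
End Schur.

(** * Statement of the finite problem, its base cases and block operations *)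

Section Schur2.
Variable (R : realType).
Local Notation C := R[i].
Local Notation Re := complex.Re.
Local Notation Im := complex.Im.
Local Notation "A ^a" := (adjmx A) (at level 8, format "A ^a").
Local Notation unitary_ae U := (aeI (fun t => (U t)^a *m U t = 1%:M)).

Definition zdiag n (e : 'I_n -> int) (t : R) : 'M[C]_n := diag_mx (\row_k (ee t) ^ (e k)).

(** Wiener-Hopf factorization without the ordering of the indices. The class of the factors is a
    parameter: Hinf for the finite problem, H2 for interpolants of a general symbol. *)
Definition wh (cls : (R -> C) -> Prop) n (E : R -> 'M[C]_n) (e : 'I_n -> int) : Prop :=
  exists Q1 Q2 Q1i Q2i : R -> 'M[C]_n,
  [/\ mx_in cls Q1, mx_in cls Q2, mx_in cls Q1i & mx_in cls Q2i] /\
  aeI (fun t => [/\ E t = (Q2 t)^a *m zdiag e t *m Q1 t, Q1 t *m Q1i t = 1%:M & Q2 t *m Q2i t = 1%:M]).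

(** L matters only modulo z^N. After division by z^N the first r indices become negative and the
    others become the prescribed [dd]; r is fixed before [dd] is given. *)
Definition schur_for N n (L : R -> 'M[C]_n) : Prop :=
  exists r : nat, (r <= n)%N /\ forall dd : 'I_n -> int,
    (forall i j : 'I_n, (r <= i)%N -> (i <= j)%N -> 0 <= dd i <= dd j) ->
  exists E e, [/\ mx_in (@Hinf R) E, unitary_ae E, mx_in (@Hinf R) (zs (- N%:Z) (fun t => E t - L t)) & wh (@Hinf R) E e] /\
    [/\ forall i j : 'I_n, (i <= j)%N -> e i <= e j,
        forall i : 'I_n, (i < r)%N -> 0 <= e i < N%:Z &
        forall i : 'I_n, (r <= i)%N -> e i = N%:Z + dd i].

Definition schur N n : Prop := forall L : R -> 'M[C]_n, mx_in (@Hinf R) L ->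
  hankel_le 1 (zs (- N%:Z) L) -> schur_for N L.

Lemma zdiag_adj n (e : 'I_n -> int) t : (zdiag e t)^a *m zdiag e t = 1%:M.
Proof.
have -> : (zdiag e t)^a = diag_mx (\row_k ee t ^ (- e k)).
  apply/matrixP => i j; rewrite adjmxE !mxE.
  by have [->|ne] := eqVneq i j; rewrite ?eqxx ?mulr1n ?eezJ// ?(eq_sym j) ?(negbTE ne) ?mulr0n ?conjc0.
rewrite mulmx_diag -diag_const_mx; congr diag_mx; apply/matrixP => i j.
by rewrite !mxE mulrC eezK.
Qed.

Lemma zdiag_Linf n (e : 'I_n -> int) : mx_in (@Linf R) (zdiag e).
Proof.
move=> i j; rewrite /zdiag; under eq_fun do rewrite !mxE.
by have [_|_] := eqVneq i j; rewrite ?mulr1n ?mulr0n; [exact: Linf_eez|exact: Linf_cst].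
Qed.

Lemma zdiag_Hinf n (e : 'I_n -> int) : (forall i, 0 <= e i) -> mx_in (@Hinf R) (zdiag e).
Proof.
move=> e0 i j; rewrite /zdiag; under eq_fun do rewrite !mxE.
by have [_|_] := eqVneq i j; rewrite ?mulr1n ?mulr0n; [exact: Hinf_eez|exact: Hinf_cst].
Qed.

Lemma schur_zero n : schur 0 n.
Proof.
move=> L hL _; exists 0%N; split=> // dd hdd; exists (zdiag dd), dd.
have d0 i : 0 <= dd i by have /andP[] := hdd i i (leq0n _) (leqnn _).
split; [split|split].
- exact: zdiag_Hinf.
- by apply: aeI_W => t _; exact: zdiag_adj.
- by rewrite oppr0 zs0; apply: mx_HinfB => //; exact: zdiag_Hinf.
- exists (fun=> 1%:M), (fun=> 1%:M), (fun=> 1%:M), (fun=> 1%:M).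
  by split; [split; exact: mx_Hinf_cst|apply: aeI_W => t _; rewrite adjmx1 !mul1mx !mulmx1].
- by move=> i j ij; have /andP[] := hdd i j (leq0n _) ij.
- by [].
- by move=> i _; rewrite add0r.
Qed.

Lemma schur_flat N : schur N 0.
Proof.
move=> L hL _; exists 0%N; split=> // dd hdd; exists (fun=> 0), dd.
have f0 (A B : 'M[C]_0) : A = B by apply/matrixP => -[].
split; [split|split]; try by case.
- by apply: aeI_W => t _; exact: f0.
exists (fun=> 0), (fun=> 0), (fun=> 0), (fun=> 0).
by split; [split; case|apply: aeI_W => t _; split; exact: f0].
Qed.

Definition bl n (A : 'M[C]_n) : 'M[C]_n.+1 := block_mx (1%:M : 'M[C]_1) 0 0 A.
Lemma blM n (A B : 'M[C]_n) : bl (A *m B) = bl A *m bl B.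
Proof. by rewrite /bl (@mulmx_block _ 1 n 1 n 1 n) !mulmx0 !mul0mx !addr0 !add0r mulmx1. Qed.
Lemma bl1 n : bl (1%:M : 'M[C]_n) = 1%:M.
Proof. by rewrite /bl -scalar_mx_block. Qed.
Lemma bl_adj n (A : 'M[C]_n) : (bl A)^a = bl A^a.
Proof.
have e1 : (map_mx (@conjc R) (1%:M : 'M[C]_1))^T = 1%:M by exact: adjmx1.
have e0 a b : (map_mx (@conjc R) (0 : 'M[C]_(a, b)))^T = 0 by exact: adjmx0.
by rewrite /bl /adjmx (@map_block_mx _ _ _ 1 n 1 n) (@tr_block_mx _ 1 n 1 n) e1 !e0.
Qed.
Definition ble n (e : 'I_n -> int) (i : 'I_n.+1) : int := if unlift ord0 i is Some j then e j else 0.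
Lemma bl_zdiag n (e : 'I_n -> int) t : bl (zdiag e t) = zdiag (ble e) t.
Proof.
have b0 k : ble e (lshift n k : 'I_(1 + n)) = 0.
  have -> : lshift n k = ord0 by apply/val_inj; rewrite /= (ord1 k).
  by rewrite /ble unlift_none.
have b1 k : ble e (rshift 1 k : 'I_(1 + n)) = e k.
  have -> : rshift 1 k = lift ord0 k by apply/val_inj.
  by rewrite /ble liftK.
apply/matrixP => i j; rewrite /bl /zdiag [RHS]mxE [X in X *+ _]mxE.
case: (split_ordP (m := 1) i) => i' ->; case: (split_ordP (m := 1) j) => j' ->.
- by rewrite (@block_mxEul _ 1 n 1 n) b0 expr0z (ord1 i') (ord1 j') eqxx !mxE.
- by rewrite (@block_mxEur _ 1 n 1 n) -val_eqE /= (ord1 i') !mxE mulr0n.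
- by rewrite (@block_mxEdl _ 1 n 1 n) -val_eqE /= (ord1 j') !mxE mulr0n.
- by rewrite (@block_mxEdr _ 1 n 1 n) b1 -val_eqE /= eqSS val_eqE !mxE.
Qed.
Lemma bl_in n (P : (R -> C) -> Prop) (F : R -> 'M[C]_n) : (forall c : C, P (fun=> c)) ->
  mx_in P F -> mx_in P (fun t => bl (F t)).
Proof.
move=> hc hF i j; rewrite /bl.
case: (split_ordP (m := 1) i) => i' ->; case: (split_ordP (m := 1) j) => j' ->.
- by under eq_fun do rewrite (@block_mxEul _ 1 n 1 n); exact: hc.
- by under eq_fun do rewrite (@block_mxEur _ 1 n 1 n); exact: hc.
- by under eq_fun do rewrite (@block_mxEdl _ 1 n 1 n); exact: hc.
- by under eq_fun do rewrite (@block_mxEdr _ 1 n 1 n); exact: hF.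
Qed.

Lemma wh_bl n E (e : 'I_n -> int) : wh (@Hinf R) E e -> wh (@Hinf R) (fun t => bl (E t)) (ble e).
Proof.
move=> [Q1 [Q2 [Q1i [Q2i [[h1 h2 h3 h4] h]]]]].
exists (fun t => bl (Q1 t)), (fun t => bl (Q2 t)), (fun t => bl (Q1i t)), (fun t => bl (Q2i t)).
split; first by split; apply: bl_in => //; exact: Hinf_cst.
apply: aeI_S h => t _ [e1 e2 e3]; rewrite -!blM e2 e3 bl1; split=> //.
by rewrite e1 !blM bl_adj bl_zdiag.
Qed.

(** Of P only stability under multiplication by Hinf on either side is asked, so that it can be Hinf
    or H2. *)
Lemma wh_mul (P : (R -> C) -> Prop) n E U D1 D2 D1i D2i (e : 'I_n -> int) :
  (forall A B : R -> 'M[C]_n, mx_in (@Hinf R) A -> mx_in P B -> mx_in P (fun t => A t *m B t)) ->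
  (forall A B : R -> 'M[C]_n, mx_in P A -> mx_in (@Hinf R) B -> mx_in P (fun t => A t *m B t)) ->
  wh (@Hinf R) E e -> [/\ mx_in P D1, mx_in P D2, mx_in P D1i & mx_in P D2i] ->
  aeI (fun t => [/\ U t = (D2 t)^a *m E t *m D1 t, D1 t *m D1i t = 1%:M & D2 t *m D2i t = 1%:M]) ->
  wh P U e.
Proof.
move=> hm1 hm2 [Q1 [Q2 [Q1i [Q2i [[h1 h2 h3 h4] h]]]]] [d1 d2 d3 d4] hd.
exists (fun t => Q1 t *m D1 t), (fun t => Q2 t *m D2 t), (fun t => D1i t *m Q1i t), (fun t => D2i t *m Q2i t).
split; first by split; [exact: hm1|exact: hm1|exact: hm2|exact: hm2].
apply: aeI_S2 h hd => t _ [e1 e2 e3] [u1 u2 u3]; split.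
- by rewrite u1 e1 adjmxM !mulmxA.
- by rewrite mulmxA -(mulmxA (Q1 t)) u2 mulmx1.
- by rewrite mulmxA -(mulmxA (Q2 t)) u3 mulmx1.
Qed.

Lemma wh_zs (P : (R -> C) -> Prop) n U (e : 'I_n -> int) (k : int) : wh P U e -> wh P (zs k U) (fun i => k + e i).
Proof.
move=> [Q1 [Q2 [Q1i [Q2i [hh h]]]]]; exists Q1, Q2, Q1i, Q2i; split; first exact: hh.
apply: aeI_S h => t _ [e1 e2 e3]; split; [|exact: e2|exact: e3]; rewrite /zs e1 scalemxAl scalemxAr.
congr (_ *m _ *m _); apply/matrixP => i j; rewrite !mxE eezD.
by case: eqP; rewrite ?mulr1n ?mulr0n ?mulr0.
Qed.

Lemma unitary_zs n k (U : R -> 'M[C]_n) : unitary_ae U -> unitary_ae (zs k U).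
Proof.
apply: aeI_S => t _ e; rewrite /zs adjmxZ -scalemxAl -scalemxAr scalerA e eezJ mulrC eezK.
by rewrite scale1r.
Qed.

Lemma hankel_unitary n N (M : R -> 'M[C]_n) (V W : 'M[C]_n) : V^a *m V = 1%:M -> W^a *m W = 1%:M ->
  hankel_le 1 (zs (- N%:Z) M) -> hankel_le 1 (zs (- N%:Z) (fun t => V *m M t *m W)).
Proof.
move=> uV uW hh f g hf hg hfg.
have nuc (A : 'M[C]_n) (x : R -> 'cV[C]_n) : A^a *m A = 1%:M -> l2norm (fun t => A *m x t) = l2norm x.
  move=> uA; rewrite !l2normE !nnE; congr Num.sqrt; congr rint; apply/funext => t.
  by rewrite vsq_unitary.
have uV' : (V^a)^a *m V^a = 1%:M by rewrite adjmxK; exact: mulmx1C.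
have VV := mulmx1C uV.
rewrite -(nuc V^a g uV') -(nuc W f uW); apply: hh.
- by apply: mx_Hinf_H2M => //; exact: mx_Hinf_cst.
- exact: mx_cstM_H2m.
- rewrite (_ : (fun t => _) = fun t => V^a *m (zs (- N%:Z) (fun t => V *m M t *m W) t *m f t - g t)).
    by apply: mx_Hinf_H2M => //; exact: mx_Hinf_cst.
  apply/funext => t; rewrite mulmxBr /zs -!scalemxAl -scalemxAr !mulmxA uV mul1mx.
  by rewrite -!mulmxA.
Qed.

(** The Hankel operator of z^-1 L0 sees only constant coefficients, so q = z^-1 c0 and p = c1 with
    constants c0 and c1. Boundedness of p keeps the factors of a Schur step in Hinf. *)
Lemma half_const n (L0 : 'M[C]_n) p q be : half_theta (zs (-1) (fun=> L0)) p q be -> mx_in (@Linf R) p.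
Proof.
move=> [hp hq hB hs _].
pose c0 := L0 *m cf p 0.
have hc (c : 'M[C]_n) : mx_in (@H2 R) (fun=> c) by apply: mx_Hinf_H2; exact: mx_Hinf_cst.
have hcm (c : 'M[C]_n) : mx_in (@H2minus R) (zs (-1) (fun=> c)).
  move=> i j; under eq_fun do rewrite zsE -[c i j]conjcK.
  by apply: H2J_m => //; apply: Hinf_H2; exact: Hinf_cst.
have q0 : aeI (fun t => q t - zs (-1) (fun=> c0) t = 0).
  apply: mx_H1_H1m; last by apply: mx_H2m_H1m; apply: mx_H2mB.
  apply: mx_H2_H1.
  rewrite (_ : (fun t => _) = fun t => zs (-1) (fun t => L0 *m (p t - cf p 0)) t - (zs (-1) (fun=> L0) t *m p t - q t)).
    have hLp : mx_in (@H2 R) (fun t => p t - cf p 0) by apply: mx_H2B.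
    have hLp' : mx_in (@H2 R) (zs (-1) (fun t => p t - cf p 0)).
      by apply: zs_H2_down => //; rewrite cfB ?cf_cst ?subrr//; exact: mx_H2_L1.
    apply: mx_H2B; last exact: hB.
    rewrite (_ : zs _ _ = fun t => L0 *m zs (-1) (fun t => p t - cf p 0) t).
      by apply: mx_Hinf_H2M; [exact: mx_Hinf_cst|exact: hLp'].
    by apply/funext => t; rewrite /zs -scalemxAr.
  apply/funext => t; rewrite /zs -scalemxAl mulmxBr scalerBr -/c0.
  by rewrite opprB [RHS]addrC addrA subrK.
pose c1 := L0^a *m c0 + be.
have p0 : aeI (fun t => p t - c1 = 0).
  apply: mx_H1_H1m; first exact: mx_H2_H1 (mx_H2B hp (hc c1)).
  apply: (mx_in_ae (@H1m_ae R)) (mx_H2m_H1m (mx_H2mN hs)).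
    exact: mx_H2_meas (mx_H2B hp (hc c1)).
  apply: aeI_S q0 => t _ /eqP; rewrite subr_eq0 => /eqP ->.
  rewrite /zs adjmxZ -scalemxAl -scalemxAr scalerA eezJ opprK -eezD subrr expr0z scale1r.
  by rewrite /c1 opprB opprD addrA addrAC.
move=> i j; apply: (Linf_ae (f := fun=> c1 i j)); [exact: (mx_H2_meas hp)| |exact: Linf_cst].
apply: aeI_S p0 => t _ /(congr1 (fun M => fun_of_matrix M i j)); rewrite !mxE => /eqP.
by rewrite subr_eq0 => /eqP ->.
Qed.
End Schur2.

(** * The Schur algorithm *)

Section Schur3.
Variable (R : realType).
Local Notation C := R[i].
Local Notation Re := complex.Re.
Local Notation Im := complex.Im.
Local Notation "A ^a" := (adjmx A) (at level 8, format "A ^a").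
Local Notation unitary_ae U := (aeI (fun t => (U t)^a *m U t = 1%:M)).

(** In place of compactness of the sphere, 1 - A^* A is factored as ga^* ga with inverse be of ga;
    then |v|^2 <= frob be (|v|^2 - |A v|^2), from which k is read off. *)
Lemma strict_contr n (A : 'M[C]_n) : (forall v : 'cV[C]_n, v != 0 -> vsq (A *m v) < vsq v) ->
  exists k : R, [/\ 0 <= k, k < 1 & forall v, vsq (A *m v) <= k ^+ 2 * vsq v].
Proof.
move=> hA; pose b := 1%:M - A^a *m A.
have eb : (1%:M : 'M[C]_n)^a *m 1%:M - A^a *m A = b by rewrite adjmx1 mulmx1.
have ba : b^a = b by rewrite /b adjmxB adjmx1 adjmxM adjmxK.
have eV v : vdot (b *m v) v = (vsq v - vsq (A *m v))%:C%C.
  by rewrite (vsq_herm v eb) mul1mx.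
have pos (v : 'cV[C]_n) : v != 0 -> 0 < Re (vdot (b *m v) v).
  by move=> v0; rewrite eV /= subr_gt0 hA.
have [be [ga [h1 h2 h3]]] := posdef_factor ba pos.
have bg : b = ga^a *m ga.
  rewrite -[LHS]mulmx1 -h2 -[LHS]mul1mx -[X in X *m _]adjmx1 -h2 adjmxM.
  by rewrite !mulmxA -(mulmxA ga^a) -(mulmxA ga^a) h1 mulmx1.
have eg v : vsq (ga *m v) = vsq v - vsq (A *m v).
  apply: (@complexI R); rewrite -eV bg -mulmxA -[RHS](_ : vdot (ga^a *m (ga *m v)) v = _)//.
  by rewrite vdot_adj adjmxK vdot_vsq.
pose M : R := 1 + frob be.
have M0 : 0 < M by rewrite ltr_pwDl// frob_ge0.
have M1 : 0 <= 1 - M^-1 by rewrite subr_ge0 invf_le1// lerDl frob_ge0.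
exists (Num.sqrt (1 - M^-1)); rewrite sqrtr_ge0 sqr_sqrtr//; split=> //.
  by rewrite -[ltRHS]sqrtr1 ltr_sqrt// gtrBl invr_gt0.
move=> v; have := vsq_frob be (ga *m v); rewrite mulmxA h2 mul1mx eg => le.
have le2 : vsq v <= M * (vsq v - vsq (A *m v)).
  by rewrite mulrDl mul1r (le_trans le)// lerDr -eg vsq_ge0.
rewrite mulrBl mul1r lerBrDr -lerBrDl -(ler_pM2l M0) mulVKf ?gt_eqF//.
Qed.

Lemma hankel_le_sup n (Psi : R -> 'M[C]_n) (k : R) : 0 <= k -> mx_in (@Linf R) Psi ->
  aeI (fun t => forall v, vsq (Psi t *m v) <= k ^+ 2 * vsq v) -> hankel_le k Psi.
Proof.
move=> k0 lP h f g hf hg hfg; have Lf := mx_H2_L2 hf.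
have LPf : mx_in (@L2 R) (fun t => Psi t *m f t) by exact: mx_Linf_L2M.
apply: le_trans (l2norm_projm LPf hg hfg) _; apply: nn_le => //.
by apply: aeI_S h => t _ H; exact: H.
Qed.

Lemma zs_tr m n k (F : R -> 'M[C]_(m, n)) : (fun t => (zs k F t)^T) = zs k (fun t => (F t)^T).
Proof. by apply/funext => t; rewrite /zs linearZ. Qed.

(** Take Psi = z^-1 L0 with L0 the constant coefficient, so of Hankel norm below 1, and K = z^-1 (L
    - L0); then z^-N (Psi + K) = z^-(N+1) L. The reduced problem has N coefficients. Its solution U
    gives E = z U, which raises every index by 1, so that indices below N stay below N + 1. *)
Lemma schur_step N n (L : R -> 'M[C]_n) : schur R N n -> mx_in (@Hinf R) L ->
  hankel_le 1 (zs (- N.+1%:Z) L) -> (forall v : 'cV[C]_n, v != 0 -> vsq (cf L 0 *m v) < vsq v) ->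
  schur_for N.+1 L.
Proof.
move=> IH hL hh strict; pose L0 := cf L 0.
have [k [k0 k1 hk]] := strict_contr strict.
have lP : mx_in (@Linf R) (zs (-1) (fun=> L0)).
  by apply: zs_Linf; apply: mx_Hinf_Linf; exact: mx_Hinf_cst.
have hkP : hankel_le k (zs (-1) (fun=> L0)).
  apply: hankel_le_sup => //; apply: aeI_W => t _ v.
  by rewrite /zs -scalemxAl vsqZ cabs_eez expr1n mul1r.
have lPT := mx_in_tr lP.
have hkT := hankel_tr k0 lP hkP.
have [p [q [be [ga [th _]]]]] := half_thetaP k0 k1 lP hkP.
have [p' [q' [be' [ga' [th' [hga _]]]]]] := half_thetaP k0 k1 lPT hkT.
have Lp := half_const th.
have Lp' : mx_in (@Linf R) p' by move: (th'); rewrite zs_tr; exact: half_const.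
pose K := zs (-1) (fun t => L t - L0).
have hK : mx_in (@Hinf R) K.
  apply: (@zs_Hinf_down _ _ _ 1); first by apply: mx_HinfB => //; exact: mx_Hinf_cst.
  move=> [|//] _; rewrite cfB ?cf_cst ?subrr//; apply: mx_H2_L1; apply: mx_Hinf_H2 => //.
  exact: mx_Hinf_cst.
have ePK : (fun t => zs (-1) (fun=> L0) t + K t) = zs (-1) L.
  by apply/funext => t; rewrite /K zsB addrC subrK.
have eN : - N%:Z + -1 = - N.+1%:Z by lia.
have hhN : hankel_le 1 (zs (- N%:Z) (fun t => zs (-1) (fun=> L0) t + K t)).
  by rewrite ePK zs_zs eN.
have [L1 hL1 hF] := step_L th th' hga N hK.
have hh1 := step_hankel th th' hK hL1 hF hhN.
have [r [rn hr]] := IH L1 hL1 hh1.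
exists r; split=> // dd hdd; have [E [e [[hE uE hEL hw] [e1 e2 e3]]]] := hr dd hdd.
have [U [D1 [D2 [D1i [D2i [[LU uU hU eU] [_ hD]]]]]]] := step_U k0 k1 lP hkP th th' hK hL1 hF hE uE hEL.
have hwU : wh (@Hinf R) U e.
  by apply: wh_mul hw (hD Lp Lp') eU => A B; exact: mx_HinfM.
have eL : zs (- N.+1%:Z) (fun t => zs 1 U t - L t) = zs (- N%:Z) (fun t => U t - (zs (-1) (fun=> L0) t + K t)).
  rewrite -eN -zs_zs; congr (zs _ _); apply/funext => t.
  rewrite zsB; have := congr1 (fun F => F t) ePK => /= ->; congr (_ - _).
  by rewrite -[LHS]/(zs (-1) (zs 1 U) t) zs_zs addNr zs0.
have hZ : mx_in (@Hinf R) (zs (- N.+1%:Z) (fun t => zs 1 U t - L t)) by rewrite eL.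
exists (zs 1 U), (fun i => 1 + e i); split; [split|split].
- rewrite (_ : zs 1 U = fun t => zs N.+1%:Z (zs (- N.+1%:Z) (fun t => zs 1 U t - L t)) t + L t).
    by apply: mx_HinfD; [exact: (zs_Hinf _ hZ)|exact: hL].
  by rewrite zs_zs subrr zs0; apply/funext => t; rewrite subrK.
- exact: unitary_zs.
- exact: hZ.
- exact: wh_zs.
- by move=> i j ij; rewrite lerD2l e1.
- by move=> i ir; have := e2 i ir; lia.
- by move=> i ir; rewrite (e3 i ir); lia.
Qed.

Lemma cf_cstM m n p l (c : 'M[C]_(m, n)) (F : R -> 'M[C]_(n, p)) (d : 'M[C]_(p, l)) k :
  mx_in (@L1 R) F -> cf (fun t => c *m F t *m d) k = c *m cf F k *m d.
Proof.
move=> hF; have hcF : mx_in (@L1 R) (fun t => c *m F t).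
  apply: (@mx_in_mul _ _ _ _ (@Linf R) (@L1 R)) (hF) => //.
  - by move=> f g; exact: Linf_L1M.
  - by move=> G hG; exact: L1_sum.
  - by move=> i j; exact: Linf_cst.
rewrite cf_mul_cst//; congr (_ *m _).
apply/matrixP => i j; rewrite !mxE.
under eq_fun do rewrite mxE; rewrite fcoef_sum; last by move=> a _; apply: L1Z; exact: hF.
by apply: eq_bigr => a _; rewrite fcoefZ ?mxE//; exact: hF.
Qed.

Lemma cf_tr m n (F : R -> 'M[C]_(m, n)) k : cf (fun t => (F t)^T) k = (cf F k)^T.
Proof. by apply/matrixP => i j; rewrite !mxE; under eq_fun do rewrite mxE. Qed.

(* Where the constant coefficient is isometric, the Hankel bound forces L to split off
   a constant unimodular block modulo z^(N+1). *)
Lemma schur_peel N n (L : R -> 'M[C]_n.+1) (v : 'cV[C]_n.+1) : schur R N.+1 n -> mx_in (@Hinf R) L ->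
  hankel_le 1 (zs (- N.+1%:Z) L) -> v != 0 -> vsq v <= vsq (cf L 0 *m v) ->
  schur_for N.+1 L.
Proof.
move=> IH hL hh v0 hv.
pose e0 : 'cV[C]_n.+1 := delta_mx ord0 ord0.
have L1L : mx_in (@L1 R) L by apply: mx_H2_L1; exact: mx_Hinf_H2.
have c0le (M : R -> 'M[C]_n.+1) x : mx_in (@Hinf R) M -> hankel_le 1 (zs (- N.+1%:Z) M) ->
    vsq (cf M 0 *m x) + \sum_(k < N) vsq (cf M k.+1%:Z *m x) <= vsq x.
  by move=> hM hMh; have := hankel_coefs x hM hMh; rewrite big_ord_recl.
have s0 (M : R -> 'M[C]_n.+1) x : 0 <= \sum_(k < N) vsq (cf M k.+1%:Z *m x).
  by apply: sumr_ge0 => k _; exact: vsq_ge0.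
have vp : 0 < vsq v.
  by rewrite lt_neqAle vsq_ge0 andbT eq_sym; apply: contraNneq v0 => /vsq_eq0 ->.
pose s : R := (Num.sqrt (vsq v))^-1.
have ss : s ^+ 2 * vsq v = 1 by rewrite exprVn sqr_sqrtr ?ltW// mulVf// gt_eqF.
pose u := s%:C%C *: v.
have s_ge0 : 0 <= s by rewrite invr_ge0 sqrtr_ge0.
have vu : vsq u = 1 by rewrite vsqZ cabs_Cr ger0_norm.
have vu' : vsq (cf L 0 *m u) = 1.
  apply/eqP; rewrite eq_le; apply/andP; split.
    by rewrite -vu (le_trans _ (c0le L u hL hh))// lerDl.
  by rewrite /u -scalemxAr vsqZ cabs_Cr ger0_norm// -ss ler_wpM2l// exprn_ge0.
have [W uW eW] := unitary_first_col vu.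
have [V uV eV] := unitary_first_col vu'.
have VV := mulmx1C uV; have WW := mulmx1C uW.
have uVa : (V^a)^a *m V^a = 1%:M by rewrite adjmxK.
pose M t := V^a *m L t *m W.
have hM : mx_in (@Hinf R) M.
  by apply: mx_HinfM; [apply: mx_HinfM => //|]; exact: mx_Hinf_cst.
have hMh : hankel_le 1 (zs (- N.+1%:Z) M) by exact: hankel_unitary.
have L1M : mx_in (@L1 R) M by apply: mx_H2_L1; exact: mx_Hinf_H2.
have ve0 : vsq e0 = 1.
  rewrite /vsq (bigD1 ord0)//= mxE !eqxx cabs1 expr1n big1 ?addr0// => l lj.
  by rewrite mxE (negbTE lj) cabs0 expr0n.
(* Isometry on [e0] exhausts the bound of [hankel_coefs], so the coefficients of index 1 to N
   annihilate [e0]. *)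
have rest (F : R -> 'M[C]_n.+1) : mx_in (@Hinf R) F -> hankel_le 1 (zs (- N.+1%:Z) F) ->
    1 <= vsq (cf F 0 *m e0) -> forall k : nat, (k < N)%N -> cf F k.+1%:Z *m e0 = 0.
  move=> hF hFh ge k kN; apply: vsq_eq0; apply/eqP.
  have := c0le F e0 hF hFh; rewrite ve0 => le.
  have : \sum_(k < N) vsq (cf F k.+1%:Z *m e0) == 0.
    by rewrite eq_le s0 andbT; move: ge le; move: (\sum_(_ < _) _) => z; lra.
  rewrite psumr_eq0; last by move=> i _; exact: vsq_ge0.
  by move=> /allP /(_ (Ordinal kN)); rewrite mem_index_enum => /(_ isT).
have M0 : cf M 0 *m e0 = e0.
  by rewrite /M cf_cstM// -mulmxA eW -mulmxA -eV mulmxA uV mul1mx.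
have Mk k : (k < N)%N -> cf M k.+1%:Z *m e0 = 0 by apply: rest => //; rewrite M0 ve0.
pose MT t := (M t)^T.
have hMT : mx_in (@Hinf R) MT by exact: mx_in_tr.
have hMTh : hankel_le 1 (zs (- N.+1%:Z) MT).
  by rewrite -zs_tr; apply: hankel_tr => //; apply: zs_Linf; exact: mx_Hinf_Linf.
(* The same for the first row: its corner entry is 1 and its length at most 1, so it is the first
   unit vector. *)
have MT0 : cf MT 0 *m e0 = e0.
  set x := cf MT 0 *m e0.
  have x00 : x ord0 ord0 = 1.
    rewrite /x cf_tr -colE !mxE.
    by have := congr1 (fun F => fun_of_matrix F ord0 ord0) M0; rewrite -colE !mxE eqxx.
  have xle : vsq x <= 1.
    by rewrite -ve0; apply: le_trans (c0le MT e0 hMT hMTh); rewrite lerDl.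
  have dx : vdot x (- e0) = -1.
    have e0E i : e0 i ord0 = (i == ord0)%:R by rewrite mxE eqxx andbT.
    rewrite -scaleN1r vdotZr vdotE (bigD1 ord0)//= x00 e0E !eqxx conjc1 mulr1 big1 ?addr0 ?mulr1.
      by apply: complex_eqP => /=; rewrite ?oppr0.
    by move=> i i0; rewrite e0E (negbTE i0) conjc0 mulr0.
  have : vsq (x - e0) = 0.
    apply/eqP; rewrite eq_le vsq_ge0 andbT vsqD dx vsqN ve0 /=.
    by move: xle; lra.
  by move/vsq_eq0/eqP; rewrite subr_eq0 => /eqP.
have MTk k : (k < N)%N -> cf MT k.+1%:Z *m e0 = 0 by apply: rest => //; rewrite MT0 ve0.
(* [S] deletes the first coordinate, and [P0] projects onto it. *)
pose S : 'M[C]_(n, n.+1) := \matrix_(i, j) (lift ord0 i == j)%:R.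
pose P0 : 'M[C]_n.+1 := e0 *m e0^T.
have SS : S *m S^T = 1%:M.
  apply/matrixP => i j; rewrite !mxE (bigD1 (lift ord0 i))//= !mxE eqxx mul1r.
  rewrite (inj_eq lift_inj) eq_sym big1 ?addr0// => k ki.
  by rewrite !mxE eq_sym (negbTE ki) mul0r.
have StS : S^T *m S = 1%:M - P0.
  apply/matrixP => i j; rewrite /P0 !mxE big_ord1 !mxE eqxx andbT.
  case: (unliftP ord0 i) => [i' ->|->].
    rewrite (bigD1 i')//= !mxE eqxx mul1r big1 ?addr0.
      by rewrite /= mul0r subr0.
    by move=> k ki; rewrite !mxE (inj_eq lift_inj) (negbTE ki) mul0r.
  rewrite big1; last by move=> k _; rewrite !mxE mul0r.
  by rewrite eqxx mul1r andbT eq_sym subrr.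
have blE (A : 'M[C]_n) : bl A = P0 + S^T *m A *m S.
  apply/matrixP => i j; rewrite /bl.
  have lz : lshift n (@ord0 0) = ord0 :> 'I_(1 + n) by exact: val_inj.
  have rz l : rshift 1 l = lift ord0 l :> 'I_(1 + n) by exact: val_inj.
  have Sl k : S k (lshift n (@ord0 0)) = 0 by rewrite mxE lz; case: eqP => // /(congr1 val).
  have Sr k l : S k (rshift 1 l) = (k == l)%:R by rewrite mxE rz (inj_eq lift_inj).
  have el : e0 (lshift n (@ord0 0)) ord0 = 1 by rewrite mxE lz.
  have er l : e0 (rshift 1 l) ord0 = 0 by rewrite mxE rz; case: eqP => // /(congr1 val).
  have PE a b : P0 a b = e0 a ord0 * e0 b ord0 by rewrite mxE big_ord1 [e0^T _ _]mxE.
  have SE a b : (S^T *m A *m S) a b = \sum_k (\sum_l S l a * A l k) * S k b.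
    by rewrite mxE; apply: eq_bigr => k _; rewrite mxE; congr (_ * _); apply: eq_bigr => l _; rewrite mxE.
  rewrite mxD_E PE SE.
  case: (split_ordP (m := 1) i) => i' ->; case: (split_ordP (m := 1) j) => j' ->; rewrite ?(ord1 i') ?(ord1 j').
  - rewrite (@block_mxEul _ 1 n 1 n) el mulr1 big1 ?addr0 ?mxE// => k _; by rewrite Sl mulr0.
  - rewrite (@block_mxEur _ 1 n 1 n) el er mulr0 add0r mxE big1// => k _.
    by rewrite big1 ?mul0r// => l _; rewrite Sl mul0r.
  - rewrite (@block_mxEdl _ 1 n 1 n) el er mul0r add0r mxE big1// => k _; by rewrite Sl mulr0.
  - rewrite (@block_mxEdr _ 1 n 1 n) er mul0r add0r (bigD1 j')//= Sr eqxx mulr1 (bigD1 i')//= Sr eqxx mul1r.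
    by rewrite !big1 ?addr0// => k kj; rewrite Sr (negbTE kj) ?mul0r ?mulr0.
pose M' t := S *m M t *m S^T.
have hM' : mx_in (@Hinf R) M'.
  by apply: mx_HinfM; [apply: mx_HinfM => //|]; exact: mx_Hinf_cst.
(* Analyticity of [X] says that M is the direct sum of 1 and [M'] modulo z^(N+1). *)
pose X := zs (- N.+1%:Z) (fun t => M t - bl (M' t)).
have hX : mx_in (@Hinf R) X.
  have hMM : mx_in (@Hinf R) (fun t => M t - (P0 + S^T *m S *m M t *m (S^T *m S))).
    apply: mx_HinfB => //; apply: mx_HinfD; first exact: mx_Hinf_cst.
    by apply: mx_HinfM; [apply: mx_HinfM => //|]; exact: mx_Hinf_cst.
  rewrite /X (_ : (fun t => M t - bl (M' t)) = fun t => M t - (P0 + S^T *m S *m M t *m (S^T *m S))); last first.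
    by apply/funext => t; rewrite blE /M' !mulmxA.
  apply: zs_Hinf_down => // k kN.
  have hP0 : mx_in (@L1 R) (fun=> P0) by move=> i j; exact: L1_cst.
  have hSM : mx_in (@L1 R) (fun t => S^T *m S *m M t *m (S^T *m S)).
    apply: mx_H2_L1; apply: mx_Hinf_H2.
    by apply: mx_HinfM; [apply: mx_HinfM => //|]; exact: mx_Hinf_cst.
  have hPS : mx_in (@L1 R) (fun t => P0 + S^T *m S *m M t *m (S^T *m S)).
    by move=> i j; under eq_fun do rewrite mxD_E; apply: L1D; [exact: hP0|exact: hSM].
  rewrite cfB// cfD// cf_cstM// StS.
  case: k kN => [|k] kN.
    have a1 : cf M 0 *m P0 = P0 by rewrite /P0 mulmxA M0.
    have a2 : P0 *m cf M 0 = P0.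
      have := congr1 (@trmx _ _ _) MT0; rewrite cf_tr trmx_mul trmxK => a2.
      by rewrite /P0 -mulmxA a2.
    have a3 : P0 *m P0 = P0 by rewrite /P0 /e0 trmx_delta !mul_delta_mx.
    rewrite cf_cst mulmxBl mul1mx a2 mulmxBr mulmx1 mulmxBl a1 a3 subrr subr0.
    by rewrite subrKC subrr.
  have a1 : cf M k.+1%:Z *m P0 = 0 by rewrite /P0 mulmxA Mk// mul0mx.
  have a2 : P0 *m cf M k.+1%:Z = 0.
    have := congr1 (@trmx _ _ _) (MTk _ kN); rewrite cf_tr trmx_mul trmxK trmx0 => a2.
    by rewrite /P0 -mulmxA a2 mulmx0.
  have -> : cf (fun=> P0) k.+1%:Z = 0.
    by apply/matrixP => i j; rewrite mxE fcoef_cst mulr0 [RHS]mxE.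
  by rewrite mulmxBl mul1mx a2 subr0 mulmxBr mulmx1 a1 subr0 add0r subrr.
have StSa : (S^T)^a *m S^T = 1%:M.
  have -> : (S^T)^a = S.
    by apply/matrixP => i j; rewrite !mxE; case: eqP; rewrite ?conjc1 ?conjc0.
  exact: SS.
(* [S^T] embeds the smaller space isometrically, and [X] is analytic, so [M'] inherits the bound of
   M. *)
have hM'h : hankel_le 1 (zs (- N.+1%:Z) M').
  have nS (f : R -> 'cV[C]_n) : l2norm (fun t => S^T *m f t) = l2norm f.
    rewrite !l2normE !nnE; congr Num.sqrt; congr rint; apply/funext => t.
    apply: (@complexI R); rewrite -!vdot_vsq vdot_adj mulmxA StSa mul1mx//.
  move=> f g hf hg hfg; rewrite -(nS f) -(nS g); apply: hMh.
  - by apply: mx_Hinf_H2M => //; exact: mx_Hinf_cst.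
  - exact: mx_cstM_H2m.
  - rewrite (_ : (fun t => _) = fun t => X t *m S^T *m f t + S^T *m (zs (- N.+1%:Z) M' t *m f t - g t)).
      apply: mx_H2D; apply: mx_Hinf_H2M => //; last exact: mx_Hinf_cst.
      by apply: mx_HinfM => //; exact: mx_Hinf_cst.
    apply/funext => t; rewrite /X /zs blE; move: (ee t ^ _) => z.
    have z0 : P0 *m S^T = 0.
      apply/eqP; rewrite -subr_eq0 subr0 -[P0](opprK) -[- P0](addKr 1%:M) -StS opprD opprK.
      by rewrite mulmxBl mul1mx -mulmxA SS mulmx1 subrr.
    rewrite [S^T *m (_ - _)]mulmxBr addrA; congr (_ - _).
    rewrite -!scalemxAl -[S^T *m (_ *: _)]scalemxAr -scalerDr; congr (_ *: _).
    have e : (M t - (P0 + S^T *m M' t *m S)) *m S^T = M t *m S^T - S^T *m M' t.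
      by rewrite mulmxBl mulmxDl z0 add0r -(mulmxA _ S S^T) SS mulmx1.
    by rewrite e mulmxBl !mulmxA subrK.
have [r [rn hr]] := IH M' hM' hM'h.
(* The split block has index 0 < N + 1, so it joins the indices that become negative after division
   by z^(N+1). *)
exists r.+1; split=> // dd hdd.
have [|E' [e' [[hE uE hEL hw] [e1 e2 e3]]]] := hr (fun i => dd (lift ord0 i)).
  by move=> i j ri ij; apply: hdd; rewrite !lift0.
(* Nonnegativity lets the index 0 of the split block stand first in increasing order. *)
have e'0 i : 0 <= e' i.
  have [ir|ri] := ltnP i r; first by have /andP[] := e2 i ir.
  have ri' : (r.+1 <= lift ord0 i)%N by rewrite lift0.
  have /andP[d0 _] := hdd _ _ ri' (leqnn _).
  by rewrite e3// addr_ge0.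
exists (fun t => V *m bl (E' t) *m W^a), (ble e'); split; [split|split].
- apply: mx_HinfM; [apply: mx_HinfM|]; try exact: mx_Hinf_cst.
  by apply: bl_in => //; exact: Hinf_cst.
- apply: aeI_S uE => t _ uEt; rewrite !adjmxM adjmxK !mulmxA.
  by rewrite -(mulmxA (W *m _)) uV mulmx1 bl_adj -(mulmxA W) -blM uEt bl1 mulmx1 WW.
- rewrite (_ : zs _ _ = fun t => V *m (S^T *m zs (- N.+1%:Z) (fun t => E' t - M' t) t *m S - X t) *m W^a).
    apply: mx_HinfM; [apply: mx_HinfM|]; try exact: mx_Hinf_cst.
    apply: mx_HinfB => //; apply: mx_HinfM; [apply: mx_HinfM|] => //; exact: mx_Hinf_cst.
  apply/funext => t; rewrite /X /zs.
  have {1}-> : L t = V *m M t *m W^a.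
    by rewrite /M !mulmxA VV mul1mx -mulmxA WW mulmx1.
  rewrite -mulmxBl -mulmxBr -scalemxAr -scalemxAl -scalerBr -scalemxAr -scalemxAl.
  congr (_ *: (_ *m _ *m _)); rewrite !blE mulmxBr mulmxBl.
  move: (S^T *m E' t *m S) (S^T *m M' t *m S) (M t) (P0) => a b c d.
  by apply/matrixP => i j; rewrite !mxE; ring.
- apply: (wh_mul (P := @Hinf R) (D1 := fun=> W^a) (D2 := fun=> V^a) (D1i := fun=> W) (D2i := fun=> V) _ _ (wh_bl hw)).
  + by move=> A B; exact: mx_HinfM.
  + by move=> A B; exact: mx_HinfM.
  + by split; exact: mx_Hinf_cst.
  + by apply: aeI_W => t _; rewrite adjmxK.
- move=> i j; rewrite /ble; case: (unliftP ord0 i) => [i' ->|->]; case: (unliftP ord0 j) => [j' ->|->] //.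
  by rewrite !lift0 ltnS; exact: e1.
- move=> i; rewrite /ble; case: (unliftP ord0 i) => [i' ->|->] //.
  by rewrite lift0 ltnS; exact: e2.
- move=> i; rewrite /ble; case: (unliftP ord0 i) => [i' ->|->] //.
  by rewrite lift0 ltnS; exact: e3.
Qed.

(** Double induction: a strict contraction lowers N for the same n, a split lowers n for the same
    N. *)
Lemma schur_all n N : schur R N n.
Proof.
elim: n N => [|n IHn] N; first exact: schur_flat.
elim: N => [|N IHN]; first exact: schur_zero.
move=> L hL hh.
have [strict|] := pselect (forall v : 'cV[C]_n.+1, v != 0 -> vsq (cf L 0 *m v) < vsq v).
  exact: schur_step.
move/existsNP => [v /not_implyP[v0 /negP]]; rewrite -leNgt => hv.
exact: schur_peel (IHn N.+1) hL hh v0 hv.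
Qed.
End Schur3.

(** * Unitary interpolants *)

Section Interp.
Variable (R : realType).
Local Notation C := R[i].
Local Notation Re := complex.Re.
Local Notation Im := complex.Im.
Local Notation "A ^a" := (adjmx A) (at level 8, format "A ^a").
Local Notation unitary_ae U := (aeI (fun t => (U t)^a *m U t = 1%:M)).

(** Working form of membership in Hinf + C, in the operator norm: approximability by z^-N Hinf. It
    passes directly to interpolants of Phi and to products Phi H with H in Hinf. *)
Definition apx n (Phi : R -> 'M[C]_n) : Prop := mx_in (@Linf R) Phi /\
  forall e : R, 0 < e -> exists (N : nat) (F : R -> 'M[C]_n), mx_in (@Hinf R) F /\
    aeI (fun t => forall v, vsq ((zs N%:Z Phi t - F t) *m v) <= e ^+ 2 * vsq v).

Lemma Hinf_trig (p : R -> C) : trig p -> exists N0 : nat, forall N, (N0 <= N)%N -> Hinf (fun t => p t * ee t ^ N%:Z).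
Proof.
move=> tp; have [N0 h] := trig_bound tp; exists N0 => N NN; split.
  by apply: LinfM; [exact: trig_Linf|exact: Linf_eez].
by move=> k k0; rewrite fcoef_shift h//; lia.
Qed.

Lemma HinfC_split (f : R -> C) (e : R) : HinfC f -> 0 < e ->
  exists (h p : R -> C), [/\ Hinf h, trig p & aeI (fun t => cabs (f t - (h t + p t)) <= e)].
Proof.
move=> [mf [h [g [hh [[g' [c1 [c2 [per eg]]]] ef]]]]] e0.
have [p tp hp] := fejer c1 c2 (esym (etrans (congr1 g' (esym (add0r 1))) (per 0))) e0.
exists h, p; split=> //; apply: aeI_S2 eg ef => t It e1 e2.
by rewrite e2 e1 opprD addrACA subrr add0r -cabsN opprB; exact: hp.
Qed.

Lemma HinfC_Linf (f : R -> C) : HinfC f -> Linf f.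
Proof.
move=> hf; have [h [p [hh tp hp]]] := HinfC_split hf ltr01.
have [M M0 hM] := Linf_bound (LinfD hh.1 (trig_Linf tp)).
split; first exact: hf.1.
exists (1 + M); apply: aeI_S2 hp hM => t _ h1 h2.
by rewrite -[f t](subrK (h t + p t)) (le_trans (cabsD _ _))// lerD.
Qed.

Lemma HinfC_apx n (Phi : R -> 'M[C]_n) : mx_in (@HinfC R) Phi -> apx Phi.
Proof.
move=> hP; split; first by move=> i j; exact: HinfC_Linf.
(* An error of e / (n + 1) in each of the n^2 entries keeps the Frobenius norm below e; the shift N
   below is the sum of those needed by the entries. *)
move=> e e0; pose e' := e / n.+1%:R.
have e'0 : 0 < e' by rewrite divr_gt0.
have hex (ij : 'I_n * 'I_n) : exists hpN : (R -> C) * (R -> C) * nat,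
   [/\ Hinf hpN.1.1, aeI (fun t => cabs (Phi t ij.1 ij.2 - (hpN.1.1 t + hpN.1.2 t)) <= e') &
     forall N, (hpN.2 <= N)%N -> Hinf (fun t => hpN.1.2 t * ee t ^ N%:Z)].
  have [h [p [hh tp hp]]] := HinfC_split (hP ij.1 ij.2) e'0.
  by have [N0 hN] := Hinf_trig tp; exists (h, p, N0).
have [G hG] := choice hex.
pose N := \sum_ij (G ij).2; exists N.
exists (fun t => \matrix_(i, j) (((G (i, j)).1.1 t + (G (i, j)).1.2 t) * ee t ^ N%:Z)); split.
  move=> i j; under eq_fun do rewrite mxE mulrDl.
  have [h1 _ h3] := hG (i, j); apply: HinfD; first by apply: HinfM => //; exact: Hinf_eez.
  by apply: h3; rewrite /N (bigD1 (i, j))//= leq_addr.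
have hae ij : aeI (fun t => cabs (Phi t ij.1 ij.2 - ((G ij).1.1 t + (G ij).1.2 t)) <= e') by case: (hG ij).
have := aeI_forall hae; apply: aeI_S => t _ H v.
apply: le_trans (vsq_frob _ _) _; rewrite ler_wpM2r ?vsq_ge0//.
apply: le_trans (_ : \sum_(i < n) \sum_(j < n) e' ^+ 2 <= _).
  apply: ler_sum => i _; apply: ler_sum => j _.
  rewrite lerXn2r ?nnegrE ?cabs_ge0 ?(ltW e'0)//.
  by rewrite mxD_E zsE mxN_E mxE -mulrBl cabsM cabs_eez mulr1; exact: (H (i, j)).
under eq_bigr do rewrite sumr_const card_ord.
rewrite sumr_const card_ord -mulrnA -mulr_natr /e' expr_div_n -mulrA ler_piMr ?sqr_ge0//.
rewrite mulrC ler_pdivrMr ?exprn_gt0// mul1r -natrX ler_nat; lia.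
Qed.

(** [r] is quantified before [dd], so that interpolants for different prescribed indices share it.
    The bound 1/2 on Psi is an arbitrary constant below 1. This is the one reduction in which p may
    be unbounded: its H2 factors multiply the Hinf factors of E. *)
Lemma interp n (Phi : R -> 'M[C]_n) : apx Phi -> hankel_le 1 Phi ->
  exists r : nat, (r <= n)%N /\ forall dd : 'I_n -> int,
    (forall i j : 'I_n, (r <= i)%N -> (i <= j)%N -> 0 <= dd i <= dd j) ->
  exists U d, [/\ mx_in (@Linf R) U, unitary_ae U, mx_in (@Hinf R) (fun t => Phi t - U t) & wh (@H2 R) U d] /\
    [/\ forall i j : 'I_n, (i <= j)%N -> d i <= d j,
        forall i : 'I_n, (i < r)%N -> d i < 0 &
        forall i : 'I_n, (r <= i)%N -> d i = dd i].
Proof.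
move=> [lPhi hapx] hh.
have h2 : 0 < (2^-1 : R) by rewrite invr_gt0.
have [N [K [hK hsm]]] := hapx _ h2.
pose Psi t := zs N%:Z Phi t - K t.
have k0 : 0 <= (2^-1 : R) by exact: ltW.
have k1 : (2^-1 : R) < 1 by rewrite invf_lt1// ltr1n.
have lP : mx_in (@Linf R) Psi by apply: mx_LinfB; [exact: zs_Linf|exact: mx_Hinf_Linf].
have hkP : hankel_le 2^-1 Psi by exact: hankel_le_sup.
have ePK : zs (- N%:Z) (fun t => Psi t + K t) = Phi.
  have -> : (fun t => Psi t + K t) = zs N%:Z Phi by apply/funext => t; rewrite /Psi subrK.
  by rewrite zs_zs addNr zs0.
have lPT := mx_in_tr lP.
have hkT := hankel_tr k0 lP hkP.
have [p [q [be [ga [th _]]]]] := half_thetaP k0 k1 lP hkP.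
have [p' [q' [be' [ga' [th' [hga _]]]]]] := half_thetaP k0 k1 lPT hkT.
have [L1 hL1 hF] := step_L th th' hga N hK.
have hhN : hankel_le 1 (zs (- N%:Z) (fun t => Psi t + K t)) by rewrite ePK.
have hh1 := step_hankel th th' hK hL1 hF hhN.
have [r [rn hr]] := schur_all hL1 hh1.
exists r; split=> // dd hdd; have [E [e [[hE uE hEL hw] [e1 e2 e3]]]] := hr dd hdd.
have [U [D1 [D2 [D1i [D2i [[LU uU hU eU] [hD _]]]]]]] := step_U k0 k1 lP hkP th th' hK hL1 hF hE uE hEL.
have hwU : wh (@H2 R) U e.
  by apply: wh_mul hw hD eU => A B; [exact: mx_Hinf_H2M|exact: mx_H2_HinfM].
exists (zs (- N%:Z) U), (fun i => - N%:Z + e i); split; [split|split].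
- exact: zs_Linf.
- exact: unitary_zs.
- rewrite (_ : (fun t => _) = fun t => - zs (- N%:Z) (fun t => U t - (Psi t + K t)) t).
    exact: mx_HinfN.
  by apply/funext => t; rewrite zsB opprB -[in LHS]ePK.
- exact: wh_zs.
- by move=> i j ij; rewrite lerD2l e1.
- by move=> i ir; have := e2 i ir; lia.
- by move=> i ir; rewrite (e3 i ir) addKr.
Qed.

(** The parametrization with N = 0 and E = 1: no coefficient of E is prescribed. *)
Lemma nehari n (Psi : R -> 'M[C]_n) (k : R) : 0 <= k -> k < 1 -> mx_in (@Linf R) Psi -> hankel_le k Psi ->
  exists U, [/\ mx_in (@Linf R) U, unitary_ae U & mx_in (@Hinf R) (fun t => U t - Psi t)].
Proof.
move=> k0 k1 lP hkP; have lPT := mx_in_tr lP; have hkT := hankel_tr k0 lP hkP.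
have [p [q [be [ga [th _]]]]] := half_thetaP k0 k1 lP hkP.
have [p' [q' [be' [ga' [th' [hga _]]]]]] := half_thetaP k0 k1 lPT hkT.
have hK : mx_in (@Hinf R) (fun _ : R => 0 : 'M[C]_n) by exact: mx_Hinf_cst.
have [L1 hL1 hF] := step_L th th' hga 0 hK.
have h1 : mx_in (@Hinf R) (fun _ : R => 1%:M : 'M[C]_n) by exact: mx_Hinf_cst.
have u1 : unitary_ae (fun _ : R => 1%:M : 'M[C]_n) by apply: aeI_W => t _; rewrite adjmx1 mulmx1.
have hEL : mx_in (@Hinf R) (zs (- 0%:Z) (fun t => 1%:M - L1 t)).
  by rewrite oppr0 zs0; exact: mx_HinfB.
have [U [D1 [D2 [D1i [D2i [[LU uU hU eU] _]]]]]] := step_U k0 k1 lP hkP th th' hK hL1 hF h1 u1 hEL.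
exists U; split=> //; move: hU; rewrite oppr0 zs0.
by under eq_fun do rewrite addr0.
Qed.

(** G / (2 e) has Hankel norm at most 1/2; losing a factor 2 avoids the extremal case of Nehari's
    theorem. *)
Lemma nehari_scaled n (G : R -> 'M[C]_n) (e : R) : 0 < e -> mx_in (@Linf R) G -> hankel_le e G ->
  exists2 F, mx_in (@Hinf R) F & aeI (fun t => forall v, vsq ((G t - F t) *m v) <= (2 * e) ^+ 2 * vsq v).
Proof.
move=> e0 lG hG; pose c : R := (2 * e)^-1.
have c0 : 0 < c by rewrite invr_gt0 mulr_gt0.
have ci : c^-1 = 2 * e by rewrite invrK.
pose Psi t := c%:C%C *: G t.
have Zin (P : (R -> C) -> Prop) (a : C) (F : R -> 'M[C]_n) : (forall f, P f -> P (fun t => a * f t)) ->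
   mx_in P F -> mx_in P (fun t => a *: F t).
  by move=> H hF i j; under eq_fun do rewrite mxE; exact/H/hF.
have lP : mx_in (@Linf R) Psi by apply: Zin lG => f hf; apply: LinfM => //; exact: Linf_cst.
have h2 : 0 <= (2^-1 : R) by rewrite invr_ge0.
have hP : hankel_le 2^-1 Psi.
  move=> f g hf hg hfg.
  have Lg := mx_H2m_L2 hg.
  have : l2norm (fun t => (c^-1)%:C%C *: g t) <= e * l2norm f.
    apply: hG => //.
      by move=> i j; under eq_fun do rewrite mxE; apply: H2m_cstM; exact: hg.
    rewrite (_ : (fun t => _) = fun t => (c^-1)%:C%C *: (Psi t *m f t - g t)).
      move=> i j; under eq_fun do rewrite mxE.
      by apply: (@Hinf_H2M _ (fun=> (c^-1)%:C%C)); [exact: Hinf_cst|exact: hfg].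
    apply/funext => t; rewrite /Psi scalerBr -scalemxAl scalerA -CrM mulVf ?gt_eqF//.
    by rewrite scale1r.
  rewrite (l2normZ _ Lg) cabs_Cr ci ger0_norm ?mulr_ge0 ?(ltW e0)//.
  by rewrite [2 * e]mulrC -mulrA ler_pM2l// -ler_pdivlMl.
have [|U [LU uU hU]] := nehari h2 _ lP hP; first by rewrite invf_lt1// ltr1n.
exists (fun t => - ((2 * e)%:C%C *: (U t - Psi t))).
  by apply: mx_HinfN; apply: Zin hU => f hf; apply: HinfM => //; exact: Hinf_cst.
apply: aeI_S uU => t _ u v; rewrite opprK scalerBr /Psi scalerA -CrM mulfV ?gt_eqF ?mulr_gt0//.
rewrite scale1r addrC subrK -scalemxAl vsqZ cabs_Cr ger0_norm ?mulr_ge0 ?(ltW e0)//.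
by rewrite vsq_unitary.
Qed.
End Interp.

(** * Closedness of HinfC *)

Section VP.
Variable (R : realType).
Local Notation C := R[i].
Local Notation Re := complex.Re.
Local Notation Im := complex.Im.
Local Notation mu := (@lebesgue_measure R).

Lemma n2_trig (c : nat -> C) (kap : nat -> int) M : injective kap ->
  n2 (fun t : R => \sum_(k < M) c k * ee t ^ kap k) = \sum_(k < M) cabs (c k) ^+ 2.
Proof.
move=> inj; set f := fun t : R => _.
have Lf : L2 f by apply: L2_sum => k _; exact: L2_eezZ.
have cfE j : (j < M)%N -> fcoef f (kap j) = c j.
  move=> jM; rewrite /f fcoef_sum; last by move=> k _; apply: L2_L1; exact: L2_eezZ.
  under eq_bigr do rewrite (fcoefZ _ _ (Linf_L1 (@Linf_eez R _))) fcoef_eez.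
  rewrite (bigD1 (Ordinal jM))//= eqxx mulr1 big1 ?addr0// => k kj.
  case: eqP => [/inj e|]; last by rewrite mulr0.
  by case/eqP: kj; apply/val_inj.
have := n2_psum f inj 0 M; rewrite big_mkord.
have -> : psum kap f 0 M = f.
  by apply/funext => t; rewrite /psum big_mkord; apply: eq_bigr => k _; rewrite cfE.
by move=> ->; apply: eq_bigr => k _; rewrite cfE.
Qed.

(* g is z^-M times the convolution of F with the kernel M^-1 conj(D_M) D_2M, whose
   L1 norm is at most sqrt 2 and whose coefficients of index 0 to M are 1. *)
Lemma vp (F : R -> C) (B : R) M : (0 < M)%N -> 0 <= B -> Hinf F -> aeI (fun t => cabs (F t) <= B) ->
  exists g : R -> C, [/\ trig g, forall s, cabs (g s) <= 2 * B & Hinf (fun t => F t * ee t ^ (- M%:Z) - g t)].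
Proof.
move=> M0 B0 hF hB; have LF := Linf_L1 hF.1.
have Mn0 : (M%:R : R) != 0 by rewrite pnatr_eq0 -lt0n.
pose w : C := (M%:R^-1)%:C%C.
pose g s : C := \sum_(a < M) \sum_(b < (M + M)%N) (w * fcoef F (b%:Z - a%:Z)) * ee s ^ (b%:Z - a%:Z - M%:Z).
have tg : trig g.
  by apply: trig_sum => a; apply: trig_sum => b; constructor.
exists g; split=> //.
- move=> s.
  (* [A] and [D] are D_M and conj D_2M centred at s. Up to a unimodular factor and 1 / M, g s is the
     integral of F A D, and Cauchy-Schwarz applies with [n2 A] equal to M and that of D to 2 M. *)
  pose A t : C := \sum_(a < M) (ee s ^ (- a%:Z)) * ee t ^ a%:Z.
  pose D t : C := \sum_(b < (M + M)%N) (ee s ^ b%:Z) * ee t ^ (- b%:Z).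
  have LA : Linf A by apply: Linf_sum => a _; apply: LinfM; [exact: Linf_cst|exact: Linf_eez].
  have LD : Linf D by apply: Linf_sum => a _; apply: LinfM; [exact: Linf_cst|exact: Linf_eez].
  have LFA : Linf (fun t => F t * A t) by apply: LinfM => //; exact: hF.1.
  have eg : g s = ee s ^ (- M%:Z) * (w * cint (fun t => F t * A t * D t)).
    have -> : cint (fun t => F t * A t * D t) = \sum_(a < M) \sum_(b < (M + M)%N) fcoef F (b%:Z - a%:Z) * ee s ^ (b%:Z - a%:Z).
      have e2 : (fun t => F t * A t * D t) = fun t => \sum_(a < M) \sum_(b < (M + M)%N) (ee s ^ (b%:Z - a%:Z)) * (F t * ee t ^ (- (b%:Z - a%:Z))).
        apply/funext => t; rewrite /A /D [F t * _]mulr_sumr mulr_suml; apply: eq_bigr => a _.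
        rewrite mulr_sumr; apply: eq_bigr => b _.
        by rewrite opprB !eezD; ring.
      have L1t (a b : int) : L1 (fun t => ee s ^ a * (F t * ee t ^ b)) by apply: L1Z; exact: L1_eez.
      rewrite e2 cint_sum; last by move=> a _; apply: L1_sum => b _; exact: L1t.
      apply: eq_bigr => a _; rewrite cint_sum; last by move=> b _; exact: L1t.
      by apply: eq_bigr => b _; rewrite (cintZ _ (L1_eez _ LF)) [LHS]mulrC.
    rewrite /g !mulr_sumr; apply: eq_bigr => a _; rewrite !mulr_sumr; apply: eq_bigr => b _.
    by rewrite !eezD; ring.
  have n2A : n2 A = M%:R.
    rewrite /A (n2_trig (fun a => ee s ^ (- a%:Z))) ; last by move=> a b [].
    under eq_bigr do rewrite cabs_eez expr1n.
    by rewrite sumr_const card_ord.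
  have n2D' : n2 (fun t => conjc (D t)) = (M + M)%:R.
    have -> : n2 (fun t => conjc (D t)) = n2 D by congr rint; apply/funext => t; rewrite cabsJ.
    rewrite /D (n2_trig (fun b => ee s ^ b%:Z) (kap := fun b => - b%:Z)) ; last by move=> a b /oppr_inj [].
    under eq_bigr do rewrite cabs_eez expr1n.
    by rewrite sumr_const card_ord.
  have n2FA : n2 (fun t => F t * A t) <= B ^+ 2 * M%:R.
    have /L2E[_ i1] := Linf_L2 LFA; have /L2E[_ i2] := Linf_L2 LA.
    rewrite -n2A /n2 -rintZ//; apply: rint_le => //; first exact: RI_Z.
    apply: aeI_S hB => t _ h; rewrite cabsM exprMn ler_wpM2r ?sqr_ge0//.
    by rewrite lerXn2r ?nnegrE ?cabs_ge0.
  have cs := ipc_CS (Linf_L2 LFA) (L2J (Linf_L2 LD)).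
  have eI : ipc (fun t => F t * A t) (fun t => conjc (D t)) = cint (fun t => F t * A t * D t).
    by rewrite /ipc; under eq_fun do rewrite conjcK.
  have le : cabs (cint (fun t => F t * A t * D t)) <= 2 * B * M%:R.
    rewrite -(@ler_pXn2r _ 2)// ?nnegrE ?cabs_ge0 ?mulr_ge0//.
    rewrite -eI (le_trans cs)// n2D'; apply: le_trans (_ : B ^+ 2 * M%:R * (M + M)%:R <= _).
      by rewrite ler_wpM2r.
    have -> : ((M + M)%:R : R) = 2 * M%:R by rewrite natrD; ring.
    have -> : B ^+ 2 * M%:R * (2 * M%:R) = 2 * (B * M%:R) ^+ 2 by ring.
    have -> : (2 * B * M%:R) ^+ 2 = 4 * (B * M%:R) ^+ 2 by ring.
    by rewrite ler_wpM2r ?sqr_ge0// ler_nat.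
  rewrite eg !cabsM cabs_eez mul1r /w cabs_Cr ger0_norm ?invr_ge0//.
  by rewrite ler_pdivrMl ?ltr0n// mulrC.
- have Lg := trig_Linf tg.
  split; first by apply: LinfB => //; apply: LinfM; [exact: hF.1|exact: Linf_eez].
  move=> k k0; rewrite fcoefB; [|exact: L1_eez|exact: Linf_L1].
  rewrite fcoef_shift opprK /g fcoef_sum; last first.
    by move=> a _; apply: Linf_L1; apply: Linf_sum => b _; apply: LinfM; [exact: Linf_cst|exact: Linf_eez].
  have e1 (a : 'I_M) : fcoef (fun t : R => \sum_(b < (M + M)%N) w * fcoef F (b%:Z - a%:Z) * ee t ^ (b%:Z - a%:Z - M%:Z)) k = w * fcoef F (k + M%:Z).
    rewrite fcoef_sum; last by move=> b _; apply: Linf_L1; apply: LinfM; [exact: Linf_cst|exact: Linf_eez].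
    under eq_bigr do rewrite (fcoefZ _ _ (Linf_L1 (@Linf_eez R _))) fcoef_eez.
    have [kM|kM] := ltP (k + M%:Z) 0.
      rewrite hF.2// mulr0 big1// => b _; case: eqP => [e|]; last by rewrite mulr0.
      by rewrite (_ : b%:Z - a%:Z = k + M%:Z) ?hF.2 ?mulr0 ?mul0r//; lia.
    (* For each a exactly one b = a + l contributes; it is in range because k < 0 gives l < M. This
       is why the second kernel has length 2 M. *)
    have [l el] : exists l : nat, k + M%:Z = l%:Z by exists (absz (k + M%:Z)); lia.
    have lb : (a + l < M + M)%N by have := ltn_ord a; lia.
    rewrite (bigD1 (Ordinal lb))//= big1 ?addr0.
      rewrite (_ : k == _) ?mulr1; last by apply/eqP; lia.
      by rewrite el; congr (_ * fcoef F _); lia.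
    move=> b ne; case: eqP => [e|]; last by rewrite mulr0.
    by case/eqP: ne; apply/val_inj => /=; lia.
  under eq_bigr do rewrite e1.
  rewrite sumr_const card_ord -mulr_natl mulrA.
  have -> : M%:R * w = 1.
    rewrite /w; have -> : (M%:R : C) = (M%:R : R)%:C%C by rewrite rmorph_nat.
    by rewrite -CrM mulfV.
  by rewrite mul1r subrr.
Qed.

(** The limit is the supremum of the lower ends of the intervals with centre a_m and radius 2 c
    2^-m, every one of which contains it. *)
Lemma geo_lim (a : nat -> R) (c : R) : 0 <= c -> (forall m, `|a m.+1 - a m| <= c * 2^-1 ^+ m) ->
  exists l, forall m, `|l - a m| <= 2 * c * 2^-1 ^+ m.
Proof.
move=> c0 h.
have hk m k : `|a (m + k)%N - a m| <= 2 * c * 2^-1 ^+ m - 2 * c * 2^-1 ^+ (m + k).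
  elim: k => [|k IH]; first by rewrite addn0 !subrr normr0.
  rewrite addnS -[a _ - a m](subrKA (a (m + k)%N)) (le_trans (ler_normD _ _))//.
  have h' := h (m + k)%N; rewrite exprS; set z := 2^-1 ^+ (m + k) in IH h' *.
  have -> : 2 * c * (2^-1 * z) = c * z by rewrite mulrA [2 * c]mulrC mulfK.
  lra.
have p0 m : 0 <= 2 * c * (2^-1 : R) ^+ m by rewrite !mulr_ge0 ?exprn_ge0.
pose S := [set x : R | exists m, x = a m - 2 * c * 2^-1 ^+ m].
have ub m : ubound S (a m + 2 * c * 2^-1 ^+ m).
  move=> x [k ->]; have [mk|km] := leqP m k.
    have := hk m (k - m)%N; rewrite subnKC// ler_norml => /andP[_]; have := p0 k; have := p0 m; lra.
  have := hk k (m - k)%N; rewrite (subnKC (ltnW km)) ler_norml => /andP[+ _]; have := p0 k; have := p0 m.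
  by move: (2 * c * 2^-1 ^+ m) (2 * c * 2^-1 ^+ k) => y z; lra.
have S0 : S !=set0 by exists (a 0%N - 2 * c * 2^-1 ^+ 0), 0%N.
have hS : has_sup S by split=> //; exists (a 0%N + 2 * c * 2^-1 ^+ 0); exact: ub.
exists (sup S) => m; rewrite ler_norml lerBrDr lerBlDr; apply/andP; split.
  by apply: ub_le_sup; [case: hS|exists m; rewrite addrC].
by rewrite addrC; apply: ge_sup => //; exact: ub.
Qed.

Lemma trig_cont (f : R -> C) : trig f ->
  [/\ continuous (fun t => Re (f t)), continuous (fun t => Im (f t)) & forall t, f (t + 1) = f t].
Proof.
elim=> [c k|{}f g _ [f1 f2 f3] _ [g1 g2 g3]].
  have cc : continuous (fun t : R => cos (2 * pi * (k%:~R * t)) : R).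
    move=> t; apply: (@continuous_comp _ _ _ (fun t : R => 2 * pi * (k%:~R * t)) (@cos R)); last exact: continuous_cos.
    by apply: cvgM; [exact: cvg_cst|apply: cvgM; [exact: cvg_cst|exact: cvg_id]].
  have cs : continuous (fun t : R => sin (2 * pi * (k%:~R * t)) : R).
    move=> t; apply: (@continuous_comp _ _ _ (fun t : R => 2 * pi * (k%:~R * t)) (@sin R)); last exact: continuous_sin.
    by apply: cvgM; [exact: cvg_cst|apply: cvgM; [exact: cvg_cst|exact: cvg_id]].
  split.
  - under eq_fun do rewrite -ee_intM cReM /=.
    by move=> t; apply: cvgB; apply: cvgM; [exact: cvg_cst|exact: cc|exact: cvg_cst|exact: cs].
  - under eq_fun do rewrite -ee_intM cImM /=.
    by move=> t; apply: cvgD; apply: cvgM; [exact: cvg_cst|exact: cs|exact: cvg_cst|exact: cc].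
  - by move=> t; rewrite eeD ee1 mulr1.
split.
- by under eq_fun do rewrite cReD; move=> t; apply: cvgD; [exact: f1|exact: g1].
- by under eq_fun do rewrite cImD; move=> t; apply: cvgD; [exact: f2|exact: g2].
- by move=> t; rewrite f3 g3.
Qed.

Lemma unif_lim_cont (S : nat -> R -> R) (G : R -> R) (c : R) : 0 < c -> (forall m, continuous (S m)) ->
  (forall m t, `|G t - S m t| <= c * 2^-1 ^+ m) -> continuous G.
Proof.
move=> c0 cS h t; apply/cvgrPdist_le => e e0.
have [m hm] : exists m : nat, c * 2^-1 ^+ m <= e / 3.
  have [m hm] : exists m : nat, 3 * c / e <= m%:R.
    by exists (Num.bound (3 * c / e)); apply/ltW/archi_boundP; rewrite divr_ge0 ?mulr_ge0 ?ltW.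
  exists m; rewrite exprVn ler_pdivrMr ?exprn_gt0// mulrAC ler_pdivlMr// mulrC.
  move: hm; rewrite ler_pdivrMr// => hm; apply: le_trans hm _; rewrite mulrC ler_wpM2l ?(ltW e0)//.
  by rewrite -natrX ler_nat ltnW// ltn_expl.
have e3 : 0 < e / 3 by rewrite divr_gt0.
have /cvgrPdist_le /(_ _ e3) := cS m t; apply: filterS => s hs.
have h1 := h m t; have h2 := h m s.
move: hs h1 h2; rewrite !ler_norml => /andP[a1 a2] /andP[b1 b2] /andP[d1 d2].
by apply/andP; split; lra.
Qed.

(** Consecutive approximants differ by z^-M F with F small and in Hinf; [vp] yields a trigonometric
    polynomial of comparable size that absorbs the nonanalytic part. These polynomials sum uniformly
    to a continuous function, and f minus that function is a uniform limit of functions in Hinf. *)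
Lemma HinfC_closed (f : R -> C) : cmeas f ->
  (forall e : R, 0 < e -> exists (M : nat) (F : R -> C), Hinf F /\ aeI (fun t => cabs (f t - F t * ee t ^ (- M%:Z)) <= e)) ->
  HinfC f.
Proof.
move=> mf happ; split=> //.
have p0 m : 0 < (2^-1 : R) ^+ m by rewrite exprn_gt0.
have hex1 (m : nat) : exists MF : nat * (R -> C), Hinf MF.2 /\
   aeI (fun t => cabs (f t - MF.2 t * ee t ^ (- MF.1%:Z)) <= 2^-1 ^+ m).
  by have [M [F hF]] := happ _ (p0 m); exists (M, F).
have [MF hMF] := choice hex1.
pose u m t := (MF m).2 t * ee t ^ (- (MF m).1%:Z).
have Lu m : Linf (u m) by apply: LinfM; [exact: (hMF m).1.1|exact: Linf_eez].
have hex2 (m : nat) : exists g : R -> C, [/\ trig g, forall s, cabs (g s) <= 4 * 2^-1 ^+ m &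
    Hinf (fun t => u m.+1 t - u m t - g t)].
  (* The exponent clears both negative powers of z; the successor provides [0 < M]. *)
  pose M := ((MF m).1 + (MF m.+1).1).+1.
  pose F t := (MF m.+1).2 t * ee t ^ ((MF m).1%:Z + 1) - (MF m).2 t * ee t ^ ((MF m.+1).1%:Z + 1).
  have hF : Hinf F.
    apply: HinfD; [|apply: HinfN]; apply: HinfM; try exact: (hMF _).1; exact: Hinf_eez.
  have eF t : F t * ee t ^ (- M%:Z) = u m.+1 t - u m t.
    by rewrite /F /u mulrBl -!mulrA -!eezD; congr (_ * ee t ^ _ - _ * ee t ^ _); rewrite /M; lia.
  have bF : aeI (fun t => cabs (F t) <= 2 * 2^-1 ^+ m).
    apply: aeI_S2 (hMF m).2 (hMF m.+1).2 => t _; rewrite -/(u m t) -/(u m.+1 t) => h1 h2.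
    have -> : cabs (F t) = cabs (u m.+1 t - u m t) by rewrite -eF cabsM cabs_eez mulr1.
    have -> : u m.+1 t - u m t = (f t - u m t) - (f t - u m.+1 t) by rewrite opprB [RHS]addrC addrA subrK.
    rewrite (le_trans (cabsD _ _))// cabsN.
    have h3 : (2^-1 : R) ^+ m.+1 <= 2^-1 ^+ m by rewrite exprS ler_piMl ?(ltW (p0 m))// invf_le1// ler1n.
    by move: h1 h2 h3 => h1 h2 h3; lra.
  have B0 : 0 <= 2 * (2^-1 : R) ^+ m by rewrite mulr_ge0// ltW.
  have [g [tg bg hg]] := vp (ltn0Sn _ : (0 < M)%N) B0 hF bF.
  exists g; split=> //; first by move=> s; rewrite (le_trans (bg s))// mulrA -natrM.
  by move: hg; under eq_fun do rewrite eF.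
have [g hg] := choice hex2.
have [gz [tgz hgz]] : exists gz, trig gz /\ Hinf (fun t => u 0%N t - gz t).
  pose F t := (MF 0%N).2 t * ee t ^ 1%:Z.
  have hF : Hinf F by apply: HinfM; [exact: (hMF _).1|exact: Hinf_eez].
  have [B B0 hB] := Linf_bound hF.1.
  have [g' [tg _ hg']] := vp (ltn0Sn (MF 0%N).1) B0 hF hB.
  exists g'; split=> //; move: hg'; rewrite /F /u; under eq_fun do rewrite -mulrA -eezD.
  by have -> : 1%:Z - (MF 0%N).1.+1%:Z = - (MF 0%N).1%:Z by lia.
pose S m t := gz t + \sum_(j < m) g j t.
have tS m : trig (S m).
  by apply: trig_add => //; apply: trig_sum => j; case: (hg j).
have hS m : Hinf (fun t => u m t - S m t).
  elim: m => [|m IH]; first by move: hgz; rewrite /S; under [in X in _ -> X]eq_fun do rewrite big_ord0 addr0.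
  have [_ _ h] := hg m.
  rewrite (_ : (fun t => _) = fun t => (u m.+1 t - u m t - g m t) + (u m t - S m t)); first exact: HinfD.
  by apply/funext => t; rewrite /S big_ord_recr/=; ring.
have dS m t : cabs (S m.+1 t - S m t) <= 4 * 2^-1 ^+ m.
  have [_ h _] := hg m; rewrite (_ : S m.+1 t - S m t = g m t)//.
  by rewrite /S big_ord_recr/=; ring.
have hex3 t : exists G : C, forall m, `|Re G - Re (S m t)| <= 8 * 2^-1 ^+ m /\ `|Im G - Im (S m t)| <= 8 * 2^-1 ^+ m.
  have c4 : 0 <= (4 : R) by [].
  have [|a ha] := @geo_lim (fun m => Re (S m t)) 4 c4.
    by move=> m; rewrite -cReN -cReD; exact: le_trans (Re_le_cabs _) (dS m t).
  have [|b hb] := @geo_lim (fun m => Im (S m t)) 4 c4.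
    by move=> m; rewrite -cImN -cImD; exact: le_trans (Im_le_cabs _) (dS m t).
  exists (Complex a b) => m; split; [have := ha m|have := hb m]; by rewrite -natrM.
have [G0 hG0] := choice hex3.
have c8 : 0 < (8 : R) by [].
(* [G0] comes from pointwise choice, so its periodicity is recovered from the estimate, which
   determines its values. *)
have G0per t : G0 (t + 1) = G0 t.
  have Sper m : S m (t + 1) = S m t by have [_ _ ->] := trig_cont (tS m).
  have eq (x y : R) : (forall m, `|x - y| <= 16 * 2^-1 ^+ m) -> x = y.
    move=> H; apply/eqP; rewrite -subr_eq0 -normr_le0; apply/ler_addgt0Pr => e e0; rewrite add0r.
    have [m hm] : exists m : nat, 16 / e <= m%:R.
      by exists (Num.bound (16 / e)); apply/ltW/archi_boundP; rewrite divr_ge0 ?ltW.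
    apply: le_trans (H m) _; rewrite exprVn ler_pdivrMr ?exprn_gt0//.
    move: hm; rewrite ler_pdivrMr// => hm; apply: le_trans hm _; rewrite mulrC ler_wpM2l ?(ltW e0)//.
    by rewrite -natrX ler_nat ltnW// ltn_expl.
  apply: complex_eqP; apply: eq => m; have [a1 a2] := hG0 t m; have [b1 b2] := hG0 (t + 1) m; rewrite Sper in b1 b2.
    by move: a1 b1; rewrite !ler_norml => /andP[? ?] /andP[? ?]; apply/andP; split; lra.
  by move: a2 b2; rewrite !ler_norml => /andP[? ?] /andP[? ?]; apply/andP; split; lra.
have cRe : continuous (fun t => Re (G0 t)).
  by apply: (unif_lim_cont c8 (S := fun m t => Re (S m t))) => [m|m t]; [case: (trig_cont (tS m))|case: (hG0 t m)].
have cIm : continuous (fun t => Im (G0 t)).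
  by apply: (unif_lim_cont c8 (S := fun m t => Im (S m t))) => [m|m t]; [case: (trig_cont (tS m))|case: (hG0 t m)].
have mG : cmeas G0.
  have m (F : R -> R) : continuous F -> measurable_fun (@I01 R) F.
    by move=> cF; apply: (@measurable_funS _ _ _ _ setT) => //; exact: continuous_measurable_fun.
  by split; exact: m.
have dG m t : cabs (G0 t - S m t) <= 16 * 2^-1 ^+ m.
  apply: le_trans (cabs_le_ReIm _) _; rewrite cReD cImD cReN cImN.
  by have [a b] := hG0 t m; lra.
have bd m : aeI (fun t => cabs ((f t - G0 t) - (u m t - S m t)) <= 17 * 2^-1 ^+ m).
  apply: aeI_S (hMF m).2 => t _; rewrite -/(u m t) => h.
  have -> : f t - G0 t - (u m t - S m t) = (f t - u m t) - (G0 t - S m t) by ring.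
  by rewrite (le_trans (cabsD _ _))// cabsN; have := dG m t; lra.
have mh : cmeas (fun t => f t - G0 t) by exact: cmeasB.
have Lh : Linf (fun t => f t - G0 t).
  split=> //; have [B _ hB] := Linf_bound (hS 0%N).1.
  exists (17 + B); apply: aeI_S2 (bd 0%N) hB => t _; rewrite expr0 mulr1 => h1 h2.
  by rewrite -[f t - G0 t](subrK (u 0%N t - S 0%N t)) (le_trans (cabsD _ _))// lerD.
exists (fun t => f t - G0 t), G0; split; last first.
  split; last by apply: aeI_W => t _; rewrite subrK.
  by exists G0; split=> //; split=> //; split=> //; apply: aeI_W.
split=> // k k0; apply: cabs_eq0; apply/eqP; rewrite eq_le cabs_ge0 andbT.
apply/ler_addgt0Pr => e e0; rewrite add0r.
have [m hm] : exists m : nat, 17 / e <= m%:R.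
  by exists (Num.bound (17 / e)); apply/ltW/archi_boundP; rewrite divr_ge0 ?ltW.
have hm' : 17 * 2^-1 ^+ m <= e.
  rewrite exprVn ler_pdivrMr ?exprn_gt0//.
  move: hm; rewrite ler_pdivrMr// => hm; apply: le_trans hm _; rewrite mulrC ler_wpM2l ?(ltW e0)//.
  by rewrite -natrX ler_nat ltnW// ltn_expl.
have Ld : L1 (fun t => f t - G0 t - (u m t - S m t)) by apply: L1B; apply: Linf_L1 => //; exact: (hS m).1.
have -> : fcoef (fun t => f t - G0 t) k = fcoef (fun t => f t - G0 t - (u m t - S m t)) k.
  by rewrite [RHS]fcoefB ?(hS m).2 ?subr0//; apply: Linf_L1 => //; exact: (hS m).1.
apply: le_trans hm'; rewrite /fcoef.
have Lz := L1_eez (- k) Ld.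
apply: le_trans (cabs_cint Lz) _; rewrite -[leRHS](rint_cst (17 * 2^-1 ^+ m : R)).
apply: rint_le; [exact: Lz.2|exact: RI_cst|].
by apply: aeI_S (bd m) => t _ h; rewrite cabsM cabs_eez mulr1.
Qed.
End VP.

(** * Kernels of Toeplitz operators *)

Section Kernel.
Variable (R : realType).
Local Notation C := R[i].
Local Notation Re := complex.Re.
Local Notation Im := complex.Im.
Local Notation "A ^a" := (adjmx A) (at level 8, format "A ^a").
Local Notation unitary_ae U := (aeI (fun t => (U t)^a *m U t = 1%:M)).

Lemma fcoef_CS (f g : R -> C) l : L2 f -> L2 g ->
  cabs (fcoef (fun t => f t * g t) l) <= Num.sqrt (n2 f) * Num.sqrt (n2 g).
Proof.
move=> hf hg.
have -> : fcoef (fun t => f t * g t) l = ipc f (fun t => conjc (g t) * ee t ^ l).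
  by rewrite /fcoef /ipc; congr cint; apply/funext => t; rewrite cJM conjcK eezJ mulrA.
have hg' : L2 (fun t => conjc (g t) * ee t ^ l) by apply: L2_eez; exact: L2J.
have := ipc_CS hf hg'; have -> : n2 (fun t => conjc (g t) * ee t ^ l) = n2 g.
  by congr rint; apply/funext => t; rewrite cabsM cabs_eez mulr1 cabsJ.
move=> h; rewrite -(@ler_pXn2r _ 2)// ?nnegrE ?cabs_ge0 ?mulr_ge0 ?sqrtr_ge0//.
rewrite exprMn (sqr_sqrtr (n2_ge0 hf)) (sqr_sqrtr (n2_ge0 hg)).
exact: h.
Qed.

Lemma H1_poly (f : R -> C) m : L1 f -> (forall k : int, k < 0 -> fcoef f k = 0) ->
  (forall k : int, m%:Z <= k -> fcoef f k = 0) ->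
  aeI (fun t => f t = \sum_(l < m) fcoef f l%:Z * ee t ^ l%:Z).
Proof.
move=> Lf h1 h2; apply: L1_unique2 => //.
  by apply: L1_sum => k _; apply: L2_L1; exact: L2_eezZ.
move=> j; rewrite fcoef_sum; last by move=> k _; apply: L2_L1; exact: L2_eezZ.
under eq_bigr do rewrite (fcoefZ _ _ (Linf_L1 (@Linf_eez R _))) fcoef_eez.
have [j0|j0] := ltP j 0.
  rewrite h1// big1// => i _; case: eqP => [e|]; last by rewrite mulr0.
  by move: j0; rewrite e ltNge.
case: j j0 => // j _; have [jN|Nj] := ltnP j m.
  rewrite (bigD1 (Ordinal jN))//= eqxx mulr1 big1 ?addr0// => i ne.
  by case: eqP => [[e]|]; [case/eqP: ne; apply/val_inj|rewrite mulr0].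
rewrite h2// big1// => i _; case: eqP => [[e]|]; last by rewrite mulr0.
by have := ltn_ord i; rewrite -e ltnNge Nj.
Qed.

Lemma zdiag_adjE n (e : 'I_n -> int) (t : R) : (zdiag e t)^a = zdiag (fun i => - e i) t.
Proof.
apply/matrixP => i j; rewrite adjmxE !mxE.
by have [->|ne] := eqVneq i j; rewrite ?eqxx ?mulr1n ?eezJ// ?(eq_sym j) ?(negbTE ne) ?mulr0n ?conjc0.
Qed.

Lemma sqrt_n2_le n (k : R -> 'cV[C]_n) j : mx_in (@L2 R) k -> Num.sqrt (n2 (fun t => k t j ord0)) <= l2norm k.
Proof.
move=> hk; rewrite l2normE ler_wsqrtr// (nn_sum hk) (bigD1 j)//= lerDl.
by apply: sumr_ge0 => i _; exact: (n2_ge0 (hk i ord0)).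
Qed.

(** For k in the kernel of the adjoint Toeplitz operator, multiplying U^* k by the adjoint of Q1^-1
    shows that z^-e Q2 k is antianalytic; removing z^-e shifts the vanishing in component i to the
    indices from [e i] on. *)
Lemma wh_kernel n (U : R -> 'M[C]_n) e (Q1 Q2 Q1i Q2i : R -> 'M[C]_n) (k : R -> 'cV[C]_n) :
  mx_in (@H2 R) Q2 -> mx_in (@H2 R) Q1i ->
  aeI (fun t => [/\ U t = (Q2 t)^a *m zdiag e t *m Q1 t, Q1 t *m Q1i t = 1%:M & Q2 t *m Q2i t = 1%:M]) ->
  mx_in (@H2 R) k -> mx_in (@H2minus R) (fun t => (U t)^a *m k t) ->
  forall i l, e i <= l -> fcoef (fun t => (Q2 t *m k t) i ord0) l = 0.
Proof.
move=> h2 h1i hw hk hm i l il.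
have hx := mx_H2_H1M h2 hk.
have hy := mx_H2a_H2m h1i hm.
have mz : mx_in (@cmeas R) (fun t => zdiag (fun i => - e i) t *m (Q2 t *m k t)).
  apply: mx_cmeasM; first by apply: mx_Linf_meas; exact: zdiag_Linf.
  by apply: mx_cmeasM; exact: mx_H2_meas.
have hz : mx_in (@H1m R) (fun t => zdiag (fun i => - e i) t *m (Q2 t *m k t)).
  apply: (mx_in_ae (@H1m_ae R) mz) hy; apply: aeI_S hw => t _ [e1 e2 e3].
  by rewrite e1 !adjmxM adjmxK zdiag_adjE !mulmxA -adjmxM e2 adjmx1 mul1mx.
have [_ /(_ (l - e i))] := hz i ord0; rewrite subr_ge0 => /(_ il).
under eq_fun do rewrite /zdiag mul_diag_mx mxE [X in X * _]mxE mulrC.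
by rewrite fcoef_shift opprK subrK.
Qed.

(** By [wh_kernel] Q2 k is a vector of polynomials of degree below a common m, so k is a combination
    of the functions z^l times a column of Q2^-1. These functions need not lie in the kernel:
    spanning it with a bound on the coefficients, and independence, is what later estimates use. *)
Lemma ker_fin n (U : R -> 'M[C]_n) e : wh (@H2 R) U e ->
  exists (D : nat) (g : 'I_D -> R -> 'cV[C]_n) (Cst : R), [/\ 0 <= Cst, (forall a, mx_in (@H2 R) (g a)),
   (forall k, mx_in (@H2 R) k -> mx_in (@H2minus R) (fun t => (U t)^a *m k t) ->
     exists v : 'cV[C]_D, aeI (fun t => k t = \sum_a v a ord0 *: g a t) /\
       forall a, cabs (v a ord0) <= Cst * l2norm k) &
   (forall v : 'cV[C]_D, aeI (fun t => \sum_a v a ord0 *: g a t = 0) -> v = 0)].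
Proof.
move=> [Q1 [Q2 [Q1i [Q2i [[h1 h2 h1i h2i] hw]]]]].
pose m := (\sum_i absz (e i))%N.
have em i : e i <= m%:Z by rewrite /m (bigD1 i)//=; lia.
pose I := ('I_n * 'I_m)%type.
pose g (a : 'I_#|{: I}|) t : 'cV[C]_n := ee t ^ ((enum_val a).2 : nat)%:Z *: col (enum_val a).1 (Q2i t).
pose Cst : R := \sum_(i < n) \sum_(j < n) Num.sqrt (n2 (fun t => Q2 t i j)).
have sg (v : 'cV[C]_#|{: I}|) t : \sum_a v a ord0 *: g a t =
    Q2i t *m (\col_i \sum_(l < m) v (enum_rank (i, l)) ord0 * ee t ^ l%:Z).
  rewrite (reindex (@enum_rank I)) /=; last first.
    by exists enum_val => x _; [exact: enum_rankK|exact: enum_valK].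
  apply/matrixP => a b; rewrite summxE mxE.
  rewrite (eq_bigr (fun p : I => (v (enum_rank (p.1, p.2)) ord0 *: g (enum_rank (p.1, p.2)) t) a b)); last by case.
  rewrite -(pair_bigA _ (fun i l => (v (enum_rank ((i, l) : I)) ord0 *: g (enum_rank ((i, l) : I)) t) a b)) /=.
  apply: eq_bigr => i _; rewrite mxE mulr_sumr; apply: eq_bigr => l _.
  by rewrite /g enum_rankK /= !mxE; ring.
exists #|{: I}|, g, Cst; split.
- by apply: sumr_ge0 => i _; apply: sumr_ge0 => j _; exact: sqrtr_ge0.
- move=> a i j; rewrite /g; under eq_fun do rewrite !mxE mulrC.
  by apply: H2_eez => //; exact: h2i.
- move=> k hk hm; have Lk := mx_H2_L2 hk; have L2Q := mx_H2_L2 h2.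
  have hx := mx_H2_H1M h2 hk.
  exists (\col_(a < #|{: I}|) fcoef (fun t => (Q2 t *m k t) (enum_val a).1 ord0) ((enum_val a).2 : nat)%:Z); split.
    have hx2 : aeI (fun t => forall i, (Q2 t *m k t) i ord0 =
       \sum_(l < m) fcoef (fun t => (Q2 t *m k t) i ord0) l%:Z * ee t ^ l%:Z).
      apply: aeI_forall => i; apply: H1_poly; [exact: (hx i ord0).1|exact: (hx i ord0).2|].
      by move=> l ml; apply: (wh_kernel h2 h1i hw hk hm); exact: le_trans (em i) ml.
    apply: aeI_S2 hw hx2 => t _ [_ _ e3] hxt; rewrite sg.
    rewrite -[LHS]mul1mx -(mulmx1C e3) -mulmxA; congr (_ *m _).
    apply/matrixP => i j; rewrite (ord1 j) hxt mxE; apply: eq_bigr => l _.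
    by rewrite mxE enum_rankK.
  suff bd (i : 'I_n) (l : int) : cabs (fcoef (fun t => (Q2 t *m k t) i ord0) l) <= Cst * l2norm k.
    by move=> a; rewrite mxE; exact: bd.
  have -> : (fun t => (Q2 t *m k t) i ord0) = (fun t => \sum_j Q2 t i j * k t j ord0).
    by apply/funext => t; rewrite mxE.
  rewrite (@fcoef_sum R _ _ _ (fun j t => Q2 t i j * k t j ord0)); last by move=> j _; apply: L2_L1M; [exact: L2Q|exact: Lk].
  apply: le_trans (cabs_sum _ _ _) _.
  apply: le_trans (_ : \sum_(j < n) Num.sqrt (n2 (fun t => Q2 t i j)) * l2norm k <= _).
    apply: ler_sum => j _; apply: le_trans (fcoef_CS _ (L2Q i j) (Lk j ord0)) _.
    by rewrite ler_wpM2l ?sqrtr_ge0//; exact: sqrt_n2_le.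
  rewrite -mulr_suml ler_wpM2r ?l2norm_ge0// /Cst [leRHS](bigD1 i)//= lerDl.
  by apply: sumr_ge0 => i' _; apply: sumr_ge0 => j _; exact: sqrtr_ge0.
- move=> v hv.
  have hz : aeI (fun t => forall i, \sum_(l < m) v (enum_rank (i, l)) ord0 * ee t ^ l%:Z = 0).
    apply: aeI_S2 hw hv => t _ [_ _ e3]; rewrite sg => e0 i.
    have := congr1 (mulmx (Q2 t)) e0; rewrite mulmxA e3 mul1mx mulmx0.
    by move=> /(congr1 (fun M => fun_of_matrix M i ord0)); rewrite !mxE.
  apply/matrixP => a j; rewrite (ord1 j) [RHS]mxE -[a]enum_valK; case: (enum_val a) => i l.
  have : fcoef (fun t : R => \sum_(l < m) v (enum_rank (i, l)) ord0 * ee t ^ l%:Z) l%:Z = fcoef (fun=> 0 : C) l%:Z.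
    apply: fcoef_ae; last by apply: aeI_S hz => t _ ->.
      by apply: cmeas_sum => k _; apply: cmeasM; [case: (@Linf_cst R (v (enum_rank (i, k)) ord0))|exact: cmeas_eez].
    by case: (@Linf_cst R 0).
  rewrite fcoef_cst mul0r fcoef_sum; last by move=> k _; apply: L2_L1; exact: L2_eezZ.
  under eq_bigr do rewrite (fcoefZ _ _ (Linf_L1 (@Linf_eez R _))) fcoef_eez.
  rewrite (bigD1 l)//= eqxx mulr1 big1 ?addr0// => k kl.
  by case: eqP => [[ek]|]; [case/eqP: kl; apply/val_inj|rewrite mulr0].
Qed.

Lemma apx_hankel n (U : R -> 'M[C]_n) (ep : R) : apx U -> 0 < ep -> exists N : nat, hankel_le ep (zs N%:Z U).
Proof.
move=> [LU hU] e0; have [N [F [hF hs]]] := hU _ e0; exists N => f g hf hg hfg.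
have Ld : mx_in (@Linf R) (fun t => zs N%:Z U t - F t) by apply: mx_LinfB; [exact: zs_Linf|exact: mx_Hinf_Linf].
apply: (hankel_le_sup (ltW e0) Ld hs hf hg).
rewrite (_ : (fun t => _) = fun t => (zs N%:Z U t *m f t - g t) - F t *m f t).
  by apply: mx_H2B; [exact: hfg|exact: mx_Hinf_H2M].
by apply/funext => t; rewrite mulmxBl addrAC.
Qed.

Lemma shift_orth_vec n (g : R -> 'cV[C]_n) (e : R) : mx_in (@L2 R) g -> 0 < e ->
  exists M0 : nat, forall M, (M0 <= M)%N -> forall h, mx_in (@H2minus R) h ->
    cabs (vip h (zs M%:Z g)) <= e * l2norm h.
Proof.
move=> hg e0; pose e' := e / n.+1%:R.
have e'0 : 0 < e' by rewrite divr_gt0.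
have hex (i : 'I_n) := shift_orth (hg i ord0) e'0.
have [M0 hM0] := choice hex.
exists (\sum_i M0 i)%N => M MM h hh; have Lh := mx_H2m_L2 hh.
rewrite /vip; apply: le_trans (cabs_sum _ _ _) _.
apply: le_trans (_ : \sum_(i < n) e' * l2norm h <= _).
  apply: ler_sum => i _; under [X in ipc _ X]eq_fun do rewrite zsE.
  apply: le_trans (hM0 i M _ _ (hh i ord0)) _; first by rewrite (leq_trans _ MM)// (bigD1 i)//= leq_addr.
  by rewrite ler_wpM2l ?(ltW e'0)//; exact: sqrt_n2_le.
rewrite sumr_const card_ord -mulrnAl ler_wpM2r ?l2norm_ge0// -mulr_natr /e' mulrAC.
by rewrite ler_pdivrMr// ler_wpM2l ?(ltW e0)// ler_nat.
Qed.
End Kernel.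

(** * Hankel operators of the adjoint and membership in QC *)

Section QCpart.
Variable (R : realType).
Local Notation C := R[i].
Local Notation Re := complex.Re.
Local Notation Im := complex.Im.
Local Notation "A ^a" := (adjmx A) (at level 8, format "A ^a").
Local Notation unitary_ae U := (aeI (fun t => (U t)^a *m U t = 1%:M)).

Lemma mulmx_sum_cols m D (X : 'M[C]_(m, D)) (v : 'cV[C]_D) : X *m v = \sum_a v a ord0 *: col a X.
Proof.
apply/matrixP => i j; rewrite (ord1 j) mxE summxE; apply: eq_bigr => a _.
by rewrite !mxE mulrC.
Qed.

Lemma vdot_sumr m (I : Type) (r : seq I) (F : I -> 'cV[C]_m) h : vdot h (\sum_(a <- r) F a) = \sum_(a <- r) vdot h (F a).
Proof.
elim: r => [|a r IH]; last by rewrite !big_cons vdotDr IH.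
by rewrite !big_nil vdotE big1// => i _; rewrite mxE conjc0 mulr0.
Qed.

Lemma mproj m n (A : R -> 'M[C]_(m, n)) : mx_in (@L2 R) A ->
  exists2 B : R -> 'M[C]_(m, n), mx_in (@H2 R) B & mx_in (@H2minus R) (fun t => A t - B t).
Proof.
move=> hA.
have hex (ij : 'I_m * 'I_n) : exists g : R -> C, H2 g /\ H2minus (fun t => A t ij.1 ij.2 - g t).
  by have [g h1 h2] := riesz_proj (hA ij.1 ij.2); exists g.
have [G hG] := choice hex.
exists (fun t => \matrix_(i, j) G (i, j) t) => i j.
  by under eq_fun do rewrite mxE; exact: (hG (i, j)).1.
by under eq_fun do rewrite mxD_E mxN_E mxE; exact: (hG (i, j)).2.
Qed.

Lemma ker_mx n (U : R -> 'M[C]_n) e : wh (@H2 R) U e ->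
  exists (D : nat) (G : R -> 'M[C]_(n, D)) (Cst : R), [/\ 0 <= Cst, mx_in (@H2 R) G,
   (forall k, mx_in (@H2 R) k -> mx_in (@H2minus R) (fun t => (U t)^a *m k t) ->
     exists v : 'cV[C]_D, aeI (fun t => k t = G t *m v) /\
       forall a, cabs (v a ord0) <= Cst * l2norm k) &
   (forall v : 'cV[C]_D, aeI (fun t => G t *m v = 0) -> v = 0)].
Proof.
move=> /ker_fin[D [g [Cst [C0 hg h1 h2]]]].
pose G t : 'M[C]_(n, D) := \matrix_(i, a) g a t i ord0.
have eG t v : G t *m v = \sum_a v a ord0 *: g a t.
  rewrite mulmx_sum_cols; apply: eq_bigr => a _; congr (_ *: _).
  by apply/matrixP => i j; rewrite !mxE (ord1 j).
exists D, G, Cst; split=> //.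
- by move=> i a; rewrite /G; under eq_fun do rewrite mxE; exact: hg.
- move=> k hk hm; have [v [e1 e2]] := h1 k hk hm; exists v; split=> //.
  by apply: aeI_S e1 => t _ ->; rewrite eG.
- by move=> v hv; apply: h2; apply: aeI_S hv => t _; rewrite eG.
Qed.

(** For unitary U the operator P_+ U^* P_+ U = 1 - H^* H is invertible on H2. If (1 - H^* H) p = g,
    then x = P_+ (U p) has the same image g under P_+ U^* as v, so k = v - x is in the kernel; and x
    is orthogonal to k because <U p, k> = <p, U^* k> = 0. *)
Lemma split_ker n (U : R -> 'M[C]_n) (ep : R) v g : 0 <= ep -> ep < 1 -> mx_in (@Linf R) U -> unitary_ae U ->
  hankel_le ep U -> mx_in (@H2 R) v -> mx_in (@H2 R) g -> mx_in (@H2minus R) (fun t => (U t)^a *m v t - g t) ->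
  exists x k, [/\ mx_in (@H2 R) x, mx_in (@H2 R) k, (forall t, v t = x t + k t),
    mx_in (@H2minus R) (fun t => (U t)^a *m k t) & vip x k = 0] /\ (1 - ep ^+ 2) * l2norm x <= l2norm g.
Proof.
move=> e0 e1 LU uU hU hv hg hvg.
have [p [q [hp hq hx hs le]]] := hankel_fix e0 e1 LU hU hg.
have LUa := mx_Linf_adj LU; have Lp := mx_H2_L2 hp; have Lq := mx_H2m_L2 hq.
have LUp := mx_Linf_L2M LU Lp.
have hk := mx_H2B hv hx.
have hUk : mx_in (@H2minus R) (fun t => (U t)^a *m (v t - (U t *m p t - q t))).
  apply: (mx_in_ae (@H2m_ae R)) (mx_H2mD hvg hs).
    by apply: mx_L2_meas; apply: (mx_Linf_L2M LUa); exact: (mx_H2_L2 hk).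
  apply: aeI_S uU => t _ u; rewrite !mulmxBr mulmxA u mul1mx.
  by rewrite !opprB !addrA; apply/matrixP => i j; rewrite !mxE; ring.
exists (fun t => U t *m p t - q t), (fun t => v t - (U t *m p t - q t)); split.
  split=> //; first by move=> t; rewrite subrKC.
  rewrite (vipBl LUp Lq (mx_H2_L2 hk)) (vip_orth' hk hq) subr0.
  by rewrite (vip_adj LU Lp (mx_H2_L2 hk)) (vip_orth hp hUk).
apply: le_trans le; rewrite ler_wpM2l ?subr_ge0 ?expr_le1 ?(ltW e1)//.
have <- : l2norm (fun t => U t *m p t) = l2norm p by rewrite !l2normE (nn_unitary uU LU Lp).
apply: l2norm_proj; [exact: LUp|exact: hx|].
by under eq_fun do rewrite opprB addrC subrK.
Qed.

Lemma vip_mulr n D (h : R -> 'cV[C]_n) (X : R -> 'M[C]_(n, D)) (v : 'cV[C]_D) : mx_in (@L2 R) h -> mx_in (@L2 R) X ->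
  vip h (fun t => X t *m v) = \sum_a conjc (v a ord0) * vip h (fun t => col a (X t)).
Proof.
move=> hh hX.
have hcol a : mx_in (@L2 R) (fun t => col a (X t)) by move=> i j; under eq_fun do rewrite mxE; exact: hX.
have hXv : mx_in (@L2 R) (fun t => X t *m v).
  by apply: mx_L2_LinfM => //; apply: mx_Hinf_Linf; exact: mx_Hinf_cst.
have L1d (a : 'I_D) : L1 (fun t => vdot (h t) (col a (X t))).
  under eq_fun do rewrite vdotE; apply: L1_sum => i _; apply: L2_L1M; [exact: hh|].
  by under eq_fun do rewrite mxE; apply: L2J; exact: hX.
rewrite (vip_cint hh hXv).
under [in RHS]eq_bigr do rewrite (vip_cint hh (hcol _)) -(cintZ _ (L1d _)).
rewrite -cint_sum; last by move=> a _; apply: L1Z; exact: L1d.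
congr cint; apply/funext => t; rewrite mulmx_sum_cols vdot_sumr; apply: eq_bigr => a _.
by rewrite vdotZr.
Qed.

(** By duality it suffices to bound v = P_+ (U' z^-M h) for h in H2minus, where U' = z^N U has small
    Hankel norm. Then P_+ (U'^* v) is small, and [split_ker] writes v as a small x plus k in the
    kernel. Finally |k|^2 = <h, z^M U'^* k> is small, because the finitely many columns of z^M U'^*
    G are almost orthogonal to H2minus. *)
Lemma qc_hankel n (U : R -> 'M[C]_n) d (eta : R) : mx_in (@Linf R) U -> unitary_ae U -> wh (@H2 R) U d ->
  apx U -> 0 < eta -> exists M : nat, hankel_le eta (zs M%:Z (fun t => (U t)^a)).
Proof.
move=> LU uU hw hapx eta0.
(* Chosen so that ep <= 1/2 and ep <= eta / 4. *)
pose ep : R := eta / (4 + 2 * eta).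
have den : 0 < 4 + 2 * eta by lra.
have ep0 : 0 < ep by rewrite divr_gt0.
have ep2 : ep <= 2^-1 by rewrite ler_pdivrMr//; lra.
have ep1 : ep < 1 by apply: le_lt_trans ep2 _; rewrite invf_lt1// ltr1n.
have ep4 : ep <= eta / 4 by rewrite ler_pdivrMr// mulrAC ler_pdivlMr//; nra.
have [N hN] := apx_hankel hapx ep0.
pose U' := zs N%:Z U.
have LU' : mx_in (@Linf R) U' by exact: zs_Linf.
have uU' : unitary_ae U' by exact: unitary_zs.
have LUa := mx_Linf_adj LU'.
have [D [G [Cst [C0 hG hker _]]]] := ker_mx (wh_zs N%:Z hw).
pose W t := (U' t)^a *m G t.
have LW : mx_in (@L2 R) W by exact: mx_Linf_L2M LUa (mx_H2_L2 hG).
have Lcol a : mx_in (@L2 R) (fun t => col a (W t)) by move=> i j; under eq_fun do rewrite mxE; exact: LW.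
(* The D coefficients of a kernel element, each at most [Cst * l2norm k], then contribute at most
   eta / 2 in total. *)
pose e1 : R := eta / (2 * (D%:R * Cst + 1)).
have den1 : 0 < 2 * (D%:R * Cst + 1) by rewrite mulr_gt0// ltr_wpDl// mulr_ge0.
have e10 : 0 < e1 by rewrite divr_gt0.
have hex (a : 'I_D) := shift_orth_vec (Lcol a) e10.
have [M0 hM0] := choice hex.
(* [M] exceeds [M2] by N because z^-M U' = z^-M2 U. *)
pose M2 := (\sum_a M0 a)%N; pose M := (M2 + N)%N.
have kb (h k : R -> 'cV[C]_n) : mx_in (@H2minus R) h -> mx_in (@H2 R) k ->
   mx_in (@H2minus R) (fun t => (U' t)^a *m k t) ->
   cabs (vip h (zs M%:Z (fun t => (U' t)^a *m k t))) <= eta / 2 * (l2norm k * l2norm h).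
  move=> hh hk hUk; have Lh := mx_H2m_L2 hh.
  have [v [ev bv]] := hker k hk hUk.
  have LZW : mx_in (@L2 R) (zs M%:Z W) by exact: zs_L2.
  have LWv : mx_in (@L2 R) (fun t => zs M%:Z W t *m v).
    by apply: mx_L2_LinfM => //; apply: mx_Hinf_Linf; exact: mx_Hinf_cst.
  have LUk : mx_in (@L2 R) (zs M%:Z (fun t => (U' t)^a *m k t)) by apply: zs_L2; exact: mx_H2m_L2.
  have -> : vip h (zs M%:Z (fun t => (U' t)^a *m k t)) = vip h (fun t => zs M%:Z W t *m v).
    rewrite (vipC LUk Lh) (vipC LWv Lh); congr conjc; apply: vip_ae => //.
    by apply: aeI_S ev => t _ e; rewrite /zs e /W -scalemxAl mulmxA.
  rewrite (vip_mulr _ Lh LZW); apply: le_trans (cabs_sum _ _ _) _.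
  apply: le_trans (_ : \sum_(a < D) (Cst * l2norm k) * (e1 * l2norm h) <= _).
    apply: ler_sum => a _; rewrite cabsM cabsJ ler_pM ?cabs_ge0 ?bv//.
    have -> : (fun t => col a (zs M%:Z W t)) = zs M%:Z (fun t => col a (W t)).
      by apply/funext => t; rewrite /zs linearZ.
    by apply: hM0 => //; rewrite /M (leq_trans _ (leq_addr _ _))// /M2 (bigD1 a)//= leq_addr.
  rewrite sumr_const card_ord -[leLHS]mulr_natl.
  have -> : D%:R * (Cst * l2norm k * (e1 * l2norm h)) = (D%:R * Cst * e1) * (l2norm k * l2norm h) by ring.
  rewrite ler_wpM2r ?mulr_ge0 ?l2norm_ge0// /e1 mulrA ler_pdivrMr//.
  have := mulr_ge0 (ler0n R D) C0; move: (D%:R * Cst) => z z0.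
  by rewrite mulrAC -mulrA; nra.
have main (h v : R -> 'cV[C]_n) : mx_in (@H2minus R) h -> mx_in (@H2 R) v ->
   mx_in (@H2minus R) (fun t => U' t *m zs (- M%:Z) h t - v t) -> l2norm v <= eta * l2norm h.
  move=> hh hv hm; have Lh := mx_H2m_L2 hh; have Lv := mx_H2_L2 hv.
  pose zh := zs (- M%:Z) h.
  have hzh : mx_in (@H2minus R) zh by apply: zs_H2m => //; rewrite oppr_le0.
  have Lzh := mx_H2m_L2 hzh.
  have Lw : mx_in (@L2 R) (fun t => U' t *m zh t) by exact: mx_Linf_L2M.
  have nw : l2norm (fun t => U' t *m zh t) = l2norm h.
    by rewrite l2normE (nn_unitary uU' LU' Lzh) -l2normE zs_l2norm.
  have nm : l2norm (fun t => U' t *m zh t - v t) <= l2norm h.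
    rewrite -nw; apply: l2norm_projm => //.
    by under eq_fun do rewrite opprB addrC subrK.
  have [g hg hgm] := vproj (mx_Linf_L2M LUa Lv).
  (* U'^* (U' z^-M h - v) equals z^-M h - U'^* v, whose analytic part is - g; the dual Hankel bound
     of U' applies. *)
  have ng : l2norm g <= ep * l2norm h.
    have hng : mx_in (@H2 R) (fun t => - g t) by exact: mx_H2N.
    have := hankel_dual (ltW ep0) LU' hN hng hm; rewrite (l2normN (mx_H2_L2 hg)) => H.
    apply: le_trans (H _) _; last by rewrite ler_wpM2l ?(ltW ep0).
    apply: (mx_in_ae (@H2m_ae R)) (mx_H2mB hzh hgm).
      apply: mx_L2_meas; apply: mx_L2B; last exact: mx_L2N (mx_H2_L2 hg).
      exact: mx_Linf_L2M LUa (mx_H2m_L2 hm).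
    apply: aeI_S uU' => t _ u; rewrite mulmxBr mulmxA u mul1mx opprK opprB addrA.
    by rewrite [RHS]addrAC.
  have [x [k [[hx hk exk hUk xk] nx]]] := split_ker (ltW ep0) ep1 LU' uU' hN hv hg hgm.
  have Lx := mx_H2_L2 hx; have Lk := mx_H2_L2 hk.
  have nk : l2norm k <= eta / 2 * l2norm h.
    have e2 : (nn k)%:C%C = vip h (zs M%:Z (fun t => (U' t)^a *m k t)).
      have ev : v = (fun t => x t + k t) by apply/funext.
      have s1 : (nn k)%:C%C = vip v k by rewrite -(vip_nn Lk) ev (vipDl Lx Lk Lk) xk add0r.
      have s2 : vip (fun t => U' t *m zh t - v t) k = 0 by exact: (vip_orth' hk hm).
      have s3 : vip (fun t => U' t *m zh t) k = vip v k.
        by move: s2; rewrite (vipBl Lw Lv Lk) => /eqP; rewrite subr_eq0 => /eqP.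
      rewrite s1 -s3 (vip_adj LU' Lzh Lk) (vip_cint Lzh (mx_H2m_L2 hUk)).
      rewrite (vip_cint Lh (zs_L2 M%:Z (mx_H2m_L2 hUk))); congr cint; apply/funext => t.
      by rewrite /zh /zs vdotZl vdotZr eezJ.
    have := kb h k hh hk hUk; rewrite -e2 cabs_Cr ger0_norm ?(nn_ge0 Lk)// -(l2norm_sq Lk) => le.
    have [->|k0] := eqVneq (l2norm k) 0; first by rewrite mulr_ge0 ?l2norm_ge0// divr_ge0// ltW.
    have kp : 0 < l2norm k by rewrite lt_neqAle eq_sym k0 l2norm_ge0.
    by rewrite -(ler_pM2l kp) -expr2 (le_trans le)// mulrCA.
  have ev : v = (fun t => x t + k t) by apply/funext.
  rewrite ev (le_trans (l2normD Lx Lk))//.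
  have h0 := l2norm_ge0 h; have x0 := l2norm_ge0 x.
  have e34 : 3 / 4 * l2norm x <= ep * l2norm h.
    apply: le_trans ng; apply: le_trans nx; rewrite ler_wpM2r//.
    have : ep ^+ 2 <= 2^-1 ^+ 2 by rewrite lerXn2r ?nnegrE ?(ltW ep0).
    have -> : (2^-1 : R) ^+ 2 = 4^-1 by rewrite exprVn -natrX.
    by move: (ep ^+ 2) => z hz; lra.
  have e5 : ep * l2norm h <= eta / 4 * l2norm h by rewrite ler_wpM2r.
  move: nk e34 e5 h0 x0; move: (l2norm k) (l2norm x) (l2norm h) (ep * _) => a b c z; nra.
(* Return from the dual estimate: with v the analytic part of Z^* p one has |p|^2 = <f, v>. *)
exists M2 => f p hf hp hfp.
have Lf := mx_H2_L2 hf; have Lp := mx_H2m_L2 hp.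
pose Z := zs M2%:Z (fun t => (U t)^a).
have LZ : mx_in (@Linf R) Z by apply: zs_Linf; exact: mx_Linf_adj.
have LZf := mx_Linf_L2M LZ Lf.
have LZp := mx_Linf_L2M (mx_Linf_adj LZ) Lp.
have [v hv hvm] := vproj LZp.
have Lv := mx_H2_L2 hv.
have nv : l2norm v <= eta * l2norm p.
  apply: main => //.
  rewrite (_ : (fun t => _) = fun t => (Z t)^a *m p t - v t)//.
  apply/funext => t; congr (_ - _); rewrite /Z /U' /zs adjmxZ adjmxK eezJ -!scalemxAl -scalemxAr scalerA -eezD.
  by congr (ee t ^ _ *: _); rewrite /M; lia.
have e1' : (nn p)%:C%C = vip f v.
  have s1 : vip (fun t => Z t *m f t) p = (nn p)%:C%C.
    have := vip_orth hfp hp; rewrite (vipBl LZf Lp Lp) (vip_nn Lp) => /eqP.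
    by rewrite subr_eq0 => /eqP.
  rewrite -s1 (vip_adj LZ Lf Lp).
  have := vip_orth hf hvm; rewrite (vipBr LZp Lv Lf) => /eqP.
  by rewrite subr_eq0 => /eqP.
have [->|p0] := eqVneq (l2norm p) 0; first by rewrite mulr_ge0 ?l2norm_ge0// ltW.
have pp : 0 < l2norm p by rewrite lt_neqAle eq_sym p0 l2norm_ge0.
rewrite -(ler_pM2l pp) -expr2 (l2norm_sq Lp) -[leLHS]ger0_norm ?(nn_ge0 Lp)// -cabs_Cr e1'.
apply: le_trans (CS Lf Lv) _; rewrite mulrCA [l2norm p * _]mulrC mulrCA ler_wpM2l ?l2norm_ge0//.
Qed.

(** U differs from Phi by Hinf. For its conjugate, a small Hankel norm of z^M U^* means by Nehari's
    theorem that U^* is close to z^-M Hinf, and Hinf + C is closed. *)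
Lemma unitary_QC n (Phi U : R -> 'M[C]_n) d : mx_in (@HinfC R) Phi -> mx_in (@Linf R) U -> unitary_ae U ->
  mx_in (@Hinf R) (fun t => Phi t - U t) -> wh (@H2 R) U d -> apx U -> mx_in (@QC R) U.
Proof.
move=> hP LU uU hU hw hapx i j; split.
  have [mP [h [g [hh [hg e]]]]] := hP i j; split; first exact: (LU i j).1.
  exists (fun t => h t - (Phi t - U t) i j), g; split; first by apply: HinfD => //; apply: HinfN; exact: hU.
  split=> //; apply: aeI_S e => t _; rewrite mxD_E mxN_E => ->; ring.
apply: HinfC_closed; first by apply: cmeasJ; exact: (LU i j).1.
move=> e e0.
have e20 : 0 < e / 2 by rewrite divr_gt0.
have [M hM] := qc_hankel LU uU hw hapx e20.
have LZ : mx_in (@Linf R) (zs M%:Z (fun t => (U t)^a)) by apply: zs_Linf; exact: mx_Linf_adj.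
have [F hF hb] := nehari_scaled e20 LZ hM.
exists M, (fun t => F t j i); split; first exact: hF.
apply: aeI_S hb => t _; have -> : 2 * (e / 2) = e by rewrite mulrC divfK.
move=> /(vsq_entry j i); rewrite mxD_E mxN_E zsE adjmxE.
rewrite (@ler_pXn2r _ 2)// ?nnegrE ?cabs_ge0 ?(ltW e0)//; apply: le_trans.
rewrite -[leRHS]mulr1 -(cabs_eez (- M%:Z) t) -cabsM mulrBl -mulrA eezK mulr1//.
Qed.
End QCpart.

(** * The gap *)

Section Gap.
Variable (R : realType).
Local Notation C := R[i].
Local Notation Re := complex.Re.
Local Notation Im := complex.Im.
Local Notation "A ^a" := (adjmx A) (at level 8, format "A ^a").
Local Notation unitary_ae U := (aeI (fun t => (U t)^a *m U t = 1%:M)).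

(** Read with X = |x|, A = |P_+ U^* p|, Z = |T v| and Y = |G v| in [hankel_adj_lt1]; it is the
    source of the constant 2 + 3 C1 there. *)
Lemma arith_gap (c X A Z Y : R) : 0 <= c -> 0 <= X -> 0 <= A -> Z <= A + X -> 3 / 4 * X <= A ->
  Y <= c * Z -> X + Y <= (2 + 3 * c) * A.
Proof.
move=> c0 X0 A0 h1 h2 h3; have Z3 : Z <= 3 * A by lra.
have : c * Z <= c * (3 * A) by rewrite ler_wpM2l.
have -> : c * (3 * A) = 3 * c * A by ring.
by rewrite mulrDl; lra.
Qed.

Lemma sqrt_l2 n (x : R -> 'cV[C]_n) (a : R) : mx_in (@L2 R) x -> 0 <= a -> nn x <= a ^+ 2 -> l2norm x <= a.
Proof. by move=> hx a0 h; rewrite -(@ler_pXn2r _ 2)// ?nnegrE ?l2norm_ge0// (l2norm_sq hx). Qed.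

(** Injectivity makes the Gram matrix of the columns of T positive definite; its factorization
    provides the constant. *)
Lemma gram_low n D (T : R -> 'M[C]_(n, D)) : mx_in (@L2 R) T ->
  (forall v : 'cV[C]_D, nn (fun t => T t *m v) = 0 -> v = 0) ->
  exists2 c : R, 0 <= c & forall v, vsq v <= c * nn (fun t => T t *m v).
Proof.
move=> hT inj.
have LX a b : L1 (fun t => ((T t)^a *m T t) a b) by exact: (mx_L2_L1M (mx_L2_adj hT) hT).
pose b : 'M[C]_D := \matrix_(a, c) cint (fun t => ((T t)^a *m T t) a c).
have Tv (v : 'cV[C]_D) : mx_in (@L2 R) (fun t => T t *m v).
  by apply: mx_L2_LinfM => //; apply: mx_Hinf_Linf; exact: mx_Hinf_cst.
have ba : b^a = b.
  apply/matrixP => i j; rewrite adjmxE !mxE -(cintJ (LX _ _)); congr cint; apply/funext => t.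
  by rewrite -adjmxE adjmxM adjmxK.
have eb v : vdot (b *m v) v = (nn (fun t => T t *m v))%:C%C.
  rewrite -(vip_nn (Tv v)) (vip_cint (Tv v) (Tv v)).
  have -> : (fun t => vdot (T t *m v) (T t *m v)) = fun t => \sum_a \sum_c (v c ord0 * conjc (v a ord0)) * ((T t)^a *m T t) a c.
    apply/funext => t.
    have -> : vdot (T t *m v) (T t *m v) = vdot (((T t)^a *m T t) *m v) v by rewrite -mulmxA [RHS]vdot_adj adjmxK.
    rewrite vdotE; move: ((T t)^a *m T t) => X.
    by apply: eq_bigr => a _; rewrite mxE mulr_suml; apply: eq_bigr => c _; ring.
  rewrite cint_sum; last by move=> a _; apply: L1_sum => c _; apply: L1Z; exact: LX.
  rewrite vdotE; apply: eq_bigr => a _; rewrite cint_sum; last by move=> c _; apply: L1Z; exact: LX.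
  rewrite mxE mulr_suml; apply: eq_bigr => c _; rewrite (cintZ _ (LX _ _)) mxE; ring.
have pos (v : 'cV[C]_D) : v != 0 -> 0 < Re (vdot (b *m v) v).
  move=> v0; rewrite eb /= lt_neqAle (nn_ge0 (Tv v)) andbT eq_sym; apply/eqP => e.
  by move/eqP: v0; apply; apply: inj.
have [be [ga [h1 h2 h3]]] := posdef_factor ba pos.
have bg : b = ga^a *m ga.
  rewrite -[LHS]mulmx1 -h2 -[LHS]mul1mx -[X in X *m _]adjmx1 -h2 adjmxM.
  by rewrite !mulmxA -(mulmxA ga^a) -(mulmxA ga^a) h1 mulmx1.
exists (frob be); first exact: frob_ge0.
move=> v; have <- : vsq (ga *m v) = nn (fun t => T t *m v).
  by apply: (@complexI R); rewrite -eb bg -mulmxA vdot_adj adjmxK vdot_vsq.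
by have := vsq_frob be (ga *m v); rewrite mulmxA h2 mul1mx.
Qed.

(** With all indices at most 0, [wh_kernel] leaves the analytic function Q2 k without coefficients
    of nonnegative index. *)
Lemma wh_ker0 n (U : R -> 'M[C]_n) d (k : R -> 'cV[C]_n) : wh (@H2 R) U d -> (forall i, d i <= 0) ->
  mx_in (@H2 R) k -> mx_in (@H2minus R) (fun t => (U t)^a *m k t) -> aeI (fun t => k t = 0).
Proof.
move=> [Q1 [Q2 [Q1i [Q2i [[h1 h2 h1i h2i] hw]]]]] d0 hk hm.
have hx := mx_H2_H1M h2 hk.
have hz : aeI (fun t => Q2 t *m k t = 0).
  apply: mx_H1_H1m; first exact: hx.
  move=> i j; rewrite (ord1 j); split; first exact: (hx i ord0).1.
  by move=> l l0; apply: (wh_kernel h2 h1i hw hk hm); exact: le_trans (d0 i) l0.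
apply: aeI_S2 hz hw => t _ e [_ _ e3].
by rewrite -[k t]mul1mx -(mulmx1C e3) -mulmxA e mulmx0.
Qed.

(* Modulo the finite-dimensional kernel of the adjoint Toeplitz operator of z^N U, where
   injectivity gives a bound through a Gram matrix, that operator is bounded below. *)
Lemma hankel_adj_lt1 n (U : R -> 'M[C]_n) d : mx_in (@Linf R) U -> unitary_ae U -> wh (@H2 R) U d ->
  (forall i, d i <= 0) -> apx U ->
  exists k : R, [/\ 0 <= k, k < 1 & hankel_le k (fun t => (U t)^a)].
Proof.
move=> LU uU hw d0 hapx.
have h2 : 0 < (2^-1 : R) by rewrite invr_gt0.
have h21 : (2^-1 : R) < 1 by rewrite invf_lt1// ltr1n.
have [N hN] := apx_hankel hapx h2.
pose U' := zs N%:Z U.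
have LU' : mx_in (@Linf R) U' by exact: zs_Linf.
have uU' : unitary_ae U' by exact: unitary_zs.
have LUa := mx_Linf_adj LU.
have uUa : aeI (fun t => ((U t)^a)^a *m (U t)^a = 1%:M).
  by apply: aeI_S uU => t _ u; rewrite adjmxK; exact: mulmx1C.
have [D [G [Cst [C0 hG hker hind]]]] := ker_mx (wh_zs N%:Z hw).
have [T hT hTm] := mproj (mx_Linf_L2M LUa (mx_H2_L2 hG)).
have hTv (v : 'cV[C]_D) : mx_in (@H2 R) (fun t => T t *m v) by apply: mx_H2_HinfM => //; exact: mx_Hinf_cst.
have hGv (v : 'cV[C]_D) : mx_in (@H2 R) (fun t => G t *m v) by apply: mx_H2_HinfM => //; exact: mx_Hinf_cst.
have hTGm (v : 'cV[C]_D) : mx_in (@H2minus R) (fun t => (U t)^a *m (G t *m v) - T t *m v).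
  by have := mx_H2m_cst v hTm; under eq_fun do rewrite mulmxBl -mulmxA.
have [|c c0 hc] := gram_low (mx_H2_L2 hT).
  move=> v /(nn_eq0 (mx_H2_L2 (hTv v))) hz; apply: hind.
  apply: (wh_ker0 hw d0 (hGv v)).
  apply: (mx_in_ae (@H2m_ae R)) (hTGm v).
    by apply: mx_L2_meas; apply: mx_Linf_L2M LUa _; exact: mx_H2_L2.
  by apply: aeI_S hz => t _ ->; rewrite subr0.
have [g0 g00 hg0] : exists2 g0 : R, 0 <= g0 & forall v, nn (fun t => G t *m v) <= g0 * vsq v.
  have LG := mx_H2_L2 hG; exists (rint (fun t => frob (G t))).
    by apply: rint_ge0; [apply: aeI_W => t _; exact: frob_ge0|exact: RI_frob].
  move=> v; rewrite nnE mulrC -(rintZ _ (RI_frob LG)); apply: rint_le.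
  - exact: (RI_nn (mx_H2_L2 (hGv v))).
  - by apply: RI_Z; exact: RI_frob.
  - by apply: aeI_W => t _; rewrite mulrC; exact: vsq_frob.
(* The square root of the constant in |G v|^2 <= g0 |v|^2 <= g0 c |T v|^2. *)
pose C1 : R := Num.sqrt (g0 * c).
have C10 : 0 <= C1 by exact: sqrtr_ge0.
have kb (v : 'cV[C]_D) : l2norm (fun t => G t *m v) <= C1 * l2norm (fun t => T t *m v).
  apply: sqrt_l2; [exact: mx_H2_L2 (hGv v)|by rewrite mulr_ge0 ?l2norm_ge0|].
  rewrite exprMn sqr_sqrtr ?mulr_ge0// (l2norm_sq (mx_H2_L2 (hTv v))).
  by apply: le_trans (hg0 v) _; rewrite -mulrA ler_wpM2l.
clearbody C1.
pose C2 : R := 2 + 3 * C1.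
have C20 : 0 < C2 by rewrite /C2; lra.
have C2g : 1 <= C2 by rewrite /C2; lra.
(* The adjoint Toeplitz operator of U, which sends p to a, is bounded below: p is split with respect
   to z^N U into x, controlled by a, and k = G v, controlled through T v = P_+ (U^* k). *)
have low (p a : R -> 'cV[C]_n) : mx_in (@H2 R) p -> mx_in (@H2 R) a ->
    mx_in (@H2minus R) (fun t => (U t)^a *m p t - a t) -> l2norm p <= C2 * l2norm a.
  move=> hp ha hpa; have La := mx_H2_L2 ha.
  have [g hg hgm] := vproj (zs_L2 (- N%:Z) La).
  have ng : l2norm g <= l2norm a.
    by rewrite -(zs_l2norm (- N%:Z) a); apply: l2norm_proj => //; exact: zs_L2.
  have hpg : mx_in (@H2minus R) (fun t => (U' t)^a *m p t - g t).
    rewrite (_ : (fun t => _) = fun t => zs (- N%:Z) (fun t => (U t)^a *m p t - a t) t + (zs (- N%:Z) a t - g t)).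
      by apply: mx_H2mD => //; apply: zs_H2m => //; rewrite oppr_le0.
    by apply/funext => t; rewrite /U' /zs adjmxZ eezJ -scalemxAl scalerBr addrA subrK.
  have [x [k [[hx hk exk hUk _] nx]]] := split_ker (ltW h2) h21 LU' uU' hN hp hg hpg.
  have [v [ev _]] := hker k hk hUk.
  have Lx := mx_H2_L2 hx; have Lk := mx_H2_L2 hk; have LTv := mx_H2_L2 (hTv v).
  have nk : l2norm k = l2norm (fun t => G t *m v) by apply: l2norm_ae => //; exact: mx_H2_L2 (hGv v).
  have hd : mx_in (@H2 R) (fun t => a t - T t *m v) by exact: mx_H2B ha (hTv v).
  have nd : l2norm (fun t => a t - T t *m v) <= l2norm x.
    have LUx := mx_Linf_L2M LUa Lx.
    have <- : l2norm (fun t => (U t)^a *m x t) = l2norm x by rewrite !l2normE (nn_unitary uUa LUa Lx).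
    apply: l2norm_proj; [exact: LUx|exact: hd|].
    apply: (mx_in_ae (@H2m_ae R)) (mx_H2mB hpa (hTGm v)).
      by apply: mx_L2_meas; apply: mx_L2B => //; exact: mx_H2_L2 hd.
    apply: aeI_S ev => t _ ek; rewrite exk mulmxDr -ek.
    by apply/matrixP => i j; rewrite !mxE; ring.
  have nT : l2norm (fun t => T t *m v) <= l2norm a + l2norm x.
    have -> : (fun t => T t *m v) = (fun t => a t - (a t - T t *m v)) by apply/funext => t; rewrite opprB addrC subrK.
    by apply: le_trans (l2normB La (mx_H2_L2 hd)) _; rewrite lerD2l.
  have ep : p = (fun t => x t + k t) by apply/funext.
  rewrite ep (le_trans (l2normD Lx Lk))// nk.
  have := kb v; have x0 := l2norm_ge0 x; have a0 := l2norm_ge0 a.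
  have e34 : 3 / 4 * l2norm x <= l2norm a.
    apply: le_trans ng; apply: le_trans nx; rewrite ler_wpM2r//.
    have -> : (2^-1 : R) ^+ 2 = 4^-1 by rewrite exprVn -natrX.
    lra.
  by move=> kY; exact: arith_gap C10 x0 a0 nT e34 kY.
have C21 : C2 ^- 2 <= 1.
  by rewrite invf_le1 ?exprn_gt0// exprn_ege1.
(* From |p|^2 = |P_+ U^* p|^2 + |q|^2 and |p| <= C2 |P_+ U^* p|. *)
exists (Num.sqrt (1 - C2 ^- 2)); split.
- exact: sqrtr_ge0.
- by rewrite -[ltRHS]sqrtr1 ltr_sqrt// gtrBl invr_gt0 exprn_gt0.
move=> p q hp hq hpq; have Lp := mx_H2_L2 hp; have Lq := mx_H2m_L2 hq.
have LUp := mx_Linf_L2M LUa Lp.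
have := low _ _ hp hpq; have ha := mx_H2_L2 hpq.
have hz : mx_in (@H2minus R) (fun t => (U t)^a *m p t - ((U t)^a *m p t - q t)).
  by under eq_fun do rewrite opprB addrC subrK.
move=> /(_ hz) le.
have e1 : nn p = nn (fun t => (U t)^a *m p t - q t) + nn q.
  rewrite -(nn_unitary uUa LUa Lp) -(nn_pyth hpq hq); congr nn; apply/funext => t.
  by rewrite subrK.
apply: sqrt_l2 => //; first by rewrite mulr_ge0 ?sqrtr_ge0 ?l2norm_ge0.
rewrite exprMn sqr_sqrtr ?subr_ge0// (l2norm_sq Lp) mulrBl mul1r.
have : C2 ^- 2 * nn p <= nn (fun t => (U t)^a *m p t - q t).
  rewrite ler_pdivrMl ?exprn_gt0// -(l2norm_sq Lp) -(l2norm_sq ha) -exprMn.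
  by rewrite lerXn2r ?nnegrE ?mulr_ge0 ?l2norm_ge0 ?(ltW C20).
by rewrite e1; move: (nn q) (nn (fun t => _ - _)) (C2 ^- 2 * _) => x y z; lra.
Qed.
End Gap.

(** * Spectral factorization of 1 - theta S for a projection-valued S *)

Section Spectral.
Variable (R : realType).
Local Notation C := R[i].
Local Notation Re := complex.Re.
Local Notation Im := complex.Im.
Local Notation "A ^a" := (adjmx A) (at level 8, format "A ^a").
Local Notation unitary_ae U := (aeI (fun t => (U t)^a *m U t = 1%:M)).

(** Hermitian symmetry carries the vanishing of the coefficients of positive index to those of
    negative index. *)
Lemma herm_const n (X : R -> 'M[C]_n) : mx_in (@L1 R) X -> (forall t, (X t)^a = X t) ->
  (forall i j l, 0 < l -> fcoef (fun t => X t i j) l = 0) -> exists b, aeI (fun t => X t = b).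
Proof.
move=> LX aX hk1.
have hk2 i j l : l < 0 -> fcoef (fun t => X t i j) l = 0.
  move=> l0; have -> : (fun t => X t i j) = (fun t => conjc (X t j i)).
    by apply/funext => t; rewrite -adjmxE aX.
  by rewrite (fcoefJ _ (LX _ _)) hk1 ?conjc0// oppr_gt0.
pose b : 'M[C]_n := \matrix_(i, j) fcoef (fun t => X t i j) 0; exists b.
have : aeI (fun t => forall i j, X t i j = b i j).
  apply: aeI_forall => i; apply: aeI_forall => j.
  apply: L1_unique2; [exact: LX|exact: L1_cst|move=> l].
  rewrite fcoef_cst mxE; case: (ltrgtP l 0) => l0 /=.
  - by rewrite hk2// mulr0.
  - by rewrite hk1// mulr0.
  - by rewrite l0 mulr1.
by apply: aeI_S => t _ h; apply/matrixP => i j.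
Qed.

Section Factor.
Variables (n : nat) (S : R -> 'M[C]_n) (th : R).
Hypotheses (th0 : 0 < th) (th1 : th < 1) (mS : mx_in (@cmeas R) S).
Hypotheses (hS : forall t, (S t)^a = S t) (pS : aeI (fun t => S t *m S t = S t)).
Let w t : 'M[C]_n := 1%:M - th%:C%C *: S t.

Lemma proj_contr t (v : 'cV[C]_n) : S t *m S t = S t -> vsq (S t *m v) <= vsq v.
Proof.
move=> pSt.
have h (z : 'cV[C]_n) : vsq z = vsq (S t *m z) + vsq (z - S t *m z).
  have ez : z = S t *m z + (z - S t *m z) by rewrite subrKC.
  rewrite [in LHS]ez [LHS]vsqD.
  have -> : vdot (S t *m z) (z - S t *m z) = 0.
    by rewrite vdot_adj hS mulmxBr mulmxA pSt subrr vdotE big1// => i _; rewrite mxE conjc0 mulr0.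
  by rewrite mulr0 addr0.
by rewrite [leRHS](h v) lerDl vsq_ge0.
Qed.

Lemma spec_w t (v : 'cV[C]_n) : S t *m S t = S t -> vdot (w t *m v) v = (vsq v - th * vsq (S t *m v))%:C%C.
Proof.
move=> pSt; rewrite /w mulmxBl mul1mx -scalemxAl -scaleN1r scalerA vdotDl vdotZl vdot_vsq.
have -> : vdot (S t *m v) v = (vsq (S t *m v))%:C%C.
  by rewrite -vdot_vsq -{1}pSt -mulmxA vdot_adj hS.
by apply: complex_eqP => /=; ring.
Qed.

Lemma LS : mx_in (@Linf R) S.
Proof.
move=> i j; apply: (@Linf_sq_le _ _ 1); first exact: mS.
by apply: aeI_S pS => t _ e; apply: vsq_entry => v; rewrite mul1r; exact: proj_contr.
Qed.
Lemma wE t (v : 'cV[C]_n) : w t *m v = v - th%:C%C *: (S t *m v).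
Proof. by rewrite /w mulmxBl mul1mx scalemxAl. Qed.
Lemma wa t : (w t)^a = w t.
Proof. by rewrite /w adjmxB adjmx1 adjmxZ conjc_real hS. Qed.
Lemma Lw : mx_in (@Linf R) w.
Proof.
apply: mx_LinfB; first by apply: mx_Hinf_Linf; exact: mx_Hinf_cst.
by move=> i j; under eq_fun do rewrite mxE; apply: LinfM; [exact: Linf_cst|exact: LS].
Qed.

(** The Toeplitz operator of w is 1 - th T, where T is the compression of the projection S and hence
    a contraction; the fixed point theorem inverts it. *)
Lemma w_solve (g : R -> 'cV[C]_n) : mx_in (@H2 R) g ->
  exists2 x : R -> 'cV[C]_n, mx_in (@H2 R) x & mx_in (@H2minus R) (fun t => w t *m x t - g t).
Proof.
move=> hg.
have LSx (x : R -> 'cV[C]_n) : mx_in (@H2 R) x -> mx_in (@L2 R) (fun t => th%:C%C *: (S t *m x t)).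
  by move=> hx; apply: V2Z; apply: mx_Linf_L2M LS _; exact: mx_H2_L2.
have hex (x : R -> 'cV[C]_n) : exists y : R -> 'cV[C]_n, mx_in (@H2 R) x ->
    mx_in (@H2 R) y /\ mx_in (@H2minus R) (fun t => th%:C%C *: (S t *m x t) - y t).
  have [hx|nx] := pselect (mx_in (@H2 R) x); last by exists x.
  by have [y h1 h2] := vproj (LSx x hx); exists y.
have [T hT] := choice hex.
have [||x hx ex] := @fix_H2 _ _ (fun x t => g t + T x t) th (ltW th0) th1.
- by move=> x hx; apply: mx_H2D => //; case: (hT x hx).
- move=> x y hx hy; have [hx1 hx2] := hT x hx; have [hy1 hy2] := hT y hy.
  have hd := mx_H2B hx hy; have Ld := mx_H2_L2 hd.
  have -> : (fun t => g t + T x t - (g t + T y t)) = (fun t => T x t - T y t).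
    by apply/funext => t; rewrite opprD addrACA subrr add0r.
  apply: le_trans (_ : l2norm (fun t => th%:C%C *: (S t *m (x t - y t))) <= _).
    apply: l2norm_proj; [exact: LSx|exact: mx_H2B|].
    rewrite (_ : (fun t => _) = fun t => (th%:C%C *: (S t *m x t) - T x t) - (th%:C%C *: (S t *m y t) - T y t)).
      exact: mx_H2mB.
    by apply/funext => t; rewrite mulmxBr scalerBr !opprB !addrA [in RHS]addrAC; apply/matrixP => i j; rewrite !mxE; ring.
  apply: nn_le; [exact: ltW|exact: LSx|exact: Ld|].
  apply: aeI_S pS => t _ e; rewrite -/(vsq _) -/(vsq _) vsqZ cabs_Cr ger0_norm ?(ltW th0)//.
  by rewrite ler_wpM2l ?sqr_ge0//; exact: proj_contr.
exists x => //; have [h1 h2] := hT x hx.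
apply: (mx_in_ae (@H2m_ae R)) (mx_H2mN h2).
  by apply: mx_L2_meas; apply: mx_L2B; [exact: mx_Linf_L2M Lw (mx_H2_L2 hx)|exact: mx_H2_L2].
apply: aeI_S ex => t _ e; rewrite wE {2}e; apply/matrixP => i j; rewrite !mxE; ring.
Qed.

(* y solves w y - 1 in H2minus; then y^* w y is a constant b = ga^* ga and h = ga y^-1. *)
Lemma spectral_factor : exists h hi : R -> 'M[C]_n, [/\ mx_in (@Hinf R) h, mx_in (@Hinf R) hi &
  aeI (fun t => [/\ h t *m hi t = 1%:M, hi t *m h t = 1%:M & (h t)^a *m h t = w t])].
Proof.
have hex (j : 'I_n) : exists y : R -> 'cV[C]_n,
   mx_in (@H2 R) y /\ mx_in (@H2minus R) (fun t => w t *m y t - delta_mx j ord0).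
  have hg : mx_in (@H2 R) (fun=> (delta_mx j ord0 : 'cV[C]_n)).
    by apply: mx_Hinf_H2; exact: mx_Hinf_cst.
  by have [y h1 h2] := w_solve hg; exists y.
have [Y hY] := choice hex.
pose y t : 'M[C]_n := \matrix_(i, j) Y j t i ord0.
have coly t j : col j (y t) = Y j t by apply/matrixP => i l; rewrite !mxE (ord1 l).
have col1 j : col j (1%:M : 'M[C]_n) = delta_mx j ord0.
  by apply/matrixP => i l; rewrite !mxE ord1 eqxx andbT.
have hy : mx_in (@H2 R) y by move=> i j; rewrite /y; under eq_fun do rewrite mxE; exact: (hY j).1.
have hm : mx_in (@H2minus R) (fun t => w t *m y t - 1%:M).
  move=> i j; have := (hY j).2 i ord0.
  suff -> : (fun t => (w t *m Y j t - delta_mx j ord0) i ord0) = (fun t => (w t *m y t - 1%:M) i j) by [].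
  apply/funext => t; rewrite -col1 -coly -col_mulmx.
  by rewrite !mxD_E !mxN_E [col _ (_ *m _) _ _]mxE [col _ 1%:M _ _]mxE.
clearbody y; clear coly col1 hY Y hex.
have Ly := mx_H2_L2 hy.
pose X t := (y t)^a *m (w t *m y t).
have [b hb] : exists b, aeI (fun t => X t = b).
  apply: herm_const.
  - exact: (mx_L2_L1M (mx_L2_adj Ly) (mx_Linf_L2M Lw Ly)).
  - by move=> t; rewrite /X !adjmxM adjmxK wa mulmxA.
  - move=> i j l l0.
    have L1p : L1 (fun t => conjc (y t j i)) by apply: L1J; apply: L2_L1; exact: Ly.
    have [L1b hb] := mx_H2a_H2m hy hm i j.
    have -> : (fun t => X t i j) = (fun t => conjc (y t j i) + ((y t)^a *m (w t *m y t - 1%:M)) i j).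
      by apply/funext => t; rewrite /X -adjmxE -mxD_E mulmxBr mulmx1 subrKC.
    rewrite (fcoefD _ L1p L1b) hb ?(ltW l0)// addr0 fcoefJ ?(hy j i).2 ?conjc0 ?oppr_lt0//.
    by apply: L2_L1; exact: Ly.
have hb' : aeI (fun t => forall v, vdot (b *m v) v = (vsq (y t *m v) - th * vsq (S t *m (y t *m v)))%:C%C).
  apply: aeI_S2 hb pS => t _ e pt v; rewrite -e /X -!mulmxA vdot_adj adjmxK.
  by rewrite (mulmxA (w t)) -mulmxA -(spec_w (y t *m v) pt).
(* As b does not depend on t, these two-sided bounds make y and its inverse bounded. *)
have lowb : aeI (fun t => forall v, (1 - th) * vsq (y t *m v) <= Re (vdot (b *m v) v) <= vsq (y t *m v)).
  apply: aeI_S2 hb' pS => t _ e pt v; rewrite e /=.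
  have := proj_contr (y t *m v) pt; have := vsq_ge0 (S t *m (y t *m v)).
  move: (vsq (y t *m v)) (vsq (S t *m _)) => x z z0 zx.
  have h1 : 0 <= th * z by rewrite mulr_ge0// ltW.
  have h2 : th * z <= th * x by rewrite ler_wpM2l// ltW.
  by apply/andP; split; lra.
have th1' : 0 < 1 - th by rewrite subr_gt0.
have ba : b^a = b by have [t _ <-] := aeI_ex hb; rewrite /X !adjmxM adjmxK wa mulmxA.
have pos (v : 'cV[C]_n) : v != 0 -> 0 < Re (vdot (b *m v) v).
  move=> v0; rewrite ltNge; apply/negP => le0; case/eqP: v0.
  have yz : aeI (fun t => y t *m v = 0).
    apply: aeI_S lowb => t _ /(_ v) /andP[h1 _]; apply: vsq_eq0; apply/eqP.
    by rewrite eq_le vsq_ge0 andbT -(pmulr_rle0 _ th1') (le_trans h1).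
  have hv : mx_in (@H2minus R) (fun _ : R => v).
    apply: (mx_in_ae (@H2m_ae R)) (mx_H2mN (mx_H2m_cst v hm)); first by apply: mx_L2_meas; exact: V2_cst.
    by apply: aeI_S yz => t _ e; rewrite mulmxBl mul1mx -mulmxA e mulmx0 sub0r opprK.
  apply/matrixP => i j; have [_ /(_ 0 (lexx _))] := hv i j.
  by rewrite fcoef_cst eqxx mulr1 mxE.
have [be [ga [h1 h2 h3]]] := posdef_factor ba pos.
have bg : b = ga^a *m ga.
  rewrite -[LHS]mulmx1 -h2 -[LHS]mul1mx -[X in X *m _]adjmx1 -h2 adjmxM.
  by rewrite !mulmxA -(mulmxA ga^a) -(mulmxA ga^a) h1 mulmx1.
have eg v : Re (vdot (b *m v) v) = vsq (ga *m v) by rewrite bg -mulmxA vdot_adj adjmxK vdot_vsq.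
have up : aeI (fun t => forall v, vsq (y t *m v) <= (1 - th)^-1 * frob ga * vsq v).
  apply: aeI_S lowb => t _ H v; have /andP[H1 _] := H v.
  rewrite -mulrA ler_pdivlMl// (le_trans H1)// eg; exact: vsq_frob.
have dn : aeI (fun t => forall v, vsq v <= frob be * vsq (y t *m v)).
  apply: aeI_S lowb => t _ H v; have /andP[_ H2] := H v.
  have := vsq_frob be (ga *m v); rewrite mulmxA h2 mul1mx => /le_trans; apply.
  by rewrite ler_wpM2l ?frob_ge0// -eg.
have uy : aeI (fun t => y t \in unitmx).
  apply: aeI_S dn => t _ H; apply: unit_inj => v e; apply: vsq_eq0; apply/eqP.
  by rewrite eq_le vsq_ge0 andbT (le_trans (H v))// e vsq0 mulr0.
have Liy : mx_in (@Linf R) (fun t => iv (y t)).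
  move=> i j; apply: (@Linf_sq_le _ _ (frob be)); first by apply: mx_meas_iv; exact: mx_H2_meas.
  apply: aeI_S2 dn uy => t _ H u; apply: vsq_entry => v.
  by apply: le_trans (H _) _; rewrite mulmxA iv_mulmxV// mul1mx.
have hyinf : mx_in (@Hinf R) y.
  apply: mx_HinfE; last exact: mx_H2_H1.
  move=> i j; apply: (@Linf_sq_le _ _ ((1 - th)^-1 * frob ga)); first exact: (mx_H2_meas hy).
  by apply: aeI_S up => t _ H; exact: vsq_entry.
have hiy : mx_in (@Hinf R) (fun t => iv (y t)).
  apply: mx_HinfE => //; apply: mx_H2_H1; apply: (outer_inv hy (mx_Linf_L2 Liy)).
    by apply: aeI_S uy => t _ u; exact: iv_mulVmx.
  (* y is outer: if x in H2 solves w x - g in H2minus, then y^* w x is both analytic and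
     antianalytic, so w x = 0 and g is in H2minus as well as in H2. *)
  move=> g hg hyg; have [x hx hxm] := w_solve hg.
  have z1 : aeI (fun t => (y t)^a *m (w t *m x t) = 0).
    apply: mx_H1_H1m.
      rewrite (_ : (fun t => _) = fun t => x t + (w t *m y t - 1%:M)^a *m x t).
        by apply: mx_H1D; [exact: mx_H2_H1|apply: mx_H2_H1M => //; exact: mx_H2m_adj].
      by apply/funext => t; rewrite adjmxB adjmx1 adjmxM wa (mulmxBl ((y t)^a *m w t) 1%:M (x t)) mul1mx subrKC mulmxA.
    rewrite (_ : (fun t => _) = fun t => (y t)^a *m g t + (y t)^a *m (w t *m x t - g t)).
      by apply: mx_H1mD => //; exact: mx_H2a_H2m.
    by apply/funext => t; rewrite mulmxBr subrKC.
  have z2 : aeI (fun t => w t *m x t = 0).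
    apply: aeI_S2 z1 uy => t _ e u.
    by rewrite -[LHS]mul1mx -[X in X *m _]adjmx1 -(iv_mulmxV u) adjmxM -mulmxA e mulmx0.
  have hgm : mx_in (@H2minus R) g.
    apply: (mx_in_ae (@H2m_ae R)) (mx_H2mN hxm); first exact: mx_H2_meas.
    by apply: aeI_S z2 => t _ ->; rewrite sub0r opprK.
  exact: VH_VHm0.
exists (fun t => ga *m iv (y t)), (fun t => y t *m be); split.
- by apply: mx_HinfM => //; exact: mx_Hinf_cst.
- by apply: mx_HinfM => //; exact: mx_Hinf_cst.
apply: aeI_S2 uy hb => t _ u e.
have e1 : ga *m iv (y t) *m (y t *m be) = 1%:M.
  by rewrite mulmxA -(mulmxA ga) iv_mulVmx// mulmx1.
split=> //; first exact: mulmx1C.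
rewrite adjmxM mulmxA -(mulmxA _ ga^a) -bg -e /X !mulmxA -adjmxM iv_mulmxV// adjmx1 mul1mx.
by rewrite -mulmxA iv_mulmxV// mulmx1.
Qed.
End Factor.
End Spectral.

(** * Contractive errors with a gap in their singular values *)

Section GapInterp.
Variable (R : realType).
Local Notation C := R[i].
Local Notation Re := complex.Re.
Local Notation Im := complex.Im.
Local Notation "A ^a" := (adjmx A) (at level 8, format "A ^a").
Local Notation unitary_ae U := (aeI (fun t => (U t)^a *m U t = 1%:M)).

Lemma apx_sub n (Phi U : R -> 'M[C]_n) : apx Phi -> mx_in (@Linf R) U -> mx_in (@Hinf R) (fun t => Phi t - U t) -> apx U.
Proof.
move=> [LP hP] LU hU; split=> // e e0; have [N [F [hF hs]]] := hP e e0.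
exists N, (fun t => F t - zs N%:Z (fun t => Phi t - U t) t); split.
  by apply: mx_HinfB => //; exact: zs_Hinf.
apply: aeI_S hs => t _ H v; apply: le_trans (H v).
rewrite (_ : zs N%:Z U t - _ = zs N%:Z Phi t - F t)//.
by rewrite zsB; apply/matrixP => i j; rewrite !mxE; ring.
Qed.

Lemma apx_mulr n (Phi H : R -> 'M[C]_n) : apx Phi -> mx_in (@Hinf R) H -> apx (fun t => Phi t *m H t).
Proof.
move=> [LP hP] hH; have LH := mx_Hinf_Linf hH; split; first exact: mx_LinfM.
move=> e e0; have [M hM] := mx_Linf_frob LH.
pose e' := e / (1 + Num.sqrt `|M|).
have den : 0 < 1 + Num.sqrt `|M| by rewrite ltr_wpDr// sqrtr_ge0.
have e'0 : 0 < e' by rewrite divr_gt0.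
have [N [F [hF hs]]] := hP e' e'0.
exists N, (fun t => F t *m H t); split; first exact: mx_HinfM.
apply: aeI_S2 hs hM => t _ Hs Hm v.
have -> : (zs N%:Z (fun t => Phi t *m H t) t - F t *m H t) *m v = (zs N%:Z Phi t - F t) *m (H t *m v).
  by rewrite /zs scalemxAl -mulmxBl mulmxA.
apply: le_trans (Hs _) _.
apply: le_trans (_ : e' ^+ 2 * (`|M| * vsq v) <= _).
  rewrite ler_wpM2l ?sqr_ge0// (le_trans (vsq_frob _ _))// ler_wpM2r ?vsq_ge0//.
  exact: le_trans Hm (ler_norm _).
rewrite mulrA ler_wpM2r ?vsq_ge0// /e' expr_div_n mulrAC ler_pdivrMr ?exprn_gt0//.
rewrite ler_wpM2l ?sqr_ge0// -[leLHS](sqr_sqrtr (normr_ge0 M)) lerXn2r ?nnegrE ?sqrtr_ge0 ?(ltW den)//.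
by rewrite lerDr.
Qed.

Lemma iv_adj n (A : 'M[C]_n) : (iv A)^a = iv A^a.
Proof.
rewrite /iv adjmxZ; have -> : \det A^a = conjc (\det A) by rewrite /adjmx det_tr det_map_mx.
rewrite (_ : conjc (\det A)^-1 = (conjc (\det A))^-1); last by rewrite -fmorphV.
by congr (_ *: _); rewrite /adjmx -trmx_adj -map_mx_adj.
Qed.

(* Orthogonal projection onto the span of the first r columns of an invertible A; the
   summand 1 - pid_mx r only makes the Gram matrix invertible. *)
Definition spanproj n r (A : 'M[C]_n) : 'M[C]_n :=
  let F : 'M[C]_n := A *m pid_mx r in F *m iv (F^a *m F + (1%:M - pid_mx r)) *m F^a.

Lemma pid_adj n r : (pid_mx r : 'M[C]_n)^a = pid_mx r.
Proof.
apply/matrixP => i j; rewrite adjmxE !mxE [in LHS]eq_sym.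
have [->|ne] := eqVneq i j; first by rewrite eqxx /=; case: (_ < _)%N; rewrite ?conjc1 ?conjc0.
have ne' : (i == j :> nat) = false by apply/negP => /eqP e; case/eqP: ne; apply: val_inj.
by rewrite ne' conjc0.
Qed.

Lemma spanproj_herm n r (A : 'M[C]_n) : (spanproj r A)^a = spanproj r A.
Proof.
rewrite /spanproj; move: (A *m _) => F.
have hH : (F^a *m F + (1%:M - pid_mx r))^a = F^a *m F + (1%:M - pid_mx r).
  by rewrite adjmxD adjmxM adjmxK adjmxB adjmx1 pid_adj.
by rewrite adjmxM adjmxK adjmxM iv_adj hH mulmxA.
Qed.

Lemma spanproj_rank n r (A : 'M[C]_n) : (r <= n)%N -> (\rank (spanproj r A) <= r)%N.
Proof.
move=> rn; rewrite /spanproj -mulmxA.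
apply: leq_trans (mxrankM_maxl _ _) _; apply: leq_trans (mxrankM_maxr _ _) _.
by rewrite rank_pid_mx.
Qed.

(** With J = [pid_mx r], the matrix H = F^* F + (1 - J) is invertible because F v = 0 and (1 - J) v
    = 0 force v = 0, and it commutes with J. Hence F H^-1 F^* F = F H^-1 (H - (1 - J)) = F. *)
Lemma spanproj_fix n r (A B : 'M[C]_n) : (r <= n)%N -> B *m A = 1%:M ->
  spanproj r A *m (A *m (pid_mx r : 'M[C]_n)) = A *m pid_mx r.
Proof.
move=> rn BA; set J := pid_mx r : 'M[C]_n; set F := A *m J.
have JJ : J *m J = J by rewrite mul_pid_mx minnn (minn_idPr rn).
have FJ : F *m J = F by rewrite /F -mulmxA JJ.
have BF : B *m F = J by rewrite mulmxA BA mul1mx.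
have eP : spanproj r A = F *m iv (F^a *m F + (1%:M - J)) *m F^a by [].
have Ja : J^a = J by exact: pid_adj.
rewrite eP; clear eP; clearbody F J.
have JFa : J *m F^a = F^a by rewrite -{1}Ja -adjmxM FJ.
set H := F^a *m F + (1%:M - J).
have uH : H \in unitmx.
  apply: unit_inj => v e.
  have e0 : vsq (F *m v) + vsq ((1%:M - J) *m v) = 0.
    apply: (@complexI R); rewrite CrD -!vdot_vsq.
    have -> : vdot ((1%:M - J) *m v) ((1%:M - J) *m v) = vdot ((1%:M - J) *m v) v.
      rewrite [LHS]vdot_adj [RHS]vdot_adj adjmxB adjmx1 Ja mulmxA.
      congr (vdot _ (_ *m _)).
      by rewrite mulmxBl mul1mx mulmxBr mulmx1 JJ subrr subr0.
    have -> : vdot (F *m v) (F *m v) = vdot (F^a *m F *m v) v by rewrite -mulmxA [RHS]vdot_adj adjmxK.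
    by rewrite -vdotDl -mulmxDl -/H e vdotE big1// => i _; rewrite mxE mul0r.
  have f0 := vsq_ge0 (F *m v); have g0 := vsq_ge0 ((1%:M - J) *m v).
  have z1 : F *m v = 0 by apply: vsq_eq0; lra.
  have z2 : (1%:M - J) *m v = 0 by apply: vsq_eq0; lra.
  have z3 : J *m v = 0 by rewrite -BF -mulmxA z1 mulmx0.
  by move: z2; rewrite mulmxBl mul1mx z3 subr0.
have HJ : H *m J = J *m H.
  by rewrite /H mulmxDl mulmxDr -mulmxA FJ mulmxA JFa mulmxBl mulmxBr mul1mx mulmx1.
have iJ : iv H *m J = J *m iv H.
  rewrite -[LHS]mulmx1 -(iv_mulmxV uH) !mulmxA -(mulmxA (iv H) J) -HJ mulmxA iv_mulVmx// mul1mx//.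
have -> : F *m iv H *m F^a *m F = F *m iv H *m (H - (1%:M - J)) by rewrite /H addrK mulmxA.
rewrite mulmxBr -(mulmxA F) iv_mulVmx// mulmx1 mulmxBr mulmx1 -(mulmxA F) iJ mulmxA FJ.
by rewrite subrr subr0.
Qed.

Lemma spanproj_idem n r (A B : 'M[C]_n) : (r <= n)%N -> B *m A = 1%:M ->
  spanproj r A *m spanproj r A = spanproj r A.
Proof.
move=> rn BA; have e := spanproj_fix rn BA.
have [Z eZ] : exists Z, spanproj r A = A *m (pid_mx r : 'M[C]_n) *m Z.
  by rewrite /spanproj -mulmxA; eexists.
by rewrite {2}eZ mulmxA e -eZ.
Qed.

(** The construction gives |X v|^2 = |v|^2 - th |S v|^2 with S = 1 - P. So X is contractive and X S
    = X - X P has norm at most the square root of 1 - th. As X P has rank at most r, this bounds the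
    singular value of index r of X. *)
Lemma gap_interp n (Phi U : R -> 'M[C]_n) d r : (r <= n)%N -> apx Phi -> mx_in (@Linf R) U ->
  unitary_ae U -> mx_in (@Hinf R) (fun t => Phi t - U t) -> wh (@H2 R) U d ->
  (forall i, d i <= 0) -> (forall i : 'I_n, (r <= i)%N -> d i = 0) ->
  exists (X P : R -> 'M[C]_n) (c : R), [/\ 0 <= c, c < 1 & mx_in (@Hinf R) (fun t => Phi t - X t)] /\
   aeI (fun t => [/\ forall v, vsq (X t *m v) <= vsq v,
     forall v, vsq ((X t - X t *m P t) *m v) <= c ^+ 2 * vsq v & (\rank (P t) <= r)%N]).
Proof.
move=> rn hapx LU uU hPU hw d0 dr.
have hapU := apx_sub hapx LU hPU.
have [k [k0 k1 hk]] := hankel_adj_lt1 LU uU hw d0 hapU.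
have [Q1 [Q2 [Q1i [Q2i [[hq1 hq2 hq1i hq2i] hQ]]]]] := hw.
have LUa := mx_Linf_adj LU.
have uUa : aeI (fun t => ((U t)^a)^a *m (U t)^a = 1%:M).
  by apply: aeI_S uU => t _ u; rewrite adjmxK; exact: mulmx1C.
have hQa : aeI (fun t => [/\ (U t)^a = (Q1 t)^a *m zdiag (fun i => - d i) t *m Q2 t, Q2 t *m Q2i t = 1%:M & Q1 t *m Q1i t = 1%:M]).
  apply: aeI_S hQ => t _ [e1 e2 e3]; split=> //.
  by rewrite e1 !adjmxM adjmxK zdiag_adjE mulmxA.
pose P t := spanproj r (Q1i t).
pose S t := 1%:M - P t.
have SQ : aeI (fun t => S t *m (Q1i t *m (pid_mx r : 'M[C]_n)) = 0).
  by apply: aeI_S hQ => t _ [_ e2 _]; rewrite /S mulmxBl mul1mx (spanproj_fix rn e2) subrr.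
have mS : mx_in (@cmeas R) S.
  have hF : mx_in (@cmeas R) (fun t => Q1i t *m (pid_mx r : 'M[C]_n)).
    by apply: mx_cmeasM; [exact: mx_H2_meas|apply: mx_Linf_meas; apply: mx_Hinf_Linf; exact: mx_Hinf_cst].
  have hc (c : 'M[C]_n) : mx_in (@cmeas R) (fun=> c) by apply: mx_Linf_meas; apply: mx_Hinf_Linf; exact: mx_Hinf_cst.
  apply: mx_cmeasB; first exact: hc.
  apply: mx_cmeasM; last exact: mx_cmeas_adj.
  apply: mx_cmeasM => //; apply: mx_meas_iv; apply: mx_cmeasD; last exact: hc.
  by apply: mx_cmeasM => //; exact: mx_cmeas_adj.
have hS t : (S t)^a = S t by rewrite /S adjmxB adjmx1 spanproj_herm.
have pS : aeI (fun t => S t *m S t = S t).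
  apply: aeI_S hQ => t _ [_ e2 _]; have e := spanproj_idem rn e2.
  by rewrite {2}/S mulmxBr mulmx1 {2}/S mulmxBl mul1mx e subrr subr0.
(* The quotient alone would do for the estimate; the summand 1 makes C2 > 1, so that th = C2^-2 is
   less than 1 even for k = 0. *)
pose C2 : R := 1 + (1 - k ^+ 2)^-1.
have kk : 0 < 1 - k ^+ 2 by rewrite subr_gt0 expr_lt1.
have C20 : 0 < C2 by rewrite ltr_wpDr// invr_ge0 ltW.
have C21 : 1 < C2 by rewrite ltrDl invr_gt0.
have LS' := LS mS hS pS.
(* x' = P_+ (U^* p) has the same image g under P_+ U as x, and norm at most C2 |g|. By [wh_kernel]
   for U^*, whose indices are - d, the components of Q1 (x - x') from r on vanish; so x - x' is in
   the range of P and S x = S x'. *)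
have gap (x g : R -> 'cV[C]_n) : mx_in (@H2 R) x -> mx_in (@H2 R) g ->
    mx_in (@H2minus R) (fun t => U t *m x t - g t) -> l2norm (fun t => S t *m x t) <= C2 * l2norm g.
  move=> hx hg hxg.
  have [p [q [hp hq hpq hs le]]] := hankel_fix k0 k1 LUa hk hg.
  have Lp := mx_H2_L2 hp.
  pose x' t := (U t)^a *m p t - q t.
  have hd : mx_in (@H2 R) (fun t => x t - x' t) by exact: mx_H2B hx hpq.
  have hUd : mx_in (@H2minus R) (fun t => ((U t)^a)^a *m (x t - x' t)).
    apply: (mx_in_ae (@H2m_ae R)) (mx_H2mD hxg hs).
      by apply: mx_L2_meas; apply: mx_Linf_L2M (mx_Linf_adj LUa) _; exact: mx_H2_L2 hd.
    apply: aeI_S uUa => t _ u; rewrite mulmxBr /x' mulmxBr mulmxA u mul1mx adjmxK.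
    by apply/matrixP => i j; rewrite !mxE; ring.
  have hz : aeI (fun t => forall i : 'I_n, (r <= i)%N -> (Q1 t *m (x t - x' t)) i ord0 = 0).
    apply: aeI_forall => i; have [ri|ir] := leqP r i; last by apply: aeI_W.
    suff : aeI (fun t => (Q1 t *m (x t - x' t)) i ord0 = 0) by apply: aeI_S => t _ ->.
    have [L1x h1x] := mx_H2_H1M hq1 hd i ord0.
    apply: L1_unique => // l; have [l0|l0] := ltP l 0; first exact: h1x.
    by apply: (wh_kernel hq1 hq2i hQa hd hUd); rewrite (dr i ri) oppr0.
  have eS : aeI (fun t => S t *m x t = S t *m x' t).
    apply: aeI_S3 hz SQ hQ => t _ H sq [_ e2 _].
    apply/eqP; rewrite -subr_eq0 -mulmxBr; apply/eqP.
    set y := x t - x' t in H *.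
    have eJ : (pid_mx r : 'M[C]_n) *m (Q1 t *m y) = Q1 t *m y.
      apply/matrixP => i j; rewrite (ord1 j) mxE (bigD1 i)//= big1 ?addr0.
        rewrite mxE eqxx /=; case: (ltnP i r) => ir; first by rewrite mul1r.
        by rewrite mul0r H.
      move=> l li; rewrite mxE; have -> : (i == l :> nat) = false by apply/negP => /eqP e; case/eqP: li; exact: val_inj.
      by rewrite mul0r.
    by rewrite -[y]mul1mx -(mulmx1C e2) -mulmxA -eJ !mulmxA -(mulmxA (S t)) sq !mul0mx.
  have Lx' := mx_H2_L2 hpq.
  have LSx' := mx_Linf_L2M LS' Lx'.
  rewrite (l2norm_ae (mx_Linf_L2M LS' (mx_H2_L2 hx)) LSx' eS).
  apply: le_trans (_ : 1 * l2norm x' <= _).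
    apply: nn_le => //; apply: aeI_S pS => t _ e; rewrite expr1n mul1r.
    exact: (proj_contr (S := S) hS (x' t) e).
  rewrite mul1r; apply: le_trans (_ : l2norm p <= _).
    have <- : l2norm (fun t => (U t)^a *m p t) = l2norm p by rewrite !l2normE (nn_unitary uUa LUa Lp).
    apply: l2norm_proj; [exact: mx_Linf_L2M|exact: hpq|].
    by rewrite /x'; under eq_fun do rewrite opprB addrC subrK.
  have g0 := l2norm_ge0 g.
  have : l2norm p <= (1 - k ^+ 2)^-1 * l2norm g by rewrite ler_pdivlMl.
  by move/le_trans; apply; rewrite ler_wpM2r// /C2 lerDr.
pose th : R := C2 ^- 2.
have th0 : 0 < th by rewrite invr_gt0 exprn_gt0.
have th1 : th < 1 by rewrite invf_lt1 ?exprn_gt0// exprn_egt1.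
have [h [hi [hh hhi he]]] := spectral_factor th0 th1 mS hS pS.
have vh : aeI (fun t => forall v, vsq (h t *m v) = vsq v - th * vsq (S t *m v)).
  apply: aeI_S2 he pS => t _ [_ _ e] pt v; apply: (@complexI R).
  rewrite -(spec_w th hS v pt) -e -vdot_vsq -mulmxA.
  by rewrite [RHS]vdot_adj adjmxK.
pose Phi' t := Phi t *m hi t.
have hapx' : apx Phi' by exact: apx_mulr.
(* With x = h^-1 f and g = P_+ (U x): |f|^2 = |x|^2 - th |S x|^2, |x|^2 = |g|^2 + |p|^2 and th |S
   x|^2 <= |g|^2; hence |p| <= |f|. *)
have hhk : hankel_le 1 Phi'.
  move=> f p hf hp hfp; rewrite mul1r.
  pose x t := hi t *m f t.
  have hx : mx_in (@H2 R) x by exact: mx_Hinf_H2M.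
  have Lf := mx_H2_L2 hf; have Lp := mx_H2m_L2 hp; have Lx := mx_H2_L2 hx.
  pose g t := U t *m x t - p t.
  have hg : mx_in (@H2 R) g.
    rewrite (_ : g = fun t => (Phi' t *m f t - p t) - (Phi t - U t) *m x t).
      by apply: mx_H2B => //; exact: mx_Hinf_H2M.
    apply/funext => t; rewrite /g /Phi' /x -mulmxA mulmxBl.
    by apply/matrixP => i j; rewrite !mxE; ring.
  have hgm : mx_in (@H2minus R) (fun t => U t *m x t - g t).
    by rewrite /g; under eq_fun do rewrite opprB addrC subrK.
  have le := gap x g hx hg hgm.
  have Lg := mx_H2_L2 hg.
  have LSx := mx_Linf_L2M LS' Lx.
  have n1 : nn x = nn g + nn p.
    rewrite -(nn_unitary uU LU Lx) -(nn_pyth hg hp); congr nn; apply/funext => t.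
    by rewrite /g subrK.
  have n2' : nn f = nn x - th * nn (fun t => S t *m x t).
    rewrite !nnE -(rintZ _ (RI_nn LSx)) -(rintB (RI_nn Lx) (RI_Z th (RI_nn LSx))).
    apply: rint_ae; [exact: RI_meas (RI_nn Lf)|exact: RI_meas (RI_B (RI_nn Lx) (RI_Z th (RI_nn LSx)))|].
    apply: aeI_S2 he vh => t _ [e1 _ _] H; rewrite -[LHS]/(vsq (f t)).
    by rewrite -[f t]mul1mx -e1 -mulmxA H.
  have n3 : th * nn (fun t => S t *m x t) <= nn g.
    rewrite /th ler_pdivrMl ?exprn_gt0// -(l2norm_sq LSx) -(l2norm_sq Lg) -exprMn.
    by rewrite lerXn2r ?nnegrE ?mulr_ge0 ?l2norm_ge0 ?(ltW C20).
  apply: l2norm_le => //; rewrite n2' n1.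
  by rewrite lerBrDr addrC lerD2r.
have [r' [_ hr']] := interp hapx' hhk.
have [|V [d' [[LV uV hV _] _]]] := hr' (fun=> 0) => //.
exists (fun t => V t *m h t), P, (Num.sqrt (1 - th)); split; [split|].
- exact: sqrtr_ge0.
- by rewrite -[ltRHS]sqrtr1 ltr_sqrt// gtrBl.
- apply: (mx_in_ae (A := fun t => (Phi' t - V t) *m h t) (@Hinf_ae R)).
  + apply: mx_cmeasB; first by apply: mx_Linf_meas; case: hapx.
    by apply: mx_cmeasM; apply: mx_Linf_meas => //; exact: mx_Hinf_Linf.
  + apply: aeI_S he => t _ [_ e _]; rewrite mulmxBl /Phi' -mulmxA e mulmx1//.
  + exact: mx_HinfM.
apply: aeI_S3 uV vh pS => t _ u H pt.
have eV v : vsq (V t *m h t *m v) = vsq v - th * vsq (S t *m v) by rewrite -mulmxA (vsq_unitary _ u) H.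
split.
- by move=> v; rewrite eV gerBl mulr_ge0 ?vsq_ge0// ltW.
- move=> v; have -> : (V t *m h t - V t *m h t *m P t) *m v = V t *m h t *m (S t *m v).
    by rewrite [RHS]mulmxA; congr (_ *m _); rewrite /S mulmxBr mulmx1.
  rewrite eV mulmxA pt sqr_sqrtr ?subr_ge0 ?(ltW th1)// -{1}[vsq _]mul1r -mulrBl ler_wpM2l ?subr_ge0 ?(ltW th1)//.
  exact: (proj_contr (S := S) hS v pt).
- exact: spanproj_rank.
Qed.
End GapInterp.

(** * Superoptimal singular values *)

Section Count.
Variable (R : realType).
Local Notation C := R[i].
Local Notation Re := complex.Re.
Local Notation Im := complex.Im.
Local Notation "A ^a" := (adjmx A) (at level 8, format "A ^a").
Local Notation unitary_ae U := (aeI (fun t => (U t)^a *m U t = 1%:M)).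

Lemma vnormE n (v : 'cV[C]_n) : vnorm v = Num.sqrt (vsq v). Proof. by []. Qed.
Lemma vnorm_ge0 n (v : 'cV[C]_n) : 0 <= vnorm v. Proof. exact: sqrtr_ge0. Qed.
Lemma vnorm_le n (u v : 'cV[C]_n) (M : R) : 0 <= M -> vsq u <= M ^+ 2 * vsq v -> vnorm u <= M * vnorm v.
Proof.
move=> M0 h; rewrite -(@ler_pXn2r _ 2)// ?nnegrE ?mulr_ge0 ?vnorm_ge0//.
by rewrite exprMn !vnormE !sqr_sqrtr ?vsq_ge0.
Qed.

Let opset n (A : 'M[C]_n) := [set M : R | 0 <= M /\ forall v : 'cV[C]_n, vnorm (A *m v) <= M * vnorm v].
Lemma opset_lb n (A : 'M[C]_n) : has_lbound (opset A). Proof. by exists 0 => x []. Qed.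
Lemma opset_ne n (A : 'M[C]_n) : opset A !=set0.
Proof.
exists (Num.sqrt (frob A)); split; first exact: sqrtr_ge0.
by move=> v; apply: vnorm_le; rewrite ?sqrtr_ge0// sqr_sqrtr ?frob_ge0//; exact: vsq_frob.
Qed.
Lemma opnorm_le n (A : 'M[C]_n) (M : R) : 0 <= M -> (forall v, vsq (A *m v) <= M ^+ 2 * vsq v) -> opnorm A <= M.
Proof.
by move=> M0 h; apply: (ge_inf (opset_lb A)); split=> // v; exact: vnorm_le.
Qed.
Lemma opnorm_ge n (A : 'M[C]_n) v : vnorm (A *m v) <= opnorm A * vnorm v.
Proof.
have [v0|v0] := eqVneq (vnorm v) 0.
  have vz : v = 0.
    by apply: vsq_eq0; move: v0; rewrite vnormE => /eqP; rewrite sqrtr_eq0 => h; apply/eqP; rewrite eq_le vsq_ge0 h.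
  by rewrite v0 mulr0 vz mulmx0 vnormE vsq0 sqrtr0.
have vp : 0 < vnorm v by rewrite lt_neqAle eq_sym v0 vnorm_ge0.
rewrite -ler_pdivrMr//; apply: lb_le_inf; first exact: opset_ne.
by move=> M [M0 h]; rewrite ler_pdivrMr.
Qed.
Lemma opnorm_ge0 n (A : 'M[C]_n) : 0 <= opnorm A.
Proof. by apply: lb_le_inf; [exact: opset_ne|move=> M []]. Qed.

Let svset n j (A : 'M[C]_n) := [set x : R | exists B : 'M[C]_n, (\rank B <= j)%N /\ x = opnorm (A - B)].
Lemma svset_lb n j (A : 'M[C]_n) : has_lbound (svset j A).
Proof. by exists 0 => x [B [_ ->]]; exact: opnorm_ge0. Qed.
Lemma svset_ne n j (A : 'M[C]_n) : svset j A !=set0.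
Proof. by exists (opnorm (A - 0)), 0; rewrite mxrank0. Qed.
Lemma sval_le n j (A B : 'M[C]_n) (x : R) : (\rank B <= j)%N -> opnorm (A - B) <= x -> Defs.sval j A <= x.
Proof. by move=> rB h; apply: le_trans h; apply: (ge_inf (svset_lb j A)); exists B. Qed.
Lemma sval_ge n j (A : 'M[C]_n) (x : R) : (forall B : 'M[C]_n, (\rank B <= j)%N -> x <= opnorm (A - B)) -> x <= Defs.sval j A.
Proof. by move=> h; apply: lb_le_inf; [exact: svset_ne|move=> y [B [rB ->]]; exact: h]. Qed.
Lemma sval_mono n j j' (A : 'M[C]_n) : (j <= j')%N -> Defs.sval j' A <= Defs.sval j A.
Proof. by move=> jj; apply: sval_ge => B rB; apply: sval_le (lexx _); exact: leq_trans rB jj. Qed.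
Lemma sval0 n (A : 'M[C]_n) : Defs.sval 0 A = opnorm A.
Proof.
apply/eqP; rewrite eq_le; apply/andP; split.
  by apply: (@sval_le _ _ _ 0); rewrite ?mxrank0// subr0.
by apply: sval_ge => B; rewrite leqn0 mxrank_eq0 => /eqP ->; rewrite subr0.
Qed.
Lemma sval0_contr n (A : 'M[C]_n) : (Defs.sval 0 A <= 1) <-> (forall v, vsq (A *m v) <= vsq v).
Proof.
rewrite sval0; split=> [h v|h]; last by apply: opnorm_le => // v; rewrite expr1n mul1r.
have := le_trans (opnorm_ge A v) (ler_wpM2r (vnorm_ge0 v) h).
rewrite mul1r -(@ler_pXn2r _ 2)// ?nnegrE ?vnorm_ge0//.
by rewrite !vnormE !sqr_sqrtr ?vsq_ge0.
Qed.

Lemma esssup_le (g : R -> R) (c : \bar R) : aeI (fun t => ((g t)%:E <= c)%E) -> (esssupT g <= c)%E.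
Proof. by move=> h; apply: ereal_inf_lbound. Qed.
Lemma esssup_ge (g : R -> R) (c : R) : aeI (fun t => c <= g t) -> (c%:E <= esssupT g)%E.
Proof.
move=> h; apply: le_ereal_inf_tmp => y hy.
have [t _ [h1 h2]] := aeI_ex (aeI_and h hy).
by apply: le_trans h2; rewrite lee_fin.
Qed.
(** The bounds c + 1 / (m + 1) are countably many, so they hold simultaneously almost everywhere. *)
Lemma esssup_ae (g : R -> R) (c : R) : (esssupT g <= c%:E)%E -> aeI (fun t => g t <= c).
Proof.
move=> h.
have hn (m : nat) : aeI (fun t => g t <= c + m.+1%:R^-1).
  have : (esssupT g < (c + m.+1%:R^-1)%:E)%E.
    by apply: le_lt_trans h _; rewrite lte_fin ltrDl invr_gt0.
  move=> /ereal_inf_lt[y hy yl]; apply: aeI_S hy => t _ gy.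
  by rewrite -lee_fin (le_trans gy)// ltW.
apply: aeI_S (aeI_foralln hn) => t _ H; apply/ler_addgt0Pr => e e0.
have [m hm] : exists m : nat, e^-1 <= m%:R.
  by exists (Num.bound e^-1); apply/ltW/archi_boundP; rewrite invr_ge0 ltW.
apply: le_trans (H m) _; rewrite lerD2l -[leRHS]invrK lef_pV2 ?posrE ?invr_gt0//.
by rewrite (le_trans hm)// ler_nat.
Qed.
Lemma esssup_mono (g1 g2 : R -> R) : (forall t, g1 t <= g2 t) -> (esssupT g1 <= esssupT g2)%E.
Proof.
move=> h; apply: le_ereal_inf_tmp => y hy; apply: esssup_le.
by apply: aeI_S hy => t _; apply: le_trans; rewrite lee_fin.
Qed.

Lemma so_cost_mono n (Phi F : R -> 'M[C]_n) j j' : (j <= j')%N -> (so_cost Phi j' F <= so_cost Phi j F)%E.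
Proof. by move=> jj; apply: esssup_mono => t; exact: sval_mono. Qed.

(** A matrix B of rank at most j < r annihilates some nonzero combination v of the first r columns
    of Q; there |(A - B) v| = |U v| = |v|. *)
Lemma sval_iso n r (A U Q Qi : 'M[C]_n) j : (j < r)%N -> (r <= n)%N -> U^a *m U = 1%:M -> Qi *m Q = 1%:M ->
  (forall i : 'I_n, (i < r)%N -> A *m col i Q = U *m col i Q) -> 1 <= Defs.sval j A.
Proof.
move=> jr rn uU QQ hA; apply: sval_ge => B rB.
pose S : 'M[C]_(n, r) := pid_mx r.
have SS : (pid_mx r : 'M[C]_(r, n)) *m S = 1%:M by rewrite mul_pid_mx minnn (minn_idPr rn) pid_mx_1.
have eAU : A *m (Q *m S) = U *m (Q *m S).
  rewrite !mulmxA; apply/matrixP => k l; rewrite ![(_ *m S) k l]mxE; apply: eq_bigr => m _.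
  rewrite [S m l]mxE; case: (ltnP m r) => mr; last by rewrite andbF !mulr0.
  have := congr1 (fun M => fun_of_matrix M k ord0) (hA m mr); rewrite -!col_mulmx !mxE => <-//.
have : kermx (B *m (Q *m S))^T != 0.
  rewrite -mxrank_eq0 mxrank_ker mxrank_tr subn_eq0 -ltnNge.
  by apply: leq_ltn_trans (mxrankM_maxl _ _) _; exact: leq_ltn_trans rB jr.
move=> /rowV0Pn[x /sub_kermxP xk x0].
pose v := Q *m S *m x^T.
have Bv : B *m v = 0.
  by rewrite /v mulmxA -[LHS]trmxK trmx_mul trmxK xk trmx0.
have v0 : vsq v != 0.
  apply/eqP => /vsq_eq0 vz; case/eqP: x0.
  have : (pid_mx r : 'M[C]_(r, n)) *m (Qi *m v) = x^T.
    by rewrite /v !mulmxA -(mulmxA _ Qi) QQ mulmx1 SS mul1mx.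
  by rewrite vz !mulmx0 => /(congr1 (@trmx _ _ _)); rewrite trmx0 trmxK => <-.
have eAv : (A - B) *m v = U *m v.
  by rewrite mulmxBl Bv subr0 /v !mulmxA -(mulmxA A) eAU mulmxA.
have := opnorm_ge (A - B) v; rewrite eAv !vnormE (vsq_unitary _ uU) => h.
have vp : 0 < Num.sqrt (vsq v) by rewrite sqrtr_gt0 lt_neqAle eq_sym v0 vsq_ge0.
by rewrite -(ler_pM2r vp) mul1r.
Qed.

Section Main.
Variables (n : nat) (Phi U : R -> 'M[C]_n) (d : 'I_n -> int) (r : nat).
Hypotheses (rn : (r <= n)%N) (hapx : apx Phi) (LU : mx_in (@Linf R) U) (uU : unitary_ae U).
Hypotheses (hPU : mx_in (@Hinf R) (fun t => Phi t - U t)) (hw : wh (@H2 R) U d).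
Hypotheses (dneg : forall i : 'I_n, (i < r)%N -> d i < 0) (d0 : forall i : 'I_n, (r <= i)%N -> d i = 0).

Let contr (F : R -> 'M[C]_n) := aeI (fun t => forall v, vsq ((Phi t - F t) *m v) <= vsq v).

(** For f the column i of Q1^-1, i < r, U f is z^(d i) times column i of the adjoint of Q2, hence in
    H2minus since d i < 0, while (Phi - F) f - U f is analytic. Pythagoras and |(Phi - F) f| <= |f|
    = |U f| force (Phi - F) f = U f. *)
Lemma iso_ae F : mx_in (@Hinf R) F -> contr F ->
  aeI (fun t => forall j, (j < r)%N -> 1 <= Defs.sval j (Phi t - F t)).
Proof.
move=> hF cF; have [Q1 [Q2 [Q1i [Q2i [[h1 h2 h1i h2i] hQ]]]]] := hw.
have LA : mx_in (@Linf R) (fun t => Phi t - F t) by apply: mx_LinfB; [case: hapx|exact: mx_Hinf_Linf].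
have hc : aeI (fun t => forall i : 'I_n, (i < r)%N -> (Phi t - F t) *m col i (Q1i t) = U t *m col i (Q1i t)).
  apply: aeI_forall => i; have [ir|ri] := ltnP i r; last by apply: aeI_W.
  suff : aeI (fun t => (Phi t - F t) *m col i (Q1i t) = U t *m col i (Q1i t)) by apply: aeI_S => t _ ->.
  pose f t := col i (Q1i t).
  have hf : mx_in (@H2 R) f by move=> k l; rewrite /f; under eq_fun do rewrite mxE; exact: h1i.
  have Lf := mx_H2_L2 hf; have LUf := mx_Linf_L2M LU Lf.
  have hUf : mx_in (@H2minus R) (fun t => U t *m f t).
    apply: (mx_in_ae (A := fun t => ee t ^ d i *: col i (Q2 t)^a) (@H2m_ae R)); first exact: mx_L2_meas.
      apply: aeI_S hQ => t _ [e1 e2 _]; rewrite e1 /f !colE -!mulmxA (mulmxA (Q1 t)) e2 mul1mx.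
      rewrite scalemxAr; congr (_ *m _); apply/matrixP => k l; rewrite /zdiag mul_diag_mx !mxE.
      by have [->|ne] := eqVneq k i; rewrite /= ?mulr0.
    move=> k l; under eq_fun do rewrite mxE mxE adjmxE mulrC.
    by apply: H2J_m; [exact: dneg|exact: h2].
  have hd : mx_in (@H2 R) (fun t => (Phi t - F t) *m f t - U t *m f t).
    rewrite (_ : (fun t => _) = fun t => ((Phi t - U t) - F t) *m f t).
      by apply: mx_Hinf_H2M => //; exact: mx_HinfB.
    by apply/funext => t; rewrite -mulmxBl; congr (_ *m _); rewrite addrAC.
  have LAf := mx_Linf_L2M LA Lf.
  have e1 : nn (fun t => (Phi t - F t) *m f t) = nn (fun t => (Phi t - F t) *m f t - U t *m f t) + nn (fun t => U t *m f t).
    by rewrite -(nn_pyth hd hUf); congr nn; apply/funext => t; rewrite subrK.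
  have le : nn (fun t => (Phi t - F t) *m f t) <= nn f.
    rewrite !nnE; apply: rint_le; [exact: RI_nn LAf|exact: RI_nn Lf|].
    by apply: aeI_S cF => t _ H; exact: H.
  have z : nn (fun t => (Phi t - F t) *m f t - U t *m f t) = 0.
    apply/eqP; rewrite eq_le (nn_ge0 (mx_H2_L2 hd)) andbT.
    by move: le; rewrite e1 (nn_unitary uU LU Lf) -lerBrDr subrr.
  apply: aeI_S (nn_eq0 (mx_H2_L2 hd) z) => t _ /eqP; rewrite subr_eq0 => /eqP //.
apply: aeI_S3 hc uU hQ => t _ H u [_ e2 _] j jr.
exact: (sval_iso jr rn u e2 H).
Qed.

Lemma contr_cost F : contr F <-> (so_cost Phi 0 F <= 1)%E.
Proof.
split=> [h|h].
  by apply: esssup_le; apply: aeI_S h => t _ H; rewrite lee_fin; apply/sval0_contr.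
by apply: aeI_S (esssup_ae h) => t _ /sval0_contr.
Qed.

Lemma cost_one F j : mx_in (@Hinf R) F -> contr F -> (j < r)%N -> so_cost Phi j F = 1%E.
Proof.
move=> hF cF jr; apply/eqP; rewrite eq_le; apply/andP; split.
  by apply: le_trans (so_cost_mono _ _ (leq0n j)) _; apply/contr_cost.
by apply: esssup_ge; apply: aeI_S (iso_ae hF cF) => t _; apply.
Qed.

Lemma cost0_ge1 F : mx_in (@Hinf R) F -> (0 < r)%N -> (1 <= so_cost Phi 0 F)%E.
Proof.
move=> hF r0; have [h|h] := leP (so_cost Phi 0 F) 1%E; last exact: ltW.
by rewrite (cost_one hF _ r0)//; apply/contr_cost.
Qed.

Lemma contr_U : contr (fun t => Phi t - U t).
Proof.
apply: aeI_S uU => t _ u v; have -> : Phi t - (Phi t - U t) = U t by rewrite opprB addrC subrK.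
by rewrite vsq_unitary.
Qed.

(** Every contractive F has cost 1 at each level below r, so the minimizations after the first
    exclude nothing there. *)
Lemma so_below j : (j < r)%N -> so_sval Phi j = 1%E /\ (forall F, Omega Phi j F <-> mx_in (@Hinf R) F /\ contr F).
Proof.
elim: j => [|j IH] jr.
  have e : so_sval Phi 0 = 1%E.
    apply/eqP; rewrite eq_le; apply/andP; split.
      apply: ge_ereal_inf; exists (so_cost Phi 0 (fun t => Phi t - U t)); first by exists (fun t => Phi t - U t).
      by apply/contr_cost; exact: contr_U.
    by apply: le_ereal_inf_tmp => y [F hF <-]; exact: cost0_ge1.
  split=> // F; split=> [[hF hc]|[hF cF]].
    by split=> //; apply/contr_cost; rewrite hc -[ereal_inf _]/(so_sval Phi 0) e.
  by split=> //; rewrite -[ereal_inf _]/(so_sval Phi 0) e; exact: cost_one.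
have [_ hO] := IH (ltnW jr).
have e : so_sval Phi j.+1 = 1%E.
  apply/eqP; rewrite eq_le; apply/andP; split.
    apply: ge_ereal_inf; exists (so_cost Phi j.+1 (fun t => Phi t - U t)).
      by exists (fun t => Phi t - U t) => //; apply/hO; split=> //; exact: contr_U.
    by rewrite cost_one//; exact: contr_U.
  by apply: le_ereal_inf_tmp => y [F /hO[hF cF] <-]; rewrite cost_one.
split=> // F; split=> [[/hO[hF cF] _]//|[hF cF]].
split; first by apply/hO.
by rewrite -[ereal_inf _]/(so_sval Phi j.+1) e; exact: cost_one.
Qed.

(* Above level r the sets Omega may be empty; the infimum is then +oo. *)
Lemma so_above j : (r <= j)%N -> so_sval Phi j <> 1%E.
Proof.
have dle i : d i <= 0 by have [/dneg/ltW//|/d0 ->] := ltnP i r.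
have [X [P [c [[c0 c1 hX] hb]]]] := gap_interp rn hapx LU uU hPU hw dle d0.
pose F t := Phi t - X t.
have PF t : Phi t - F t = X t by rewrite /F opprB addrC subrK.
have cF : contr F by apply: aeI_S hb => t _ [H _ _] v; rewrite PF.
have costF : (so_cost Phi r F <= c%:E)%E.
  apply: esssup_le; apply: aeI_S hb => t _ [_ H rk]; rewrite lee_fin PF.
  apply: (@sval_le _ _ _ (X t *m P t)); first exact: leq_trans (mxrankM_maxr _ _) rk.
  exact: opnorm_le.
have hr : (so_sval Phi r <= c%:E)%E.
  apply: ge_ereal_inf; exists (so_cost Phi r F) => //; exists F => //.
  case: (r) so_below => [//|r'] hb'; have [_ hO] := hb' r' (ltnSn _).
  by apply/hO.
have c1' : (c%:E < 1%:E)%E by rewrite lte_fin.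
move=> rj; rewrite -(subnKC rj); move: (j - r)%N => m {rj j}.
have OmS i F' : Omega Phi i.+1 F' -> Omega Phi i F' by case.
have Om i F' : Omega Phi (r + i) F' -> Omega Phi r F'.
  by elim: i => [|i IH]; rewrite ?addn0// addnS => /OmS /IH.
(* Members of [Omega Phi r] attain the infimum, so their cost at level r is at most c; later levels
   range over such functions only, and the cost decreases with the level. *)
have Or F' : Omega Phi r F' -> (so_cost Phi r F' <= c%:E)%E.
  by move: hr; rewrite /so_sval; case: (r) => [|r'] h [_ ->].
case: m => [|m]; first by rewrite addn0 => e; move: hr; rewrite e leNgt c1'.
rewrite addnS => e.
have [[F' hF']|nF] := pselect (exists F', Omega Phi (r + m) F').
  have : (so_sval Phi (r + m).+1 <= c%:E)%E.
    apply: ge_ereal_inf; exists (so_cost Phi (r + m).+1 F'); first by exists F'.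
    apply: le_trans (Or _ (Om _ _ hF')).
    by apply: so_cost_mono; rewrite -addnS leq_addr.
  by rewrite e leNgt c1'.
move: e; rewrite /so_sval.
have -> : so_cost Phi (r + m).+1 @` Omega Phi (r + m) = set0.
  by apply/seteqP; split=> // y [F' hF' _]; exfalso; apply: nF; exists F'.
by rewrite ereal_inf0.
Qed.

Lemma n_sv_oneE : n_sv_one Phi = r.
Proof.
rewrite /n_sv_one -sum1_card (eq_bigl (fun j : 'I_n => (j < r)%N)).
  by rewrite -(big_ord_widen n (fun=> 1%N) rn) sum_nat_const card_ord muln1.
move=> j; rewrite inE; have [jr|rj] := ltnP j r; apply/eqP; last exact: so_above.
by case: (so_below jr).
Qed.
End Main.
End Count.

Theorem theorem4p4 (R : realType) (n : nat) (Phi : R -> 'M[R[i]]_n) :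
  mx_in (@HinfC R) Phi ->
  hankel_norm_le1 Phi ->
  forall dd : 'I_n -> int,
    (forall i j : 'I_n, (n_sv_one Phi <= i)%N -> (i <= j)%N -> 0 <= dd i <= dd j) ->
  exists U : R -> 'M[R[i]]_n,
    unitary_interpolant Phi U /\ mx_in (@QC R) U /\
    exists d : 'I_n -> int,
      WH_factorization U d /\
      (forall i : 'I_n, (i < n_sv_one Phi)%N -> d i < 0) /\
      (forall i : 'I_n, (n_sv_one Phi <= i)%N -> d i = dd i).
Proof.
move=> hP hh dd; have hapx := HinfC_apx hP.
have hh1 : hankel_le 1 Phi by move=> f p hf hp hfp; rewrite mul1r; exact: hh.
have [r [rn hr]] := interp hapx hh1.
(* Indices 0 beyond r serve to identify r with [n_sv_one Phi]; only then does the hypothesis on [dd]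
   refer to this r. *)
have [|U0 [d0 [[LU0 uU0 hU0 hw0] [_ neg0 zero0]]]] := hr (fun=> 0) => //.
rewrite (n_sv_oneE rn hapx LU0 uU0 hU0 hw0 neg0 zero0) => hdd.
have [U [d [[LU uU hU hw] [srt neg eqd]]]] := hr dd hdd.
exists U; split; [by split|split].
  by apply: (unitary_QC hP LU uU hU hw); exact: apx_sub hapx LU hU.
exists d; split=> //; split=> //.
have [Q1 [Q2 [Q1i [Q2i [[h1 h2 h3 h4] hQ]]]]] := hw.
exists Q1, Q2, Q1i, Q2i; do 4 split=> //.
by apply: aeI_S hQ => t _ [e1 e2 e3]; split=> //; exact: mulmx1C.
Qed.
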